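(* Let $\Omega\subset\mathbb{R}^2$ be a bounded polygonal domain with macro-element mesh $\mathcal{M}_h$ and triangulation $\mathcal{T}_h$ as in the context, and let $U_h$, $\Sigma_{2,h}$, $V_{2,h}$ be the finite element spaces defined there. Then the sequence $$P_1(\Omega)\subset U_h\stackrel{J}{\longrightarrow}\Sigma_{2,h}\stackrel{\operatorname{div}}{\longrightarrow}V_{2,h}\longrightarrow0$$ is exact; that is, $J$ maps $U_h$ into $\Sigma_{2,h}$ with $\ker(J|_{U_h})=P_1(\Omega)$, $J U_h=\ker(\operatorname{div}|_{\Sigma_{2,h}})$, and $\operatorname{div}\Sigma_{2,h}=V_{2,h}$.
   Context: $\mathbb{S}=\mathbb{R}^{2\times2}_{\rm sym}$. $\operatorname{div}$ is the row-wise divergence, and $H(\operatorname{div},\Omega;\mathbb{S})=\{\tau\in L^2(\Omega;\mathbb{S}):\operatorname{div}\tau\in L^2(\Omega;\mathbb{R}^2)\}$. $P_k(K;W)$: polynomials of degree at most $k$ on $K$ with values in $W$ ($P_k(K)$ if scalar). The Airy operator $J:H^2(\Omega)\to H(\operatorname{div},\Omega;\mathbb{S})$ is $$Jq=\begin{bmatrix}\partial^2_{yy}q&-\partial^2_{xy}q\\-\partial^2_{xy}q&\partial^2_{xx}q\end{bmatrix}.$$ Meshes: $\mathcal{M}_h$ is a conforming triangulation of $\Omega$ into triangles (macro-elements) $M=x_0x_1x_2$. Let $m_1,m_2,m_3$ be the midpoints of $x_1x_2$, $x_0x_1$, $x_0x_2$, respectively. Each $M$ is divided into four triangles $K_1=x_1m_1m_2$,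 $K_2=x_0m_1m_2$, $K_3=x_0m_1m_3$, $K_4=x_2m_1m_3$, separated by the interior edges $E_1=m_1m_2$, $E_2=m_1x_0$, $E_3=m_1m_3$; $d_i$ is the midpoint of $E_i$. $\mathcal{T}_h$ is the mesh of all these sub-triangles. Space $U_h$: for each $M$ let $U_M=\{u\in L^2(M): u|_{K_i}\in P_4(K_i),\ 1\leqslant i\leqslant4;\ u$ is $C^2$ at $x_0$; $u,\nabla u,\partial^2_{\bm{tt}}u,\partial^2_{\bm{tn}}u$ are continuous at $m_i$, $i=1,2,3$; $u$ is continuous at $d_i$, $i=1,3\}$, where $\bm{t},\bm{n}$ are the tangential and normal vectors of the edge of $M$ containing $m_i$, and continuity at a point means that the values from all sub-triangles of $M$ containing the point coincide. Then $U_h=\{u\in L^2(\Omega): u|_M\in U_M\ \forall M\in\mathcal{M}_h$; $u$ is $C^2$ at the vertices of $\mathcal{M}_h$; $\partial_{\bm{n}}u$, $\partial^2_{\bm{tn}}u$, $\partial^2_{\bm{tt}}u$ are continuous at the midpoints of the edges of $\mathcal{M}_h\}$. Bubbles: for a node $X$ of the quadratic Lagrange element on $\mathcal{T}_h$, $\Phi_X$ is the corresponding continuous piecewise quadratic Lagrange basis function. For $K\in\mathcal{T}_h$ let $\Sigma_{K,2,b}=\{\tau\in P_2(K;\mathbb{S}):\tau\bm{n}|_{\partial K}=0\}$. The macro-element bubble space $\Sigma_{M,2,b}$ is the linear span of the following functions on $M$: (1) all $\tau$ with $\tau|_K\in\Sigma_{K,2,b}$ for each $K\subset M$; (2) for $i=1,2,3$,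 $\Phi_{d_i}(\bm{t}_i\bm{n}_i^T+\bm{n}_i\bm{t}_i^T)$ and $\Phi_{d_i}\bm{n}_i\bm{n}_i^T$, where $\bm{t}_i,\bm{n}_i$ are tangential and normal vectors of $E_i$; (3) for $i=1,2,3$, $(\Phi_{m_i}|_M)\bm{t}\bm{t}^T$ with $\bm{t}$ the tangential vector of the edge of $M$ containing $m_i$. Spaces: $\Sigma_{2,h}=\{\sigma\in H(\operatorname{div},\Omega;\mathbb{S}):\sigma=\sigma_c+\sigma_b,\ \sigma_c\in H^1(\Omega;\mathbb{S}),\ \sigma_c|_K\in P_2(K;\mathbb{S})\ \forall K\in\mathcal{T}_h,\ \sigma_b|_M\in\Sigma_{M,2,b}\ \forall M\in\mathcal{M}_h\}$, $V_{2,h}=\{v\in L^2(\Omega;\mathbb{R}^2):v|_K\in P_1(K;\mathbb{R}^2)\ \forall K\in\mathcal{T}_h\}$.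
   Formalization: The bounded polygonal domain is taken to be the domain enclosed by a single simple closed polygon (so simply connected, without holes, slits or pinch points); with a hole, J U_h = ker(div) on Sigma_{2,h} fails. *)

(* Defs.v *)
From HB Require Import structures.
From mathcomp Require Import all_boot all_order all_algebra.
From mathcomp Require Import all_classical all_reals all_analysis.

Set Implicit Arguments.
Unset Strict Implicit.
Unset Printing Implicit Defensive.

Import Order.TTheory GRing.Theory Num.Theory.
Import numFieldNormedType.Exports.

Local Open Scope classical_set_scope.
Local Open Scope ring_scope.

(* Elements of L^2 and of its subspaces are represented by functions on the
   whole plane.  Only the values on the domain at hand matter, and every space
   below is closed under modification on a null set as long as the function
   stays measurable.  Weak differential operators are relations between a
   function and the representatives of its image. *)

Notation pt R := (R * R)%type.

(** * Plane geometry *)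

Definition cross (R : realType) (a b : pt R) : R := a.1 * b.2 - a.2 * b.1.

Definition hull (R : realType) (s : seq (pt R)) : set (pt R) :=
  [set x | exists c : 'I_(size s) -> R,
    [/\ forall i, 0 <= c i, \sum_i c i = 1 & x = \sum_i c i *: s`_i]].

Definition mid (R : realType) (e : pt R * pt R) : pt R :=
  2^-1 *: (e.1 + e.2).

(* Tangential and normal vectors of an edge are not normalised: they enter the
   definitions below only through linear spans, vanishing conditions, and
   equalities in which both sides use the same vectors. *)
Definition tangent (R : realType) (e : pt R * pt R) : pt R := e.2 - e.1.

Definition normal (R : realType) (e : pt R * pt R) : pt R :=
  ((tangent e).2, - (tangent e).1).

Definition vec (R : realType) (a : pt R) : 'cV[R]_2 :=
  \col_i (if i == 0 then a.1 else a.2).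

(* The vertices are distinct, consecutive sides (indices taken cyclically)
   meet only at their common vertex, other sides are disjoint. *)
Definition simple_polygon (R : realType) (n : nat) (p : 'I_n.+3 -> pt R) :=
  let side i := hull [:: p i; p (ordS i)] in
  [/\ injective p,
      forall i, side i `&` side (ordS i) = [set p (ordS i)]
    & forall i j, j != i -> j != ordS i -> i != ordS j ->
        side i `&` side j = set0].

(* A bounded polygonal domain: the bounded domain enclosed by a simple closed
   polygon.  In particular it is simply connected. *)
Definition polygonal_domain (R : realType) (Omega : set (pt R)) :=
  [/\ open Omega, connected Omega, bounded_set Omega
    & exists n (p : 'I_n.+3 -> pt R), simple_polygon p /\
        closure Omega `\` Omega = \bigcup_i hull [:: p i; p (ordS i)]].

(** * Meshes *)

(* ((x_0, x_1), x_2); for a macro-element the order matters, since the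
   subdivision singles out x_0. *)
Notation tri R := (pt R * pt R * pt R)%type.

Definition verts (R : realType) (K : tri R) : seq (pt R) :=
  [:: K.1.1; K.1.2; K.2].

Definition edges (R : realType) (K : tri R) : seq (pt R * pt R) :=
  [:: (K.1.2, K.2); (K.1.1, K.1.2); (K.1.1, K.2)].

Definition m1 (R : realType) (M : tri R) : pt R := mid (M.1.2, M.2).
Definition m2 (R : realType) (M : tri R) : pt R := mid (M.1.1, M.1.2).
Definition m3 (R : realType) (M : tri R) : pt R := mid (M.1.1, M.2).

(* K_1, K_2, K_3, K_4 *)
Definition subtris (R : realType) (M : tri R) : seq (tri R) :=
  [:: (M.1.2, m1 M, m2 M); (M.1.1, m1 M, m2 M);
      (M.1.1, m1 M, m3 M); (M.2, m1 M, m3 M)].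

Definition E1 (R : realType) (M : tri R) : pt R * pt R := (m1 M, m2 M).
Definition E2 (R : realType) (M : tri R) : pt R * pt R := (m1 M, M.1.1).
Definition E3 (R : realType) (M : tri R) : pt R * pt R := (m1 M, m3 M).

(* Two distinct triangles meet in the convex hull of their common vertices,
   i.e. in nothing, a common vertex or a common edge. *)
Definition conforming_mesh (R : realType) (Omega : set (pt R))
    (Mh : seq (tri R)) :=
  [/\ {in Mh, forall M : tri R,
         cross (M.1.2 - M.1.1) (M.2 - M.1.1) != 0},
      closure Omega = [set x | exists2 M, M \in Mh & hull (verts M) x]
    & {in Mh &, forall M N : tri R, M != N ->
         let common := [seq x <- verts M | x \in verts N] in
         (size common <= 2)%N /\
         hull (verts M) `&` hull (verts N) = hull common}].

Definition submesh (R : realType) (Mh : seq (tri R)) : seq (tri R) :=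
  flatten [seq subtris M | M <- Mh].

(** * Lebesgue and Sobolev spaces *)

Definition leb2 (R : realType) :
    {measure set (measurableTypeR R * measurableTypeR R) -> \bar R} :=
  (@lebesgue_measure R \x @lebesgue_measure R)%E.

Definition ae_on (R : realType) (A : set (pt R)) (P : pt R -> Prop) :=
  {ae @leb2 R, forall x, A x -> P x}.

Definition L2 (R : realType) (Omega : set (pt R)) (f : pt R -> R) :=
  f \_ Omega \in Lfun (@leb2 R) 2%:E.

(* The classical partial derivative of order a in x and b in y. *)
Definition pd (R : realType) (a b : nat) (f : pt R -> R) : pt R -> R :=
  iter a (fun g => 'D_((1, 0) : pt R) g)
    (iter b (fun g => 'D_((0, 1) : pt R) g) f).

Definition test_function (R : realType) (Omega : set (pt R))
    (phi : pt R -> R) :=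
  let supp := closure [set x | phi x != 0] in
  [/\ forall a b x, differentiable (pd a b phi) x, compact supp
    & supp `<=` Omega].

Definition weak_pd (R : realType) (Omega : set (pt R)) (a b : nat)
    (f g : pt R -> R) :=
  forall phi, test_function Omega phi ->
    \int[@leb2 R]_(x in Omega) (f x * pd a b phi x) =
    (-1) ^+ (a + b) * \int[@leb2 R]_(x in Omega) (g x * phi x).

Definition Hk (R : realType) (k : nat) (Omega : set (pt R))
    (f : pt R -> R) :=
  L2 Omega f /\
  forall a b, (a + b <= k)%N -> exists2 g, L2 Omega g & weak_pd Omega a b f g.

Definition sym_on (R : realType) (A : set (pt R)) (tau : pt R -> 'M[R]_2) :=
  ae_on A (fun x => (tau x)^T = tau x).

Definition L2S (R : realType) (Omega : set (pt R)) (tau : pt R -> 'M[R]_2) :=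
  sym_on Omega tau /\ forall i j, L2 Omega (fun x => tau x i j).

Definition H1S (R : realType) (Omega : set (pt R)) (tau : pt R -> 'M[R]_2) :=
  sym_on Omega tau /\ forall i j, Hk 1 Omega (fun x => tau x i j).

Definition L2V (R : realType) (Omega : set (pt R)) (v : pt R -> 'cV[R]_2) :=
  forall i, L2 Omega (fun x => v x i 0).

(* v = div tau (row-wise) in the sense of distributions, with v in L^2. *)
Definition is_div (R : realType) (Omega : set (pt R))
    (tau : pt R -> 'M[R]_2) (v : pt R -> 'cV[R]_2) :=
  L2V Omega v /\
  forall i phi, test_function Omega phi ->
    \int[@leb2 R]_(x in Omega)
       (tau x i 0 * pd 1 0 phi x + tau x i 1 * pd 0 1 phi x) =
    - \int[@leb2 R]_(x in Omega) (v x i 0 * phi x).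

Definition HdivS (R : realType) (Omega : set (pt R))
    (tau : pt R -> 'M[R]_2) :=
  L2S Omega tau /\ exists v, is_div Omega tau v.

(* q is in H^2 and tau = J q, J being the Airy operator. *)
Definition is_airy (R : realType) (Omega : set (pt R)) (q : pt R -> R)
    (tau : pt R -> 'M[R]_2) :=
  [/\ Hk 2 Omega q /\ L2S Omega tau,
      weak_pd Omega 0 2 q (fun x => tau x 0 0),
      weak_pd Omega 1 1 q (fun x => - tau x 0 1),
      weak_pd Omega 1 1 q (fun x => - tau x 1 0)
    & weak_pd Omega 2 0 q (fun x => tau x 1 1)].

(** * Polynomials *)

Definition polyn (R : realType) (k : nat) (p : pt R -> R) :=
  exists c : nat -> nat -> R, forall x,
    p x = \sum_(i < k.+1) \sum_(j < k.+1 | (i + j <= k)%N)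
            c i j * x.1 ^+ i * x.2 ^+ j.

Definition polynmx (R : realType) (m n k : nat) (P : pt R -> 'M[R]_(m, n)) :=
  forall i j, polyn k (fun x => P x i j).

(* f|_A is the polynomial p of degree at most k. *)
Definition restr_poly (R : realType) (A : set (pt R)) (k : nat)
    (f p : pt R -> R) :=
  polyn k p /\ ae_on A (fun x => f x = p x).

Definition restr_polymx (R : realType) (m n : nat) (A : set (pt R)) (k : nat)
    (F P : pt R -> 'M[R]_(m, n)) :=
  polynmx k P /\ ae_on A (fun x => F x = P x).

Definition P1 (R : realType) (Omega : set (pt R)) : set (pt R -> R) :=
  [set u | L2 Omega u /\ exists p, restr_poly Omega 1 u p].

(** * The space U_h *)

(* D u is continuous at X, with respect to the triangles of T: the values at X
   of D applied to the polynomial pieces of u on all triangles of T containing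
   X coincide. *)
Definition cont_at (R : realType) (T : seq (tri R)) (u : pt R -> R)
    (D : (pt R -> R) -> pt R -> R) (X : pt R) :=
  forall K L p q, K \in T -> L \in T ->
    hull (verts K) X -> hull (verts L) X ->
    restr_poly (hull (verts K)) 4 u p -> restr_poly (hull (verts L)) 4 u q ->
    D p X = D q X.

Definition C2_at (R : realType) (T : seq (tri R)) (u : pt R -> R)
    (X : pt R) :=
  forall a b, (a + b <= 2)%N -> cont_at T u (pd a b) X.

Definition dn (R : realType) (e : pt R * pt R) (f : pt R -> R) : pt R -> R :=
  'D_(normal e) f.
Definition dtt (R : realType) (e : pt R * pt R) (f : pt R -> R) : pt R -> R :=
  'D_(tangent e) ('D_(tangent e) f).
Definition dtn (R : realType) (e : pt R * pt R) (f : pt R -> R) : pt R -> R :=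
  'D_(tangent e) ('D_(normal e) f).

Definition UM (R : realType) (M : tri R) : set (pt R -> R) :=
  [set u | [/\ L2 (interior (hull (verts M))) u,
    {in subtris M, forall K, exists p, restr_poly (hull (verts K)) 4 u p},
    C2_at (subtris M) u M.1.1,
    {in edges M, forall e,
       (forall a b, (a + b <= 1)%N -> cont_at (subtris M) u (pd a b) (mid e))
       /\ cont_at (subtris M) u (dtt e) (mid e)
       /\ cont_at (subtris M) u (dtn e) (mid e)}
  & {in [:: E1 M; E3 M], forall e, cont_at (subtris M) u id (mid e)}]].

Definition Uh (R : realType) (Omega : set (pt R)) (Mh : seq (tri R)) :
    set (pt R -> R) :=
  [set u | [/\ L2 Omega u,
    {in Mh, forall M, UM M u},
    {in Mh, forall M, {in verts M, forall X, C2_at (submesh Mh) u X}}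
  & {in Mh, forall M, {in edges M, forall e,
       [/\ cont_at (submesh Mh) u (dn e) (mid e),
           cont_at (submesh Mh) u (dtn e) (mid e)
         & cont_at (submesh Mh) u (dtt e) (mid e)]}}]].

(** * The spaces Sigma_{2,h} and V_{2,h} *)

(* Phi is the quadratic Lagrange basis function Phi_X on the triangulation T. *)
Definition lagrange2 (R : realType) (T : seq (tri R)) (X : pt R)
    (Phi : pt R -> R) :=
  [/\ {within [set x | exists2 K, K \in T & hull (verts K) x],
         continuous Phi},
      {in T, forall K, exists2 p, polyn 2 p &
         forall x, hull (verts K) x -> Phi x = p x}
    & {in T, forall K : tri R,
         {in verts K ++ [seq mid e | e <- edges K], forall Y,
            Phi Y = (Y == X)%:R}}].

(* tau|_K is in Sigma_{K,2,b}. *)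
Definition SigmaKb (R : realType) (K : tri R) (tau : pt R -> 'M[R]_2) :=
  exists P, [/\ restr_polymx (hull (verts K)) 2 tau P,
    forall x, (P x)^T = P x
  & {in edges K, forall e, forall x, hull [:: e.1; e.2] x ->
       P x *m vec (normal e) = 0}].

(* The generators of Sigma_{M,2,b}; T is the triangulation T_h. *)
Definition bubble_gen (R : realType) (T : seq (tri R)) (M : tri R)
    (tau : pt R -> 'M[R]_2) :=
  [\/ {in subtris M, forall K, SigmaKb K tau},
      (exists e Phi,
        [/\ e \in [:: E1 M; E2 M; E3 M], lagrange2 T (mid e) Phi &
          let t := vec (tangent e) in let n := vec (normal e) in
          tau = (fun x => Phi x *: (t *m n^T + n *m t^T)) \/
          tau = (fun x => Phi x *: (n *m n^T))])
    | (exists e Phi,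
        [/\ e \in edges M, lagrange2 T (mid e) Phi &
          let t := vec (tangent e) in
          tau = (fun x => Phi x *: (t *m t^T))])].

(* tau|_M is in Sigma_{M,2,b}. *)
Definition SigmaMb (R : realType) (T : seq (tri R)) (M : tri R)
    (tau : pt R -> 'M[R]_2) :=
  exists (m : nat) (c : 'I_m -> R) (g : 'I_m -> pt R -> 'M[R]_2),
    (forall k, bubble_gen T M (g k)) /\
    ae_on (hull (verts M)) (fun x => tau x = \sum_k c k *: g k x).

Definition Sigma2h (R : realType) (Omega : set (pt R)) (Mh : seq (tri R)) :
    set (pt R -> 'M[R]_2) :=
  [set sigma | HdivS Omega sigma /\
    exists sc sb : pt R -> 'M[R]_2,
      [/\ ae_on Omega (fun x => sigma x = sc x + sb x),
          H1S Omega sc,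
          {in submesh Mh, forall K, exists2 P,
             restr_polymx (hull (verts K)) 2 sc P & forall x, (P x)^T = P x}
        & {in Mh, forall M, SigmaMb (submesh Mh) M sb}]].

Definition V2h (R : realType) (Omega : set (pt R)) (Mh : seq (tri R)) :
    set (pt R -> 'cV[R]_2) :=
  [set v | L2V Omega v /\
    {in submesh Mh, forall K, exists P, restr_polymx (hull (verts K)) 1 v P}].

(* Main.v *)
Require Import Defs.
From HB Require Import structures.
From mathcomp Require Import all_boot all_order all_algebra.
From mathcomp Require Import all_classical all_reals all_analysis measurable_realfun.
From mathcomp Require Import ring lra zify.
(* Imported again: mathcomp-analysis shadows names of Defs. *)
Require Import Defs.

Set Implicit Arguments.
Unset Strict Implicit.
Unset Printing Implicit Defensive.

Import Order.TTheory GRing.Theory Num.Theory.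
Import numFieldNormedType.Exports.

Local Open Scope classical_set_scope.
Local Open Scope ring_scope.

(* A divergence-free element of Sigma_h has a local quartic Airy potential on
   each triangle; normal continuity makes the jumps of these potentials affine,
   and a winding number argument, available because the boundary of a simple
   polygon is connected, removes them, giving a global C^1 potential. For C^1
   families, continuity of the Hessian at the nodes is the definition of U_h.
   Surjectivity of div is by duality: element and edge-midpoint bubbles force a
   functional vanishing on div Sigma_h to be one rigid motion on each macro-element,
   then all its edge reactions vanish, starting from an extreme edge. *)

(** Everything is translated into families of polynomials indexed by the sub-triangles. On the
    stress side the family condition is [Scond]: symmetric quadratic pieces, continuous normal
    components, one value at each macro vertex, and one value per macro-element at each midpoint of
    a macro edge. On the potential side it is C^1 continuity with the same point conditions on the
    Hessian. Green's formula and the fundamental lemma lead back to weak derivatives.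

    Continuity is known across edges, while the spaces speak of values at points. Triangles that
    touch only in a vertex can be compared because a small punctured neighbourhood of that vertex in
    Omega is connected; this rests on the local shape of a simple polygon.

    Counting dimensions would need Euler's formula for the mesh. Instead, exactness in the middle
    uses a discrete potential, and surjectivity shows that a functional annihilating all divergences
    is zero. On each triangle such a functional has an affine Riesz density; once the density is a
    rigid motion, every test against it reduces to edge terms that Simpson's rule evaluates
    exactly. *)

(** * Bivariate polynomials of bounded total degree *)

Section Polynomials.
Variable R : realType.
Implicit Types (p q r : pt R -> R) (x v w A : pt R) (k : nat) (c : nat -> nat -> R).

Let psum k c x := \sum_(i < k.+1) \sum_(j < k.+1 | (i + j <= k)%N)
  c i j * x.1 ^+ i * x.2 ^+ j.

Lemma polyn0E p : polyn 0 p -> exists a, p = fun=> a.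
Proof.
move=> [c hc]; exists (c 0%N 0%N); apply/funext => x.
by rewrite hc big_ord1 big_mkcond big_ord1 /= !expr0 !mulr1.
Qed.

Lemma polyn_cst k (a : R) : polyn k (fun=> a).
Proof.
exists (fun i j => if (i == 0%N) && (j == 0%N) then a else 0) => x.
rewrite big_ord_recl big_mkcond big_ord_recl /= !expr0 !mulr1.
rewrite big1 ?addr0; last by move=> i _; case: ifP => // _; rewrite !mul0r.
rewrite big1 ?addr0// => i _; rewrite big1// => j _.
by rewrite !mul0r.
Qed.

Lemma polynD k p q : polyn k p -> polyn k q -> polyn k (fun x => p x + q x).
Proof.
move=> [c hc] [d hd]; exists (fun i j => c i j + d i j) => x.
rewrite hc hd -big_split; apply: eq_bigr => i _.
by rewrite -big_split; apply: eq_bigr => j _; rewrite !mulrDl.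
Qed.

Lemma polynZ k (a : R) p : polyn k p -> polyn k (fun x => a * p x).
Proof.
move=> [c hc]; exists (fun i j => a * c i j) => x.
rewrite hc mulr_sumr; apply: eq_bigr => i _.
by rewrite mulr_sumr; apply: eq_bigr => j _; rewrite !mulrA.
Qed.

Lemma polynN k p : polyn k p -> polyn k (fun x => - p x).
Proof.
by move=> /(polynZ (-1)); congr polyn; apply/funext => x; rewrite mulN1r.
Qed.

Lemma polynB k p q : polyn k p -> polyn k q -> polyn k (fun x => p x - q x).
Proof. by move=> hp /polynN; apply: polynD. Qed.

Lemma polyn_sum k (I : Type) (s : seq I) (P : pred I) (F : I -> pt R -> R) :
  (forall i, P i -> polyn k (F i)) -> polyn k (fun x => \sum_(i <- s | P i) F i x).
Proof.
move=> hF; elim: s => [|i s IH].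
  rewrite (_ : (fun x => _) = fun=> 0); first exact: polyn_cst.
  by apply/funext => x; rewrite big_nil.
rewrite (_ : (fun x => _) =
    fun x => (if P i then F i x else 0) + \sum_(j <- s | P j) F j x); last first.
  by apply/funext => x; rewrite big_cons; case: ifP; rewrite ?add0r.
apply: polynD IH; case: (boolP (P i)) => [/hF//|_]; exact: polyn_cst.
Qed.

Lemma polyn_leq k l p : (k <= l)%N -> polyn k p -> polyn l p.
Proof.
move=> kl [c hc]; exists (fun i j => if (i + j <= k)%N then c i j else 0) => x.
rewrite hc (big_ord_widen l.+1
  (fun i : nat => \sum_(j < k.+1 | (i + j <= k)%N) c i j * x.1 ^+ i * x.2 ^+ j))//.
rewrite big_mkcond; apply: eq_bigr => i _ /=.
case: ifPn => [ik|]; last first.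
  rewrite -leqNgt => ki; rewrite big1// => j _.
  by rewrite leqNgt (leq_trans _ (leq_trans ki (leq_addr _ _)))// !mul0r.
rewrite (big_ord_widen_cond l.+1 (fun j => (i + j <= k)%N)
  (fun j => c i j * x.1 ^+ i * x.2 ^+ j))//.
rewrite big_mkcond [RHS]big_mkcond; apply: eq_bigr => j _ /=.
case: (leqP (i + j) k) => /= ijk.
  rewrite ltnS (leq_trans (leq_addl _ _) ijk).
  by rewrite (leq_trans ijk kl).
by case: ifP => //; rewrite !mul0r.
Qed.

Lemma polyn_mulX k p : polyn k p -> polyn k.+1 (fun x => x.1 * p x).
Proof.
move=> [c hc]; exists (fun i j => if i is i'.+1 then c i' j else 0) => x.
rewrite hc [RHS]big_ord_recl [X in _ = X + _]big1 ?add0r; last first.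
  by move=> j _; rewrite !mul0r.
rewrite mulr_sumr; apply: eq_bigr => i _ /=.
rewrite [RHS]big_mkcond big_ord_recr /= ifN ?addr0; last first.
  by rewrite -ltnNge /bump /=; lia.
rewrite mulr_sumr big_mkcond; apply: eq_bigr => j _ /=.
rewrite /bump /= add1n addSn ltnS; case: ifP => // _.
by rewrite exprS; ring.
Qed.

Lemma polyn_mulY k p : polyn k p -> polyn k.+1 (fun x => x.2 * p x).
Proof.
move=> [c hc]; exists (fun i j => if j is j'.+1 then c i j' else 0) => x.
rewrite hc [RHS]big_ord_recr /= [X in _ + X]big1 ?addr0; last first.
  by move=> [[|j] /= hj] hkj; [rewrite !mul0r|exfalso; lia].
rewrite mulr_sumr; apply: eq_bigr => i _ /=.
rewrite [RHS]big_mkcond big_ord_recl /= !mul0r if_same add0r.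
rewrite mulr_sumr big_mkcond; apply: eq_bigr => j _ /=.
rewrite /bump /= add1n addnS ltnS; case: ifP => // _.
by rewrite exprS; ring.
Qed.

(** The monomials divisible by [x.1] go to [q] and the remaining pure powers of [x.2] to [r]. This
    recursive form allows induction on the degree without touching the double sum again. *)
Lemma polynSE k p : polyn k.+1 p -> exists a q r,
  [/\ polyn k q, polyn k r & p = fun x => a + x.1 * q x + x.2 * r x].
Proof.
move=> [c hc].
exists (c 0%N 0%N), (psum k (fun i j => c i.+1 j)),
  (psum k (fun i j => if i is 0%N then c 0%N j.+1 else 0)).
split; [by eexists => x|by eexists => x|apply/funext => x].
rewrite hc big_ord_recl /= big_mkcond big_ord_recl /= !expr0 !mulr1.
rewrite -!addrA; congr (_ + _); rewrite addrC; congr (_ + _).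
  rewrite /psum mulr_sumr; apply: eq_bigr => i _.
  rewrite [LHS]big_mkcond big_ord_recr /= ifN ?addr0; last first.
    by rewrite -ltnNge /bump /=; lia.
  rewrite mulr_sumr [RHS]big_mkcond; apply: eq_bigr => j _ /=.
  rewrite /bump /= add1n addSn ltnS; case: ifP => // _.
  by rewrite exprS; ring.
rewrite /psum [in RHS]big_ord_recl /= [X in _ = _ * (_ + X)]big1 ?addr0; last first.
  by move=> i _; rewrite big1// => j _; rewrite !mul0r.
rewrite mulr_sumr [RHS]big_mkcond; apply: eq_bigr => j _ /=.
rewrite /bump /= add0n add1n ltn_ord -ltnS ltn_ord exprS.
by rewrite expr0; ring.
Qed.

(** Products, derivatives, restrictions to lines and bounds on boxes are all obtained from this
    principle. The degree bound is an argument of [P] because it has to be tracked through these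
    operations. *)
Lemma polyn_ind (P : nat -> (pt R -> R) -> Prop) :
  (forall k a, P k (fun=> a)) ->
  (forall k a q r, polyn k q -> polyn k r -> P k q -> P k r ->
     P k.+1 (fun x => a + x.1 * q x + x.2 * r x)) ->
  forall k p, polyn k p -> P k p.
Proof.
move=> h0 hS; elim=> [|k IH] p hp.
  by have [a ->] := polyn0E hp; exact: h0.
have [a [q [r [hq hr ->]]]] := polynSE hp.
by apply: hS => //; exact: IH.
Qed.

Lemma polynM k l p q : polyn k p -> polyn l q -> polyn (k + l) (fun x => p x * q x).
Proof.
move=> hp; move: k p hp l q.
apply: (polyn_ind (P := fun k p => forall l q, polyn l q ->
  polyn (k + l) (fun x => p x * q x))) => [k a l q hq|k a p r hp hr IHp IHr l q hq].
  by apply: (@polyn_leq l); [rewrite leq_addl|exact: polynZ].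
rewrite (_ : (fun x => _) = fun x => a * q x + (x.1 * (p x * q x) + x.2 * (r x * q x))).
  apply: polynD; first by apply: (@polyn_leq l); [rewrite leq_addl|exact: polynZ].
  by rewrite addSn; apply: polynD; [apply: polyn_mulX; exact: IHp|
    apply: polyn_mulY; exact: IHr].
by apply/funext => x; ring.
Qed.

Lemma polyn_fst : polyn 1 (fun x : pt R => x.1).
Proof.
by have := polyn_mulX (polyn_cst 0 1); congr polyn; apply/funext=> x; rewrite mulr1.
Qed.

Lemma polyn_snd : polyn 1 (fun x : pt R => x.2).
Proof.
by have := polyn_mulY (polyn_cst 0 1); congr polyn; apply/funext=> x; rewrite mulr1.
Qed.

Lemma polyn1E p : polyn 1 p -> exists a b c : R, forall x, p x = a + b * x.1 + c * x.2.
Proof.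
move=> /polynSE[a [q [r [/polyn0E[b ->] /polyn0E[c ->] ->]]]].
by exists a, b, c => x; ring.
Qed.

Lemma polyn2E p : polyn 2 p -> exists a b c d e f : R, forall x,
  p x = a + b * x.1 + c * x.2 + d * x.1 ^+ 2 + e * (x.1 * x.2) + f * x.2 ^+ 2.
Proof.
move=> /polynSE[a [q [r [/polyn1E[b [d [e hq]]] /polyn1E[c [e' [f hr]]] ->]]]].
by exists a, b, c, d, (e + e'), f => x; rewrite hq hr; ring.
Qed.

Lemma polyn1I (a b c : R) p : (forall x, p x = a + b * x.1 + c * x.2) -> polyn 1 p.
Proof.
move=> hp; rewrite (_ : p = fun x => (a + b * x.1) + c * x.2); last exact/funext.
apply: polynD; last exact: polynZ polyn_snd.
by apply: polynD; [exact: polyn_cst|exact: polynZ polyn_fst].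
Qed.
End Polynomials.

(** * Directional derivatives of polynomials and their restrictions to lines *)

Section Derivatives.
Variable R : realType.
Implicit Types (p q r : pt R -> R) (x v w A : pt R) (k : nat).

Lemma is_derive_fst x v : is_derive x v (fun y : pt R => y.1) v.1.
Proof.
apply: DeriveDef.
  apply/diff_derivable/linear_differentiable => y; exact: cvg_fst.
rewrite deriveE; last by apply/linear_differentiable => y; exact: cvg_fst.
by rewrite (@diff_lin _ _ _ (fst : {linear _ -> _}))// => y; exact: cvg_fst.
Qed.

Lemma is_derive_snd x v : is_derive x v (fun y : pt R => y.2) v.2.
Proof.
apply: DeriveDef.
  apply/diff_derivable/linear_differentiable => y; exact: cvg_snd.
rewrite deriveE; last by apply/linear_differentiable => y; exact: cvg_snd.
by rewrite (@diff_lin _ _ _ (snd : {linear _ -> _}))// => y; exact: cvg_snd.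
Qed.

Lemma differentiable_fst x : differentiable (fun y : pt R => y.1) x.
Proof. by apply/linear_differentiable => y; exact: cvg_fst. Qed.

Lemma differentiable_snd x : differentiable (fun y : pt R => y.2) x.
Proof. by apply/linear_differentiable => y; exact: cvg_snd. Qed.

Lemma is_derive_step (a : R) q r x v dq dr :
  is_derive x v q dq -> is_derive x v r dr ->
  is_derive x v (fun y => a + y.1 * q y + y.2 * r y)
    (v.1 * q x + x.1 * dq + v.2 * r x + x.2 * dr).
Proof.
move=> hq hr; have h1 := is_derive_fst x v; have h2 := is_derive_snd x v.
rewrite (_ : (fun y => _) = cst a + ((fun y : pt R => y.1) * q) +
  ((fun y : pt R => y.2) * r)); last by apply/funext.
have -> : v.1 * q x + x.1 * dq + v.2 * r x + x.2 * dr =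
    0 + (x.1 *: dq + q x *: v.1) + (x.2 *: dr + r x *: v.2).
  by rewrite /GRing.scale /=; ring.
have h3 := is_deriveM h1 hq; have h4 := is_deriveM h2 hr.
exact: (is_deriveD (is_deriveD (is_derive_cst a x v) h3) h4).
Qed.

Lemma polyn_derivative k p v : polyn k p ->
  exists2 p', polyn k.-1 p' & forall x, is_derive x v p (p' x).
Proof.
move: k p; apply: (polyn_ind (P := fun k p => exists2 p', polyn k.-1 p' &
  forall x, is_derive x v p (p' x))) => [k a|k a q r hq hr [dq hdq Dq] [dr hdr Dr]].
  exists (fun=> 0); first exact: polyn_cst.
  by move=> x; exact: is_derive_cst.
exists (fun x => v.1 * q x + x.1 * dq x + v.2 * r x + x.2 * dr x); last first.
  by move=> x; exact: is_derive_step.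
have hX d : polyn k.-1 d -> forall s : pt R -> R, polyn 1 s -> (forall x, is_derive x v (fun y => s y) 0) \/ True ->
  polyn k (fun x => s x * d x) \/ k = 0%N.
  move=> hd s hs _; case: k hd {hq hr hdq hdr} => [|k] hd; [by right|left].
  by rewrite -add1n; exact: polynM.
(* For [k = 0] the bound [k.-1] on [dq] is again [0], so the product [x.1 * dq x] would count as
   linear. In this case [dq] and [dr] are first seen to vanish. *)
case: k hq hr hdq hdr {hX} => [|k] /= hq hr hdq hdr.
  have [a1 hq1] := polyn0E hq; have [a2 hr1] := polyn0E hr.
  have dq0 x : dq x = 0.
    have := @derive_val _ _ _ _ _ _ _ (Dq x).
    by rewrite hq1 derive_cst => <-.
  have dr0 x : dr x = 0.
    have := @derive_val _ _ _ _ _ _ _ (Dr x).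
    by rewrite hr1 derive_cst => <-.
  rewrite (_ : (fun x => _) = fun=> v.1 * a1 + v.2 * a2); first exact: polyn_cst.
  by apply/funext => x; rewrite dq0 dr0 hq1 hr1; ring.
apply: polynD; last exact: polyn_mulY.
apply: polynD; last exact: polynZ.
by apply: polynD; [exact: polynZ|exact: polyn_mulX].
Qed.

Lemma polyn_derivable k p x v : polyn k p -> derivable p x v.
Proof. by move=> /(polyn_derivative v)[p' _ /(_ x)[]]. Qed.

Lemma polyn_D k p v : polyn k p -> polyn k.-1 ('D_v p).
Proof.
move=> /(polyn_derivative v)[p' hp' Dp].
by rewrite (_ : 'D_v p = p')//; apply/funext => x; exact: derive_val.
Qed.

Lemma polyn_differentiable k p x : polyn k p -> differentiable p x.
Proof.
move: k p; apply: (polyn_ind (P := fun k p => differentiable p x)) => [k a|k a q r _ _ dq dr].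
  exact: differentiable_cst.
rewrite (_ : (fun y => _) = cst a + ((fun y : pt R => y.1) * q) +
  ((fun y : pt R => y.2) * r)); last by apply/funext.
apply: differentiableD; last first.
  by apply: differentiableM => //; exact: differentiable_snd.
apply: differentiableD; first exact: differentiable_cst.
by apply: differentiableM => //; exact: differentiable_fst.
Qed.

Lemma polyn_continuous k p : polyn k p -> continuous p.
Proof. by move=> hp x; apply: differentiable_continuous; exact: polyn_differentiable hp. Qed.

Lemma derive_linear p x (a b : R) v w : differentiable p x ->
  'D_(a *: v + b *: w) p x = a * 'D_v p x + b * 'D_w p x.
Proof.
by move=> dp; rewrite !deriveE// linearD !linearZ.
Qed.

Lemma derive_coord p x v : differentiable p x ->
  'D_v p x = v.1 * 'D_((1, 0) : pt R) p x + v.2 * 'D_((0, 1) : pt R) p x.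
Proof.
move=> dp; rewrite -(derive_linear _ _ _ _ dp); congr ('D_ _ p x).
rewrite [LHS]surjective_pairing; congr pair => /=.
  by rewrite [X in _ + X]mulr0 addr0 [RHS]mulr1.
by rewrite [X in X + _]mulr0 add0r [RHS]mulr1.
Qed.

(** The induction carries one function [e] that is the derivative of both first derivatives; its
    recursive expression is symmetric in [v] and [w]. *)
Lemma polyn_D_comm k p v w : polyn k p -> 'D_v ('D_w p) = 'D_w ('D_v p).
Proof.
suff h : polyn k p -> exists e : pt R -> R, forall x,
    is_derive x v ('D_w p) (e x) /\ is_derive x w ('D_v p) (e x).
  move=> /h[e he]; apply/funext => x; have [h1 h2] := he x.
  by rewrite (@derive_val _ _ _ _ _ _ _ h1) (@derive_val _ _ _ _ _ _ _ h2).
move: k p; apply: (polyn_ind (P := fun k p => exists e : pt R -> R, forall x,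
    is_derive x v ('D_w p) (e x) /\ is_derive x w ('D_v p) (e x))).
  move=> k a; exists (fun=> 0) => x.
  have D0 (u : pt R) : 'D_u (fun=> a : R) = fun=> 0 :> R.
    by apply/funext => y; exact: derive_cst.
  by rewrite !D0; split; exact: is_derive_cst.
move=> k a q r hq hr [e he] [f hf].
have DE (u : pt R) : 'D_u (fun x => a + x.1 * q x + x.2 * r x) =
   fun x => (u.1 * q x + u.2 * r x) + x.1 * 'D_u q x + x.2 * 'D_u r x.
  apply/funext => x.
  have := is_derive_step a (derivableP (@polyn_derivable k q x u hq))
    (derivableP (@polyn_derivable k r x u hr)).
  by move=> /(@derive_val _ _ _ _ _ _ _) ->; ring.
have DDE (u u' x : pt R) : is_derive x u' ('D_u q) (e x) ->
    is_derive x u' ('D_u r) (f x) ->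
    is_derive x u' ('D_u (fun x => a + x.1 * q x + x.2 * r x))
      (u.1 * 'D_u' q x + u.2 * 'D_u' r x +
       (u'.1 * 'D_u q x + x.1 * e x + u'.2 * 'D_u r x + x.2 * f x)).
  move=> q2 r2; rewrite DE.
  have q1 := derivableP (@polyn_derivable k q x u' hq).
  have r1 := derivableP (@polyn_derivable k r x u' hr).
  have := is_derive_step 0 q2 r2.
  set g := (fun y => 0 + _ + _) => h.
  rewrite (_ : (fun y => _) = cst u.1 * q + cst u.2 * r + g); last first.
    by apply/funext => y; rewrite /g !fctE; ring.
  have c1 := is_deriveM (is_derive_cst u.1 x u') q1.
  have c2 := is_deriveM (is_derive_cst u.2 x u') r1.
  have := is_deriveD (is_deriveD c1 c2) h.
  by rewrite !scaler0 !addr0.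
exists (fun x => w.1 * 'D_v q x + w.2 * 'D_v r x +
       (v.1 * 'D_w q x + x.1 * e x + v.2 * 'D_w r x + x.2 * f x)) => x.
have [q1 q2] := he x; have [r1 r2] := hf x; split; first exact: DDE.
have := DDE v w x q2 r2; congr is_derive.
generalize ('D_w q x) ('D_w r x) ('D_v q x) ('D_v r x) => b1 b2 b3 b4.
by ring.
Qed.

(** Along a line everything becomes univariate, so root counting and formal derivatives can replace
    analysis on edges. *)
Lemma polyn_line k p A v : polyn k p -> exists2 g : {poly R}, (size g <= k.+1)%N &
  forall t : R, p (A + t *: v) = g.[t] /\ 'D_v p (A + t *: v) = g^`().[t].
Proof.
move: k p; apply: (polyn_ind (P := fun k p => exists2 g : {poly R},
  (size g <= k.+1)%N &
  forall t : R, p (A + t *: v) = g.[t] /\ 'D_v p (A + t *: v) = g^`().[t])).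
  move=> k a; exists a%:P; first by rewrite (leq_trans (size_polyC_leq1 _)).
  by move=> t; rewrite hornerC derivC horner0 derive_cst.
move=> k a q r hq hr [gq sq Gq] [gr sr Gr].
pose l (b c : R) : {poly R} := b%:P + c *: 'X.
have sl b c : (size (l b c) <= 2)%N.
  rewrite (leq_trans (size_polyD _ _))// geq_max (leq_trans (size_polyC_leq1 _))//.
  by rewrite (leq_trans (size_scale_leq _ _))// size_polyX.
exists (a%:P + l A.1 v.1 * gq + l A.2 v.2 * gr).
  have sM (b c : R) (g : {poly R}) : (size g <= k.+1)%N -> (size (l b c * g)%R <= k.+2)%N.
    move=> sg; rewrite (leq_trans (size_polyMleq _ _))//.
    by have := sl b c; lia.
  rewrite (leq_trans (size_polyD _ _))// geq_max sM// andbT.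
  rewrite (leq_trans (size_polyD _ _))// geq_max sM// andbT.
  by rewrite (leq_trans (size_polyC_leq1 _)).
move=> t; have [q1 q2] := Gq t; have [r1 r2] := Gr t; split.
  rewrite !hornerE q1 r1 /= /GRing.scale /=; ring.
have Q := derivableP (@polyn_derivable k q (A + t *: v) v hq).
have S := derivableP (@polyn_derivable k r (A + t *: v) v hr).
move: Q S; rewrite q2 r2 => Q S; have := is_derive_step a Q S.
move=> /(@derive_val _ _ _ _ _ _ _) ->; rewrite q1 r1.
rewrite /l !(derivD, derivM, derivC, derivZ, derivX).
rewrite !hornerE.
rewrite /= /GRing.scale /=; ring.
Qed.

Lemma poly_zero_roots (g : {poly R}) (s : seq R) : uniq s ->
  (size g <= size s)%N -> (forall t, t \in s -> g.[t] = 0) -> g = 0.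
Proof.
move=> us sg hs; apply/eqP; apply: contraT => g0.
have := max_poly_roots g0 (_ : all (root g) s) us.
by rewrite ltnNge sg; apply; apply/allP => t ts; rewrite /root hs.
Qed.

(** As many equally spaced interior points as the size of [g] are already more roots than a nonzero
    [g] can have. *)
Lemma poly_zero_itv (g : {poly R}) (a b : R) : a < b -> (forall t, a < t -> t < b -> g.[t] = 0) -> g = 0.
Proof.
move=> ab h; set n := size g.
have n0 : (0 : R) < n.+1%:R by rewrite ltr0n.
pose r := [seq a + (b - a) * (i.+1%:R / n.+1%:R) | i <- iota 0 n].
apply: (@poly_zero_roots g r).
- rewrite map_inj_uniq ?iota_uniq// => i j /addrI.
  have ba : b - a != 0 by rewrite subr_eq0 gt_eqF.
  have n1 : (n.+1%:R : R)^-1 != 0 by rewrite invr_eq0 gt_eqF.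
  by move=> /(mulfI ba)/(mulIf n1)/eqP; rewrite eqr_nat => /eqP[].
- by rewrite size_map size_iota.
- move=> u /mapP[i]; rewrite mem_iota /= add0n => ik ->; apply: h.
    by rewrite ltrDl mulr_gt0 ?subr_gt0// divr_gt0// ltr0n.
  rewrite -ltrBrDl -[ltRHS]mulr1 ltr_pM2l ?subr_gt0// ltr_pdivrMr// mul1r ltr_nat.
  by rewrite ltnS.
Qed.

(** The line from [x0] to an arbitrary point starts inside the neighbourhood, so the restriction has
    a whole interval of roots. *)
Lemma polyn_zero_near k p x0 : polyn k p -> (\forall x \near x0, p x = 0) ->
  forall x, p x = 0.
Proof.
move=> hp /nbhs_ballP[e /= e0 he] y; have [g _ hg] := polyn_line x0 (y - x0) hp.
have n1 : 0 < `|y - x0| + 1 by rewrite ltr_wpDl.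
have g0 : g = 0.
  apply: (poly_zero_itv (a := 0) (b := e / (`|y - x0| + 1))) => [|t t0]; first by rewrite divr_gt0.
  rewrite ltr_pdivlMr// => te; rewrite -(hg t).1; apply: he.
  rewrite -ball_normE /= opprD addrA subrr sub0r normrN normrZ gtr0_norm//.
  by apply: le_lt_trans te; rewrite ler_pM2l// lerDl.
by have := (hg 1).1; rewrite scale1r addrC subrK g0 horner0.
Qed.
End Derivatives.

(** * Barycentric coordinates and quadratic interpolation on a triangle *)

Section Triangles.
Variable R : realType.
Implicit Types (K L M : tri R) (x y A B : pt R).

Definition i0 : 'I_3 := @Ordinal 3 0 isT.
Definition i1 : 'I_3 := @Ordinal 3 1 isT.
Definition i2 : 'I_3 := @Ordinal 3 2 isT.

Lemma ord3P (P : 'I_3 -> Prop) : P i0 -> P i1 -> P i2 -> forall i, P i.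
Proof.
move=> h0 h1 h2 [[|[|[|//]]] hi].
- by rewrite (_ : Ordinal hi = i0)//; exact: val_inj.
- by rewrite (_ : Ordinal hi = i1)//; exact: val_inj.
- by rewrite (_ : Ordinal hi = i2)//; exact: val_inj.
Qed.

Lemma sum3 (V : nmodType) (F : 'I_3 -> V) : \sum_i F i = F i0 + F i1 + F i2.
Proof.
rewrite !big_ord_recl big_ord0 addr0 addrA.
by congr (F _ + F _ + F _); exact: val_inj.
Qed.

Definition nx (i : 'I_3) : 'I_3 :=
  match val i with 0%N => i1 | 1%N => i2 | _ => i0 end.

Lemma nxK i : nx (nx (nx i)) = i.
Proof. by move: i; apply: ord3P. Qed.

Definition vt K (i : 'I_3) : pt R := (verts K)`_i.

Definition orient K : R := cross (K.1.2 - K.1.1) (K.2 - K.1.1).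

(** The barycentric coordinates, as quotients of signed areas. Numerator and denominator change sign
    together, so the orientation of [K] does not matter. *)
Definition lam K (i : 'I_3) x : R :=
  cross (vt K (nx i) - x) (vt K (nx (nx i)) - x) / orient K.

(** Edge number [i] is the edge opposite to vertex [i]; this is its midpoint. *)
Definition ept K (i : 'I_3) : pt R := mid (vt K (nx i), vt K (nx (nx i))).

Lemma pairE (x y : pt R) : x.1 = y.1 -> x.2 = y.2 -> x = y.
Proof. by case: x y => ? ? [? ?] /= -> ->. Qed.

Lemma lam_sum K x : orient K != 0 -> \sum_i lam K i x = 1.
Proof.
move=> hK; rewrite sum3 /lam -!mulrDl; apply: (mulIf hK).
rewrite mulfVK// mul1r /orient /cross /vt /=; ring.
Qed.

Lemma lam_dec K x : orient K != 0 -> x = \sum_i lam K i x *: vt K i.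
Proof.
move=> hK; rewrite sum3 /lam; apply: pairE; rewrite /= /GRing.scale /=;
  rewrite !(mulrAC _ (orient K)^-1) -!mulrDl; apply/esym/(canLR (mulfK hK));
  rewrite /orient /cross /vt /=; ring.
Qed.

Lemma lam_vt K i j : orient K != 0 -> lam K i (vt K j) = (i == j)%:R.
Proof.
by move=> hK; move: i j; apply: ord3P; apply: ord3P; rewrite /lam ?mulr1n ?mulr0n;
  first [apply: (mulIf hK); rewrite mulfVK// ?mul1r ?mul0r /orient /cross /vt /=; ring].
Qed.

Lemma lam_aff K i x y (s t : R) : s + t = 1 ->
  lam K i (s *: x + t *: y) = s * lam K i x + t * lam K i y.
Proof.
move=> st; have -> : s = 1 - t by rewrite -st addrK.
rewrite /lam !mulrA -mulrDl; congr (_ / _).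
rewrite /cross /= /GRing.scale /=; ring.
Qed.

Lemma lam_polyn K i : polyn 1 (lam K i).
Proof.
set b := vt K (nx i); set c := vt K (nx (nx i)).
apply: (@polyn1I _ ((b.1 * c.2 - b.2 * c.1) / orient K)
  ((b.2 - c.2) / orient K) ((c.1 - b.1) / orient K)) => x.
rewrite /lam -/b -/c /cross /=.
by rewrite -!(mulrAC _ _ (orient K)^-1) -!mulrDl; congr (_ / _); ring.
Qed.

Lemma lam_uniq K (c : 'I_3 -> R) i : orient K != 0 -> \sum_i c i = 1 ->
  lam K i (\sum_i c i *: vt K i) = c i.
Proof.
move=> hK; rewrite !sum3 => hc.
have hc0 : c i0 = 1 - c i1 - c i2 by rewrite -hc; ring.
rewrite /lam; apply: (mulIf hK); rewrite mulfVK// hc0.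
move: i; apply: ord3P; rewrite ?hc0 /orient /cross /vt /= /GRing.scale /=; ring.
Qed.

Lemma hullE K : orient K != 0 ->
  hull (verts K) = [set x | forall i, 0 <= lam K i x].
Proof.
move=> hK; apply/seteqP; split=> x /=.
  move=> [c [c0 c1 ->]] i.
  by rewrite (lam_uniq (c := c) i hK c1).
move=> h; exists (fun i => lam K i x); split=> //; first exact: lam_sum.
exact: lam_dec.
Qed.

Lemma hull_vt K i : hull (verts K) (vt K i).
Proof.
exists (fun j => (j == i)%:R); split=> [j||]; first exact: ler0n.
  by rewrite (bigD1 i)//= eqxx big1 ?addr0// => j /negbTE ->.
rewrite (bigD1 i)//= eqxx scale1r big1 ?addr0// => j /negbTE ->.
exact: scale0r.
Qed.

Lemma seg_hullP A B x : hull [:: A; B] x <->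
  exists t : R, [/\ 0 <= t, t <= 1 & x = A + t *: (B - A)].
Proof.
split=> [[c [c0 c1 ->]]|[t [t0 t1 ->]]].
  move: c1; rewrite big_ord_recl big_ord1 => c1.
  exists (c (lift ord0 ord0)); split; [exact: c0|rewrite -c1 lerDr; exact: c0|].
  rewrite big_ord_recl big_ord1 /=.
  have -> : c ord0 = 1 - c (lift ord0 ord0) by rewrite -c1 addrK.
  by apply: pairE; rewrite /= /GRing.scale /=; ring.
exists (fun i => if val i == 0%N then 1 - t else t); split.
- by move=> i; case: ifP => _//; rewrite subr_ge0.
- by rewrite big_ord_recl big_ord1 /= subrK.
- rewrite big_ord_recl big_ord1 /=.
  by apply: pairE; rewrite /= /GRing.scale /=; ring.
Qed.

Lemma seg_hulll A B : hull [:: A; B] A.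
Proof. by apply/seg_hullP; exists 0; rewrite scale0r addr0; split=> //; exact: ler01. Qed.

Lemma seg_hullr A B : hull [:: A; B] B.
Proof. by apply/seg_hullP; exists 1; rewrite scale1r addrC subrK; split=> //; exact: ler01. Qed.

Lemma seg_image A B : hull [:: A; B] = (fun t : R => A + t *: (B - A)) @` `[0, 1].
Proof.
apply/seteqP; split=> x.
  by move=> /seg_hullP[t [t0 t1 ->]]; exists t => //=; rewrite in_itv /= t0.
by move=> [t /=]; rewrite in_itv /= => /andP[t0 t1] <-; apply/seg_hullP; exists t.
Qed.

Lemma hull_sub (s t : seq (pt R)) : {subset s <= t} -> uniq s -> hull s `<=` hull t.
Proof.
move=> st us x [c [c0 c1 ->]].
pose d (j : 'I_(size t)) : R := \sum_(i < size s | index s`_i t == j) c i.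
have idx (i : 'I_(size s)) : (index (nth 0%R s i) t < size t)%N.
  by rewrite index_mem st// mem_nth.
exists d; split.
- by move=> j; apply: sumr_ge0 => i _.
- rewrite -c1 /d (exchange_big_dep predT)//=; apply: eq_bigr => i _.
  rewrite (bigD1 (Ordinal (idx i)))//= big1 ?addr0// => j /andP[/eqP ij].
  by move=> /negP[]; apply/eqP/val_inj.
- rewrite /d; under [RHS]eq_bigr do rewrite scaler_suml.
  rewrite (exchange_big_dep predT)//=; apply: eq_bigr => i _.
  rewrite (bigD1 (Ordinal (idx i)))//= big1 ?addr0.
    by rewrite nth_index// st// mem_nth.
  by move=> j /andP[/eqP ij] /negP[]; apply/eqP/val_inj.
Qed.

(** The quadratic Lagrange interpolant of [S] on the three vertices and the three edge midpoints,
    written in barycentric coordinates. *)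
Definition quad K (S : pt R -> R) x : R :=
  \sum_i (S (vt K i) * (lam K i x * (2 * lam K i x - 1)) +
          S (ept K i) * (4 * (lam K (nx i) x * lam K (nx (nx i)) x))).

Lemma quad_polyn K S : polyn 2 (quad K S).
Proof.
have h i : polyn 1 (lam K i) by exact: lam_polyn.
apply: polyn_sum => i _; apply: polynD; apply: polynZ.
  apply: (polynM (k := 1) (l := 1)) => //; apply: polynB; last exact: polyn_cst.
  exact: polynZ.
by apply: polynZ; exact: (polynM (k := 1) (l := 1)).
Qed.

Lemma lam_ept K i j : orient K != 0 -> lam K i (ept K j) = if i == j then 0 else 2^-1.
Proof.
move=> hK; rewrite /ept /mid /= scalerDr lam_aff; last by field.
rewrite !lam_vt//; move: i j; apply: ord3P; apply: ord3P => /=; try by []; by field.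
Qed.

Lemma quad_vt K S i : orient K != 0 -> quad K S (vt K i) = S (vt K i).
Proof.
move=> hK; rewrite /quad sum3 !lam_vt//; move: i; apply: ord3P => /=; ring.
Qed.

Lemma quad_ept K S i : orient K != 0 -> quad K S (ept K i) = S (ept K i).
Proof.
move=> hK; rewrite /quad sum3 !lam_ept//; move: i; apply: ord3P => /=; by field.
Qed.

Lemma polyn2_quad K p x : orient K != 0 -> polyn 2 p -> p x = quad K p x.
Proof.
move=> hK /polyn2E[a [b [c [d [e [f hp]]]]]].
rewrite /quad sum3 [in LHS](lam_dec x hK) sum3.
have := lam_sum x hK; rewrite sum3 => hs.
have -> : lam K i0 x = 1 - lam K i1 x - lam K i2 x by rewrite -hs; ring.
rewrite !hp /ept /mid /vt /nx /=.
move: (lam K i1 x) (lam K i2 x) => s t.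
move: K.1.1 K.1.2 K.2 => [A1 A2] [B1 B2] [C1 C2].
rewrite /= /GRing.scale /=; by field.
Qed.
End Triangles.

Ltac pt_ring := apply: pairE; rewrite /= /GRing.scale /=; ring.

(** * Lebesgue measure in the plane and almost-everywhere statements *)

Section PlaneMeasure.
Variable R : realType.
Implicit Types (U A D : set (pt R)) (f p phi : pt R -> R) (K : tri R).
Notation mu := (@leb2 R).
Notation mpt := (measurableTypeR R * measurableTypeR R)%type.

Lemma ball_prodE (x y : pt R) (e : R) :
  ball x e y <-> `|x.1 - y.1| < e /\ `|x.2 - y.2| < e.
Proof. by []. Qed.

Lemma ball_prod_set (x : pt R) (e : R) : ball x e = ball x.1 e `*` ball x.2 e.
Proof. by []. Qed.

(** Balls of the plane are products of intervals, hence measurable for the product algebra, and an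
    open set is the countable union of the balls with rational centre and radius [1 / (n + 1)] that
    it contains. *)
Lemma open_measurable2 U : open U -> measurable (U : set mpt).
Proof.
move=> oU.
pose F (i : rat * rat * nat) : set (pt R) :=
  let B := ball ((ratr i.1.1, ratr i.1.2) : pt R) i.2.+1%:R^-1 in
  if `[< B `<=` U >] then B else set0.
have -> : U = \bigcup_i F i.
  apply/seteqP; split=> x; last first.
    by move=> [i _]; rewrite /F; case: asboolP => // h /h.
  rewrite openE in oU => /oU /nbhs_ballP[e /= e0 he].
  (* Twice the radius must stay below [e]: once for the distance from [x] to the rational centre,
     once for the ball around that centre. *)
  pose n := Num.truncn (2 / e); pose d : R := n.+1%:R^-1.
  have d0 : 0 < d by rewrite invr_gt0 ltr0n.
  have de : d + d <= e.
    have : 2 / e < n.+1%:R by rewrite truncnS_gt.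
    rewrite ltr_pdivrMr// => h.
    have -> : d + d = 2 / n.+1%:R by rewrite mulrDl mul1r.
    by rewrite ler_pdivrMr ?ltr0n// mulrC ltW.
  have [q1 hq1] : exists q : rat, ratr q \in `]x.1 - d, x.1 + d[.
    by apply: rat_in_itvoo; lra.
  have [q2 hq2] : exists q : rat, ratr q \in `]x.2 - d, x.2 + d[.
    by apply: rat_in_itvoo; lra.
  move: hq1 hq2; rewrite !in_itv /= => /andP[h1 h2] /andP[h3 h4].
  exists ((q1, q2), n) => //; rewrite /F /= asboolT; last first.
    move=> y /ball_prodE /= [hy1 hy2]; apply: he; apply/ball_prodE.
    by move: hy1 hy2; rewrite -/d !ltr_norml => /andP[? ?] /andP[? ?]; split;
      apply/andP; split; lra.
  by apply/ball_prodE; rewrite -/d /= !ltr_norml; split; apply/andP; split; lra.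
apply: countable_bigcupT_measurable => // i; rewrite /F.
case: asboolP => _; last exact: measurable0.
by rewrite ball_prod_set; apply: measurableX; exact: measurable_ball.
Qed.

Lemma closed_measurable2 U : closed U -> measurable (U : set mpt).
Proof. by move/closed_openC/open_measurable2/measurableC; rewrite setCK. Qed.

Lemma continuous_measurable2 f : continuous f ->
  measurable_fun setT (f : mpt -> measurableTypeR R).
Proof.
move=> /continuousP cf; apply: (measurability _ (RGenOpens.measurableE R)).
move=> _ [_ [a [b ->] <-]]; rewrite setTI; apply: open_measurable2.
exact/cf/interval_open.
Qed.

Lemma leb2_setX (A B : set R) : measurable (A : set (measurableTypeR R)) ->
  measurable (B : set (measurableTypeR R)) ->
  mu (A `*` B) = (@lebesgue_measure R A * @lebesgue_measure R B)%E.
Proof. exact: product_measure1E. Qed.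

Lemma pnormE (x : pt R) : `|x| = Num.max `|x.1| `|x.2|.
Proof. by []. Qed.

(** The measure integrates the sections over the first variable, and these are single points unless
    the line is vertical. A vertical line is a product with a null factor. *)
Lemma line_null (a b c : R) : (a != 0) || (b != 0) ->
  mu [set x | a * x.1 + b * x.2 = c] = 0%E.
Proof.
have [b0|b0] := eqVneq b 0; last first.
  move=> _; rewrite /leb2 /= /product_measure1 /=.
  apply: integral0_eq => x _ /=.
  rewrite (_ : xsection _ x = [set (c - a * x) / b]) ?lebesgue_measure_set1//.
  apply/seteqP; split=> y; rewrite /xsection /= inE /=.
    by move=> <-; rewrite addrAC subrr add0r mulrC mulKf.
  by move=> ->; field.
rewrite b0 orbF => a0.
rewrite (_ : [set x | _] = [set c / a] `*` setT).
  rewrite leb2_setX//.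
  by rewrite lebesgue_measure_set1 mul0e.
apply/seteqP; split=> -[x y] /=; rewrite mul0r addr0.
  by move=> <-; split => //; rewrite mulrC mulKf.
by move=> [-> _]; field.
Qed.

Lemma line_closed (a b c : R) : closed [set x : pt R | a * x.1 + b * x.2 = c].
Proof.
have h : continuous (fun x : pt R => a * x.1 + b * x.2).
  apply: (@polyn_continuous _ 1); apply: (@polyn1I _ 0 a b) => x.
  by rewrite add0r.
rewrite (_ : [set x | _] = (fun x : pt R => a * x.1 + b * x.2) @^-1` [set c])//.
by apply: closed_comp.
Qed.

Lemma line_negligible (a b c : R) : (a != 0) || (b != 0) ->
  mu.-negligible [set x | a * x.1 + b * x.2 = c].
Proof.
move=> ab; exists [set x | a * x.1 + b * x.2 = c]; split=> //.
- by apply: closed_measurable2; exact: line_closed.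
- exact: line_null ab.
Qed.

Definition box (r : R) : set (pt R) := `[- r, r] `*` `[- r, r].

Lemma box_measurable r : measurable (box r : set mpt).
Proof. by apply: measurableX; exact: measurable_itv. Qed.

Lemma mu_box r : (mu (box r) < +oo)%E.
Proof.
rewrite /box leb2_setX; try exact: measurable_itv.
rewrite lebesgue_measure_itv /=; case: ifPn => _; last by rewrite mul0e.
by rewrite -!EFinD -EFinM ltry.
Qed.

Lemma bounded_box A : bounded_set A -> exists2 r, 0 < r & A `<=` box r.
Proof.
move=> [M [_ hM]]; exists (Num.max M 0 + 1); first by rewrite ltr_wpDl// le_max lexx orbT.
move=> x Ax; have := hM (Num.max M 0 + 1).
rewrite ltr_pwDr ?le_max ?lexx// => /(_ isT) /(_ x Ax) /=.
rewrite pnormE ge_max => /andP[h1 h2].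
by split; rewrite /= in_itv /= -ler_norml.
Qed.

Lemma box_bounded r x : box r x -> `|x.1| <= r /\ `|x.2| <= r.
Proof. by move=> [/=]; rewrite !in_itv /= -!ler_norml. Qed.

Lemma Lfun2_bounded D f (C r : R) : measurable (D : set mpt) -> D `<=` box r ->
  measurable_fun setT (f : mpt -> R) -> (forall x, D x -> `|f x| <= C) ->
  f \_ D \in Lfun mu 2%:E.
Proof.
move=> mD Dr mf fC.
have mfD : measurable_fun setT (f \_ D : mpt -> R).
  by apply/(measurable_restrictT _ mD); exact: measurable_funTS.
rewrite inE; apply/andP; split; rewrite inE //=.
rewrite /finite_norm unlock /= poweR_lty//.
have C0 : 0 <= `|C| by [].
apply: (@le_lt_trans _ _ (\int[mu]_(x in box r) (`|C| ^+ 2)%:E)%E); last first.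
  rewrite integral_cst; last exact: box_measurable.
  by rewrite lte_mul_pinfty ?lee_fin ?exprn_ge0//; exact: mu_box.
rewrite [leRHS]integral_mkcond; apply: ge0_le_integral => //.
- apply/measurable_EFinP.
  apply: (measurableT_comp (measurable_powR _)) => //.
  exact: measurableT_comp.
- apply/(measurable_restrictT _ (@box_measurable r)).
  exact: measurable_cst.
- move=> x _; rewrite /= !patchE; case: ifPn => xD; last first.
    rewrite normr0 powR0 ?pnatr_eq0//.
    by case: ifP => // _; rewrite lee_fin exprn_ge0.
  rewrite mem_set; last exact/Dr/set_mem.
  rewrite lee_fin powR_mulrn// ler_pXn2r ?nnegrE//.
  by rewrite (le_trans (fC _ (set_mem xD)))// ler_norm.
Qed.

Lemma polyn_bounded k p (r : R) : polyn k p ->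
  exists C, forall x, box r x -> `|p x| <= C.
Proof.
move: k p; apply: (polyn_ind (P := fun k p => exists C, forall x, box r x -> `|p x| <= C)).
  by move=> k a; exists `|a|.
move=> k a q s _ _ [C hC] [D hD]; exists (`|a| + `|r| * `|C| + `|r| * `|D|) => x xr.
have [x1 x2] := box_bounded xr.
rewrite (le_trans (ler_normD _ _))// lerD//.
  rewrite (le_trans (ler_normD _ _))// lerD// normrM ler_pM//.
    by rewrite (le_trans x1)// ler_norm.
  by rewrite (le_trans (hC _ xr))// ler_norm.
rewrite normrM ler_pM//; first by rewrite (le_trans x2)// ler_norm.
by rewrite (le_trans (hD _ xr))// ler_norm.
Qed.

Lemma ball_mu_pos (x : pt R) (e : R) : 0 < e -> (0 < mu (ball x e))%E.
Proof.
move=> e0; rewrite ball_prod_set leb2_setX; try exact: measurable_ball.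
by rewrite !lebesgue_measure_ball ?ltW//= -EFinM lte_fin mulr_gt0// ?mulrn_wgt0//.
Qed.

Lemma ae_ball_ex (P : pt R -> Prop) (x : pt R) (e : R) : 0 < e ->
  {ae mu, forall y, P y} -> exists2 y, ball x e y & P y.
Proof.
move=> e0 [N [mN N0 hN]]; apply: contrapT => hno.
have : (mu (ball x e) <= mu N)%E.
  apply: le_measure; rewrite ?inE//.
    by rewrite ball_prod_set; apply: measurableX; exact: measurable_ball.
  move=> y xy; apply: hN => /= Py; apply: hno; by exists y.
by rewrite N0 leNgt ball_mu_pos.
Qed.

Lemma ae_onE A (P : pt R -> Prop) : ae_on A P <-> mu.-negligible [set x | A x /\ ~ P x].
Proof.
rewrite (_ : [set x | A x /\ ~ P x] = ~` [set x | A x -> P x])//.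
by apply/seteqP; split=> x /= => [/not_implyP|/not_implyP].
Qed.

Lemma ae_onW A (P : pt R -> Prop) : (forall x, A x -> P x) -> ae_on A P.
Proof.
move=> h; apply/ae_onE; rewrite (_ : [set x | _] = set0).
  exact: negligible_set0.
by rewrite -subset0 => x /= [/h].
Qed.

Lemma ae_onS A B (P Q : pt R -> Prop) : (forall x, B x -> P x -> Q x) -> B `<=` A ->
  ae_on A P -> ae_on B Q.
Proof.
move=> h BA /ae_onE hP; apply/ae_onE; apply: negligibleS hP => x /= [Bx nQ].
by split; [exact: BA|move=> Px; apply: nQ; exact: h].
Qed.

Lemma ae_on2 A (P Q S : pt R -> Prop) : ae_on A P -> ae_on A Q ->
  (forall x, A x -> P x -> Q x -> S x) -> ae_on A S.
Proof.
move=> /ae_onE hP /ae_onE hQ h; apply/ae_onE; apply: negligibleS (negligibleU hP hQ).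
move=> x /= [Ax nS]; have [Px|nP] := pselect (P x); last by left.
by right; split=> // Qx; apply: nS; exact: h.
Qed.

Lemma ae_onD A B (P : pt R -> Prop) : mu.-negligible (A `\` B) -> ae_on B P -> ae_on A P.
Proof.
move=> hN /ae_onE hP; apply/ae_onE; apply: negligibleS (negligibleU hN hP).
move=> x /= [Ax nP]; have [Bx|nB] := pselect (B x); first by right.
by left.
Qed.

(** A nonzero value would persist on a small ball by continuity, and balls have positive measure. *)
Lemma polyn_ae_ball k p (x : pt R) (e : R) : 0 < e -> polyn k p ->
  ae_on (ball x e) (fun y => p y = 0) -> forall y, p y = 0.
Proof.
move=> e0 hp hae; apply: (polyn_zero_near (x0 := x) hp).
apply/nbhs_ballP; exists e => //= y xy; apply: contrapT => /eqP py.
have oB : open (ball x e) by exact: ball_open.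
have : nbhs y [set z | ball x e z /\ p z != 0].
  apply: filterI; first by apply: open_nbhs_nbhs.
  have : p z @[z --> y] --> p y by exact: polyn_continuous hp _.
  by move=> /cvgr_neq0; apply.
move=> /nbhs_ballP[d /= d0 hd].
have [z /hd[xz pz] /(_ xz)] := ae_ball_ex y d0 hae.
by move/eqP: pz.
Qed.

Lemma hull_ball K : orient K != 0 -> exists x e, 0 < e /\ ball x e `<=` hull (verts K) /\
  (forall i y, ball x e y -> 0 < lam K i y).
Proof.
move=> hK; pose x := \sum_i (3^-1 : R) *: vt K i.
have lx i : lam K i x = 3^-1.
  by rewrite (lam_uniq (c := fun=> 3^-1))// sum3; field.
have : nbhs x [set y | forall i, 0 < lam K i y].
  have h i : \forall y \near x, 0 < lam K i y.
    have : lam K i y @[y --> x] --> lam K i x by exact: polyn_continuous (lam_polyn K i) _.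
    by move=> /cvgr_gt; apply; rewrite lx invr_gt0.
  near=> y; apply: ord3P; near: y; exact: h.
move=> /nbhs_ballP[e /= e0 he]; exists x, e; split=> //; split=> [y /he|i y /he]; last exact.
by rewrite hullE// => h i; exact/ltW/h.
Unshelve. all: by end_near.
Qed.

Lemma polyn_ae_hull k p K : orient K != 0 -> polyn k p ->
  ae_on (hull (verts K)) (fun y => p y = 0) -> forall y, p y = 0.
Proof.
move=> hK hp hae; have [x [e [e0 [hsub _]]]] := hull_ball hK.
apply: (polyn_ae_ball (x := x) e0 hp).
exact: ae_onS hae.
Qed.

(** Since a piece is determined by the function, the quantifiers over representing polynomials in
    [cont_at] amount to a condition on one fixed family. *)
Lemma restr_poly_uniq k f p q K : orient K != 0 ->
  restr_poly (hull (verts K)) k f p -> restr_poly (hull (verts K)) k f q -> p = q.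
Proof.
move=> hK [hp fp] [hq fq]; apply/funext => x; apply: subr0_eq.
move: x; apply: (polyn_ae_hull hK (polynB hp hq)).
by apply: (ae_on2 fp fq) => x Kx h1 h2; rewrite -h1// -h2// subrr.
Qed.

Lemma hull_closed K : orient K != 0 -> closed (hull (verts K)).
Proof.
move=> hK; rewrite hullE//.
have hc i : closed (lam K i @^-1` [set y | 0 <= y]).
  apply: closed_comp; last exact: closed_ge.
  by move=> x _; exact: polyn_continuous (lam_polyn K i) _.
rewrite (_ : [set x | _] = lam K i0 @^-1` [set y | 0 <= y] `&`
  lam K i1 @^-1` [set y | 0 <= y] `&` lam K i2 @^-1` [set y | 0 <= y]); last first.
  by apply/seteqP; split=> x /= => [h|[[h0 h1] h2]]; [|exact: ord3P].
by apply: closedI => //; exact: closedI.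
Qed.
End PlaneMeasure.

(** * Smooth bump functions on an interval *)

Section Bump.
Variable R : realType.
Variables (a b s : R).
Hypotheses (ab : a < b) (s0 : 0 < s).

Definition bump_weight : {poly R} := ('X - a%:P) * (b%:P - 'X).
Local Notation w := bump_weight.

Let wE x : w.[x] = (x - a) * (b - x).
Proof. by rewrite /bump_weight !hornerE. Qed.

Let w_gt0 x : a < x -> x < b -> 0 < w.[x].
Proof. by move=> ax xb; rewrite wE mulr_gt0// subr_gt0. Qed.

(** With [w] vanishing at both ends, the functions p w^(-k) exp(-s/w), extended by zero, form a
    class closed under differentiation, so smoothness follows by iteration. The scale [s] will tend
    to 0, which makes the bumps converge to the indicator of the open interval. *)
Definition bump (p : {poly R}) (k : nat) (x : R) : R :=
  if (a < x) && (x < b) then p.[x] / w.[x] ^+ k * expR (- (s / w.[x])) else 0.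

(** The numerator of the derivative over the common denominator w^(k+2). *)
Definition bump_next (p : {poly R}) k : {poly R} :=
  p^`() * w ^+ 2 - (k%:R *: (p * w^`() * w)) + s *: (p * w^`()).

Let itv_nbhs x : a < x -> x < b -> \forall y \near x, (a < y) && (y < b).
Proof.
move=> ax xb; near=> y; apply/andP; split; near: y.
  exact: lt_nbhsr.
exact: lt_nbhsl.
Unshelve. all: by end_near.
Qed.

Lemma bump_derive_in p k x : a < x -> x < b ->
  is_derive x 1 (bump p k) (bump (bump_next p k) k.+2 x).
Proof.
move=> ax xb; have w0 := w_gt0 ax xb; have wn0 := lt0r_neq0 w0.
pose f (y : R) := p.[y] * (w.[y] ^+ k)^-1 * expR (- (s * (w.[y])^-1)).
have hq (q : {poly R}) : is_derive x 1 (horner q) q^`().[x].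
  have h := @derivable_horner R q x; apply: DeriveDef => //.
  by rewrite -derive1E derivE.
have hf : is_derive x 1 f (bump (bump_next p k) k.+2 x).
  have hw := hq w; have hp := hq p.
  have hwk : is_derive x 1 (fun y => w.[y] ^+ k) (k%:R * w.[x] ^+ k.-1 * w^`().[x]).
    have := hq (w ^+ k); rewrite deriv_exp hornerMn hornerM horner_exp.
    have -> : horner (w ^+ k) = (fun y => w.[y] ^+ k).
      by apply/funext => y; rewrite horner_exp.
    by congr is_derive; rewrite -mulr_natl; ring.
  have hwki : is_derive x 1 (fun y => (w.[y] ^+ k)^-1)
     (- (w.[x] ^+ k) ^- 2 * (k%:R * w.[x] ^+ k.-1 * w^`().[x])).
    by apply: (is_deriveV (f := fun y => w.[y] ^+ k) _ hwk); rewrite expf_neq0.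
  have hwi : is_derive x 1 (fun y => - (s * (w.[y])^-1)) (s * w.[x] ^- 2 * w^`().[x]).
    have h1 := is_deriveV (f := horner w) wn0 hw.
    have := is_deriveN (is_deriveM (is_derive_cst s x 1) h1).
    by congr is_derive; rewrite /GRing.scale /= mulr0 addr0; ring.
  have he : is_derive x 1 (fun y => expR (- (s * (w.[y])^-1)))
      (expR (- (s * (w.[x])^-1)) * (s * w.[x] ^- 2 * w^`().[x])).
    have := @is_derive1_comp _ expR (fun y => - (s * (w.[y])^-1)) x _ _
      (is_derive_expR _) hwi.
    by [].
  have := is_deriveM (is_deriveM hp hwki) he; congr is_derive.
  have nextE : (bump_next p k).[x] = p^`().[x] * w.[x] ^+ 2 -
      k%:R * (p.[x] * w^`().[x] * w.[x]) + s * (p.[x] * w^`().[x]).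
    by rewrite /bump_next; move: w => v; rewrite !hornerE; ring.
  rewrite /bump ax xb /= nextE /GRing.scale /=.
  rewrite -[(horner p * _) x]/(p.[x] * w.[x] ^- k).
  set E := expR _; set W := w.[x]; set W' := w^`().[x].
  have Wk : W ^+ k.-1 * k%:R = W ^+ k * W^-1 * k%:R.
    case: k {hwk hwki f nextE} => [|k]; first by rewrite !mulr0.
    by rewrite exprSr mulfK.
  have -> : k%:R * W ^+ k.-1 * W' = W ^+ k * W^-1 * k%:R * W' by rewrite -Wk; ring.
  have Wkn0 : W ^+ k != 0 by rewrite expf_neq0.
  rewrite !exprS; move: (W ^+ k) Wkn0 => V V0.
  by field; rewrite V0 wn0.
have fE : \forall y \near x, f y = bump p k y.
  near=> y; have : (a < y) && (y < b) by near: y; exact: itv_nbhs.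
  by rewrite /bump => ->.
exact: near_eq_is_derive fE hf.
Unshelve. all: by end_near.
Qed.

(** One term of the exponential series bounds exp(-s/w) by a multiple of w^(k+2), which cancels the
    pole and leaves a factor w^2. Quadratic decay at [a] and [b] is what makes the derivative there
    exist and vanish. *)
Lemma bump_quad p k : exists2 C, 0 <= C &
  forall x, `|bump p k x| <= C * (x - a) ^+ 2 /\ `|bump p k x| <= C * (x - b) ^+ 2.
Proof.
have [P hP] : exists P : R, forall x, a <= x -> x <= b -> `|p.[x]| <= P.
  have /(EVT_max (ltW ab))[c _ hc] : {within `[a, b], continuous (fun x => `|p.[x]|)}.
    apply: continuous_subspaceT => x; apply: continuous_comp; last exact: norm_continuous.
    exact: continuous_horner.
  by exists `|p.[c]| => x ax xb; apply: hc; rewrite in_itv /= ax.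
have P0 : 0 <= P by rewrite (le_trans _ (hP a _ _))// ltW.
pose F : R := (k.+2)`!%:R / s ^+ k.+2.
have F0 : 0 <= F by rewrite divr_ge0// exprn_ge0// ltW.
exists (P * F * (b - a) ^+ 2); first by rewrite mulr_ge0 ?sqr_ge0// mulr_ge0.
have C0 : 0 <= P * F * (b - a) ^+ 2 by rewrite mulr_ge0 ?sqr_ge0// mulr_ge0.
move=> x; rewrite /bump; case: ifPn => [/andP[ax xb]|_]; last first.
  by rewrite normr0; split; apply: mulr_ge0 => //; exact: sqr_ge0.
have w0 := w_gt0 ax xb.
have key : `|p.[x] / w.[x] ^+ k * expR (- (s / w.[x]))| <= P * F * w.[x] ^+ 2.
  rewrite normrM (ger0_norm (expR_ge0 _)) normrM normfV normrX (gtr0_norm w0).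
  have h1 : expR (- (s / w.[x])) <= F * w.[x] ^+ k.+2.
    have := expR_ge1Dxn k.+1 (ltW (divr_gt0 s0 w0)).
    move=> h; have {}h : (s / w.[x]) ^+ k.+2 / (k.+2)`!%:R <= expR (s / w.[x]).
      by rewrite (le_trans _ h)// lerDr.
    rewrite expRN -[leRHS]invrK lef_pV2 ?posrE ?expR_gt0//; last first.
      by rewrite invr_gt0 mulr_gt0 ?exprn_gt0// /F divr_gt0 ?exprn_gt0// ltr0n fact_gt0.
    rewrite (le_trans _ h)// /F expr_div_n.
    rewrite le_eqVlt; apply/orP; left; apply/eqP.
    have Wn0 : w.[x] ^+ k.+2 != 0 by rewrite expf_neq0// lt0r_neq0.
    have sn0 : s ^+ k.+2 != 0 by rewrite expf_neq0// lt0r_neq0.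
    have fn0 : (k.+2)`!%:R != 0 :> R by rewrite pnatr_eq0 -lt0n fact_gt0.
    move: ((k.+2)`!%:R) (w.[x] ^+ k.+2) (s ^+ k.+2) fn0 Wn0 sn0 => u v z u0 v0 z0.
    by field; rewrite u0 v0 z0.
  have -> : P * F * w.[x] ^+ 2 = P / w.[x] ^+ k * (F * w.[x] ^+ k.+2).
    have Wn0 : w.[x] != 0 by rewrite lt0r_neq0.
    have Wkn0 : w.[x] ^+ k != 0 by rewrite expf_neq0.
    rewrite !exprS; move: (w.[x] ^+ k) Wkn0 => v v0; by field; rewrite v0.
  apply: ler_pM => //; rewrite ?mulr_ge0 ?invr_ge0 ?exprn_ge0 ?expR_ge0 ?(ltW w0)//.
  by rewrite ler_wpM2r ?invr_ge0 ?exprn_ge0 ?(ltW w0)// hP// ltW.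
have PF0 : 0 <= P * F by rewrite mulr_ge0.
split; apply: (le_trans key); rewrite -[leRHS]mulrA; apply: ler_wpM2l => //;
    rewrite wE exprMn.
  rewrite mulrC; apply: ler_wpM2r; first exact: sqr_ge0.
  by rewrite lerXn2r ?nnegrE ?subr_ge0 ?(ltW xb) ?(ltW ab)// lerD2l lerN2 ltW.
rewrite -[(x - b) ^+ 2]sqrrN opprB; apply: ler_wpM2r; first exact: sqr_ge0.
by rewrite lerXn2r ?nnegrE ?subr_ge0 ?(ltW ax) ?(ltW ab)// lerD2r ltW.
Qed.

Let derive0 (f : R -> R) (c C : R) : 0 <= C -> f c = 0 ->
  (forall x, `|f x| <= C * (x - c) ^+ 2) -> is_derive c 1 f 0.
Proof.
move=> C0 fc hf.
have h : h^-1 *: (f (h *: 1 + c) - f c) @[h --> 0^'] --> (0 : R).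
  apply/cvgrPdist_le => e e0; near=> h; rewrite sub0r normrN fc subr0.
  have h0 : h != 0 by near: h; exact: nbhs_dnbhs_neq.
  rewrite [h *: 1]mulr1 normrZ normfV ler_pdivrMl ?normr_gt0//.
  rewrite (le_trans (hf _))// addrK -[h ^+ 2]real_normK ?num_real//.
  rewrite expr2 mulrA [leRHS]mulrC ler_wpM2r//.
  have he : `|h| <= e / (C + 1).
    near: h; apply: dnbhs0_le; rewrite divr_gt0// ltr_wpDl//.
  have C1 : 0 < C + 1 by rewrite ltr_wpDl.
  rewrite ler_pdivlMr// in he; rewrite (le_trans _ he)// mulrC ler_wpM2l//.
  by rewrite lerDl.
by apply: DeriveDef; [exact: cvgP h|exact: cvg_lim h].
Unshelve. all: by end_near.
Qed.

Let derive_far p k x : x < a \/ b < x -> is_derive x 1 (bump p k) 0.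
Proof.
move=> hx.
have fE : \forall y \near x, cst 0 y = bump p k y.
  case: hx => hx; near=> y; rewrite /bump ifF//; apply/negbTE; rewrite negb_and -!leNgt.
    by apply/orP; left; apply/ltW; near: y; exact: lt_nbhsl.
  by apply/orP; right; apply/ltW; near: y; exact: lt_nbhsr.
exact: near_eq_is_derive fE (is_derive_cst _ _ _).
Unshelve. all: by end_near.
Qed.

Lemma bump_derive (p : {poly R}) (k : nat) (x : R) : is_derive x 1 (bump p k) (bump (bump_next p k) k.+2 x).
Proof.
have [C C0 hC] := bump_quad p k.
have B0 c q l : c = a \/ c = b -> bump q l c = 0.
  by rewrite /bump => -[] ->; rewrite ltxx ?andbF.
have [xa|ax|->] := ltgtP x a; last 1 first.
- rewrite B0; last by left.
  by apply: (derive0 C0) => [|y]; [rewrite B0//; left|have [] := hC y].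
- have -> : bump (bump_next p k) k.+2 x = 0 by rewrite /bump ltNge (ltW xa).
  by apply: derive_far; left.
have [bx|xb|<-] := ltgtP b x; last 1 first.
- rewrite B0; last by right.
  by apply: (derive0 C0) => [|y]; [rewrite B0//; right|have [] := hC y].
- have -> : bump (bump_next p k) k.+2 x = 0.
    by rewrite /bump [x < b]ltNge (ltW bx) andbF.
  by apply: derive_far; right.
exact: bump_derive_in.
Qed.

Lemma bump_ge0 k x : 0 <= bump 1 k x.
Proof.
rewrite /bump; case: ifP => // /andP[ax xb]; have w0 := w_gt0 ax xb.
by rewrite hornerC mulr_ge0 ?expR_ge0// mulr_ge0// invr_ge0 exprn_ge0// ltW.
Qed.

Lemma bump_gt0 x : a < x -> x < b -> 0 < bump 1 0 x.
Proof.
move=> ax xb; rewrite /bump ax xb /= hornerC expr0 divr1 mul1r; exact: expR_gt0.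
Qed.

Lemma bump_le1 x : bump 1 0 x <= 1.
Proof.
rewrite /bump; case: ifP => // /andP[ax xb]; have w0 := w_gt0 ax xb.
rewrite hornerC expr0 divr1 mul1r -[leRHS]expR0 ler_expR oppr_le0.
by rewrite divr_ge0// ltW.
Qed.

Lemma bump_out p k x : ~ (a < x < b) -> bump p k x = 0.
Proof. by rewrite /bump => /negP/negbTE ->. Qed.

Definition bump_seq := fix F n : {poly R} * nat :=
  if n is n'.+1 then (bump_next (F n').1 (F n').2, (F n').2.+2) else (1, 0%N).

Definition bumpn n x := bump (bump_seq n).1 (bump_seq n).2 x.

Lemma bumpn_derive n (x : R) : is_derive x 1 (bumpn n) (bumpn n.+1 x).
Proof. exact: bump_derive. Qed.

Lemma bumpn_differentiable n (x : R) : differentiable (bumpn n) x.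
Proof. by apply/derivable1_diffP; have [] := bumpn_derive n x. Qed.
End Bump.

(** * Test functions as products of two bumps *)

Section TestFunctions.
Variable R : realType.

Let tensor_d1 (F G dF : R -> R) : (forall x : R, is_derive x 1 F (dF x)) ->
  'D_((1, 0) : pt R) (fun x : pt R => F x.1 * G x.2) = fun x => dF x.1 * G x.2.
Proof.
move=> hF; apply/funext => x; apply: cvg_lim => //=.
have [/cvg_ex[l hl] hd] := hF x.1.
have {}hl : h^-1 *: (F (h *: 1 + x.1) - F x.1) @[h --> 0^'] --> dF x.1.
  by rewrite -hd /derive; rewrite (cvg_lim _ hl).
apply: (cvg_trans _ (cvgM hl (cvg_cst (G x.2)))); apply: near_eq_cvg; near=> h.
by rewrite /= [h *: 0]mulr0 add0r -mulrBl /GRing.scale /= mulrA.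
Unshelve. all: by end_near.
Qed.

Let tensor_d2 (F G dG : R -> R) : (forall x : R, is_derive x 1 G (dG x)) ->
  'D_((0, 1) : pt R) (fun x : pt R => F x.1 * G x.2) = fun x => F x.1 * dG x.2.
Proof.
move=> hF; apply/funext => x; apply: cvg_lim => //=.
have [/cvg_ex[l hl] hd] := hF x.2.
have {}hl : h^-1 *: (G (h *: 1 + x.2) - G x.2) @[h --> 0^'] --> dG x.2.
  by rewrite -hd /derive; rewrite (cvg_lim _ hl).
apply: (cvg_trans _ (cvgM (cvg_cst (F x.1)) hl)); apply: near_eq_cvg; near=> h.
by rewrite /= [h *: 0]mulr0 add0r -mulrBr /GRing.scale /= mulrCA.
Unshelve. all: by end_near.
Qed.

Definition bump2 (a b c d s : R) (x : pt R) : R :=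
  bumpn a b s 0 x.1 * bumpn c d s 0 x.2.

Lemma bump2_pd (a b c d s : R) m n : a < b -> c < d -> 0 < s ->
  pd m n (bump2 a b c d s) = fun x => bumpn a b s m x.1 * bumpn c d s n x.2.
Proof.
move=> ab cd s0.
have h2 : iter n (fun g => 'D_((0, 1) : pt R) g) (bump2 a b c d s) =
    fun x => bumpn a b s 0 x.1 * bumpn c d s n x.2.
  elim: n => [//|n IH]; rewrite iterS IH.
  by apply: tensor_d2 => x; exact: bumpn_derive.
rewrite /pd h2; elim: m => [//|m IH]; rewrite iterS IH.
by apply: tensor_d1 => x; exact: bumpn_derive.
Qed.

Lemma bump2_test (a b c d s : R) (Omega : set (pt R)) : a < b -> c < d -> 0 < s ->
  `[a, b] `*` `[c, d] `<=` Omega -> test_function Omega (bump2 a b c d s).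
Proof.
move=> ab cd s0 hQ.
have sub : closure [set x | bump2 a b c d s x != 0] `<=` `[a, b] `*` `[c, d].
  have /closure_id hcl : closed (`[a, b] `*` `[c, d] : set (pt R)).
    apply: compact_closed; first exact: norm_hausdorff.
    by apply: compact_setX; exact: segment_compact.
  rewrite [X in _ `<=` X]hcl; apply: closureS => x /=; rewrite /bump2 mulf_eq0 negb_or => /andP[h1 h2].
  split; rewrite /= in_itv /=; apply/andP.
    have [/andP[/ltW ? /ltW ?]//|/negP h] := boolP (a < x.1 < b).
    by move/eqP: h1; rewrite /bumpn bump_out.
  have [/andP[/ltW ? /ltW ?]//|/negP h] := boolP (c < x.2 < d).
  by move/eqP: h2; rewrite /bumpn bump_out.
split.
- move=> m n x; rewrite bump2_pd//.
  apply: (@differentiableM _ _ (fun x => bumpn a b s m x.1) (fun x => bumpn c d s n x.2)).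
    apply: differentiable_comp; first exact: differentiable_fst.
    exact: bumpn_differentiable.
  apply: differentiable_comp; first exact: differentiable_snd.
  exact: bumpn_differentiable.
- apply: (subclosed_compact _ _ sub); first exact: closed_closure.
  by apply: compact_setX; exact: segment_compact.
- exact: subset_trans sub hQ.
Qed.
End TestFunctions.

(** * Signed ray crossings and winding numbers of weighted chains of segments *)

Section Crossing.
Variable R : realType.
Implicit Types (A B x y d : pt R).

Lemma cross_cont A B : continuous (fun x : pt R => cross A (x - B)).
Proof.
apply: (@polyn_continuous _ 1); apply: (@polyn1I _ (A.2 * B.1 - A.1 * B.2) (- A.2) A.1) => x.
rewrite /cross /=; ring.
Qed.

Definition dot A B : R := A.1 * B.1 + A.2 * B.2.

Lemma cross_decomp (t v u : pt R) : cross t v != 0 ->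
  u = (cross u v / cross t v) *: t + (cross t u / cross t v) *: v.
Proof.
by move=> h; apply: pairE; rewrite /= /GRing.scale /=; move: h; rewrite /cross => h; field.
Qed.

Lemma crossZ (u v : pt R) (s : R) : cross u (s *: v) = s * cross u v.
Proof. by rewrite /cross /= /GRing.scale /=; ring. Qed.

Lemma crossC (u v : pt R) : cross u v = - cross v u.
Proof. by rewrite /cross; ring. Qed.

Lemma crossN (u v : pt R) : cross (- u) v = - cross u v.
Proof. by rewrite /cross /=; ring. Qed.

Lemma dot_gt0 (u : pt R) : u != 0 -> 0 < dot u u.
Proof.
move=> u0; rewrite /dot -!expr2 lt_neqAle addr_ge0 ?sqr_ge0// andbT eq_sym; apply: contra u0.
rewrite paddr_eq0 ?sqr_ge0// !sqrf_eq0 => /andP[/eqP a1 /eqP a2].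
by apply/eqP/pairE.
Qed.

Lemma cross_eq0 (u z : pt R) : u != 0 -> cross u z = 0 -> z = (dot u z / dot u u) *: u.
Proof.
move=> u0 c; apply: (scalerI (lt0r_neq0 (dot_gt0 u0))).
rewrite scalerA mulrCA mulfV ?lt0r_neq0 ?dot_gt0// mulr1.
have E1 : dot u u * z.1 - dot u z * u.1 = - u.2 * cross u z by rewrite /dot /cross; ring.
have E2 : dot u u * z.2 - dot u z * u.2 = u.1 * cross u z by rewrite /dot /cross; ring.
by rewrite c !mulr0 in E1 E2; apply: pairE; apply: subr0_eq.
Qed.

(** The rule for an endpoint lying exactly on the line through [x] in direction [d]. Points close to
    [x] on the two sides of that line see the endpoint according to the two values of [b]. *)
Definition halfopen (b : bool) (a : R) : bool := if b then a <= 0 else a < 0.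

(* The signed crossing of the segment e with the ray from x in direction -d. *)
Definition crossing (b : bool) d (e : pt R * pt R) x : R :=
  ((halfopen b (cross (e.1 - x) d))%:R - (halfopen b (cross (e.2 - x) d))%:R) *
  (0 < cross (e.2 - e.1) (x - e.1) * cross (e.2 - e.1) d)%R%:R.

(** The weights are real because the chains will carry jumps of potentials, not multiplicities. *)
Definition winding d (I : finType) (c : I -> R) (e : I -> pt R * pt R) x : R :=
  \sum_i c i * crossing true d (e i) x.

Lemma on_seg_cross e x : hull [:: e.1; e.2] x -> cross (e.2 - e.1) (x - e.1) = 0.
Proof.
move=> /seg_hullP[t [_ _ ->]]; rewrite /cross /= /GRing.scale /=; ring.
Qed.

Lemma cross_on_seg d e x : cross (e.2 - e.1) d != 0 ->
  cross (e.2 - e.1) (x - e.1) = 0 ->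
  cross (e.1 - x) d * cross (e.2 - x) d <= 0 -> hull [:: e.1; e.2] x.
Proof.
move=> hd hx hs; apply/seg_hullP.
set D := cross (e.2 - e.1) d in hd.
set a := cross (e.1 - x) d in hs; set b := cross (e.2 - x) d in hs.
have Dab : D = b - a by rewrite /D /a /b /cross /=; ring.
exists (- a / D).
have h : 0 <= - a / D /\ - a / D <= 1.
  have D2 : 0 < D ^+ 2 by rewrite exprn_even_gt0.
  have -> : - a / D = - a * D / D ^+ 2 by field.
  rewrite ler_pdivrMr// mul1r; split; last by rewrite Dab; nra.
  by rewrite divr_ge0 ?(ltW D2)// Dab; nra.
have [h0 h1] := h; split=> //.
have key : D *: (x - e.1) = (- a) *: (e.2 - e.1).
  have E1 : D * (x - e.1).1 - (- a) * (e.2 - e.1).1 =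
      d.1 * cross (e.2 - e.1) (x - e.1).
    rewrite /D /a /cross /=; ring.
  have E2 : D * (x - e.1).2 - (- a) * (e.2 - e.1).2 =
      d.2 * cross (e.2 - e.1) (x - e.1).
    rewrite /D /a /cross /=; ring.
  apply: pairE; apply: subr0_eq.
    by rewrite -[LHS]/(D * (x - e.1).1 - (- a) * (e.2 - e.1).1) E1 hx mulr0.
  by rewrite -[LHS]/(D * (x - e.1).2 - (- a) * (e.2 - e.1).2) E2 hx mulr0.
by rewrite mulrC -scalerA -key scalerA mulVf// scale1r addrC subrK.
Qed.

Lemma cross_cont_r A B : continuous (fun x : pt R => cross (A - x) B).
Proof.
apply: (@polyn_continuous _ 1).
apply: (@polyn1I _ (A.1 * B.2 - A.2 * B.1) (- B.2) B.1) => x.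
rewrite /cross /=; ring.
Qed.

Lemma near_gt0 (f : pt R -> R) x : continuous f -> 0 < f x -> \forall y \near x, 0 < f y.
Proof. by move=> cf; apply: (cvgr_gt _ (cf x)). Qed.

Lemma near_lt0 (f : pt R -> R) x : continuous f -> f x < 0 -> \forall y \near x, f y < 0.
Proof. by move=> cf; apply: (cvgr_lt _ (cf x)). Qed.

Lemma near_right e d x : cross (e.2 - e.1) (x - e.1) != 0 -> \forall y \near x,
  (0 < cross (e.2 - e.1) (y - e.1) * cross (e.2 - e.1) d) =
  (0 < cross (e.2 - e.1) (x - e.1) * cross (e.2 - e.1) d).
Proof.
have [->|hd] := eqVneq (cross (e.2 - e.1) d) 0.
  by move=> _; near=> y; rewrite !mulr0.
rewrite neq_lt => /orP[h|h]; near=> y.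
  have hy : cross (e.2 - e.1) (y - e.1) < 0.
    by near: y; exact: near_lt0 (@cross_cont (e.2 - e.1) e.1) h.
  by rewrite !nmulr_rgt0.
have hy : 0 < cross (e.2 - e.1) (y - e.1).
  by near: y; exact: near_gt0 (@cross_cont (e.2 - e.1) e.1) h.
by rewrite !pmulr_rgt0.
Unshelve. all: by end_near.
Qed.

Lemma near_up (b : bool) A d x : \forall y \near x, (0 <= cross (y - x) d) = b ->
  (cross (A - y) d <= 0) = halfopen b (cross (A - x) d).
Proof.
rewrite /halfopen; have [h|h|h] := ltgtP (cross (A - x) d) 0.
- rewrite if_same; near=> y => _; apply/ltW; near: y; exact: near_lt0 (@cross_cont_r A d) h.
- rewrite if_same; near=> y => _; apply/negbTE; rewrite -ltNge.
  by near: y; exact: near_gt0 (@cross_cont_r A d) h.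
- near=> y => hy; have -> : cross (A - y) d = cross (A - x) d - cross (y - x) d.
    by rewrite /cross /=; ring.
  by rewrite h sub0r oppr_le0 hy; case: (b).
Unshelve. all: by end_near.
Qed.

Lemma off_seg d e x : cross (e.2 - e.1) d != 0 -> ~ hull [:: e.1; e.2] x ->
  cross (e.2 - e.1) (x - e.1) = 0 -> 0 < cross (e.1 - x) d * cross (e.2 - x) d.
Proof.
by move=> hd nx h; rewrite ltNge; apply/negP => h'; apply: nx; exact: cross_on_seg h'.
Qed.

(** Near [x] only the rule for endpoints on the ray's line can change. If [x] lies on the line of
    [e] but off the segment, both endpoints are strictly on one side of the ray's line, so the
    crossing vanishes whatever the second factor does. *)
Lemma crossing_near b d e x : cross (e.2 - e.1) d != 0 -> ~ hull [:: e.1; e.2] x ->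
  \forall y \near x, (0 <= cross (y - x) d) = b -> crossing true d e y = crossing b d e x.
Proof.
move=> hd nx.
have hr : cross (e.2 - e.1) (x - e.1) != 0 -> \forall y \near x,
    (0 < cross (e.2 - e.1) (y - e.1) * cross (e.2 - e.1) d) =
    (0 < cross (e.2 - e.1) (x - e.1) * cross (e.2 - e.1) d) by exact: near_right.
have [h|/hr {}hr] := eqVneq (cross (e.2 - e.1) (x - e.1)) 0; near=> y => hy; rewrite {1}/crossing /=;
  (have -> : (cross (e.1 - y) d <= 0) = halfopen b (cross (e.1 - x) d) by move: hy; near: y; exact: near_up);
  (have -> : (cross (e.2 - y) d <= 0) = halfopen b (cross (e.2 - x) d) by move: hy; near: y; exact: near_up).
  have := off_seg hd nx h; rewrite /crossing /halfopen.
  by case: (ltgtP (cross (e.1 - x) d) 0) => ha; case: (ltgtP (cross (e.2 - x) d) 0) => hb; case: (b);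
    rewrite ?subrr ?mul0r// ?ha ?hb ?mul0r ?mulr0 ?ltxx//; nra.
congr (_ * _%:R); congr nat_of_bool; near: y; exact: hr.
Unshelve. all: by end_near.
Qed.

(** The indicator of [A] lying on the open ray from [x] in direction [-d]. *)
Definition behind d x A : R := ((cross (A - x) d == 0) && (0 < dot (x - A) d))%R%:R.

(** The two conventions disagree only at endpoints on the ray. The disagreement is a difference of
    one function at the two ends of [e], so it cancels over a closed chain. *)
Lemma crossing_diff d e x : cross (e.2 - e.1) d != 0 ->
  crossing true d e x - crossing false d e x = behind d x e.1 - behind d x e.2.
Proof.
move=> hd; rewrite /crossing /halfopen /behind.
set r := (0 < _)%R.
have dd : 0 < d.1 ^+ 2 + d.2 ^+ 2.
  rewrite lt_neqAle addr_ge0 ?sqr_ge0// andbT eq_sym; apply: contra hd.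
  rewrite paddr_eq0 ?sqr_ge0// !sqrf_eq0 => /andP[/eqP h1 /eqP h2].
  by rewrite /cross h1 h2 !mulr0 subrr.
have D2 : 0 < cross (e.2 - e.1) d ^+ 2 by rewrite exprn_even_gt0.
have key A : A = e.1 \/ A = e.2 -> cross (A - x) d = 0 -> r = (0 < dot (x - A) d).
  move=> hA h; rewrite /r.
  have E : (d.1 ^+ 2 + d.2 ^+ 2) * (cross (e.2 - e.1) (x - e.1) * cross (e.2 - e.1) d) =
      cross (e.2 - e.1) d ^+ 2 * dot (x - A) d.
    have : (d.1 ^+ 2 + d.2 ^+ 2) * cross (e.2 - e.1) (x - e.1) -
      cross (e.2 - e.1) d * dot (x - A) d = 0; last first.
      by move/eqP; rewrite subr_eq0 => /eqP E; rewrite mulrA E; ring.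
    have {}h : cross (A - x) d * dot (e.2 - e.1) d = 0 by rewrite h mul0r.
    by rewrite -[RHS]h; case: hA => ->; rewrite /dot /cross /=; ring.
  by rewrite -(pmulr_rgt0 _ dd) E pmulr_rgt0.
have step A : A = e.1 \/ A = e.2 -> (cross (A - x) d <= 0)%R%:R * r%:R -
    (cross (A - x) d < 0)%R%:R * r%:R =
    ((cross (A - x) d == 0) && (0 < dot (x - A) d))%:R :> R.
  move=> hA; case: (ltgtP (cross (A - x) d) 0) => h /=; rewrite ?subrr ?mul0r ?subrr//.
  by rewrite subr0 mul1r -(key A hA h).
rewrite -(step e.1); last by left.
rewrite -(step e.2); last by right.
by ring.
Qed.

Lemma pt_nearW x (P : pt R -> Prop) : (forall y, P y) -> \forall y \near x, P y.
Proof. by move=> h; near=> y; exact: h. Unshelve. all: by end_near. Qed.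

Section Chain.
Variables (d : pt R) (I : finType) (c : I -> R) (e : I -> pt R * pt R).
Hypothesis generic : forall i, cross ((e i).2 - (e i).1) d != 0.

Lemma near_forall (J : finType) (P : J -> pt R -> Prop) x :
  (forall i, \forall y \near x, P i y) -> \forall y \near x, forall i, P i y.
Proof.
move=> h; suff : \forall y \near x, forall i, i \in enum J -> P i y.
  by apply: filterS => y hy i; apply: hy; rewrite mem_enum.
elim: (enum J) => [|j s IH]; first by apply: pt_nearW => y i; rewrite in_nil.
by apply: filterS2 (h j) IH => y hj hs i; rewrite inE => /predU1P[->|/hs].
Qed.

(** Closedness of the chain is expressed by testing its boundary against all functions; the one that
    matters is [behind d x], which compares the two endpoint conventions. *)
Lemma winding_loc_const x :
  (forall f : pt R -> R, \sum_i c i * (f (e i).1 - f (e i).2) = 0) ->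
  (forall i, ~ hull [:: (e i).1; (e i).2] x) ->
  \forall y \near x, winding d c e y = winding d c e x.
Proof.
move=> closed hx; near=> y; rewrite /winding.
have E b : (0 <= cross (y - x) d) = b -> \sum_i c i * crossing true d (e i) y = \sum_i c i * crossing b d (e i) x.
  move=> hy; apply: eq_bigr => i _; congr (_ * _); move: b hy i; near: y.
  have := near_forall (fun k : bool * I => crossing_near k.1 (generic k.2) (hx k.2)).
  by apply: filterS => y h b hy i; exact: (h (b, i)).
case hy: (0 <= cross (y - x) d); rewrite (E _ hy)//.
apply/eqP; rewrite eq_sym -subr_eq0 -sumrB; apply/eqP.
rewrite -[RHS](closed (behind d x)); apply: eq_bigr => i _.
by rewrite -mulrBr crossing_diff.
Unshelve. all: by end_near.
Qed.

Lemma line_cont x : continuous (fun s : R => x + s *: d).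
Proof.
move=> s; apply: cvgD; first exact: cvg_cst.
by apply: cvgZl; exact: cvg_id.
Qed.

Lemma near_line x (P : pt R -> Prop) : (\forall y \near x, P y) ->
  exists2 e0 : R, 0 < e0 & forall s : R, `|s| < e0 -> P (x + s *: d).
Proof.
move=> h; have : \forall s \near (0 : R), P (x + s *: d).
  by apply: (@line_cont x 0); rewrite /= scale0r addr0.
move=> /nbhs_ballP[r /= r0 hr]; exists r => // s hs; apply: hr.
by rewrite -ball_normE /= sub0r normrN.
Qed.

(** Moving along [d] keeps the line of the ray fixed, so no endpoint convention changes. A segment
    through [x] is met by the ray from [x + s *: d] and missed by the ray from [x - s *: d]; the
    other segments contribute equally. *)
Lemma winding_jump x (J : pred I) :
  (forall i, ~~ J i -> ~ hull [:: (e i).1; (e i).2] x) ->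
  (forall i, J i -> exists t : R, [/\ 0 < t, t < 1 & x = (e i).1 + t *: ((e i).2 - (e i).1)]) ->
  exists2 r : R, 0 < r & forall s : R, 0 < s -> s < r ->
    winding d c e (x + s *: d) - winding d c e (x - s *: d) =
    \sum_(i | J i) c i * Num.sg (cross ((e i).2 - (e i).1) d).
Proof.
move=> hN hJ.
have : \forall y \near x, forall i, ~~ J i -> 0 <= cross (y - x) d ->
    crossing true d (e i) y = crossing true d (e i) x.
  apply: near_forall => i; case: (boolP (J i)) => Ji; first by apply: pt_nearW => y /negP.
  by have := crossing_near true (generic i) (hN i Ji); apply: filterS => y h _.
move=> /near_line[r r0 hr]; exists r => // s s0 sr.
rewrite /winding -sumrB [RHS]big_mkcond; apply: eq_bigr => i _.
have hs (u : R) : cross (x + u *: d - x) d = 0.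
  by rewrite /cross /= /GRing.scale /=; ring.
case: ifPn => Ji; last first.
  have hs' (u : R) : `|u| < r -> crossing true d (e i) (x + u *: d) = crossing true d (e i) x.
    by move=> ur; apply: hr => //; rewrite hs.
  have -> : x - s *: d = x + (- s) *: d by rewrite scaleNr.
  by rewrite (hs' s) ?(hs' (- s)) ?subrr ?normrN ?gtr0_norm.
have [t [t0 t1 hx]] := hJ i Ji.
have hd := generic i; set D := cross _ d in hd *.
have E1 (u : R) : cross ((e i).1 - (x + u *: d)) d = - t * D.
  by rewrite hx /D /cross /= /GRing.scale /=; ring.
have E2 (u : R) : cross ((e i).2 - (x + u *: d)) d = (1 - t) * D.
  by rewrite hx /D /cross /= /GRing.scale /=; ring.
have E3 (u : R) : cross ((e i).2 - (e i).1) (x + u *: d - (e i).1) = u * D.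
  by rewrite hx /D /cross /= /GRing.scale /=; ring.
have D2 : 0 < D ^+ 2 by rewrite exprn_even_gt0.
have -> : x - s *: d = x + (- s) *: d by rewrite scaleNr.
rewrite /crossing /halfopen !E1 !E2 !E3 -/D -!mulrA -expr2.
rewrite pmulr_lgt0// s0 pmulr_lgt0// ltrNr oppr0 (ltNge s) (ltW s0) /=.
rewrite !mulr0 subr0 mulr1; congr (_ * _).
have t1' : 0 < 1 - t by rewrite subr_gt0.
rewrite mulNr oppr_le0 pmulr_rge0// pmulr_rle0//.
by have [D0|D0|D0] := sgrP D; [rewrite D0 eqxx in hd| |]; rewrite ?subr0 ?sub0r.
Qed.
End Chain.

Lemma generic_direction (s : seq (pt R)) : (forall v, v \in s -> v != 0) ->
  exists d, forall v, v \in s -> cross v d != 0.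
Proof.
move=> hs.
pose bad := [seq v.2 / v.1 | v <- s].
have [t ht] : exists t : R, t \notin bad.
  (* This number exceeds every bad slope in absolute value. *)
  exists (1 + \sum_(b <- bad) `|b|); apply/negP => h.
  have : `|1 + \sum_(b <- bad) `|b| | <= \sum_(b <- bad) `|b|.
    rewrite [leRHS](perm_big _ (perm_to_rem h)) big_cons lerDl.
    exact: sumr_ge0.
  rewrite ger0_norm ?addr_ge0 ?sumr_ge0// -subr_ge0 opprD addrCA subrr addr0.
  by rewrite oppr_ge0 ler10.
exists (1, t) => v vs; apply/negP => /eqP; rewrite /cross /= mulr1 => h.
have [v1|v1] := eqVneq v.1 0.
  move: h; rewrite v1 mul0r sub0r => /eqP; rewrite oppr_eq0 => /eqP v2.
  by have := hs _ vs; rewrite (_ : v = 0) ?eqxx//; exact: pairE.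
move/negP: ht; apply; apply/mapP; exists v => //.
by move/eqP: h; rewrite subr_eq0 => /eqP <-; rewrite mulrC mulKf.
Qed.

(** The values may lie in any type, so the lemma also serves for predicates and for data attached to
    triangles. *)
Lemma loc_const_connected (U : Type) (T : topologicalType) (f : T -> U) (S : set T) :
  connected S -> (forall x : T, S x -> \forall y \near x, S y -> f y = f x) ->
  forall x y : T, S x -> S y -> f x = f y.
Proof.
move=> cS hf x y Sx Sy.
pose B := [set z | S z /\ f z = f x].
have BE : B = S; last by move: Sy; rewrite -BE => -[_ ->].
apply: cS.
- by exists x.
- exists [set z | \forall w \near z, S w -> f w = f x].
    by rewrite openE => z /= h; exact: (near_join h).
  apply/seteqP; split=> z [Sz hz]; split=> //.
    by have := hf z Sz; apply: filterS => w h /h ->.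
  exact: nbhs_singleton hz Sz.
- exists (~` [set z | \forall w \near z, S w -> f w <> f x]).
    by apply: open_closedC; rewrite openE => z /= h; exact: (near_join h).
  apply/seteqP; split=> z [Sz hz]; split=> //.
    by move=> /nbhs_singleton /(_ Sz).
  apply: contrapT => nz; apply: hz; have := hf z Sz.
  by apply: filterS => w h /h ->.
Qed.
End Crossing.

(** * Topology of the domain enclosed by a simple polygon *)

Section Domain.
Variable R : realType.
Implicit Types (A B x y d : pt R) (K L M : tri R).

Lemma seg_closed A B : closed (hull [:: A; B]).
Proof.
rewrite seg_image; apply: compact_closed; first exact: norm_hausdorff.
apply: continuous_compact; last exact: segment_compact.
by apply: continuous_subspaceT => t; exact: line_cont.
Qed.

Lemma near_nhull A B x : ~ hull [:: A; B] x -> \forall y \near x, ~ hull [:: A; B] y.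
Proof. by move=> h; have := closed_openC (@seg_closed A B); rewrite openE; apply. Qed.

Lemma convex_connected (S : set (pt R)) :
  (forall x y t, S x -> S y -> 0 <= t -> t <= 1 -> S (x + t *: (y - x))) -> connected S.
Proof.
move=> cS; have [->|/set0P[x0 Sx0]] := eqVneq S set0; first exact: connected0.
have -> : S = \bigcup_(y in S) hull [:: x0; y].
  apply/seteqP; split=> y; first by move=> Sy; exists y => //; exact: seg_hullr.
  by move=> [z Sz /seg_hullP[t [t0 t1 ->]]]; exact: cS.
apply: bigcup_connected; first by exists x0 => y _; exact: seg_hulll.
move=> y _; rewrite seg_image.
apply: connected_continuous_connected; first exact: segment_connected.
by apply: continuous_subspaceT => t; exact: line_cont.
Qed.

Lemma seg_convex A B x y t : hull [:: A; B] x -> hull [:: A; B] y -> 0 <= t -> t <= 1 ->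
  hull [:: A; B] (x + t *: (y - x)).
Proof.
move=> /seg_hullP[a [a0 a1 ->]] /seg_hullP[b [b0 b1 ->]] t0 t1.
apply/seg_hullP; exists (a + t * (b - a)); split; [nra|nra|].
pt_ring.
Qed.

Lemma ball_convex x (e : R) y z t : ball x e y -> ball x e z -> 0 <= t -> t <= 1 ->
  ball x e (y + t *: (z - y)).
Proof.
rewrite -ball_normE /= => hy hz t0 t1.
have -> : x - (y + t *: (z - y)) = (1 - t) *: (x - y) + t *: (x - z).
  by pt_ring.
rewrite (le_lt_trans (ler_normD _ _))// !normrZ (ger0_norm t0) ger0_norm ?subr_ge0//.
have [->|t0'] := eqVneq t 0; first by rewrite subr0 mul1r mul0r addr0.
have t0'' : 0 < t by rewrite lt_neqAle eq_sym t0' t0.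
have -> : e = (1 - t) * e + t * e by ring.
apply: ler_ltD; last by rewrite ltr_pM2l.
by rewrite ler_wpM2l ?subr_ge0// ltW.
Qed.

Variables (Omega : set (pt R)) (n : nat) (p : 'I_n.+3 -> pt R).
Hypotheses (oO : open Omega) (cO : connected Omega) (bO : bounded_set Omega).
Hypothesis simp : simple_polygon p.
Hypothesis bdO : closure Omega `\` Omega = \bigcup_i hull [:: p i; p (ordS i)].

Local Notation P := (\bigcup_i hull [:: p i; p (ordS i)]).
Local Notation side i := (hull [:: p i; p (ordS i)]).

Lemma ordS_neq (i : 'I_n.+3) : ordS i != i.
Proof.
apply/eqP => /(congr1 val) /=; case: (ltngtP i n.+2) => h.
- by rewrite modn_small; [move/eqP; rewrite eqn_leq ltnn|rewrite !ltnS].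
- by move: (ltn_ord i); rewrite ltnS leqNgt h.
- by rewrite h modnn.
Qed.

Lemma side_neq i : p i != p (ordS i).
Proof.
by have [inj _ _] := simp; apply/eqP => /inj /esym/eqP; rewrite (negbTE (ordS_neq i)).
Qed.

Lemma P_sub : P `<=` closure Omega. Proof. by rewrite -bdO => x []. Qed.

Lemma P_notin x : P x -> ~ Omega x. Proof. by rewrite -bdO => -[]. Qed.

Lemma closureP x : closure Omega x -> ~ Omega x -> P x.
Proof. by rewrite -bdO. Qed.

Lemma side_int i j (t : R) : 0 < t -> t < 1 -> j != i ->
  ~ side j (p i + t *: (p (ordS i) - p i)).
Proof.
move=> t0 t1 ji hj; have [inj h1 h2] := simp.
set x := p i + _ in hj.
have hi : side i x by apply/seg_hullP; exists t; rewrite !ltW.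
have v0 : p (ordS i) - p i != 0 by rewrite subr_eq0 eq_sym side_neq.
have xi : x != p i.
  by rewrite /x -subr_eq0 addrC addKr scaler_eq0 negb_or v0 gt_eqF.
have xSi : x != p (ordS i).
  rewrite /x -subr_eq0.
  have -> : p i + t *: (p (ordS i) - p i) - p (ordS i) = (t - 1) *: (p (ordS i) - p i).
    by rewrite scalerBl scale1r opprB addrCA addrA.
  by rewrite scaler_eq0 negb_or v0 subr_eq0 lt_eqF.
have [jSi|jSi] := eqVneq j (ordS i).
  have : [set p (ordS i)] x by rewrite -(h1 i); split=> //; rewrite -jSi.
  by move=> /= /eqP; rewrite (negbTE xSi).
have [iSj|iSj] := eqVneq i (ordS j).
  have : [set p (ordS j)] x by rewrite -(h1 j); split=> //; rewrite -iSj.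
  by move=> /= /eqP; rewrite -iSj (negbTE xi).
by have : set0 x by rewrite -(h2 i j ji jSi iSj).
Qed.

Lemma closure_out x : ~ closure Omega x -> \forall y \near x, ~ Omega y.
Proof.
move=> h; have := closed_openC (@closed_closure _ Omega); rewrite openE => /(_ x h).
by apply: filterS => y hy Oy; apply: hy; exact: subset_closure.
Qed.

(** Away from the polygon both Omega and its complement are open, so membership is locally constant
    on [S]. *)
Lemma connected_in_or_out (S : set (pt R)) : connected S -> (forall x, S x -> ~ P x) ->
  forall x y, S x -> S y -> Omega x -> Omega y.
Proof.
move=> cS SP x y Sx Sy Ox.
suff <- : Omega x = Omega y by [].
apply: (loc_const_connected (f := Omega) cS) => // z Sz.
have [Oz|nOz] := pselect (Omega z).
  have : \forall w \near z, Omega w by apply: open_nbhs_nbhs.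
  by apply: filterS => w Ow _; apply/propext; split.
have : ~ closure Omega z by move=> h; exact: (SP z Sz (closureP h nOz)).
by move=> /closure_out; apply: filterS => w nOw _; apply/propext; split.
Qed.

Lemma near_nside x (J : pred 'I_n.+3) : (forall i, J i -> ~ side i x) ->
  \forall y \near x, forall i, J i -> ~ side i y.
Proof.
move=> h; apply: near_forall => i; case: (boolP (J i)) => Ji; last exact: pt_nearW.
by have := near_nhull (h i Ji); apply: filterS.
Qed.

Lemma param_near A B (t e : R) : 0 <= t -> t <= 1 -> 0 < e ->
  exists t', [/\ 0 < t', t' < 1 & `|(t' - t) *: (B - A)| < e].
Proof.
move=> t0 t1 e0; pose N := `|B - A| + 1.
have N0 : 0 < N by rewrite ltr_pwDr.
pose s := Num.min (4^-1) (e / (2 * N)).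
have s0 : 0 < s by rewrite /s lt_min invr_gt0 ltr0n divr_gt0// mulr_gt0.
have s4 : s <= 4^-1 by rewrite /s ge_min lexx.
have sN : s * N < e.
  have : s <= e / (2 * N) by rewrite /s ge_min lexx orbT.
  by rewrite ler_pdivlMr ?mulr_gt0//; nra.
have key (t' : R) : `|t' - t| <= s -> `|(t' - t) *: (B - A)| < e.
  move=> h; rewrite normrZ (le_lt_trans _ sN)// ler_pM// /N lerDl//.
case: (leP t 2^-1) => ht.
  exists (t + s); split; [by rewrite ltr_wpDl|lra|apply: key].
  by rewrite addrAC subrr add0r gtr0_norm.
exists (t - s); split; [lra|lra|apply: key].
by rewrite addrAC subrr add0r normrN gtr0_norm.
Qed.

(** A boundary point interior to the closure could be moved to the relative interior of a side, with
    points of Omega just on both sides of it. The winding number of the polygon is constant on the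
    connected set Omega, but it jumps by 1 or -1 across a side. *)
Lemma interior_closure_sub : (closure Omega)^° `<=` Omega.
Proof.
move=> x0 hx0; apply: contrapT => nx0.
have [i _ /seg_hullP[t0 [t00 t01 x0E]]] := closureP (interior_subset hx0) nx0.
have [e /= e0 he] : exists2 e : R, 0 < e & ball x0 e `<=` (closure Omega)^°.
  have : nbhs x0 (closure Omega)^° by exact: nbhs_interior.
  by move=> /nbhs_ballP[e /= e0 he]; exists e.
have [t [tp tl ht]] := param_near (p i) (p (ordS i)) t00 t01 e0.
pose x := p i + t *: (p (ordS i) - p i).
have {hx0 he} hx : (closure Omega)^° x.
  apply: he; rewrite -ball_normE /= -normrN opprB.
  suff -> : x - x0 = (t - t0) *: (p (ordS i) - p i) by [].
  rewrite /x x0E; pt_ring.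
have nxj j : j != i -> ~ side j x by exact: side_int.
have [d hd] : exists d, forall v, v \in [seq p (ordS j) - p j | j : 'I_n.+3] -> cross v d != 0.
  by apply: generic_direction => v /mapP[j _ ->]; rewrite subr_eq0 eq_sym side_neq.
pose E j := (p j, p (ordS j)).
have gen j : cross ((E j).2 - (E j).1) d != 0.
  by apply: hd; apply/mapP; exists j => //; rewrite mem_enum.
have closed (f : pt R -> R) : \sum_j 1 * (f (E j).1 - f (E j).2) = 0.
  under eq_bigr do rewrite mul1r.
  rewrite sumrB [X in X - _](reindex_inj (@ordS_inj n.+3)) /=.
  exact: subrr.
have wc y z : Omega y -> Omega z -> winding d (fun=> 1) E y = winding d (fun=> 1) E z.
  apply: (loc_const_connected cO) => w Ow.
  have /(winding_loc_const gen closed) : forall j, ~ hull [:: (E j).1; (E j).2] w.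
    by move=> j hj; apply: (@P_notin w) => //; exists j.
  by apply: filterS.
have hJ j : pred1 i j -> exists t : R,
    [/\ 0 < t, t < 1 & x = (E j).1 + t *: ((E j).2 - (E j).1)].
  by move=> /eqP ->; exists t.
have [r r0 hr] := @winding_jump R d _ (fun=> 1) E gen x (pred1 i) nxj hJ.
have : \forall y \near x, closure Omega y /\ forall j, j != i -> ~ side j y.
  apply: filterI; last exact: near_nside.
  exact: hx.
move=> /(near_line d)[r' r'0 hr'].
pose s := Num.min (r / 2) (r' / 2).
have s0 : 0 < s by rewrite /s lt_min !divr_gt0.
have sr : s < r by rewrite /s gt_min; apply/orP; left; lra.
have sr' : s < r' by rewrite /s gt_min; apply/orP; right; lra.
have inO (u : R) : `|u| = s -> Omega (x + u *: d).
  move=> us; have /hr' [h1 h2] : `|u| < r' by rewrite us.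
  apply: contrapT => h; have [j _ hj] := closureP h1 h.
  have [ji|ji] := eqVneq j i; last exact: h2 hj.
  have /on_seg_cross : hull [:: (E i).1; (E i).2] (x + u *: d) by rewrite -ji.
  have -> : cross ((E i).2 - (E i).1) (x + u *: d - (E i).1) =
      u * cross ((E i).2 - (E i).1) d.
    by rewrite /x /E /cross /= /GRing.scale /=; ring.
  move=> /eqP; rewrite mulf_eq0 (negbTE (gen i)) orbF => /eqP u0.
  by move: us; rewrite u0 normr0 => us; rewrite -us ltxx in s0.
have := hr s s0 sr; rewrite (wc (x + s *: d) (x - s *: d)); last 2 first.
- by apply: inO; rewrite gtr0_norm.
- by rewrite -scaleNr; apply: inO; rewrite normrN gtr0_norm.
rewrite subrr big_pred1_eq mul1r => /esym/eqP.
by rewrite sgr_eq0 (negbTE (gen i)).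
Qed.

Lemma boundary_connected : connected P.
Proof.
have h m : (0 < m)%N -> connected (\bigcup_(i in [set i : 'I_n.+3 | (i < m)%N]) side i).
  case: m => // m _; elim: m => [|m IH].
    rewrite (_ : \bigcup_(i in _) _ = side ord0).
      by apply: convex_connected => *; exact: seg_convex.
    apply/seteqP; split=> x; last by move=> h; exists ord0.
    by move=> [i /=]; rewrite ltnS leqn0 => /eqP i0 hx; rewrite (_ : ord0 = i)//; exact: val_inj.
  have [hm|hm] := leqP n.+3 m.+1.
    rewrite (_ : [set i : 'I_n.+3 | _] = [set i : 'I_n.+3 | (i < m.+1)%N])//.
    apply/seteqP; split=> i /= hi; last by rewrite ltnS ltnW.
    by rewrite (leq_trans (ltn_ord i)).
  pose j := Ordinal hm; pose k := Ordinal (ltnW hm).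
  have kj : ordS k = j by apply: val_inj; rewrite /= modn_small.
  rewrite (_ : \bigcup_(i in _) _ =
     \bigcup_(i in [set i : 'I_n.+3 | (i < m.+1)%N]) side i `|` side j).
    apply: connectedU => //.
      by exists (p j); split; [exists k => //=; rewrite -kj; exact: seg_hullr|exact: seg_hulll].
    by apply: convex_connected => *; exact: seg_convex.
  apply/seteqP; split=> x.
    move=> [i /=]; rewrite ltnS leq_eqVlt => /predU1P[im|im] hx; last by left; exists i.
    by right; rewrite (_ : j = i)//; apply: val_inj.
  by move=> [[i /= hi hx]|hx]; [exists i => //=; rewrite ltnS ltnW|exists j => /=].
have := h n.+3 isT; congr connected; apply/seteqP; split=> x [i _ hx]; exists i => //=.
Qed.

(** Otherwise the monic polynomial with roots [s] would vanish on an interval. *)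
Lemma avoid_finite (s : seq R) (a b : R) : a < b -> exists t, [/\ a < t, t < b & t \notin s].
Proof.
move=> ab; apply: contrapT => h.
have /eqP := monic_neq0 (monic_prod_XsubC s xpredT id); apply.
apply: (poly_zero_itv ab) => t ta tb; apply/eqP; rewrite -[_ == 0]/(root _ _) root_prod_XsubC.
by apply: contrapT => /negP ts; apply: h; exists t.
Qed.

(** Serves to move a boundary point slightly along its side until it is no vertex of the mesh. *)
Lemma boundary_perfect (F : seq (pt R)) x e : P x -> 0 < e ->
  exists y, [/\ P y, ball x e y & y \notin F].
Proof.
move=> [i _ /seg_hullP[t0 [t00 t01 xE]]] e0.
have w0 : p (ordS i) - p i != 0 by rewrite subr_eq0 eq_sym side_neq.
have [t [h0 h1 ht]] := param_near (p i) (p (ordS i)) t00 t01 e0.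
pose w := p (ordS i) - p i.
have [r r0 hr] : exists2 r : R, 0 < r & forall u, `|u| < r -> ball x e (p i + t *: w + u *: w).
  have /(near_line w)[r r0 hr] : \forall y \near p i + t *: w, ball x e y.
    rewrite -/(nbhs _ _); apply: open_nbhs_nbhs; split; first exact: ball_open.
    by rewrite -ball_normE /= -normrN opprB (_ : _ - x = (t - t0) *: w)// xE /w; pt_ring.
  by exists r.
have tr : t < Num.min 1 (t + r) by rewrite lt_min h1 ltrDl.
have [s [s1]] := avoid_finite [seq dot w (y - p i) / dot w w | y <- F] tr.
rewrite lt_min => /andP[s2 s3] sF; exists (p i + s *: w); split.
- by exists i => //; apply/seg_hullP; exists s; rewrite !ltW// (lt_trans h0).
- have -> : p i + s *: w = p i + t *: w + (s - t) *: w by pt_ring.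
  by apply: hr; rewrite gtr0_norm; lra.
- apply: contra sF => hF; apply/mapP; exists (p i + s *: w) => //.
  have -> : p i + s *: w - p i = s *: w by rewrite addrC addKr.
  by rewrite (_ : dot w _ = s * dot w w) ?mulfK ?lt0r_neq0 ?dot_gt0// /dot /= /GRing.scale /=; ring.
Qed.

Definition on_rays (X u v y : pt R) := exists2 s : R, 0 <= s & y = X + s *: u \/ y = X + s *: v.

Lemma convex_gt0 (a b t : R) : 0 < a -> 0 < b -> 0 <= t -> t <= 1 -> 0 < (1 - t) * a + t * b.
Proof.
move=> a0 b0 t0 t1; have [->|tn0] := eqVneq t 0; first by rewrite subr0 mul1r mul0r addr0.
apply: ltr_wpDl; first by apply: mulr_ge0; [rewrite subr_ge0|exact: ltW].
by apply: mulr_gt0 => //; rewrite lt_neqAle eq_sym tn0.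
Qed.

Lemma halfplane_convex (X a y z : pt R) (e t : R) : ball X e y /\ 0 < cross a (y - X) ->
  ball X e z /\ 0 < cross a (z - X) -> 0 <= t -> t <= 1 ->
  ball X e (y + t *: (z - y)) /\ 0 < cross a (y + t *: (z - y) - X).
Proof.
move=> [y1 y2] [z1 z2] t0 t1; split; first exact: ball_convex.
have -> : cross a (y + t *: (z - y) - X) = (1 - t) * cross a (y - X) + t * cross a (z - X).
  by rewrite /cross /= /GRing.scale /=; ring.
exact: convex_gt0.
Qed.

Lemma connected_halfplane (X a : pt R) (e : R) :
  connected [set y | ball X e y /\ 0 < cross a (y - X)].
Proof. by apply: convex_connected => y z t hy hz t0 t1; exact: halfplane_convex. Qed.

(** The two rays cut the ball into a convex sector, where both strict inequalities hold, and its
    complement, a union of two half-balls. The half-balls share the point [X - k *: (u + v)], which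
    makes their union connected. *)
Lemma sectors_pos (X u v : pt R) (e : R) : 0 < e -> 0 < cross u v -> exists S1 S2,
  [/\ connected S1, connected S2,
      forall y, ball X e y -> ~ on_rays X u v y -> S1 y \/ S2 y &
      forall y, S1 y \/ S2 y -> ball X e y /\ ~ on_rays X u v y].
Proof.
move=> e0 uv.
pose H a := [set y | ball X e y /\ 0 < cross a (y - X)].
exists (H u `&` H (- v)), (H (- u) `|` H v).
have ray s w : X + s *: w - X = s *: w by rewrite addrC addKr.
split.
- apply: convex_connected => y z t [y1 y2] [z1 z2] t0 t1.
  by split; exact: halfplane_convex.
- apply: connectedU; try exact: connected_halfplane.
  pose N := `|u + v| + 1; have N0 : 0 < N by rewrite ltr_pwDr.
  (* Scaled so that the common point stays within distance [e] of [X]. *)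
  pose k := e / (2 * N); have k0 : 0 < k by rewrite divr_gt0// mulr_gt0.
  have hb : ball X e (X - k *: (u + v)).
    rewrite -ball_normE /= opprD opprK addrA subrr add0r normrZ gtr0_norm//.
    rewrite /k mulrAC ltr_pdivrMr ?mulr_gt0// ltr_pM2l// /N.
    by have := normr_ge0 (u + v); lra.
  exists (X - k *: (u + v)); split; split=> //.
    have -> : cross (- u) (X - k *: (u + v) - X) = k * cross u v.
      by rewrite /cross /= /GRing.scale /=; ring.
    exact: mulr_gt0.
  have -> : cross v (X - k *: (u + v) - X) = k * cross u v.
    by rewrite /cross /= /GRing.scale /=; ring.
  exact: mulr_gt0.
- move=> y yb nr; have uvn0 : cross u v != 0 by rewrite gt_eqF.
  have yE : y = X + (y - X) by rewrite addrC subrK.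
  case: (ltgtP (cross u (y - X)) 0) => h1.
  + by right; left; split=> //; rewrite crossN oppr_gt0.
  + case: (ltgtP (cross v (y - X)) 0) => h2.
    * by left; split; split=> //; rewrite crossN oppr_gt0.
    * by right; right.
    * exfalso; apply: nr; exists (cross u (y - X) / cross u v); first by rewrite divr_ge0// ltW.
      right; rewrite {1}yE {1}(cross_decomp (y - X) uvn0) crossC h2 oppr0 mul0r scale0r.
      by rewrite add0r.
  + case: (ltP 0 (cross v (y - X))) => h2; first by right; right.
    exfalso; apply: nr; exists (cross (y - X) v / cross u v).
      by rewrite divr_ge0 ?(ltW uv)// crossC oppr_ge0.
    by left; rewrite {1}yE {1}(cross_decomp (y - X) uvn0) h1 mul0r scale0r addr0.
- have cc w : cross w w = 0 by rewrite /cross; ring.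
  move=> y [[[yb h1] [_ h2]]|[[yb h1]|[yb h1]]]; split=> // -[s s0 [yE|yE]]; subst y;
    move: h1; try move: h2; rewrite ?ray ?crossN ?crossZ ?(crossC v u) ?cc; nra.
Qed.

(** The case of negative [cross u v] follows by exchanging the rays. If it is zero, the hypothesis
    on [k] leaves only opposite rays, and the two sectors are half-balls. *)
Lemma sectors (X u v : pt R) (e : R) : 0 < e -> u != 0 -> v != 0 ->
  (forall k : R, 0 < k -> u != k *: v) -> exists S1 S2,
  [/\ connected S1, connected S2,
      forall y, ball X e y -> ~ on_rays X u v y -> S1 y \/ S2 y &
      forall y, S1 y \/ S2 y -> ball X e y /\ ~ on_rays X u v y].
Proof.
move=> e0 u0 v0 hk; have [h|h|h] := ltgtP 0 (cross u v); first exact: sectors_pos.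
  have : 0 < cross v u by move: h; rewrite /cross; lra.
  move=> /(sectors_pos X e0)[S1 [S2 [h1 h2 h3 h4]]]; exists S1, S2.
  have sw y : on_rays X u v y <-> on_rays X v u y.
    by split=> -[s s0 [yE|yE]]; exists s => //; [right|left|right|left].
  split=> // y; first by move=> yb yr; apply: h3 => //; move/sw.
  by move=> /h4[h5 h6]; split=> // /sw.
have vE := cross_eq0 u0 (esym h); move: vE; set k := _ / _ => vE.
have k0 : k < 0.
  rewrite ltNge le_eqVlt; apply/negP => /predU1P[k0|k0].
    by rewrite vE -k0 scale0r eqxx in v0.
  have := hk k^-1; rewrite invr_gt0 => /(_ k0).
  by rewrite vE scalerA mulVf ?gt_eqF// scale1r eqxx.
exists [set y | ball X e y /\ 0 < cross u (y - X)], [set y | ball X e y /\ 0 < cross (- u) (y - X)].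
have ray s w : X + s *: w - X = s *: w by rewrite addrC addKr.
split; try exact: connected_halfplane.
- move=> y yb nr.
  have [h1|h1|h1] := ltgtP 0 (cross u (y - X)); [by left|by right; split=> //; rewrite crossN oppr_gt0|].
  exfalso; apply: nr; have := cross_eq0 u0 (esym h1); set s := _ / _ => /(canRL (subrK X)).
  rewrite addrC => yE.
  have [s0|s0] := leP 0 s; first by exists s => //; left.
  exists (s / k); first by rewrite mulr_le0 ?ltW// invr_lt0.
  by right; rewrite vE scalerA divfK ?lt_eqF.
- have cc : cross u u = 0 by rewrite /cross; ring.
  move=> y [[yb h1]|[yb h1]]; split=> // -[s s0 [yE|yE]]; subst y; move: h1;
    by rewrite ray ?vE ?scalerA ?crossN crossZ cc mulr0 ?oppr0 ltxx.
Qed.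

(** Inside a side the rays are the two directions of that side; at a corner they follow the two
    incident sides. Corner rays cannot have the same direction, since the incident sides would then
    overlap in more than the corner. *)
Lemma boundary_rays X : P X -> exists u v (e : R), [/\ 0 < e, u != 0, v != 0,
  (forall k : R, 0 < k -> u != k *: v) & forall y, ball X e y -> P y <-> on_rays X u v y].
Proof.
move=> [i _ /seg_hullP[t [t0 t1 XE]]].
(* The final endpoint of a side is the initial point of the next one, so the parameter may be taken
   below 1. *)
suff main j s : 0 <= s -> s < 1 -> X = p j + s *: (p (ordS j) - p j) ->
    exists u v (e : R), [/\ 0 < e, u != 0, v != 0,
    (forall k : R, 0 < k -> u != k *: v) & forall y, ball X e y -> P y <-> on_rays X u v y].
  have [t1'|t1'] := ltP t 1; first exact: (main i t).
  apply: (main (ordS i) 0) => //; rewrite scale0r addr0 XE.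
  have -> : t = 1 by apply/eqP; rewrite eq_le t1.
  by rewrite scale1r addrC subrK.
move=> {i t t0 t1 XE} s0 s1 XE; have [inj h1 h2] := simp.
pose w := p (ordS j) - p j; have w0 : w != 0 by rewrite subr_eq0 eq_sym side_neq.
have wN : 0 < `|w| by rewrite normr_gt0.
have nball (J : pred 'I_n.+3) : (forall i, J i -> ~ side i X) -> exists2 e : R, 0 < e &
    forall y, ball X e y -> forall i, J i -> ~ side i y.
  by move=> /near_nside /nbhs_ballP[e /= e0 he]; exists e.
have ball_ray (u : pt R) (a e : R) : 0 < `|u| -> ball X e (X + a *: u) -> 0 <= a -> a < e / `|u|.
  move=> u0; rewrite -ball_normE /= opprD addrA subrr sub0r normrN normrZ => h a0.
  by rewrite ltr_pdivlMr// -(ger0_norm a0).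
have [s00|s00] := eqVneq s 0; last first.
  have s0' : 0 < s by rewrite lt_neqAle eq_sym s00.
  have [e1 e10 he1] := nball (predC1 j) (fun i hi => ltac:(rewrite XE; exact: side_int)).
  pose e := Num.min e1 (Num.min (s * `|w|) ((1 - s) * `|w|)).
  have e0 : 0 < e by rewrite /e !lt_min e10 !mulr_gt0 ?subr_gt0.
  have ee1 : e <= e1 by rewrite /e ge_min lexx.
  have ees : e <= s * `|w| by rewrite /e !ge_min lexx !orbT.
  have ee1s : e <= (1 - s) * `|w| by rewrite /e !ge_min lexx !orbT.
  exists w, (- w), e; split=> //; first by rewrite oppr_eq0.
    move=> k k0; rewrite scalerN -addr_eq0 -[X in X + _]scale1r -scalerDl scaler_eq0 negb_or w0 andbT.
    by rewrite gt_eqF// addr_gt0.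
  move=> y yb; split.
    move=> [i _ hi]; have [ij|ij] := eqVneq i j; last first.
      by exfalso; apply: (he1 y _ i ij hi); exact: le_ball yb.
    move: hi; rewrite ij => /seg_hullP[t [t0 t1 yE]].
    have [st|ts] := leP s t.
      exists (t - s); first by rewrite subr_ge0.
      by left; rewrite yE XE /w; pt_ring.
    exists (s - t); first by rewrite subr_ge0 ltW.
    by right; rewrite yE XE /w; pt_ring.
  move=> [a a0 yE]; exists j => //; apply/seg_hullP; case: yE => yE; subst y.
    exists (s + a); split; first by rewrite addr_ge0.
      have := ball_ray w a e wN yb a0; rewrite ltr_pdivlMr// => h.
      have : a * `|w| < (1 - s) * `|w| by exact: lt_le_trans ee1s.
      by rewrite ltr_pM2r// => h'; lra.
    by rewrite [X in X + _]XE /w; pt_ring.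
  have := ball_ray (- w) a e; rewrite normrN => /(_ wN yb a0); rewrite ltr_pdivlMr// => h.
  have : a * `|w| < s * `|w| by exact: lt_le_trans ees.
  rewrite ltr_pM2r// => h'; exists (s - a); split; [lra|lra|].
  by rewrite [X in X + _]XE /w; pt_ring.
have {XE} XE : X = p j by rewrite XE s00 scale0r addr0.
pose i := ord_pred j; have ij : ordS i = j by exact: ord_predK.
have i_neq : i != j by rewrite -[X in _ != X]ij eq_sym ordS_neq.
pose v := p i - p j.
have v0 : v != 0 by rewrite /v subr_eq0 -ij side_neq.
have vN : 0 < `|v| by rewrite normr_gt0.
have hnot k : (k != i) && (k != j) -> ~ side k X.
  move=> /andP[ki kj] hk.
  have hj : side j X by rewrite XE; exact: seg_hulll.
  have [kSj|kSj] := eqVneq k (ordS j).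
    have : [set p (ordS j)] X by rewrite -(h1 j); split=> //; rewrite -kSj.
    by rewrite /= XE => /inj /esym/eqP; rewrite (negbTE (ordS_neq j)).
  have jSk : j != ordS k.
    by rewrite -ij; apply: contra ki => /eqP /ordS_inj ->.
  by have : set0 X by rewrite -(h2 j k kj kSj jSk).
have [e1 e10 he1] := nball [pred k | (k != i) && (k != j)] hnot.
pose e := Num.min e1 (Num.min `|w| `|v|).
have e0 : 0 < e by rewrite /e !lt_min e10 wN.
have ee1 : e <= e1 by rewrite /e ge_min lexx.
have eew : e <= `|w| by rewrite /e !ge_min lexx !orbT.
have eev : e <= `|v| by rewrite /e !ge_min lexx !orbT.
exists w, v, e; split=> //.
  move=> k k0; apply/eqP => wkv.
  (* A parameter admissible on both incident sides at once, so that [X + a *: w] would be a second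
     common point. *)
  pose a := Num.min 1 k^-1.
  have a0 : 0 < a by rewrite /a lt_min ltr01 invr_gt0.
  have a1 : a <= 1 by rewrite /a ge_min lexx.
  have ak : a * k <= 1.
    have : a <= k^-1 by rewrite /a ge_min lexx orbT.
    by rewrite -ler_pdivlMr// mul1r.
  have hj : side j (X + a *: w) by rewrite XE; apply/seg_hullP; exists a; rewrite (ltW a0).
  have hi : side i (X + a *: w).
    apply/seg_hullP; exists (1 - a * k); split; [lra|by rewrite gerBl mulr_ge0// ltW|].
    rewrite XE wkv scalerA ij /v; pt_ring.
  have : [set p (ordS i)] (X + a *: w) by rewrite -(h1 i); split=> //; rewrite ij.
  rewrite /= ij XE => /eqP; rewrite addrC -subr_eq0 addrK scaler_eq0 (negbTE w0) orbF.
  by rewrite gt_eqF.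
move=> y yb; split.
  move=> [k _ hk]; have [kj|kj] := eqVneq k j.
    move: hk; rewrite kj => /seg_hullP[t [t0 t1 yE]].
    by exists t => //; left; rewrite XE.
  have [ki|ki] := eqVneq k i; last first.
    by exfalso; apply: (he1 y _ k _ hk); [exact: le_ball yb|rewrite /= ki kj].
  move: hk; rewrite ki => /seg_hullP[t [t0 t1 yE]].
  exists (1 - t); first by rewrite subr_ge0.
  right; rewrite yE XE ij /v; pt_ring.
move=> [a a0 [yE|yE]]; subst y.
  exists j => //; apply/seg_hullP; exists a; split=> //; last by rewrite XE.
  have := ball_ray w a e wN yb a0; rewrite ltr_pdivlMr// => h.
  have : a * `|w| < 1 * `|w| by rewrite mul1r; exact: lt_le_trans eew.
  by rewrite ltr_pM2r// => /ltW.
exists i => //; apply/seg_hullP; exists (1 - a).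
have := ball_ray v a e vN yb a0; rewrite ltr_pdivlMr// => h.
have : a * `|v| < 1 * `|v| by rewrite mul1r; exact: lt_le_trans eev.
rewrite ltr_pM2r// => h'; split; [lra|lra|].
by rewrite ij XE /v; pt_ring.
Qed.

(** At an interior point the punctured ball is a union of four overlapping half-balls. At a boundary
    point each of the two sectors lies wholly inside or wholly outside Omega, and both cannot lie
    inside, since [X] would then be interior to the closure. *)
Lemma punctured_connected (X : pt R) (e : R) : closure Omega X -> 0 < e ->
  exists2 d : R, 0 < d <= e &
    connected [set y | [/\ Omega y, ball X d y & y != X]].
Proof.
move=> cX e0; have [OX|nOX] := pselect (Omega X).
  have [d /= d0 hd] : exists2 d : R, 0 < d & ball X d `<=` Omega.
    have : nbhs X Omega by apply: open_nbhs_nbhs.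
    by move=> /nbhs_ballP[d /= d0 hd]; exists d.
  pose m := Num.min d e; have m0 : 0 < m by rewrite /m lt_min d0.
  exists m; first by rewrite m0 /m ge_min lexx orbT.
  pose H a := [set y | ball X m y /\ 0 < cross a (y - X)].
  have -> : [set y | [/\ Omega y, ball X m y & y != X]] =
      H (1, 0) `|` H (0, 1) `|` (H (-1, 0) `|` H (0, -1)).
    apply/seteqP; split=> y.
      move=> [_ yb yX]; have : (y - X).1 != 0 \/ (y - X).2 != 0.
        apply/orP; rewrite -negb_and; apply: contra yX => /andP[/eqP h1 /eqP h2].
        by rewrite -subr_eq0; apply/eqP/pairE.
      rewrite !neq_lt => -[] /orP[] h.
      - by left; right; split=> //; move: h; rewrite /cross /=; lra.
      - by right; right; split=> //; move: h; rewrite /cross /=; lra.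
      - by right; left; split=> //; move: h; rewrite /cross /=; lra.
      - by left; left; split=> //; move: h; rewrite /cross /=; lra.
    have hin a : H a y -> [/\ Omega y, ball X m y & y != X].
      move=> [yb hy]; split=> //; first by apply: hd; apply: le_ball yb; rewrite /m ge_min lexx.
      by apply: contraTneq hy => ->; rewrite subrr /cross /= !mulr0 subrr ltxx.
    by move=> [[]|[]]; exact: hin.
  have hq (a b : R) : `|a| <= m / 2 -> `|b| <= m / 2 -> ball X m (X + (a, b)).
    move=> ha hb; rewrite -ball_normE /= opprD addrA subrr sub0r normrN.
    by rewrite [X in X < _](_ : _ = Num.max `|a| `|b|)// gt_max; apply/andP; split; lra.
  have n2 : `|m / 2| <= m / 2 by rewrite ger0_norm// divr_ge0// ltW.
  have n2' : `|- (m / 2)| <= m / 2 by rewrite normrN.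
  have mh : 0 < m / 2 by rewrite divr_gt0.
  have hH a b c : `|b| <= m / 2 -> `|c| <= m / 2 -> 0 < cross a (b, c) -> H a (X + (b, c)).
    by move=> hb hc h; split; [exact: hq|rewrite addrC addKr].
  apply: connectedU.
  - exists (X + (m / 2, m / 2)); split.
      by left; apply: hH => //; rewrite /cross /=; lra.
    by right; apply: hH => //; rewrite /cross /=; lra.
  - apply: connectedU; try exact: connected_halfplane.
    exists (X + (- (m / 2), m / 2)).
    by split; apply: hH => //; rewrite /cross /=; lra.
  - apply: connectedU; try exact: connected_halfplane.
    exists (X + (m / 2, - (m / 2))).
    by split; apply: hH => //; rewrite /cross /=; lra.
have PX := closureP cX nOX.
have [u [v [d [d0 u0 v0 huv hd]]]] := boundary_rays PX.
pose m := Num.min d e; have m0 : 0 < m by rewrite /m lt_min d0.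
exists m; first by rewrite m0 /m ge_min lexx orbT.
have mball y : ball X m y -> ball X d y by apply: le_ball; rewrite /m ge_min lexx.
have [S1 [S2 [c1 c2 h3 h4]]] := sectors X m0 u0 v0 huv.
have SP y : S1 y \/ S2 y -> ~ P y.
  by move=> /h4[yb nr] /(hd _ (mball _ yb)).
have inout S : connected S -> (forall y, S y -> ~ P y) ->
    (S `<=` Omega) \/ (forall y, S y -> ~ Omega y).
  move=> cS hS; have [[y [Sy Oy]]|h] := pselect (exists y, S y /\ Omega y).
    by left=> z Sz; exact: (connected_in_or_out cS hS Sy Sz Oy).
  by right=> y Sy Oy; apply: h; exists y.
have E : [set y | [/\ Omega y, ball X m y & y != X]] = [set y | Omega y /\ (S1 y \/ S2 y)].
  apply/seteqP; split=> y.
    move=> [Oy yb _]; split=> //; apply: h3 => // hr.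
    by apply: (P_notin _ Oy); apply/(hd _ (mball _ yb)).
  move=> [Oy /h4[yb nr]]; split=> //; apply/negP => /eqP yX; apply: nr.
  by exists 0 => //; left; rewrite scale0r addr0.
rewrite E.
have [s1|s1] := inout S1 c1 (fun y h => SP y (or_introl h));
have [s2|s2] := inout S2 c2 (fun y h => SP y (or_intror h)).
- exfalso; apply: nOX; apply: interior_closure_sub.
  apply/nbhs_ballP; exists m => //= y yb.
  have [Py|nPy] := pselect (P y); first exact: P_sub.
  apply: subset_closure; have : S1 y \/ S2 y.
    by apply: h3 => // hr; apply: nPy; apply/(hd _ (mball _ yb)).
  by move=> [/s1|/s2].
- rewrite (_ : [set y | _] = S1)//; apply/seteqP; split=> y.
    by move=> [Oy [//|/s2]].
  by move=> Sy; split; [exact: s1|left].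
- rewrite (_ : [set y | _] = S2)//; apply/seteqP; split=> y.
    by move=> [Oy [/s1|//]].
  by move=> Sy; split; [exact: s2|right].
- rewrite (_ : [set y | _] = set0); first exact: connected0.
  by rewrite -subset0 => y [Oy [/s1|/s2]].
Qed.
End Domain.

(** * The fundamental lemma of the calculus of variations in the plane *)

Section FundamentalLemma.
Variable R : realType.
Implicit Types (Omega : set (pt R)) (f h phi : pt R -> R).
Notation mu := (@leb2 R).
Notation mpt := (measurableTypeR R * measurableTypeR R)%type.

Lemma box_compact (r : R) : compact (box r).
Proof. by apply: compact_setX; exact: segment_compact. Qed.

Lemma compact_box (S : set (pt R)) : compact S -> exists2 r : R, 0 < r & S `<=` box r.
Proof. by move=> /compact_bounded /bounded_box. Qed.

Lemma Lfun2_compact f (S : set (pt R)) : continuous f -> compact S ->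
  (forall x, ~ S x -> f x = 0) -> f \in Lfun mu 2%:E.
Proof.
move=> cf cS f0; have [r r0 Sr] := compact_box cS.
have : compact (f @` box r).
  by apply: continuous_compact (@box_compact r); exact: continuous_subspaceT.
move=> /compact_bounded[M [_ hM]].
have fM x : box r x -> `|f x| <= `|M| + 1.
  move=> xr; have := hM (`|M| + 1); rewrite (le_lt_trans (ler_norm M)) ?ltrDl//.
  by move=> /(_ isT) /(_ (f x)); apply; exists x.
have -> : f = f \_ (box r).
  apply/funext => x; rewrite patchE; case: ifPn => // /negP xr.
  by apply: f0 => /Sr h; apply: xr; exact/mem_set.
apply: (Lfun2_bounded (r := r) _ _ _ fM) => //; first exact: box_measurable.
exact: continuous_measurable2.
Qed.

Lemma derive_out f (S : set (pt R)) (v : pt R) : closed S ->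
  (forall x, ~ S x -> f x = 0) -> forall x, ~ S x -> 'D_v f x = 0.
Proof.
move=> cS f0 x nSx.
have fE : \forall y \near x, cst 0 y = f y.
  have := closed_openC cS; rewrite openE => /(_ x nSx).
  by apply: filterS => y /f0 ->.
by rewrite -(near_eq_derive _ fE) derive_cst.
Qed.

Definition tsupp phi : set (pt R) := closure [set x | phi x != 0].

Lemma tsupp_out phi x : ~ tsupp phi x -> phi x = 0.
Proof.
move=> h; apply/eqP; apply: contrapT => /negP px; apply: h.
exact: subset_closure.
Qed.

Lemma pd_out phi a b x : ~ tsupp phi x -> pd a b phi x = 0.
Proof.
have cl : closed (tsupp phi) by exact: closed_closure.
have h2 : forall x, ~ tsupp phi x -> iter b (fun g => 'D_((0, 1) : pt R) g) phi x = 0.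
  elim: b => [|b IH]; first exact: tsupp_out.
  by move=> y; rewrite iterS; exact: derive_out.
rewrite /pd; elim: a x => [|a IH] x; first exact: h2.
by rewrite iterS; exact: derive_out.
Qed.

Lemma test_continuous Omega phi a b : test_function Omega phi -> continuous (pd a b phi).
Proof. by move=> [h _ _] x; apply: differentiable_continuous; exact: h. Qed.

Lemma test_Lfun2 Omega phi a b : test_function Omega phi -> pd a b phi \in Lfun mu 2%:E.
Proof.
move=> tp; have [_ c _] := tp.
apply: (Lfun2_compact _ c); first exact: test_continuous tp.
by move=> x; exact: pd_out.
Qed.

Lemma Lfun2_integrable f h : f \in Lfun mu 2%:E -> h \in Lfun mu 2%:E ->
  mu.-integrable setT (EFin \o (fun x => f x * h x)).
Proof. by move=> hf hh; apply/Lfun1_integrable; exact: Lfun2_mul_Lfun1. Qed.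

Lemma Rintegral_restrict Omega f h :
  \int[mu]_(x in Omega) (f x * h x) = \int[mu]_x ((f \_ Omega) x * h x).
Proof.
rewrite Rintegral_mkcond; apply: eq_Rintegral => x _; rewrite !patchE.
by case: ifP => //; rewrite mul0r.
Qed.

Lemma indic_Lfun2 (A : set (pt R)) r : measurable (A : set mpt) -> A `<=` box r ->
  (\1_A : pt R -> R) \in Lfun mu 2%:E.
Proof.
move=> mA Ar; have -> : (\1_A : pt R -> R) = (cst 1 : pt R -> R) \_ A.
  by apply/funext => x; rewrite patchE indicE; case: (x \in A).
apply: (Lfun2_bounded (C := 1) mA Ar); first exact: measurable_cst.
by move=> x _; rewrite normr1.
Qed.

Definition orect (a b c d : R) : set (pt R) := `]a, b[ `*` `]c, d[.

Lemma orect_measurable a b c d : measurable (orect a b c d : set mpt).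
Proof. by apply: measurableX; exact: measurable_itv. Qed.

Lemma orect_box a b c d : exists r, orect a b c d `<=` box r.
Proof.
exists (`|a| + `|b| + `|c| + `|d|) => x [/=]; rewrite !in_itv /=.
move=> /andP[h1 h2] /andP[h3 h4]; split; rewrite /= in_itv /=.
  have := ler_norm b; have := lerNnormlW (lexx `|a|).
  have := normr_ge0 a; have := normr_ge0 b; have := normr_ge0 c; have := normr_ge0 d.
  by move=> *; apply/andP; split; lra.
have := ler_norm d; have := lerNnormlW (lexx `|c|).
have := normr_ge0 a; have := normr_ge0 b; have := normr_ge0 c; have := normr_ge0 d.
by move=> *; apply/andP; split; lra.
Qed.

Lemma bump_cvg1 (a b x : R) : a < x -> x < b ->
  bump a b n.+1%:R^-1 1 0 x @[n --> \oo] --> (1 : R).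
Proof.
move=> ax xb; pose w := (bump_weight a b).[x].
have -> : (fun n : nat => bump a b n.+1%:R^-1 1 0 x) =
    (fun n : nat => expR (- (harmonic n * w^-1))).
  by apply/funext => n; rewrite /bump ax xb /= hornerC expr0 divr1 mul1r.
have : - (harmonic n * w^-1) @[n --> \oo] --> - (0 * w^-1).
  by apply: cvgN; apply: cvgMr_tmp; exact: cvg_harmonic.
rewrite mul0r oppr0 => h0; rewrite -expR0.
by apply: continuous_cvg h0; exact: continuous_expR.
Qed.

Variables (Omega : set (pt R)) (h : pt R -> R).
Hypothesis oO : open Omega.
Hypothesis hL2 : L2 Omega h.
Hypothesis h0 : forall phi, test_function Omega phi ->
  \int[mu]_(x in Omega) (h x * phi x) = 0.

(** Product bumps with parameter [1 / (n + 1)] converge pointwise to the indicator of the open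
    rectangle and stay below it, so dominated convergence applies. *)
Lemma fund_rect a b c d : a < b -> c < d -> `[a, b] `*` `[c, d] `<=` Omega ->
  (\int[mu]_(x in orect a b c d) (h x)%:E = 0)%E.
Proof.
move=> ab cd hQ; pose Q := orect a b c d.
have mQ : measurable (Q : set mpt) by exact: orect_measurable.
have [r hr] := orect_box a b c d.
have QO : Q `<=` Omega.
  move=> x [/=]; rewrite !in_itv /= => /andP[h1 h2] /andP[h3 h4]; apply: hQ.
  by split; rewrite /= in_itv /= !ltW.
pose H := h \_ Omega.
have [mH _] : measurable_fun setT (H : mpt -> R) /\ True.
  by split=> //; move: hL2; rewrite /L2 inE => /andP[/[!inE] /=].
pose phi (n : nat) := bump2 a b c d n.+1%:R^-1.
have s0 (n : nat) : 0 < n.+1%:R^-1 :> R by rewrite invr_gt0 ltr0n.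
have tphi n : test_function Omega (phi n) by exact: bump2_test.
have phi_out n x : ~ Q x -> phi n x = 0.
  move=> nQ; rewrite /phi /bump2 /bumpn.
  have [/andP[h1 h2]|/negP k] := boolP (a < x.1 < b); last by rewrite bump_out ?mul0r.
  have [/andP[h3 h4]|/negP k] := boolP (c < x.2 < d); last by rewrite [X in _ * X]bump_out ?mulr0.
  by exfalso; apply: nQ; split; rewrite /= in_itv /= ?h1 ?h2 ?h3 ?h4.
have phi_bnd n x : `|phi n x| <= (\1_Q x : R).
  rewrite indicE; have [xQ|xQ] := boolP (x \in Q); last first.
    by rewrite phi_out ?normr0// => /mem_set; rewrite (negbTE xQ).
  rewrite /phi /bump2 /bumpn normrM !ger0_norm ?bump_ge0//.
  by rewrite -[leRHS]mulr1 ler_pM ?bump_ge0 ?bump_le1.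
have phi_cvg x : phi n x @[n --> \oo] --> (\1_Q x : R).
  rewrite indicE; have [|xQ] := boolP (x \in Q); last first.
    rewrite (_ : (fun n => _) = fun=> 0); first exact: cvg_cst.
    by apply/funext => n; rewrite phi_out// => /mem_set; rewrite (negbTE xQ).
  rewrite inE => -[/=]; rewrite !in_itv /= => /andP[h1 h2] /andP[h3 h4].
  rewrite -[1]mulr1; apply: cvgM; exact: bump_cvg1.
have mphi n : measurable_fun setT (phi n : mpt -> R).
  by apply: continuous_measurable2; exact: (test_continuous (a := 0) (b := 0) (tphi n)).
pose f_ (n : nat) (x : mpt) : \bar R := (H x * phi n x)%:E.
have int0 n : (\int[mu]_x f_ n x = 0)%E.
  have iH : mu.-integrable setT (EFin \o (fun x => H x * phi n x)).
    by apply: Lfun2_integrable => //; exact: (test_Lfun2 0 0 (tphi n)).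
  have := h0 (tphi n); rewrite Rintegral_restrict /Rintegral => /eqP.
  rewrite fine_eq0; first by move/eqP.
  exact: integrable_fin_num iH.
have := @dominated_convergence _ _ _ mu setT measurableT f_
  (fun x => (H x * \1_Q x)%:E) (fun x => (`|H x * \1_Q x|)%:E).
case.
- by move=> n; apply/measurable_EFinP; exact: measurable_funM.
- apply/measurable_EFinP; apply: measurable_funM => //.
- apply: aeW => x _; apply: cvg_EFin; first by apply: nearW.
  by apply: cvgM; [exact: cvg_cst|exact: phi_cvg].
- have : mu.-integrable setT (EFin \o (fun x => H x * \1_Q x)).
    by apply: Lfun2_integrable => //; exact: indic_Lfun2 hr.
  by move=> /integrable_abse; apply: eq_integrable.
- apply: aeW => x n _; rewrite lee_fin !normrM ler_wpM2l//.
  by rewrite -normrM (le_trans (phi_bnd n x))// ler_norm.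
move=> _ _; rewrite (_ : [sequence _]_n = fun=> 0%E); last exact/funext.
move=> cv; have E : (\int[mu]_(x in orect a b c d) (h x)%:E =
    \int[mu]_x (H x * \1_Q x)%:E :> \bar R)%E.
  rewrite integral_mkcond; apply: eq_integral => x _.
  rewrite !patchE /H patchE indicE.
  have [xQ|xQ] := boolP (x \in Q); last by rewrite mulr0.
  by rewrite mem_set ?mulr1//; exact/QO/set_mem.
by rewrite E; exact: (@cvg_unique _ (@ereal_hausdorff R) _ _ _ _ cv (cvg_cst 0%E)).
Qed.

(** The pi-lambda argument for a signed integrand, with a map [g] so that it can be used for each
    coordinate separately and then for the identity. *)
Lemma dynkin_preimage (d : measure_display) (T : measurableType d) (g : mpt -> T)
    (E : set mpt) (f : mpt -> R) (G : set (set T)) :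
  measurable_fun setT g -> measurable E -> mu.-integrable setT (EFin \o f) ->
  @measurable _ T = <<s G >> -> setI_closed G ->
  (\int[mu]_(x in E) (f x)%:E = 0)%E ->
  (forall A, G A -> (\int[mu]_(x in E `&` g @^-1` A) (f x)%:E = 0)%E) ->
  forall A, measurable A -> (\int[mu]_(x in E `&` g @^-1` A) (f x)%:E = 0)%E.
Proof.
move=> mg mE fi mG GI fE fG A; rewrite mG.
have mpre S : measurable S -> measurable (E `&` g @^-1` S).
  by move=> mS; apply: measurableI => //; rewrite -[X in measurable X]setTI; exact: mg.
apply: (dynkin_induction (P := fun S => (\int[mu]_(x in E `&` g @^-1` S) (f x)%:E = 0)%E)) => //.
- by rewrite preimage_setT setIT.
- move=> S mS hS.
  have : (\int[mu]_(x in E) (f x)%:E = 0)%E by [].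
  rewrite -{1}(setIT E) -(preimage_setT g) -(setUv S) preimage_setU setIUr.
  rewrite integral_setU_EFin//.
  + by rewrite hS add0e.
  + exact: mpre.
  + by apply: mpre; exact: measurableC.
  + by apply: measurable_funTS; apply/measurable_EFinP; case/integrableP: fi.
  + apply/disj_set2P; rewrite setIACA setIid -preimage_setI setICr preimage_set0 setI0.
    by [].
- move=> F mF tF hF; rewrite preimage_bigcup setI_bigcupr.
  rewrite integral_bigcup//.
  + by apply: eseries0 => i _ _; exact: hF.
  + move=> i j _ _ [x [[_ Fi] [_ Fj]]].
    by apply: tF => //; exists (g x).
  + by move=> k; exact: mpre.
  + by apply: integrableS fi => //; apply: bigcupT_measurable => k; exact: mpre.
Qed.

(** The vanishing integrals over open rectangles are extended to an arbitrary first factor, then to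
    an arbitrary second factor, then to all measurable sets. *)
Lemma fund_rect_ae a b c d : a < b -> c < d -> `[a, b] `*` `[c, d] `<=` Omega ->
  ae_on (orect a b c d) (fun x => h x = 0).
Proof.
move=> ab cd hQ; pose Q := orect a b c d; pose f := h \_ Q.
have mQ : measurable (Q : set mpt) by exact: orect_measurable.
have QO : Q `<=` Omega.
  move=> x [/=]; rewrite !in_itv /= => /andP[h1 h2] /andP[h3 h4]; apply: hQ.
  by split; rewrite /= in_itv /= !ltW.
have [r hr] := orect_box a b c d.
have fi : mu.-integrable setT (EFin \o (f : mpt -> R)).
  have : mu.-integrable setT (EFin \o (fun x => (h \_ Omega) x * \1_Q x)).
    by apply: Lfun2_integrable => //; exact: indic_Lfun2 hr.
  apply: eq_integrable => // x _ /=; rewrite /f !patchE indicE.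
  have [xQ|xQ] := boolP (x \in Q); last by rewrite mulr0.
  by rewrite mem_set ?mulr1//; exact/QO/set_mem.
have frect (I J : set R) : measurable (I : set (measurableTypeR R)) ->
    measurable (J : set (measurableTypeR R)) ->
    (exists a' b', I = `]a', b'[%classic) -> (exists c' d', J = `]c', d'[%classic) ->
    (\int[mu]_(x in I `*` J) (f x)%:E = 0)%E.
  move=> _ _ [a' [b' ->]] [c' [d' ->]].
  pose a2 := Num.max a a'; pose b2 := Num.min b b'.
  pose c2 := Num.max c c'; pose d2 := Num.min d d'.
  have E : (\int[mu]_(x in `]a', b'[ `*` `]c', d'[) (f x)%:E)%E =
      (\int[mu]_(x in orect a2 b2 c2 d2) (h x)%:E)%E.
    rewrite integral_mkcond [RHS]integral_mkcond; apply: eq_integral => -[x y] _.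
    rewrite !patchE /f patchE.
    have -> : ((x, y) \in orect a2 b2 c2 d2) = ((x, y) \in `]a', b'[ `*` `]c', d'[) && ((x, y) \in Q).
      apply/idP/andP; rewrite !inE /Q /orect /= !in_itv /= !gt_max !lt_min.
        by move=> [/andP[/andP[-> ->] /andP[-> ->]] /andP[/andP[-> ->] /andP[-> ->]]].
      by move=> [[/andP[-> ->] /andP[-> ->]] [/andP[-> ->] /andP[-> ->]]].
    by case: ((x, y) \in `]a', b'[ `*` `]c', d'[); case: ((x, y) \in Q).
  rewrite E; have [ab2|ab2] := ltP a2 b2; last first.
    rewrite (_ : orect _ _ _ _ = set0) ?integral_set0//.
    by rewrite -subset0 => -[x y] [/=]; rewrite in_itv /= => /andP[h1 h2]; lra.
  have [cd2|cd2] := ltP c2 d2; last first.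
    rewrite (_ : orect _ _ _ _ = set0) ?integral_set0//.
    by rewrite -subset0 => -[x y] [/= _]; rewrite in_itv /= => /andP[h1 h2]; lra.
  apply: fund_rect => //; apply: subset_trans hQ => -[x y] [/=].
  rewrite !in_itv /= !ge_max !le_min => /andP[/andP[-> _] /andP[-> _]].
  by move=> /andP[/andP[-> _] /andP[-> _]].
have Gm : @measurable _ (measurableTypeR R) = <<s @RGenOpens.G R >>.
  exact: RGenOpens.measurableE.
have GI : setI_closed (@RGenOpens.G R).
  move=> _ _ [a1 [b1 ->]] [a2 [b2 ->]]; exists (Num.max a1 a2), (Num.min b1 b2).
  apply/seteqP; split=> x; rewrite /= !in_itv /= gt_max lt_min.
    by move=> [/andP[-> ->] /andP[-> ->]].
  by move=> /andP[/andP[-> ->] /andP[-> ->]].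
have Gmeas I : @RGenOpens.G R I -> measurable (I : set (measurableTypeR R)).
  by move=> [a' [b' ->]]; exact: measurable_itv.
have fsupp (E F : set mpt) : E `&` Q = F `&` Q ->
    (\int[mu]_(x in E) (f x)%:E = \int[mu]_(x in F) (f x)%:E)%E.
  move=> EF; rewrite integral_mkcond [RHS]integral_mkcond; apply: eq_integral => x _.
  rewrite !patchE /f patchE; have [xQ|xQ] := boolP (x \in Q); last by rewrite !if_same.
  have -> // : (x \in E) = (x \in F).
  apply/idP/idP; rewrite !inE => Ex.
    by have [] : (F `&` Q) x by rewrite -EF; split=> //; exact/set_mem.
  by have [] : (E `&` Q) x by rewrite EF; split=> //; exact/set_mem.
have step1 (J : set (measurableTypeR R)) : @RGenOpens.G R J ->
    forall A : set (measurableTypeR R), measurable A ->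
    (\int[mu]_(x in A `*` J) (f x)%:E = 0)%E.
  move=> GJ A mA.
  have -> : A `*` J = (setT `*` J) `&` fst @^-1` A.
    by apply/seteqP; split=> x /= => [[? ?]|[[_ ?] ?]].
  apply: (dynkin_preimage _ _ fi Gm GI) mA.
  - exact: measurable_fst.
  - by apply: measurableX => //; exact: Gmeas.
  - rewrite (fsupp _ (`]a, b[ `*` J)); last first.
      by apply/seteqP; split=> x [[h1 h2] [h3 h4]].
    by apply: frect => //; [exact: Gmeas|exists a, b].
  - move=> I GI'; rewrite (_ : _ `&` _ = I `*` J).
      by apply: frect => //; exact: Gmeas.
    by apply/seteqP; split=> x /= => [[[_ ?] ?]|[? ?]].
have step2 (A B : set (measurableTypeR R)) : measurable A -> measurable B ->
    (\int[mu]_(x in A `*` B) (f x)%:E = 0)%E.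
  move=> mA mB.
  have -> : A `*` B = (A `*` setT) `&` snd @^-1` B.
    by apply/seteqP; split=> x /= => [[? ?]|[[? _] ?]].
  apply: (dynkin_preimage _ _ fi Gm GI) mB.
  - exact: measurable_snd.
  - exact: measurableX.
  - rewrite (fsupp _ (A `*` `]c, d[)); last first.
      by apply/seteqP; split=> x [[h1 h2] [h3 h4]].
    by apply: step1 => //; exists c, d.
  - move=> J GJ; rewrite (_ : _ `&` _ = A `*` J); first exact: step1.
    by apply/seteqP; split=> x /= => [[[? _] ?]|[? ?]].
have step3 (E : set mpt) : measurable E -> (\int[mu]_(x in E) (f x)%:E = 0)%E.
  move=> mE; rewrite -(setTI E).
  apply: (dynkin_preimage (g := idfun) _ _ fi (measurable_prod_measurableType _ _)) mE => //.
  - exact: measurable_id.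
  - move=> _ _ [A1 mA1 [B1 mB1 <-]] [A2 mA2 [B2 mB2 <-]].
    exists (A1 `&` A2); first exact: measurableI.
    by exists (B1 `&` B2); [exact: measurableI|rewrite setXI].
  - by rewrite -setXTT; exact: step2.
  - by move=> _ [A mA [B mB <-]]; rewrite setTI; exact: step2.
have : ae_eq mu setT (EFin \o f) (cst 0%E).
  apply: (integral_ae_eq _ fi) => // E _ mE.
  by rewrite step3// integral0.
rewrite /ae_eq => hae; apply/ae_onE; move: hae; apply: negligibleS => x [Qx nh] /=.
move=> /(_ I) [] /eqP; rewrite /f patchE mem_set// => /eqP; exact: nh.
Qed.

Lemma negligible_bigcup_countable (I : countType) (P : I -> set mpt) :
  (forall i, mu.-negligible (P i)) -> mu.-negligible (\bigcup_i P i).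
Proof.
move=> hP; pose F n := if unpickle n is Some i then P i else set0.
have : mu.-negligible (\bigcup_n F n).
  apply: negligible_bigcup => n; rewrite /F; case: unpickle => [i|]//.
  exact: negligible_set0.
apply: negligibleS => x [i _ Px]; exists (pickle i) => //.
by rewrite /F pickleK.
Qed.

(** Omega is covered by countably many rectangles with rational centres whose closures lie in Omega;
    a countable union of null sets is null. *)
Lemma fundamental_lemma : ae_on Omega (fun x => h x = 0).
Proof.
pose B (i : rat * rat * nat) : set (pt R) :=
  let r : R := i.2.+1%:R^-1 in let a := ratr i.1.1 in let b := ratr i.1.2 in
  if `[< `[a - r, a + r] `*` `[b - r, b + r] `<=` Omega >] then
  orect (a - r) (a + r) (b - r) (b + r) else set0.
apply/ae_onE; have : mu.-negligible (\bigcup_i [set x | B i x /\ h x <> 0]).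
  apply: negligible_bigcup_countable => i.
  apply/ae_onE; rewrite /B; case: asboolP => [hi|_]; last by apply: ae_onW.
  have r0 : 0 < i.2.+1%:R^-1 :> R by rewrite invr_gt0 ltr0n.
  move: hi r0; generalize (i.2.+1%:R^-1 : R) => r hi r0.
  by apply: fund_rect_ae => //; rewrite ltrD2l gtrN.
apply: negligibleS => x [Ox hx].
have : nbhs x Omega by apply: open_nbhs_nbhs.
move=> /nbhs_ballP[e /= e0 he].
pose n := Num.truncn (2 / e); pose d : R := n.+1%:R^-1.
have d0 : 0 < d by rewrite invr_gt0 ltr0n.
have de : d + d <= e.
  have : 2 / e < n.+1%:R by rewrite truncnS_gt.
  rewrite ltr_pdivrMr// => h'.
  have -> : d + d = 2 / n.+1%:R by rewrite mulrDl mul1r.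
  by rewrite ler_pdivrMr ?ltr0n// mulrC ltW.
have ratE (y : R) : exists (a : R) (q : rat), a = ratr q /\ y - d < a < y + d.
  have [q hq] : exists q : rat, ratr q \in `]y - d, y + d[.
    by apply: rat_in_itvoo; rewrite ltrD2l gtrN.
  by exists (ratr q), q; rewrite in_itv in hq.
have [a [q1 [aE /andP[h1 h2]]]] := ratE x.1.
have [b [q2 [bE /andP[h3 h4]]]] := ratE x.2.
suff hB : B ((q1, q2), n) x.
  by exists ((q1, q2), n).
rewrite /B [_.1.1]/= [_.1.2]/= [_.2]/= -/d -aE -bE {aE bE}.

rewrite asboolT.
  move: d0 h1 h2 h3 h4 {de}; generalize d => r *.
  by split; rewrite /= in_itv /=; apply/andP; split; lra.
move=> y [/=]; rewrite !in_itv /= => /andP[k1 k2] /andP[k3 k4].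
apply: he; apply/ball_prodE; move: d0 de h1 h2 h3 h4 k1 k2 k3 k4; generalize d => r *.
by rewrite !ltr_norml; split; apply/andP; split; lra.
Qed.
End FundamentalLemma.

(** * Edges of triangles and adjacency across an edge *)

Section HalfEdges.
Variable R : realType.
Implicit Types (K L M : tri R) (x y A B : pt R) (i j m : 'I_3).

(** [ea] and [eb] are the ends of the edge opposite to vertex [i], in the cyclic order of the
    vertices. *)
Definition ea K i : pt R := vt K (nx i).
Definition eb K i : pt R := vt K (nx (nx i)).

Lemma ord3_cases i m : [\/ m = i, m = nx i | m = nx (nx i)].
Proof.
by move: i m; apply: ord3P; apply: ord3P; rewrite /nx /=; try (by constructor 1);
  try (by constructor 2); constructor 3.
Qed.

Lemma nx_neq i : (nx i != i) * (nx (nx i) != i) * (nx (nx i) != nx i).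
Proof. by move: i; apply: ord3P. Qed.

Lemma mem_verts K x : reflect (exists m, x = vt K m) (x \in verts K).
Proof.
apply: (iffP idP) => [/(nthP 0)[k hk <-]|[m ->]]; first by exists (Ordinal hk).
by apply: mem_nth; exact: ltn_ord.
Qed.

Lemma vt_inj K : orient K != 0 -> injective (vt K).
Proof.
move=> hK i j h; have := lam_vt i j hK; rewrite -h lam_vt// eqxx.
by case: eqP => // _ /eqP; rewrite oner_eq0.
Qed.

Lemma lam_sum_aff n K i (c : 'I_n -> R) (s : 'I_n -> pt R) : \sum_k c k = 1 ->
  lam K i (\sum_k c k *: s k) = \sum_k c k * lam K i (s k).
Proof.
move=> c1; have [a [b [d hl]]] := polyn1E (lam_polyn K i).
rewrite hl (big_morph (fun x : pt R => x.1) (fun x y => erefl) erefl).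
rewrite (big_morph (fun x : pt R => x.2) (fun x y => erefl) erefl) /=.
rewrite -[a]mulr1 -c1 !mulr_sumr -!big_split /=.
by apply: eq_bigr => k _; rewrite hl /GRing.scale /=; ring.
Qed.

Lemma lam_line K i A B t : lam K i (A + t *: (B - A)) = (1 - t) * lam K i A + t * lam K i B.
Proof.
rewrite -lam_aff ?subrK//; congr lam.
by pt_ring.
Qed.

Lemma cross_edge K i x : orient K != 0 ->
  cross (eb K i - ea K i) (x - ea K i) = orient K * lam K i x.
Proof.
move=> hK; rewrite /lam mulrC mulfVK// /ea /eb; move: i; apply: ord3P;
  rewrite /cross /=; ring.
Qed.

Lemma edge_neq K i : orient K != 0 -> ea K i != eb K i.
Proof.
move=> hK; apply/eqP => /(vt_inj hK)/esym/eqP.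
by rewrite (negbTE (nx_neq i).2).
Qed.

Lemma lam_vt1 K i : orient K != 0 -> lam K i (vt K i) = 1.
Proof. by move=> hK; rewrite lam_vt// eqxx. Qed.

Lemma lam_ea K i : orient K != 0 ->
  [/\ lam K i (ea K i) = 0, lam K (nx i) (ea K i) = 1 & lam K (nx (nx i)) (ea K i) = 0].
Proof.
by move=> hK; rewrite !lam_vt// eqxx (negbTE (nx_neq i).2) eq_sym !(negbTE (nx_neq i).1.1).
Qed.

Lemma lam_eb K i : orient K != 0 ->
  [/\ lam K i (eb K i) = 0, lam K (nx i) (eb K i) = 0 & lam K (nx (nx i)) (eb K i) = 1].
Proof.
move=> hK; rewrite !lam_vt// eqxx eq_sym (negbTE (nx_neq i).1.2).
by rewrite eq_sym (negbTE (nx_neq i).2).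
Qed.

Definition oedge K i x :=
  [/\ lam K i x = 0, 0 < lam K (nx i) x & 0 < lam K (nx (nx i)) x].

Lemma oedgeP K i x : orient K != 0 ->
  oedge K i x <-> exists t : R, [/\ 0 < t, t < 1 & x = ea K i + t *: (eb K i - ea K i)].
Proof.
move=> hK; have [a1 a2 a3] := lam_ea i hK; have [b1 b2 b3] := lam_eb i hK.
split=> [[h1 h2 h3]|[t [t0 t1 ->]]]; last first.
  by rewrite /oedge !lam_line a1 a2 a3 b1 b2 b3; split; lra.
have s1 : lam K i x + lam K (nx i) x + lam K (nx (nx i)) x = 1.
  rewrite -(lam_sum x hK) sum3; move: {h1 h2 h3 a1 a2 a3 b1 b2 b3} i.
  by apply: ord3P; rewrite /nx /=; ring.
exists (lam K (nx (nx i)) x); split=> //; first lra.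
rewrite {1}(lam_dec x hK) sum3.
have -> : lam K i0 x *: vt K i0 + lam K i1 x *: vt K i1 + lam K i2 x *: vt K i2 =
    lam K i x *: vt K i + lam K (nx i) x *: ea K i + lam K (nx (nx i)) x *: eb K i.
  move: {s1 h1 h2 h3 a1 a2 a3 b1 b2 b3} i; rewrite /ea /eb; apply: ord3P; rewrite /nx //=.
    by rewrite [RHS]addrC addrA.
  by rewrite -[RHS]addrA [RHS]addrC.
have -> : lam K (nx i) x = 1 - lam K (nx (nx i)) x by rewrite -s1 h1; ring.
by rewrite h1; pt_ring.
Qed.

Lemma edge_hullP K i x : orient K != 0 ->
  hull [:: ea K i; eb K i] x <-> [/\ lam K i x = 0, 0 <= lam K (nx i) x & 0 <= lam K (nx (nx i)) x].
Proof.
move=> hK; have [a1 a2 a3] := lam_ea i hK; have [b1 b2 b3] := lam_eb i hK.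
split=> [/seg_hullP[t [t0 t1 ->]]|[h1 h2 h3]].
  by rewrite !lam_line a1 a2 a3 b1 b2 b3; split; lra.
have s1 : lam K i x + lam K (nx i) x + lam K (nx (nx i)) x = 1.
  rewrite -(lam_sum x hK) sum3; move: {h1 h2 h3 a1 a2 a3 b1 b2 b3} i.
  by apply: ord3P; rewrite /nx /=; ring.
have [z1|n1] := eqVneq (lam K (nx i) x) 0.
  apply/seg_hullP; exists 1; split=> //.
  have e3 : lam K (nx (nx i)) x = 1 by rewrite -s1 h1 z1; ring.
  rewrite (lam_dec x hK) scale1r addrC subrK (bigD1 (nx (nx i)))//= e3 scale1r big1 ?addr0//.
  by move=> m; case: (ord3_cases i m) => -> ; rewrite ?eqxx// ?h1 ?z1 scale0r.
have [z2|n2] := eqVneq (lam K (nx (nx i)) x) 0.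
  apply/seg_hullP; exists 0; split=> //.
  have e3 : lam K (nx i) x = 1 by rewrite -s1 h1 z2; ring.
  rewrite (lam_dec x hK) scale0r addr0 (bigD1 (nx i))//= e3 scale1r big1 ?addr0//.
  by move=> m; case: (ord3_cases i m) => -> ; rewrite ?eqxx// ?h1 ?z2 scale0r.
have /(oedgeP i x hK)[t [t0 t1 ->]] : oedge K i x.
  by split=> //; rewrite lt_neqAle eq_sym ?n1 ?n2.
by apply/seg_hullP; exists t; rewrite !ltW.
Qed.

(** Triangles carry no preferred orientation, so a shared edge may be traversed in either sense by
    the two of them. *)
Definition nbr K i L j := (L != K) &&
  (((ea L j == ea K i) && (eb L j == eb K i)) || ((ea L j == eb K i) && (eb L j == ea K i))).

Lemma nbr_sym K i L j : nbr K i L j -> nbr L j K i.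
Proof.
move=> /andP[h1 /orP[]/andP[/eqP h2 /eqP h3]]; rewrite /nbr eq_sym h1 h2 h3 !eqxx ?orbT//.
Qed.

Lemma nbr_hull K i L j : nbr K i L j -> hull [:: ea K i; eb K i] = hull [:: ea L j; eb L j].
Proof.
move=> /andP[_ /orP[]/andP[/eqP -> /eqP ->]]//.
apply/seteqP; split=> x /seg_hullP[t [t0 t1 ->]]; apply/seg_hullP; exists (1 - t);
  (split; [lra|lra|pt_ring]).
Qed.

(** Both coordinates are affine and vanish on the common edge, hence are proportional. *)
Lemma nbr_lam K i L j x : orient K != 0 -> orient L != 0 -> nbr K i L j ->
  lam K i x = lam K i (vt L j) * lam L j x.
Proof.
move=> hK hL hn; have [a1 a2 a3] := lam_ea i hK; have [b1 b2 b3] := lam_eb i hK.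
rewrite {1}(lam_dec x hL) lam_sum_aff; last exact: lam_sum.
rewrite (bigD1 j)//= big1 ?addr0; first by rewrite mulrC.
move=> m mj; have : lam K i (vt L m) = 0.
  case: (ord3_cases j m) mj => -> ; rewrite ?eqxx// => _.
    by case/andP: hn => _ /orP[]/andP[/eqP + _]; rewrite /ea => ->.
  by case/andP: hn => _ /orP[]/andP[_ /eqP]; rewrite /eb => ->.
by move=> ->; rewrite mulr0.
Qed.

Lemma nbr_lam_neq K i L j : orient K != 0 -> orient L != 0 -> nbr K i L j ->
  lam K i (vt L j) != 0.
Proof.
move=> hK hL hn; have := nbr_lam (vt K i) hK hL hn; rewrite lam_vt// eqxx => h.
by apply/eqP => h0; move/eqP: h; rewrite h0 mul0r oner_eq0.
Qed.

Lemma oedge_nbr K i L j x : orient K != 0 -> orient L != 0 -> nbr K i L j ->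
  oedge K i x -> oedge L j x.
Proof.
move=> hK hL hn /(oedgeP i x hK)[t [t0 t1 xE]]; apply/(oedgeP j x hL).
case/andP: hn => _ /orP[]/andP[/eqP e1 /eqP e2]; first by exists t; rewrite e1 e2.
exists (1 - t); split; [lra|lra|rewrite xE e1 e2].
by pt_ring.
Qed.

Lemma lam_cont K i : continuous (lam K i).
Proof. exact: polyn_continuous (lam_polyn K i). Qed.

Lemma lam_near_gt0 K i x : 0 < lam K i x -> \forall y \near x, 0 < lam K i y.
Proof. by apply: near_gt0; exact: lam_cont. Qed.

Definition oK K : set (pt R) := [set x | forall i, 0 < lam K i x].

Lemma oK_open K : open (oK K).
Proof.
rewrite openE => x hx; apply: near_forall => i; exact: lam_near_gt0.
Qed.

Lemma oK_hull K : orient K != 0 -> oK K `<=` hull (verts K).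
Proof. by move=> hK x hx; rewrite hullE// => i; exact/ltW/hx. Qed.

Lemma hull_oK K x : orient K != 0 -> hull (verts K) x -> ~ oK K x ->
  exists i, hull [:: ea K i; eb K i] x.
Proof.
move=> hK; rewrite hullE// => hx nx.
have [i hi] : exists i, ~ 0 < lam K i x by apply/existsNP.
exists i; apply/edge_hullP => //; split=> //.
by apply/eqP; rewrite eq_le hx andbT leNgt; exact/negP.
Qed.

Lemma edge_sub_hull K i x : orient K != 0 -> hull [:: ea K i; eb K i] x -> hull (verts K) x.
Proof.
move=> hK /(edge_hullP i x hK)[h1 h2 h3]; rewrite hullE// => m.
by case: (ord3_cases i m) => ->; rewrite ?h1.
Qed.
End HalfEdges.

(** * One-dimensional integrals *)

Section OneDim.
Variable R : realType.
Implicit Types (q g F f : R -> R) (a b t r : R).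
Notation leb := (@lebesgue_measure R).

Lemma ftc2 F f a b : a < b -> continuous f ->
  (forall x, a <= x -> x <= b -> is_derive x 1 F (f x)) ->
  (\int[leb]_(x in `[a, b]) (f x)%:E = (F b - F a)%:E)%E.
Proof.
move=> ab cf dF.
have cF x : a <= x -> x <= b -> F z @[z --> x] --> F x.
  move=> ax xb; apply/differentiable_continuous/derivable1_diffP.
  by have [] := dF x ax xb.
rewrite EFinB; apply: continuous_FTC2 => //.
- exact: continuous_subspaceT.
- split.
  + by move=> x; rewrite in_itv /= => /andP[/ltW ax /ltW xb]; have [] := dF x ax xb.
  + by apply: cvg_at_right_filter; apply: cF; rewrite // ltW.
  + by apply: cvg_at_left_filter; apply: cF; rewrite // ltW.
- move=> x; rewrite in_itv /= => /andP[/ltW ax /ltW xb].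
  by have D := dF x ax xb; rewrite derive1E derive_val.
Qed.

Lemma primitive q r : continuous q ->
  exists Q : R -> R, forall t, - r < t -> t < r -> is_derive t 1 Q (q t).
Proof.
move=> cq; pose Q x := parameterized_integral leb (- r) x q.
exists Q => t rt tr.
have qi : leb.-integrable `[- r, r] (EFin \o q).
  apply: (@continuous_compact_integrable R q _ (@segment_compact R (- r) r)).
  exact: continuous_subspaceT.
have [d1 d2] := @continuous_FTC1_closed _ q (- r) t r tr qi rt (cq t).
have h : derivable Q t 1 by exact: d1.
by apply: DeriveDef; [exact: h|rewrite -derive1E].
Qed.

Lemma is_derive_affine F f a b t : is_derive (a + t * b) 1 F (f (a + t * b)) ->
  is_derive t 1 (fun s => F (a + s * b)) (b * f (a + t * b)).
Proof.
move=> dF; have h : is_derive t 1 (fun s : R => a + s * b) b.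
  have := is_deriveD (is_derive_cst a t 1) (is_deriveM (is_derive_id t (1 : R)) (is_derive_cst b t 1)).
  by rewrite scaler0 !add0r /GRing.scale /= mulr1.
by have := @is_derive1_comp _ F (fun s : R => a + s * b) t _ _ dF h; rewrite mulrC.
Qed.

Definition lint01 q : R := \int[leb]_(t in `[0, 1]) q t.

(** The substitution rule multiplied out, so that it holds for either order of [a] and [b] and also
    when they coincide. *)
Lemma lint01_affine q Q a b r : continuous q ->
  (forall t, - r < t -> t < r -> is_derive t 1 Q (q t)) -> `|a| < r -> `|b| < r ->
  (b - a) * lint01 (fun t => q (a + t * (b - a))) = Q b - Q a.
Proof.
move=> cq dQ; rewrite !ltr_norml => /andP[a1 a2] /andP[b1 b2].
have [<-|ab] := eqVneq a b; first by rewrite !subrr mul0r.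
have ba : b - a != 0 by rewrite subr_eq0 eq_sym.
have c : continuous (fun t : R => q (a + t * (b - a))).
  move=> t; apply: continuous_comp; last exact: cq.
  by apply: cvgD; [exact: cvg_cst|apply: cvgM; [exact: cvg_id|exact: cvg_cst]].
have h : (\int[leb]_(t in `[0%R, 1%R]) (q (a + t * (b - a)))%:E =
   ((b - a)^-1 * Q (a + 1 * (b - a)) - (b - a)^-1 * Q (a + 0 * (b - a)))%:E)%E.
  apply: (ftc2 (F := fun t => (b - a)^-1 * Q (a + t * (b - a)))) => //.
  move=> t t0 t1; have dt : is_derive (a + t * (b - a)) 1 Q (q (a + t * (b - a))).
    by apply: dQ; nra.
  have := is_deriveZ (b - a)^-1 (is_derive_affine dt).
  by rewrite /GRing.scale /= mulKf.
rewrite /lint01 /Rintegral h /= mul1r mul0r addr0.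
by rewrite [a + _]addrC subrK mulrBr !mulVKf.
Qed.

Lemma lint01_rev q : continuous q -> lint01 (fun t => q (1 - t)) = lint01 q.
Proof.
move=> cq; have [Q dQ] := primitive 2 cq.
have n0 : `|0 : R| < 2 by rewrite normr0; lra.
have n1 : `|1 : R| < 2 by rewrite normr1; lra.
have := lint01_affine cq dQ n0 n1; have := lint01_affine cq dQ n1 n0.
have -> : (fun t : R => q (1 + t * (0 - 1))) = (fun t => q (1 - t)).
  by apply/funext => t; congr q; ring.
have -> : (fun t : R => q (0 + t * (1 - 0))) = q.
  by apply/funext => t; congr q; ring.
lra.
Qed.

(** A primitive is nondecreasing; without a positive total increment it would be constant, and its
    derivative at [t0] would vanish. *)
Lemma lint01_gt0 q t0 : continuous q -> (forall t, 0 <= t -> t <= 1 -> 0 <= q t) ->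
  0 < t0 -> t0 < 1 -> 0 < q t0 -> 0 < lint01 q.
Proof.
move=> cq q0 h0 h1 qt; have [Q dQ] := primitive 2 cq.
have n0 : `|0 : R| < 2 by rewrite normr0; lra.
have n1 : `|1 : R| < 2 by rewrite normr1; lra.
have := lint01_affine cq dQ n0 n1.
have -> : (fun t : R => q (0 + t * (1 - 0))) = q.
  by apply/funext => t; congr q; ring.
rewrite subr0 mul1r => ->; rewrite subr_gt0.
have mono (x y : R) : 0 <= x -> x <= y -> y <= 1 -> Q x <= Q y.
  move=> x0; rewrite le_eqVlt => /predU1P[->//|xy] y1; rewrite -subr_ge0.
  have E : (\int[leb]_(x in `[x, y]) (q x)%:E = (Q y - Q x)%:E)%E.
    by apply: ftc2 => // z z1 z2; apply: dQ; lra.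
  rewrite -lee_fin -E.
  by apply: integral_ge0 => z; rewrite /= in_itv /= => /andP[z1 z2]; rewrite lee_fin q0//; lra.
rewrite ltNge; apply/negP => Q10.
have Qc t : 0 <= t -> t <= 1 -> Q t = Q 0.
  move=> t0' t1'; apply/eqP; rewrite eq_le (mono 0 t) ?lexx// andbT.
  by rewrite (le_trans (mono t 1 _ _ _)).
have D := dQ t0 ltac:(lra) ltac:(lra).
have E : \forall t \near t0, cst (Q 0) t = Q t.
  near=> t; rewrite /cst Qc//; apply/ltW; near: t; [exact: lt_nbhsr|exact: lt_nbhsl].
have := near_eq_derive (1 : R) E.
rewrite (@derive_val _ _ _ _ _ _ _ D) (derive_cst (Q 0) t0 1) => E'.
by move: qt; rewrite -E' ltxx.
Unshelve. all: by end_near.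
Qed.

Lemma half_line g g' (r X : R) : continuous g' -> (forall x : R, is_derive x 1 g (g' x)) ->
  (forall x : R, r < `|x| -> g x = 0) ->
  (\int[leb]_x ((x < X)%R%:R * g' x)%:E = (g X)%:E)%E.
Proof.
(* A point to the left of [X] and of the support of [g]. *)
move=> cg' dg g0; pose a := - (`|r| + `|X| + 1).
have aX : a < X by rewrite /a; have := lerNnormlW (lexx `|X|); have := normr_ge0 r; lra.
have out x : x <= a -> r < `|x|.
  move=> xa; have := ler_norm (- x); rewrite normrN; have := ler_norm r.
  by have := normr_ge0 X; rewrite /a in xa; lra.
have g'0 x : x < a -> g' x = 0.
  move=> xa; have E : \forall t \near x, cst 0 t = g t.
    by near=> t; rewrite /cst g0//; apply: out; apply/ltW; near: t; exact: lt_nbhsl.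
  have := near_eq_derive (1 : R) E.
  by have D := dg x; rewrite (@derive_val _ _ _ _ _ _ _ D) (derive_cst 0 x 1).
transitivity (\int[leb]_(x in `[a, X[) (g' x)%:E)%E.
  rewrite [RHS]integral_mkcond; apply: eq_integral => x _; rewrite patchE.
  have [xX|xX] := ltP x X; last first.
    by rewrite mul0r memNset// => -[/=]; rewrite in_itv /= => /andP[_]; rewrite ltNge xX.
  have [xa|xa] := ltP x a; first by rewrite g'0 ?mulr0//; case: ifP.
  by rewrite mem_set ?mul1r//= in_itv /= xa.
have mg : measurable_fun `]a, X[ (EFin \o g').
  by apply/measurable_EFinP; apply: measurable_funTS; exact: continuous_measurable_fun.
rewrite (integral_itv_bndoo true true mg) -(integral_itv_bndoo true false mg).
rewrite (ftc2 (F := g))//; congr EFin.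
by rewrite (g0 a) ?subr0//; exact: out.
Unshelve. all: by end_near.
Qed.

Lemma step_integral_lt f F a b : continuous f ->
  (forall x, a <= x -> x <= b -> is_derive x 1 F (f x)) -> a < b ->
  (\int[leb]_y (((a < y)%R%:R - (b < y)%R%:R) * f y)%:E = (F b - F a)%:E)%E.
Proof.
move=> cf dF ab; rewrite -(ftc2 ab cf dF).
have mf : measurable_fun `]a, b[ (EFin \o f).
  by apply/measurable_EFinP; apply: measurable_funTS; exact: continuous_measurable_fun.
rewrite (integral_itv_bndoo true false mf) -(integral_itv_bndoo false false mf).
rewrite [RHS]integral_mkcond; apply: eq_integral => y _; rewrite patchE.
have [ay|ya] := ltP a y; last first.
  rewrite memNset; last by rewrite /= in_itv /= ltNge ya.
  by rewrite ltNge (le_trans ya (ltW ab)) subrr mul0r.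
have [yb|yb] := ltP b y.
  by rewrite memNset ?subrr ?mul0r//= in_itv /= ay leNgt yb.
by rewrite mem_set ?subr0 ?mul1r//= in_itv /= ay.
Qed.

(** The difference of the two step functions is the signed indicator of the interval between [a] and
    [b], so no order of the endpoints has to be assumed. *)
Lemma step_integral f F a b : continuous f ->
  (forall x : R, `|x| <= `|a| + `|b| -> is_derive x 1 F (f x)) ->
  (\int[leb]_y (((a < y)%R%:R - (b < y)%R%:R) * f y)%:E = (F b - F a)%:E)%E.
Proof.
move=> cf dF.
have bd (x c d : R) : c <= x -> x <= d -> `|x| <= `|c| + `|d|.
  move=> h1 h2; have := ler_norm d; have := ler_norm (- c); rewrite normrN => *.
  by have := normr_ge0 c; have := normr_ge0 d; rewrite ler_norml; lra.
have [ab|ba|->] := ltgtP a b.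
- by apply: step_integral_lt => // x h1 h2; apply: dF; exact: bd.
- have cNf : continuous (fun x => - f x) by move=> x; apply: cvgN; exact: cf.
  have := @step_integral_lt (fun x => - f x) (fun x => - F x) b a cNf.
  have dN x : b <= x -> x <= a -> is_derive x 1 (fun x => - F x) (- f x).
    by move=> h1 h2; apply: is_deriveN; apply: dF; rewrite addrC; exact: bd.
  move=> /(_ dN ba); rewrite opprK addrC => <-.
  by apply: eq_integral => y _; congr EFin; ring.
- by rewrite subrr; apply: integral0_eq => y _; rewrite subrr mul0r.
Qed.
End OneDim.

(** * Green's formula on a triangle *)

Section Green.
Variable R : realType.
Implicit Types (A B x y v : pt R) (G : pt R -> R) (K : tri R) (i : 'I_3).
Notation leb := (@lebesgue_measure R).
Notation mu := (@leb2 R).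
Notation mpt := (measurableTypeR R * measurableTypeR R)%type.

(** The edge integral in the parameter on [0, 1], without the factor of the edge length: the length
    is carried by the unnormalised normal that multiplies it. *)
Definition lint A B G : R := lint01 (fun t => G (A + t *: (B - A))).

Lemma bounded_integrable (H : pt R -> R) (r C : R) : measurable_fun setT (H : mpt -> R) ->
  (forall x, ~ box r x -> H x = 0) -> (forall x, box r x -> `|H x| <= C) ->
  mu.-integrable setT (EFin \o H).
Proof.
move=> mH H0 HC; have mb := @box_measurable R r.
have HE : H = H \_ (box r).
  by apply/funext => x; rewrite patchE; case: ifPn => // /negP h; apply: H0 => /mem_set.
have h2 : H \in Lfun mu 2%:E by rewrite HE; exact: (Lfun2_bounded mb (@subset_refl _ _) mH HC).
have h1 : (\1_(box r) : pt R -> R) \in Lfun mu 2%:E by exact: (indic_Lfun2 mb (@subset_refl _ _)).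
have := Lfun2_integrable h2 h1; apply: eq_integrable => // x _ /=.
rewrite indicE; have [xb|xb] := boolP (x \in box r); first by rewrite mulr1.
by rewrite mulr0 H0// => /mem_set; rewrite (negbTE xb).
Qed.

Lemma slice_derive1 G x d : is_derive x (1, 0) G d ->
  is_derive (x.1 : R) 1 (fun s : R => G (s, x.2)) d.
Proof.
move=> [dG <-].
have E : (fun h : R => h^-1 *: (((fun s : R => G (s, x.2)) \o shift x.1) (h *: (1 : R)) - G (x.1, x.2)))
  = (fun h : R => h^-1 *: ((G \o shift x) (h *: ((1, 0) : pt R)) - G x)).
  apply/funext => h; rewrite /= -surjective_pairing; congr (_ *: (G _ - _)).
  by apply: pairE; rewrite /= /GRing.scale /= ?mulr0 ?add0r.
by apply: DeriveDef; rewrite /derivable /derive E.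
Qed.

(** The sign with which the horizontal line at height [y] meets the edge from [A] to [B]. Together
    with [left_of], which tests for a smaller first coordinate than the edge line at that height, it
    describes the half-strip to the left of the edge. *)
Definition kap A B (y : R) : R := (A.2 < y)%R%:R - (B.2 < y)%R%:R.
Definition left_of A B x : bool := 0 < (B.2 - A.2) * cross (B - A) (x - A).

Lemma kap_le2 A B (y : R) : `|kap A B y| <= 2.
Proof.
by rewrite /kap; do 2 case: (_ < _)%R; rewrite ?subrr ?subr0 ?sub0r ?normrN ?normr0 ?normr1//; lra.
Qed.

Lemma bool_measurable (P : pt R -> bool) : open [set x | P x] ->
  measurable_fun setT ((fun x => (P x)%:R) : mpt -> R).
Proof.
move=> oP; have -> : (fun x => (P x)%:R) = \1_[set x | P x] :> (mpt -> R).
  by apply/funext => x; rewrite indicE; congr (nat_of_bool _)%:R; apply/idP/idP; rewrite inE.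
by apply: measurable_indic; exact: open_measurable2.
Qed.

Lemma left_of_measurable A B : measurable_fun setT ((fun x => (left_of A B x)%:R) : mpt -> R).
Proof.
apply: bool_measurable.
rewrite (_ : [set x | _] = (fun x => (B.2 - A.2) * cross (B - A) (x - A)) @^-1` [set y | 0 < y])//.
apply: open_comp; last exact: open_gt.
move=> x _; apply: (@polyn_continuous _ 1); apply: polynZ.
apply: (@polyn1I _ ((B - A).2 * A.1 - (B - A).1 * A.2) (- (B - A).2) (B - A).1) => y.
by rewrite /cross /=; ring.
Qed.

Lemma kap_measurable A B : measurable_fun setT ((fun x => kap A B x.2) : mpt -> R).
Proof.
have h (a : R) : measurable_fun setT ((fun x => (a < x.2)%R%:R) : mpt -> R).
  apply: (bool_measurable (P := fun x => a < x.2)).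
  apply: (@open_comp _ _ (fun x : pt R => x.2) [set y | a < y]); last exact: open_gt.
  by move=> x _; exact: cvg_snd.
exact: measurable_funB.
Qed.

Section GreenX.
Variables (G Gx : pt R -> R) (r : R).
Hypotheses (cG : continuous G) (cGx : continuous Gx).
Hypothesis dG : forall x, is_derive x (1, 0) G (Gx x).
Hypothesis supp : forall x, ~ box r x -> G x = 0.
Hypothesis suppx : forall x, ~ box r x -> Gx x = 0.

Lemma Gx_bounded : exists C, forall x, `|Gx x| <= C.
Proof.
have : compact (Gx @` box r).
  by apply: continuous_compact (@box_compact _ r); exact: continuous_subspaceT.
move=> /compact_bounded[M [_ hM]]; exists (`|M| + 1) => x.
have [xr|xr] := pselect (box r x); last first.
  by rewrite suppx// normr0 addr_ge0.
have := hM (`|M| + 1); rewrite (le_lt_trans (ler_norm M)) ?ltrDl//.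
by move=> /(_ isT) /(_ (Gx x)); apply; exists x.
Qed.

Lemma edge_integrable A B :
  mu.-integrable setT (EFin \o (fun x => kap A B x.2 * ((left_of A B x)%:R * Gx x))).
Proof.
have [C hC] := Gx_bounded.
apply: (@bounded_integrable _ r (2 * (1 * C))).
- apply: measurable_funM; first exact: kap_measurable.
  by apply: measurable_funM; [exact: left_of_measurable|exact: continuous_measurable2].
- by move=> x nx; rewrite suppx// !mulr0.
- move=> x _; rewrite !normrM; apply: ler_pM => //; first exact: kap_le2.
  by apply: ler_pM => //; case: left_of; rewrite ?normr0 ?normr1.
Qed.

(** On a horizontal line, integrating [Gx] up to the edge yields [G] on the edge, since [G] vanishes
    far to the left. The remaining integral over the height becomes an edge integral by an affine
    substitution. *)
Lemma edge_integral A B :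
  \int[mu]_x (kap A B x.2 * ((left_of A B x)%:R * Gx x)) = (B.2 - A.2) * lint A B G.
Proof.
pose f (x : mpt) := (kap A B x.2 * ((left_of A B x)%:R * Gx x))%:E.
rewrite -[RHS]/(fine ((B.2 - A.2) * lint A B G)%:E); congr fine.
have fi : mu.-integrable setT f by exact: edge_integrable.
rewrite -[LHS]/(\int[mu]_x f x)%E -integral21_prod_meas1//.
rewrite /fubini_G /f.
have [AB|AB] := eqVneq A.2 B.2.
  rewrite AB subrr mul0r; apply: integral0_eq => y _; apply: integral0_eq => x _.
  by rewrite /kap AB subrr mul0r.
have BA : B.2 - A.2 != 0 by rewrite subr_eq0 eq_sym.
pose q t := G (A + t *: (B - A)).
have cq : continuous q.
  move=> t; apply: continuous_comp; last exact: cG.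
  by apply: cvgD; [exact: cvg_cst|apply: cvgZr_tmp; exact: cvg_id].
have inner (y : R) : (\int[leb]_x (kap A B y * ((left_of A B (x, y))%:R * Gx (x, y)))%:E =
    (kap A B y * q ((y - A.2) / (B.2 - A.2)))%:E)%E.
  pose X := A.1 + (y - A.2) / (B.2 - A.2) * (B.1 - A.1).
  have lE (x : R) : left_of A B (x, y) = (x < X).
    rewrite /left_of /cross /X /=.
    have -> : (B.2 - A.2) * ((B.1 - A.1) * (y - A.2) - (B.2 - A.2) * (x - A.1)) =
      (B.2 - A.2) ^+ 2 * (A.1 + (y - A.2) / (B.2 - A.2) * (B.1 - A.1) - x) by field.
    by rewrite pmulr_rgt0 ?subr_gt0// exprn_even_gt0.
  transitivity (\int[leb]_x ((x < X)%R%:R * (kap A B y * Gx (x, y)))%:E)%E.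
    by apply: eq_integral => x _; rewrite lE mulrCA.
  have ck : continuous (fun x : R => kap A B y * Gx (x, y)).
    move=> x; apply: cvgM; first exact: cvg_cst.
    apply: continuous_comp; last exact: cGx.
    have -> : (fun s : R => (s, y)) = (fun s : R => (0, y) + s *: ((1, 0) : pt R)).
      by apply/funext => s; pt_ring.
    exact: line_cont.
  have dk (x : R) : is_derive x 1 (fun x : R => kap A B y * G (x, y)) (kap A B y * Gx (x, y)).
    exact: (is_deriveZ (kap A B y) (slice_derive1 (x := (x, y)) (dG _))).
  have k0 (x : R) : r < `|x| -> kap A B y * G (x, y) = 0.
    move=> xr; rewrite supp ?mulr0// => -[/=]; rewrite in_itv /= -ler_norml => + _.
    by rewrite leNgt xr.
  transitivity ((kap A B y * G (X, y))%:E); first exact: (half_line X ck dk k0).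
  congr (_ * _)%:E; rewrite /q; congr G.
  by apply: pairE; rewrite /= /GRing.scale /= ?divfK//; ring.
under eq_integral => y _ do rewrite inner.
pose D := B.2 - A.2; rewrite -/D in BA *.
pose a := - A.2 / D; pose b := D^-1.
have E (y : R) : (y - A.2) / D = a + y * b by rewrite /a /b; field.
(* The radius covers the parameters in [0, 1] and every [a + y * b] with [y] in the range that
   [step_integral] asks for. *)
have [Q dQ] := primitive (`|a| + (`|A.2| + `|B.2|) * `|b| + 2) cq.
have n0 : `|0 : R| < `|a| + (`|A.2| + `|B.2|) * `|b| + 2 by rewrite normr0 ltr_wpDl// addr_ge0// mulr_ge0// addr_ge0.
have n1 : `|1 : R| < `|a| + (`|A.2| + `|B.2|) * `|b| + 2.
  by rewrite normr1 ltr_wpDl ?ltr1n// addr_ge0// mulr_ge0// addr_ge0.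
have := lint01_affine cq dQ n0 n1.
have -> : (fun t : R => q (0 + t * (1 - 0))) = q.
  by apply/funext => t; congr q; ring.
rewrite subr0 mul1r -/(lint A B G) => ->.
transitivity (\int[leb]_y (((A.2 < y)%R%:R - (B.2 < y)%R%:R) * q (a + y * b))%:E)%E.
  by apply: eq_integral => y _; rewrite E.
pose F (y : R) : R := D * Q (a + y * b).
transitivity (F B.2 - F A.2)%:E; last first.
  by congr EFin; rewrite /F -!E subrr mul0r divff//; ring.
apply: step_integral.
  move=> y; apply: continuous_comp; last exact: cq.
  by apply: cvgD; [exact: cvg_cst|apply: cvgM; [exact: cvg_id|exact: cvg_cst]].
move=> y hy; have dy : is_derive (a + y * b) 1 Q (q (a + y * b)).
  have hab : `|a + y * b| <= `|a| + (`|A.2| + `|B.2|) * `|b|.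
    by rewrite (le_trans (ler_normD _ _))// lerD2l normrM ler_wpM2r.
  have h1 := ler_norm (a + y * b); have h2 := ler_norm (- (a + y * b)).
  by rewrite normrN in h2; apply: dQ; lra.
have := is_deriveZ D (is_derive_affine dy).
by rewrite /GRing.scale /= /b mulVKf.
Qed.
End GreenX.

Lemma step_term (a b s : R) : a != 0 -> b != 0 ->
  ((a < 0)%R%:R - (b < 0)%R%:R) * (0 < (b - a) * s)%R%:R =
  (if a < 0 then if b < 0 then 0 else (0 < s)%R%:R
   else if b < 0 then - (s < 0)%R%:R else 0) :> R.
Proof.
move=> a0 b0; case: (ltP a 0) => ha; case: (ltP b 0) => hb; rewrite ?subrr ?mul0r//.
- by rewrite subr0 mul1r pmulr_rgt0//; lra.
- by rewrite sub0r mulN1r nmulr_rgt0//; lra.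
Qed.

(** The indicator of a triangle is the signed sum of the half-strips to the left of its edges. The
    [u] are vertex heights relative to the point, the [l] its barycentric coordinates. Only signs
    matter; [f1], [f2] and [f3] exclude the sign patterns that the two linear relations forbid, and
    the remaining ones are checked. *)
Lemma triangle_step (u0 u1 u2 l0 l1 l2 o : R) : u0 != 0 -> u1 != 0 -> u2 != 0 ->
  l0 != 0 -> l1 != 0 -> l2 != 0 -> o != 0 -> l0 + l1 + l2 = 1 ->
  l0 * u0 + l1 * u1 + l2 * u2 = 0 ->
  Num.sg o * [&& 0 < l0, 0 < l1 & 0 < l2]%:R =
  ((u1 < 0)%R%:R - (u2 < 0)%R%:R) * (0 < (u2 - u1) * (o * l0))%R%:R +
  ((u2 < 0)%R%:R - (u0 < 0)%R%:R) * (0 < (u0 - u2) * (o * l1))%R%:R +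
  ((u0 < 0)%R%:R - (u1 < 0)%R%:R) * (0 < (u1 - u0) * (o * l2))%R%:R.
Proof.
move=> hu0 hu1 hu2 hl0 hl1 hl2 ho s1 s2; rewrite !step_term//.
have ltN (a : R) : a != 0 -> (a < 0) = ~~ (0 < a).
  by move=> a0; rewrite -leNgt le_eqVlt (negbTE a0).
have gtM (a b : R) : a != 0 -> b != 0 -> (0 < a * b) = (0 < a) (+) (b < 0).
  move=> a0 b0; case: (ltgtP a 0) a0 => // ha _; first by rewrite nmulr_rgt0//.
  by rewrite pmulr_rgt0//= ltN// negbK.
have f1 : [|| 0 < l0, 0 < l1 | 0 < l2].
  by apply/negPn/negP; rewrite !negb_or -!leNgt => /and3P[*]; lra.
have f2 : ~~ [&& 0 < l0 * u0, 0 < l1 * u1 & 0 < l2 * u2].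
  by apply/negP => /and3P[]; move: s2; move: (l0 * u0) (l1 * u1) (l2 * u2) => *; lra.
have f3 : [|| 0 < l0 * u0, 0 < l1 * u1 | 0 < l2 * u2].
  apply/negPn/negP; rewrite !negb_or -!ltN ?mulf_neq0// => /and3P[].
  by move: s2; move: (l0 * u0) (l1 * u1) (l2 * u2) => *; lra.
have ol (l : R) : l != 0 -> (o * l < 0) = (o < 0) (+) (l < 0).
  move=> hl; rewrite ltN ?mulf_neq0// gtM// (ltN o)//.
  by case: (0 < o); case: (l < 0).
rewrite !ol// !gtM// in f2 f3 *.
have -> : Num.sg o = if 0 < o then 1 else -1 by case: sgrP ho => // ->; rewrite eqxx.
rewrite !(ltN o)// !(ltN l0)// !(ltN l1)// !(ltN l2)//.
move: f1 f2 f3 {s1 s2 hl0 hl1 hl2 hu0 hu1 hu2 ltN gtM ol ho}.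
move: (0 < o) (0 < l0) (0 < l1) (0 < l2) (u0 < 0) (u1 < 0) (u2 < 0).
do 7 case; rewrite //= => _ _ _;
  rewrite ?(mulr1, mulr0, addr0, add0r, oppr0, subr0, sub0r, addrN, addNr, mulN1r)//.
Qed.

Lemma Rint_ae (f g : pt R -> R) : measurable_fun setT (f : mpt -> R) ->
  measurable_fun setT (g : mpt -> R) -> ae_on setT (fun x => f x = g x) ->
  \int[mu]_x f x = \int[mu]_x g x.
Proof.
move=> mf mg h; congr fine; apply: ae_eq_integral => //; try exact/measurable_EFinP.
move/ae_onE: h; apply: negligibleS => x /= hx; split=> // e; apply: hx => _.
by rewrite e.
Qed.

Lemma Rint_sum (I : Type) (s : seq I) (F : I -> pt R -> R) :
  (forall j : I, mu.-integrable setT (EFin \o F j)) ->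
  mu.-integrable setT (EFin \o (fun x => \sum_(j <- s) F j x)) /\
  \int[mu]_x (\sum_(j <- s) F j x) = \sum_(j <- s) \int[mu]_x F j x.
Proof.
move=> Fi; elim: s => [|i s [IH1 IH2]].
  rewrite big_nil; split.
    by apply: eq_integrable (@integrable0 _ _ _ mu setT) => // x _; rewrite /= big_nil.
  rewrite (_ : (fun x => \sum_(j <- [::]) F j x) = fun=> 0).
    by rewrite /Rintegral integral0.
  by apply/funext => x; rewrite big_nil.
have E : (fun x => \sum_(j <- i :: s) F j x) = (fun x => F i x + \sum_(j <- s) F j x).
  by apply/funext => x; rewrite big_cons.
rewrite E big_cons -IH2; split; last exact: RintegralD.
by apply: eq_integrable (integrableD measurableT (Fi i) IH1).
Qed.

Lemma oK_measurable K : measurable (oK K : set mpt).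
Proof. by apply: open_measurable2; exact: oK_open. Qed.

Lemma oK_integrable K (H : pt R -> R) (r C : R) : measurable_fun setT (H : mpt -> R) ->
  (forall x, ~ box r x -> H x = 0) -> (forall x, box r x -> `|H x| <= C) ->
  mu.-integrable setT (EFin \o (fun x => \1_(oK K) x * H x)).
Proof.
move=> mH H0 HC; apply: (@bounded_integrable _ r (1 * C)).
- by apply: measurable_funM => //; exact: measurable_indic (oK_measurable K).
- by move=> x nx; rewrite H0// mulr0.
- move=> x xr; rewrite normrM ler_pM ?HC//.
  by rewrite indicE; case: (_ \in _); rewrite ?normr0 ?normr1.
Qed.

Lemma lam_line_negligible K i : orient K != 0 -> mu.-negligible [set x | lam K i x = 0].
Proof.
move=> hK; have [a [b [c hl]]] := polyn1E (lam_polyn K i).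
have : mu.-negligible [set x : pt R | b * x.1 + c * x.2 = - a].
  apply: line_negligible; apply/norP => -[/negPn/eqP b0 /negPn/eqP c0].
  have := lam_vt1 i hK; have [+ _ _] := lam_ea i hK; rewrite !hl b0 c0 !mul0r !addr0 => ->.
  by move=> /eqP; rewrite eq_sym oner_eq0.
apply: negligibleS => x /= /eqP; rewrite hl -addrA addrC addr_eq0 => /eqP h; exact: h.
Qed.

Lemma tri_step K x : orient K != 0 -> (forall i, (vt K i).2 != x.2) ->
  (forall i, lam K i x != 0) ->
  Num.sg (orient K) * \1_(oK K) x =
  \sum_i kap (ea K i) (eb K i) x.2 * (left_of (ea K i) (eb K i) x)%:R.
Proof.
move=> hK hv hl; have hs := lam_sum x hK; rewrite sum3 in hs.
have hd := lam_dec x hK.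
have /(congr1 (fun x : pt R => x.2)) := hd; rewrite sum3 /= => hx.
have n0 i : (vt K i).2 - x.2 != 0 by rewrite subr_eq0.
have e0 : lam K i0 x * ((vt K i0).2 - x.2) + lam K i1 x * ((vt K i1).2 - x.2) +
    lam K i2 x * ((vt K i2).2 - x.2) = 0.
  transitivity ((lam K i0 x * (vt K i0).2 + lam K i1 x * (vt K i1).2 + lam K i2 x * (vt K i2).2) -
    (lam K i0 x + lam K i1 x + lam K i2 x) * x.2); first by ring.
  by rewrite hs mul1r; apply/eqP; rewrite subr_eq0 eq_sym; apply/eqP.
have -> : \1_(oK K) x = [&& 0 < lam K i0 x, 0 < lam K i1 x & 0 < lam K i2 x]%:R :> R.
  rewrite indicE; congr (nat_of_bool _)%:R; apply/idP/and3P => [/set_mem h|[h0 h1 h2]].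
    by split; exact: h.
  by apply/mem_set; apply: ord3P.
rewrite (triangle_step (n0 i0) (n0 i1) (n0 i2) (hl i0) (hl i1) (hl i2) hK hs e0) sum3.
have kE i : kap (ea K i) (eb K i) x.2 =
   ((ea K i).2 - x.2 < 0)%R%:R - ((eb K i).2 - x.2 < 0)%R%:R by rewrite /kap !subr_lt0.
have lE i : left_of (ea K i) (eb K i) x =
   (0 < ((eb K i).2 - x.2 - ((ea K i).2 - x.2)) * (orient K * lam K i x)).
  by rewrite /left_of cross_edge//; congr (0 < _ * _); ring.
by rewrite !kE !lE.
Qed.

(** Replacing the indicator of the triangle by the half-strips of its edges avoids integrals with
    variable limits. The heights of the vertices and the lines of the edges form a null set where
    the identity may fail. *)
Lemma green_x K G Gx r : orient K != 0 -> continuous G -> continuous Gx ->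
  (forall x, is_derive x (1, 0) G (Gx x)) -> (forall x, ~ box r x -> G x = 0) ->
  (forall x, ~ box r x -> Gx x = 0) ->
  Num.sg (orient K) * \int[mu]_x (\1_(oK K) x * Gx x) =
  \sum_i ((eb K i).2 - (ea K i).2) * lint (ea K i) (eb K i) G.
Proof.
move=> hK cG cGx dG s1 s2.
have [C hC] := Gx_bounded cGx s2.
have mI : measurable_fun setT ((\1_(oK K)) : mpt -> R).
  exact: measurable_indic (oK_measurable K).
have mGx : measurable_fun setT (Gx : mpt -> R) by exact: continuous_measurable2.
have ti := oK_integrable K mGx s2 (fun x _ => hC x).
have ei i := edge_integrable cGx s2 (ea K i) (eb K i).
rewrite -RintegralZl//.
transitivity (\int[mu]_x (\sum_i kap (ea K i) (eb K i) x.2 *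
    ((left_of (ea K i) (eb K i) x)%:R * Gx x))).
  have em i : measurable_fun setT ((fun x => kap (ea K i) (eb K i) x.2 *
    ((left_of (ea K i) (eb K i) x)%:R * Gx x)) : mpt -> R).
    by have := measurable_int mu (ei i); move/measurable_EFinP.
  apply: Rint_ae.
  - by apply: measurable_funM => //; apply: measurable_funM.
  - exact: measurable_sum.
  apply/ae_onE.
  have hy i : mu.-negligible [set x : pt R | (vt K i).2 = x.2].
    have := @line_negligible R 0 1 (vt K i).2; rewrite oner_neq0 orbT => /(_ isT).
    by apply: negligibleS => x /= ->; rewrite mul0r add0r mul1r.
  have hN : mu.-negligible (\bigcup_(i in [set: 'I_3]) ([set x : pt R | (vt K i).2 = x.2] `|`
      [set x | lam K i x = 0])).
    apply: negligible_bigcup_countable => i; apply: negligibleU => //.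
    exact: lam_line_negligible.
  apply: negligibleS hN => x [_ nx]; apply: contrapT => no; apply: nx.
  have hv i : (vt K i).2 != x.2 by apply/eqP => E; apply: no; exists i => //; left.
  have hl i : lam K i x != 0 by apply/eqP => E; apply: no; exists i => //; right.
  rewrite mulrA tri_step// mulr_suml; apply: eq_bigr => i _; ring.
rewrite (Rint_sum _ ei).2; apply: eq_bigr => i _.
exact: (edge_integral cG cGx dG s1 s2).
Qed.

Lemma Rint_swap (f : pt R -> R) : mu.-integrable setT (EFin \o f) ->
  mu.-integrable setT (EFin \o (fun x => f (x.2, x.1))) ->
  \int[mu]_x f (x.2, x.1) = \int[mu]_x f x.
Proof.
move=> fi fi'; congr fine.
rewrite -(integral21_prod_meas1 fi) -(integral12_prod_meas1 fi').
by [].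
Qed.

Definition swap (x : pt R) : pt R := (x.2, x.1).
Definition swapK K : tri R := (swap K.1.1, swap K.1.2, swap K.2).

Lemma swap_vt K i : vt (swapK K) i = swap (vt K i).
Proof. by move: i; apply: ord3P. Qed.

Lemma swap_orient K : orient (swapK K) = - orient K.
Proof. by rewrite /orient /cross /=; ring. Qed.

Lemma swap_lam K i x : lam (swapK K) i (swap x) = lam K i x.
Proof.
rewrite /lam !swap_vt swap_orient invrN mulrN -mulNr; congr (_ / _).
by rewrite /cross /=; ring.
Qed.

(** Exchanging the coordinates reduces this to the first direction. The exchange reverses the
    orientation of the triangle, which accounts for the minus sign. *)
Lemma green_y K G Gy r : orient K != 0 -> continuous G -> continuous Gy ->
  (forall x, is_derive x (0, 1) G (Gy x)) -> (forall x, ~ box r x -> G x = 0) ->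
  (forall x, ~ box r x -> Gy x = 0) ->
  Num.sg (orient K) * \int[mu]_x (\1_(oK K) x * Gy x) =
  \sum_i - ((eb K i).1 - (ea K i).1) * lint (ea K i) (eb K i) G.
Proof.
move=> hK cG cGy dG s1 s2.
have csw : continuous swap.
  move=> x; apply/cvgrPdist_lt => e e0; near=> y.
  have : `|x - y| < e by near: y; exact: cvgr_dist_lt.
  by rewrite !pnormE !gt_max /= andbC.
have hK' : orient (swapK K) != 0 by rewrite swap_orient oppr_eq0.
have bx x : box r (swap x) <-> box r x by split=> -[? ?]; split.
have c1 : continuous (G \o swap) by move=> x; apply: continuous_comp; [exact: csw|exact: cG].
have c2 : continuous (Gy \o swap) by move=> x; apply: continuous_comp; [exact: csw|exact: cGy].
have d1 x : is_derive x (1, 0) (G \o swap) ((Gy \o swap) x).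
  rewrite -[(Gy \o swap) x]/(Gy (swap x)); have [dg <-] := dG (swap x).
  have E : (fun h : R => h^-1 *: (((G \o swap) \o shift x) (h *: ((1, 0) : pt R)) - (G \o swap) x)) =
    (fun h : R => h^-1 *: ((G \o shift (swap x)) (h *: ((0, 1) : pt R)) - G (swap x))) by [].
  by apply: DeriveDef; rewrite /derivable /derive E.
have o1 x : ~ box r x -> (G \o swap) x = 0 by move=> nx; apply: s1 => /bx.
have o2 x : ~ box r x -> (Gy \o swap) x = 0 by move=> nx; apply: s2 => /bx.
have := green_x hK' c1 c2 d1 o1 o2.
have oE x : \1_(oK (swapK K)) x = \1_(oK K) (swap x) :> R.
  rewrite !indicE; congr (nat_of_bool _)%:R; apply/idP/idP => /set_mem h; apply/mem_set => i.
    by rewrite -swap_lam; exact: h.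
  by have := h i; rewrite -swap_lam.
have [C hC] := Gx_bounded c2 o2.
have hC' x : `|Gy x| <= C.
  by have := hC (swap x); rewrite /= /swap /= -surjective_pairing.
have i1 := oK_integrable K (continuous_measurable2 cGy) s2 (fun x _ => hC' x).
have i2 : mu.-integrable setT (EFin \o (fun x => \1_(oK K) (swap x) * Gy (swap x))).
  by apply: eq_integrable (oK_integrable (swapK K) (continuous_measurable2 c2) o2 (fun x _ => hC x)) => // x _; rewrite /= oE.
have -> : \int[mu]_x (\1_(oK (swapK K)) x * (Gy \o swap) x) = \int[mu]_x (\1_(oK K) x * Gy x).
  rewrite -(Rint_swap i1 i2); apply: eq_Rintegral => x _; by rewrite oE.
rewrite swap_orient sgrN mulNr => /(canRL opprK) ->; rewrite -sumrN; apply: eq_bigr => i _.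
rewrite mulNr /ea /eb !swap_vt /=; congr (- (_ * _)); rewrite /lint /lint01; apply: eq_Rintegral => t _.
Unshelve. all: by end_near.
Qed.
End Green.

(** * Polynomial Poincare lemma and local Airy potentials *)

Section PolyPotential.
Variable R : realType.
Implicit Types (p q f g : pt R -> R) (x y v w A B : pt R) (k : nat).

Lemma is_derive_bigsum (I : Type) (s : seq I) (P : pred I) (F : I -> pt R -> R) (dF : I -> R) x v :
  (forall i, is_derive x v (F i) (dF i)) ->
  is_derive x v (fun y => \sum_(i <- s | P i) F i y) (\sum_(i <- s | P i) dF i).
Proof.
move=> h; elim: s => [|i s IH].
  rewrite big_nil (_ : (fun y => _) = cst 0); first exact: is_derive_cst.
  by apply/funext => y; rewrite big_nil.
rewrite big_cons (_ : (fun y => _) = if P i then F i + (fun y => \sum_(j <- s | P j) F j y)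
  else fun y => \sum_(j <- s | P j) F j y).
  by case: ifP => // _; apply: is_deriveD.
by apply/funext => y; rewrite big_cons; case: ifP.
Qed.

Lemma polyn_mono i j : polyn (i + j) (fun x : pt R => x.1 ^+ i * x.2 ^+ j).
Proof.
elim: i => [|i IH]; last first.
  by rewrite addSn; under eq_fun do rewrite exprS -mulrA; exact: polyn_mulX.
elim: j => [|j IH]; first by under eq_fun do rewrite !expr0 mulr1; exact: polyn_cst.
by under eq_fun do rewrite exprS mulrCA; exact: polyn_mulY.
Qed.

Lemma is_derive_mono i j x v : is_derive x v (fun y : pt R => y.1 ^+ i * y.2 ^+ j)
  (i%:R * x.1 ^+ i.-1 * v.1 * x.2 ^+ j + j%:R * x.2 ^+ j.-1 * v.2 * x.1 ^+ i).
Proof.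
have X (f : pt R -> R) (d : R) n : is_derive x v f d ->
    is_derive x v (f ^+ n) (n%:R * f x ^+ n.-1 * d).
  move=> hf; case: n => [|n].
    rewrite mul0r mul0r expr0 (_ : (1 : pt R -> R) = cst 1) //; exact: is_derive_cst.
  by apply: is_derive_eq; rewrite /GRing.scale /= mulr_natl.
have h1 := X _ _ i (is_derive_fst x v); have h2 := X _ _ j (is_derive_snd x v).
rewrite (_ : (fun y => _) = ((fun y : pt R => y.1) ^+ i) * ((fun y : pt R => y.2) ^+ j)).
  apply: is_derive_eq; rewrite /GRing.scale /= !exprfctE; ring.
by apply/funext => y; rewrite fctE !exprfctE.
Qed.

(* The notation ['D_v p] is an eta-expanded limit; [dir] hides it from
   unification. *)
Definition dir_def v p x : R := 'D_v p x.
Definition dir := locked dir_def.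

Lemma dirF : dir = dir_def. Proof. by rewrite /dir -lock. Qed.

Lemma polyn_dir k p v : polyn k p -> polyn k.-1 (dir v p).
Proof. by rewrite dirF; exact: polyn_D. Qed.

Lemma dirD v k p q : polyn k p -> polyn k q ->
  dir v (fun x => p x + q x) = fun x => dir v p x + dir v q x.
Proof.
move=> hp hq; rewrite dirF; apply/funext => x.
by apply: deriveD; [exact: polyn_derivable hp|exact: polyn_derivable hq].
Qed.

Lemma dirZ v k (a : R) p : polyn k p -> dir v (fun x => a * p x) = fun x => a * dir v p x.
Proof. by move=> hp; rewrite dirF; apply/funext => x; apply: deriveZ; exact: polyn_derivable hp. Qed.

Lemma dirN v k p : polyn k p -> dir v (fun x => - p x) = fun x => - dir v p x.
Proof. by move=> hp; rewrite dirF; apply/funext => x; apply: deriveN; exact: polyn_derivable hp. Qed.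

Lemma dirB v k p q : polyn k p -> polyn k q ->
  dir v (fun x => p x - q x) = fun x => dir v p x - dir v q x.
Proof. by move=> hp hq; rewrite (dirD v hp (polynN hq)) (dirN v hq). Qed.

Lemma dir_comm k p v w : polyn k p -> dir v (dir w p) = dir w (dir v p).
Proof. by move=> hp; rewrite dirF; exact: polyn_D_comm hp. Qed.

Lemma dir_coord k p v x : polyn k p -> dir v p x = v.1 * dir (1, 0) p x + v.2 * dir (0, 1) p x.
Proof. by move=> hp; rewrite dirF; apply: derive_coord; exact: polyn_differentiable hp. Qed.

Lemma prim_x k f : polyn k f -> exists2 F, polyn k.+1 F & dir (1, 0) F = f.
Proof.
move=> [c hf].
exists (fun x => \sum_(i < k.+1) \sum_(j < k.+1 | (i + j <= k)%N) (c i j / i.+1%:R) * (x.1 ^+ i.+1 * x.2 ^+ j)).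
  apply: polyn_sum => i _; pose G (j : 'I_k.+1) (x : pt R) := (c i j / i.+1%:R) * (x.1 ^+ i.+1 * x.2 ^+ j).
  apply: (@polyn_sum R k.+1 _ (index_enum 'I_k.+1) (fun j : 'I_k.+1 => (i + j <= k)%N) G) => j ij; apply: polynZ.
  by apply: polyn_leq (polyn_mono _ _); rewrite addSn ltnS.
rewrite dirF; apply/funext => x; rewrite hf.
pose G (i j : 'I_k.+1) (x : pt R) := (c i j / i.+1%:R) * (x.1 ^+ i.+1 * x.2 ^+ j).
have h (i j : 'I_k.+1) : is_derive x (1, 0) (G i j) (c i j * x.1 ^+ i * x.2 ^+ j).
  rewrite /G; have m := is_derive_mono i.+1 j x (1, 0).
  apply: (is_derive_eq (is_deriveZ (c i j / i.+1%:R) m)).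
  by rewrite /GRing.scale /= mulr1 mulr0 mul0r addr0 !mulrA divfK ?pnatr_eq0.
by apply: (@derive_val _ _ _ _ _ _ _ (is_derive_bigsum _ _ (fun i => is_derive_bigsum _ _ (h i)))).
Qed.

Lemma prim_y k f : polyn k f -> exists2 F, polyn k.+1 F & dir (0, 1) F = f.
Proof.
move=> [c hf].
exists (fun x => \sum_(i < k.+1) \sum_(j < k.+1 | (i + j <= k)%N) (c i j / j.+1%:R) * (x.1 ^+ i * x.2 ^+ j.+1)).
  apply: polyn_sum => i _; pose G (j : 'I_k.+1) (x : pt R) := (c i j / j.+1%:R) * (x.1 ^+ i * x.2 ^+ j.+1).
  apply: (@polyn_sum R k.+1 _ (index_enum 'I_k.+1) (fun j : 'I_k.+1 => (i + j <= k)%N) G) => j ij; apply: polynZ.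
  by apply: polyn_leq (polyn_mono _ _); rewrite addnS ltnS.
rewrite dirF; apply/funext => x; rewrite hf.
pose G (i j : 'I_k.+1) (x : pt R) := (c i j / j.+1%:R) * (x.1 ^+ i * x.2 ^+ j.+1).
have h (i j : 'I_k.+1) : is_derive x (0, 1) (G i j) (c i j * x.1 ^+ i * x.2 ^+ j).
  rewrite /G; have m := is_derive_mono i j.+1 x (0, 1).
  apply: (is_derive_eq (is_deriveZ (c i j / j.+1%:R) m)).
  rewrite /GRing.scale /= mulr1 mulr0 mul0r add0r !mulrA divfK ?pnatr_eq0//.
  by rewrite -mulrA (mulrC (x.2 ^+ j)) mulrA.
by apply: (@derive_val _ _ _ _ _ _ _ (is_derive_bigsum _ _ (fun i => is_derive_bigsum _ _ (h i)))).
Qed.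

Lemma line_zero k p A v (a b : R) : polyn k p -> a < b ->
  (forall t, a < t -> t < b -> p (A + t *: v) = 0) -> forall t, p (A + t *: v) = 0.
Proof.
move=> /(polyn_line A v)[g sg hg] ab h t.
rewrite (hg t).1 (_ : g = 0) ?horner0//.
by apply: (poly_zero_itv ab) => u u0 u1; rewrite -(hg u).1; exact: h.
Qed.

Lemma line_const k p A v (a b : R) : polyn k p -> a < b ->
  (forall t, a < t -> t < b -> dir v p (A + t *: v) = 0) -> forall t, p (A + t *: v) = p A.
Proof.
move=> hp ab h t; have z := line_zero (polyn_dir v hp) ab h.
have [g _ hg] := polyn_line A v hp; rewrite dirF in z.
have g0 : g^`() = 0.
  by apply: (poly_zero_itv ltr01) => u _ _; rewrite -(hg u).2; exact: z.
have : g = (g`_0)%:P.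
  apply/polyP => -[|n]; rewrite coefC//=.
  have := coef_deriv g n; rewrite g0 coef0 => /esym/eqP.
  by rewrite mulrn_eq0 /= => /eqP.
move=> gE; rewrite -[A in RHS]addr0 -(scale0r v) !(hg _).1 gE !hornerC; reflexivity.
Qed.

Lemma derive_axis p x v : dir v (fun y => p (0, y.2)) x = dir (0, v.2) p (0, x.2).
Proof.
have E : (fun h : R => h^-1 *: (((fun y => p (0, y.2)) \o shift x) (h *: v) - p (0, x.2))) =
    (fun h => h^-1 *: ((p \o shift (0, x.2)) (h *: (0, v.2)) - p (0, x.2))).
  apply/funext => h /=; congr (_ *: (p _ - _)).
  by apply: pairE; rewrite /= /GRing.scale /= ?mulr0 ?addr0.
by rewrite dirF /dir_def /derive E.
Qed.

Lemma polyn_axis k p : polyn k p -> polyn k (fun y => p (0, y.2)).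
Proof.
move: k p; apply: polyn_ind => [k a|k a q r hq hr IHq IHr]; first exact: polyn_cst.
rewrite (_ : (fun y => _) = (fun y : pt R => a + y.2 * r (0, y.2))).
  by apply: polynD; [exact: polyn_cst|exact: polyn_mulY].
by apply/funext => y /=; rewrite mul0r addr0.
Qed.

(** After integrating [f] in the first variable, the remainder of [g] no longer depends on it and is
    integrated in the second variable. Restricting that primitive to the axis keeps it independent
    of the first variable. *)
Lemma poly_poincare k f g : polyn k f -> polyn k g -> dir (0, 1) f = dir (1, 0) g ->
  exists h, [/\ polyn k.+1 h, dir (1, 0) h = f & dir (0, 1) h = g].
Proof.
move=> hf hg E; have [F hF DF] := prim_x hf.
pose g1 x := g x - dir (0, 1) F x; have hg1 : polyn k g1 by apply: polynB => //; exact: (polyn_dir _ hF).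
have dg1 x : dir (1, 0) g1 x = 0.
  by rewrite /g1 (dirB _ hg (polyn_dir _ hF)) (dir_comm _ _ hF) DF E subrr.
have g1E x : g1 (0, x.2) = g1 x.
  have := @line_const k g1 (0, x.2) (1, 0) 0 1 hg1 ltr01 (fun t _ _ => dg1 _) x.1.
  by move=> <-; congr g1; apply: pairE; rewrite /= /GRing.scale /= ?mulr1 ?mulr0 ?add0r ?addr0.
have [G hG DG] := prim_y hg1.
have hGa : polyn k.+1 (fun y => G (0, y.2)) := polyn_axis hG.
exists (fun x => F x + G (0, x.2)); split; first exact: polynD.
- rewrite (dirD _ hF hGa) DF; apply/funext => x.
  by rewrite derive_axis /= (dir_coord _ _ hG) /= !mul0r !addr0.
- rewrite (dirD _ hF hGa); apply/funext => x.
  by rewrite derive_axis /= DG g1E /g1 addrC subrK.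
Qed.

(** Each row of a divergence-free matrix has a potential. That the two off-diagonal entries agree is
    the compatibility condition under which the pair of row potentials is itself a gradient. *)
Lemma poly_airy k s11 s12 s22 : polyn k s11 -> polyn k s12 -> polyn k s22 ->
  (forall x, dir (1, 0) s11 x + dir (0, 1) s12 x = 0) ->
  (forall x, dir (1, 0) s12 x + dir (0, 1) s22 x = 0) ->
  exists q, [/\ polyn k.+2 q, pd 0 2 q = s11, pd 1 1 q = (fun x => - s12 x) & pd 2 0 q = s22].
Proof.
move=> h1 h2 h3 e1 e2.
have h2' : polyn k (fun x => - s12 x) by exact: polynN.
have D2 v := dirN v h2.
have [a [ha ax ay]] : exists h, [/\ polyn k.+1 h, dir (1, 0) h = s22 & dir (0, 1) h = fun x => - s12 x].
  apply: poly_poincare => //; rewrite D2; apply/funext => x; apply/eqP.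
  by rewrite -addr_eq0 addrC e2.
have [b [hb bx b_y]] : exists h, [/\ polyn k.+1 h, dir (1, 0) h = (fun x => - s12 x) & dir (0, 1) h = s11].
  apply: poly_poincare => //; rewrite D2; apply/funext => x; apply/eqP.
  by rewrite eq_sym -addr_eq0 e1.
have [q [hq qx qy]] := poly_poincare ha hb (etrans ay (esym bx)).
by exists q; split=> //; rewrite -?[LHS]/(dir_def _ (dir_def _ q)) -dirF ?qx ?qy.
Qed.
End PolyPotential.

(** * Conforming triangulations, for the macro mesh as well as its subdivision *)

Section Triangulation.
Variable R : realType.
Variables (Omega : set (pt R)) (T : seq (tri R)).
Hypothesis conf : conforming_mesh Omega T.
Hypothesis oO : open Omega.
Hypothesis iO : (closure Omega)^° `<=` Omega.
Hypothesis bO : bounded_set Omega.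
Hypothesis bdconn : connected (closure Omega `\` Omega).
Hypothesis bdperf : forall (F : seq (pt R)) x (e : R), (closure Omega `\` Omega) x -> 0 < e ->
  exists y, [/\ (closure Omega `\` Omega) y, ball x e y & y \notin F].
Hypothesis punct : forall X (e : R), closure Omega X -> 0 < e ->
  exists2 r : R, 0 < r <= e & connected [set y | [/\ Omega y, ball X r y & y != X]].

Implicit Types (K L M : tri R) (x y X A B : pt R) (i j m : 'I_3).

(** * Incidence of triangles, vertices and edges *)

Section Mesh.

Lemma orT K : K \in T -> orient K != 0.
Proof. by have [h _ _] := conf; exact: h. Qed.

Lemma coverT x : closure Omega x -> exists2 K, K \in T & hull (verts K) x.
Proof. by have [_ -> _] := conf. Qed.

Lemma hullT K : K \in T -> hull (verts K) `<=` closure Omega.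
Proof. by move=> hK x hx; have [_ -> _] := conf; exists K. Qed.

(** The point is a convex combination of common vertices, and barycentric coordinates are unique; so
    a vertex with nonzero weight is common. *)
Lemma conf_lam K L x i : K \in T -> L \in T -> K != L -> hull (verts K) x ->
  hull (verts L) x -> lam K i x != 0 -> exists j, vt K i = vt L j.
Proof.
move=> KT LT KL Kx Lx; have [_ _ /(_ K L KT LT KL)[_ hc]] := conf.
apply: contraNP => nL; have : hull [seq x <- verts K | x \in verts L] x by rewrite -hc.
set s := [seq _ <- _ | _] => -[c [c0 c1 ->]]; rewrite lam_sum_aff// big1// => k _.
have : nth 0 s k \in s by apply: mem_nth; exact: ltn_ord.
rewrite mem_filter => /andP[hL /mem_verts[m hm]].
rewrite hm lam_vt ?orT//; case: eqP => [im|_]; last by rewrite mulr0.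
by exfalso; apply: nL; apply/mem_verts; rewrite im -hm.
Qed.

(** Otherwise all three vertices would be common, against the bound on their number. *)
Lemma conf_zero K L x : K \in T -> L \in T -> K != L -> hull (verts K) x ->
  hull (verts L) x -> exists i, lam K i x = 0.
Proof.
move=> KT LT KL Kx Lx; apply: contrapT => nz.
have [_ _ /(_ K L KT LT KL)[+ _]] := conf.
have -> : [seq x <- verts K | x \in verts L] = verts K.
  apply/all_filterP/allP => y /mem_verts[i ->]; apply/mem_verts.
  by apply: conf_lam Kx Lx _ => //; apply/eqP => h; apply: nz; exists i.
by [].
Qed.

Lemma vert_in K L X : K \in T -> L \in T -> hull (verts L) X -> X \in verts K -> X \in verts L.
Proof.
move=> KT LT LX /mem_verts[m Xm]; have [<-|KL] := eqVneq K L; first by apply/mem_verts; exists m.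
apply/mem_verts; rewrite Xm; apply: (@conf_lam K L X m) => //; first by rewrite Xm; exact: hull_vt.
by rewrite Xm lam_vt ?orT// eqxx oner_eq0.
Qed.

Lemma oedge_nbrP K L i x : K \in T -> L \in T -> K != L -> oedge K i x ->
  hull (verts L) x -> exists j, nbr K i L j.
Proof.
move=> KT LT KL [h1 h2 h3] Lx; have hK := orT KT; have hL := orT LT.
have Kx : hull (verts K) x.
  by rewrite hullE// => m; case: (ord3_cases i m) => ->; rewrite ?h1 //; apply/ltW.
have [a ha] : exists a, vt K (nx i) = vt L a by apply: conf_lam Kx Lx _ => //; rewrite gt_eqF.
have [b hb] : exists b, vt K (nx (nx i)) = vt L b by apply: conf_lam Kx Lx _ => //; rewrite gt_eqF.
have ab : a <> b.
  by move=> E; have := edge_neq i hK; rewrite /ea /eb ha hb E eqxx.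
have [ba|ba] : b = nx a \/ b = nx (nx a).
  by case: (ord3_cases a b) => E; [case: ab|left|right].
- exists (nx (nx a)); rewrite /nbr eq_sym KL /ea /eb nxK ha hb ba !eqxx; by [].
- exists (nx a); rewrite /nbr eq_sym KL /ea /eb nxK ha hb ba !eqxx orbT; by [].
Qed.

(** Were both triangles on the same side of the edge, a point just inside the edge would be interior
    to both. *)
Lemma nbr_opp K L i j : K \in T -> L \in T -> nbr K i L j -> lam K i (vt L j) < 0.
Proof.
move=> KT LT hn; have hK := orT KT; have hL := orT LT.
have n0 := nbr_lam_neq hK hL hn; rewrite ltNge le_eqVlt eq_sym (negbTE n0) /=; apply/negP => p0.
have KL : K != L by case/andP: hn; rewrite eq_sym.
pose x0 := ea K i + 2^-1 *: (eb K i - ea K i).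
have ox : oedge K i x0 by apply/oedgeP => //; exists 2^-1; split=> //; lra.
have [l1 l2 l3] := ox; have [m1 m2 m3] := oedge_nbr hK hL hn ox.
have : \forall y \near x0, [/\ 0 < lam K (nx i) y, 0 < lam K (nx (nx i)) y,
    0 < lam L (nx j) y & 0 < lam L (nx (nx j)) y].
  near=> y; split; near: y; exact: lam_near_gt0.
move=> /(near_line (vt L j - x0))[e e0 he].
pose s := Num.min (e / 2) 2^-1.
have s0 : 0 < s by rewrite lt_min; apply/andP; split; lra.
have se : `|s| < e by rewrite gtr0_norm// gt_min; apply/orP; left; lra.
have s1 : s < 1 by rewrite gt_min; apply/orP; right; lra.
have [k1 k2 k3 k4] := he s se; set y := x0 + _ in k1 k2 k3 k4.
have Li : 0 < lam L j y by rewrite /y lam_line m1 lam_vt1//; lra.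
have Ki : 0 < lam K i y by rewrite (nbr_lam y hK hL hn) mulr_gt0.
have [m hm] : exists m, lam K m y = 0.
  apply: (@conf_zero K L) => //; rewrite hullE// => m.
    by case: (ord3_cases i m) => ->; exact/ltW.
  by case: (ord3_cases j m) => ->; exact/ltW.
by case: (ord3_cases i m) hm => -> h; [move: Ki|move: k1|move: k2]; rewrite h ltxx.
Unshelve. all: by end_near.
Qed.

(** Of three triangles sharing an edge, two would lie on the same side of it. *)
Lemma nbr_uniq K L L' i j j' : K \in T -> L \in T -> L' \in T -> nbr K i L j -> nbr K i L' j' ->
  L = L' /\ j = j'.
Proof.
move=> KT LT LT' hn hn'; have hK := orT KT; have hL := orT LT; have hL' := orT LT'.
have LL : L = L'.
  apply/eqP; apply/negPn/negP => LL.
  have hn2 : nbr L j L' j'.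
    rewrite /nbr eq_sym LL; case/andP: hn => _ /orP[]/andP[/eqP -> /eqP ->];
    by case/andP: hn' => _ /orP[]/andP[-> ->]; rewrite ?orbT.
  have := nbr_opp KT LT' hn'; rewrite (nbr_lam _ hK hL hn).
  rewrite ltNge => /negP[]; apply/ltW.
  by rewrite nmulr_rgt0; [exact: nbr_opp hn2|exact: nbr_opp hn].
split=> //; subst L'.
have := nbr_opp KT LT hn'; rewrite (nbr_lam _ hK hL hn) lam_vt//.
by case: eqP => // _; rewrite mulr0 ltxx.
Qed.

Lemma nbr_sign K L i j : K \in T -> L \in T -> nbr K i L j ->
  [/\ ea L j = ea K i, eb L j = eb K i & Num.sg (orient L) = - Num.sg (orient K)] \/
  [/\ ea L j = eb K i, eb L j = ea K i & Num.sg (orient L) = Num.sg (orient K)].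
Proof.
move=> KT LT hn; have [hK hL] := (orT KT, orT LT).
have := nbr_opp KT LT hn => op.
have c1 := cross_edge i (vt L j) hK; have := cross_edge j (vt L j) hL.
rewrite lam_vt// eqxx mulr1 => c2.
case/andP: hn => _ /orP[]/andP[/eqP e1 /eqP e2]; move: c2; rewrite e1 e2 => c2.
  by left; split=> //; rewrite -c2 c1 sgrM (ltr0_sg op) mulrN1.
right; split=> //.
rewrite -c2; have -> : cross (ea K i - eb K i) (vt L j - eb K i) =
   - cross (eb K i - ea K i) (vt L j - ea K i) by rewrite /cross /=; ring.
by rewrite c1 -mulrN sgrM (@gtr0_sg _ (- _)) ?oppr_gt0// mulr1.
Qed.

(** With counterclockwise orientation, a shared edge is traversed in opposite directions from its
    two sides. *)
Lemma nbr_orient K L i j : K \in T -> L \in T -> nbr K i L j ->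
  Num.sg (orient K) *: (eb K i - ea K i) = - (Num.sg (orient L) *: (eb L j - ea L j)).
Proof.
move=> KT LT hn; case: (nbr_sign KT LT hn) => -[-> -> ->].
  by rewrite scaleNr opprK.
by rewrite -scalerN opprB.
Qed.

Lemma oK_sub K : K \in T -> oK K `<=` Omega.
Proof.
move=> KT; apply: subset_trans iO; apply: (@subset_trans _ ((oK K)^°)).
  by rewrite (interior_id (oK K)).1 //; exact: oK_open.
by apply: interiorS => x hx; apply: (hullT KT); exact: (oK_hull (orT KT)).
Qed.

Lemma nbr_edge_in K L i j x : K \in T -> L \in T -> nbr K i L j -> oedge K i x -> Omega x.
Proof.
move=> KT LT hn ox; have [hK hL] := (orT KT, orT LT); apply: iO.
have [k1 k2 k3] := ox; have [l1 l2 l3] := oedge_nbr hK hL hn ox.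
have op := nbr_opp KT LT hn.
rewrite /interior /=; near=> y.
have [h|h] := leP 0 (lam K i y).
  apply: (hullT KT); rewrite hullE// => m; case: (ord3_cases i m) => -> //; apply/ltW;
  near: y; exact: lam_near_gt0.
apply: (hullT LT); rewrite hullE// => m; case: (ord3_cases j m) => -> ; apply/ltW.
- by move: h; rewrite (nbr_lam y hK hL hn) nmulr_rlt0.
- near: y; exact: lam_near_gt0.
- near: y; exact: lam_near_gt0.
Unshelve. all: by end_near.
Qed.

Lemma near_seq (U : eqType) (s : seq U) (P : U -> pt R -> Prop) x :
  (forall u, u \in s -> \forall y \near x, P u y) -> \forall y \near x, forall u, u \in s -> P u y.
Proof.
elim: s => [_|u s IH h]; first by apply: pt_nearW => y u; rewrite in_nil.
have h1 : \forall y \near x, P u y by apply: h; exact: mem_head.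
have h2 : \forall y \near x, forall v, v \in s -> P v y.
  by apply: IH => v vs; apply: h; rewrite in_cons vs orbT.
near=> y => v; rewrite in_cons => /orP[/eqP ->|vs]; first by near: y.
by move: v vs; near: y.
Unshelve. all: by end_near.
Qed.

Lemma near_notin K x : K \in T -> ~ hull (verts K) x -> \forall y \near x, ~ hull (verts K) y.
Proof.
move=> KT nx; have := closed_openC (hull_closed (orT KT)).
by rewrite openE => /(_ x nx).
Qed.

Lemma near_hull x : \forall y \near x, forall K, K \in T -> hull (verts K) y -> hull (verts K) x.
Proof.
apply: near_seq => K KT; have [Kx|nKx] := pselect (hull (verts K) x); first exact: pt_nearW.
by have := near_notin KT nKx; apply: filterS => y h /h.
Qed.

Lemma edge_in_nbr K i x : K \in T -> oedge K i x -> Omega x -> exists L j, L \in T /\ nbr K i L j.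
Proof.
move=> KT ox Ox; have hK := orT KT; have [l1 l2 l3] := ox.
have nO : nbhs x Omega by exact: open_nbhs_nbhs.
have : \forall y \near x, Omega y /\ (forall L, L \in T -> hull (verts L) y -> hull (verts L) x).
  by near=> y; split; near: y => //; exact: near_hull.
move=> /(near_line (vt K i - x))[e e0 he].
have ee : `|- (e / 2)| < e by rewrite normrN gtr0_norm; lra.
have [Oy hy] := he _ ee; set y := x + _ in Oy hy.
have [L LT Ly] := coverT (subset_closure Oy).
have LK : K != L.
  apply/eqP => E; move: Ly; rewrite -E hullE// => /(_ i).
  by rewrite /y lam_line l1 lam_vt1//; lra.
have [j hj] := oedge_nbrP KT LT LK ox (hy L LT Ly).
by exists L, j.
Unshelve. all: by end_near.
Qed.

(** If a point of the edge, possibly an endpoint, lay in the open set Omega, so would some point of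
    the open edge nearby. There the far side of the edge has to be covered by another triangle,
    which is then a neighbour. *)
Lemma free_edge_out K i x : K \in T -> (forall L j, L \in T -> ~~ nbr K i L j) ->
  hull [:: ea K i; eb K i] x -> ~ Omega x.
Proof.
move=> KT nn /seg_hullP[t [t0 t1 ->]] Ox; have hK := orT KT.
have nO : nbhs (ea K i + t *: (eb K i - ea K i)) Omega by exact: open_nbhs_nbhs.
have [e e0 he] := near_line (eb K i - ea K i) nO.
have [s [s0 s1 hs]] : exists s : R, [/\ 0 < t + s, t + s < 1 & `|s| < e].
  have [r [r0 r4 re]] : exists r : R, [/\ 0 < r, r <= 4^-1 & r < e].
    by have [h|h] := ltP (e / 2) 4^-1; [exists (e / 2)|exists 4^-1]; split; lra.
  have [h|h] := leP t 2^-1; [exists r|exists (- r)]; split; try lra.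
    by rewrite gtr0_norm.
  by rewrite normrN gtr0_norm.
clear nO.
have := he s hs; rewrite -addrA -scalerDl => Oy.
have oy : oedge K i (ea K i + (t + s) *: (eb K i - ea K i)).
  by apply/oedgeP => //; exists (t + s).
have [L [j [LT hn]]] := edge_in_nbr KT oy Oy.
by move/negP: (nn L j LT).
Qed.
End Mesh.

(** * Stars of vertices, extreme edges and the boundary *)

Section MeshTopology.

Lemma ord3_others i l m : i != l -> i != m -> m != l ->
  (l = nx i /\ m = nx (nx i)) \/ (l = nx (nx i) /\ m = nx i).
Proof.
move: i l m; apply: ord3P; apply: ord3P; apply: ord3P => // _ _ _; by [left|right].
Qed.

Lemma near_pt_neq A x : x != A -> \forall y \near x, y <> A.
Proof.
move=> xA; have nA : ~ hull [:: A; A] x.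
  by move=> /seg_hullP[t [_ _]]; rewrite subrr scaler0 addr0 => E; rewrite E eqxx in xA.
have := near_nhull nA; apply: filterS => y hy E; by apply: hy; rewrite E; exact: seg_hulll.
Qed.

Section Star.

(** One can walk around [X] inside the connected punctured neighbourhood, which avoids all other
    vertices; every change of triangle then crosses an edge ending at [X]. *)
Lemma star_const (U : Type) (F : tri R -> U) X :
  (exists2 K0, K0 \in T & X \in verts K0) ->
  (forall K i L j, K \in T -> L \in T -> nbr K i L j -> X = ea K i \/ X = eb K i -> F K = F L) ->
  forall K L, K \in T -> L \in T -> hull (verts K) X -> hull (verts L) X -> F K = F L.
Proof.
move=> [K0 K0T XK0] hF.
have Xv K : K \in T -> hull (verts K) X -> X \in verts K.
  by move=> KT KX; exact: (vert_in K0T KT KX XK0).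
have cX : closure Omega X.
  by apply: (hullT K0T); case/mem_verts: XK0 => m ->; exact: hull_vt.
have h1 : \forall y \near X, forall K, K \in T -> hull (verts K) y -> hull (verts K) X.
  exact: near_hull.
have h2 : \forall y \near X, forall K, K \in T -> forall m, y = vt K m -> y = X.
  apply: near_seq => K KT; apply: near_forall => m.
  have [<-|Xm] := eqVneq X (vt K m); first exact: pt_nearW.
  by have := near_pt_neq Xm; apply: filterS => y hy /hy.
have : \forall y \near X, (forall K, K \in T -> hull (verts K) y -> hull (verts K) X) /\
    forall K, K \in T -> forall m, y = vt K m -> y = X.
  by near=> y; split; near: y.
move=> /nbhs_ballP[e /= e0 he].
have [d /andP[d0 de] cS] := punct cX e0.
set S := [set y | _] in cS.
have Se y : S y -> ball X e y by move=> [_ h _]; exact: le_ball h.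
have key y K L : S y -> K \in T -> L \in T -> hull (verts K) y -> hull (verts L) y -> F K = F L.
  move=> Sy KT LT Ky Ly; have [->//|KL] := eqVneq K L.
  have [hX hV] := he y (Se y Sy); have [_ _ yX] := Sy.
  have hK := orT KT; have hL := orT LT.
  have [i li] := conf_zero KT LT KL Ky Ly.
  have : hull [:: ea K i; eb K i] y.
    by apply/edge_hullP => //; move: Ky; rewrite hullE// => h; split.
  move=> /seg_hullP[t [t0 t1 yE]].
  have nv m : y <> vt K m by move=> /(hV K KT m)/eqP; rewrite (negbTE yX).
  have ox : oedge K i y.
    apply/oedgeP => //; exists t; split=> //; rewrite lt_neqAle.
      rewrite t0 andbT; apply/eqP => tz; apply: (nv (nx i)).
      by rewrite yE -tz scale0r addr0.
    rewrite t1 andbT; apply/eqP => tz; apply: (nv (nx (nx i))).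
    by rewrite yE tz scale1r addrC subrK.
  have [j hn] := oedge_nbrP KT LT KL ox Ly.
  apply: (hF _ _ _ _ KT LT hn).
  have /mem_verts[m Xm] := Xv K KT (hX K KT Ky).
  case: (ord3_cases i m) => E; [|by left; rewrite Xm E|by right; rewrite Xm E].
  have := nbr_lam X hK hL hn; rewrite Xm E lam_vt1// => hh.
  have : hull (verts L) X by exact: hX.
  rewrite hullE// => /(_ j) hp; have := nbr_opp KT LT hn => hm.
  exfalso; have : lam K i (vt L j) * lam L j X <= 0 by rewrite nmulr_rle0.
  by rewrite Xm E -hh ler10.
have ex K : K \in T -> hull (verts K) X -> exists2 y, S y & oK K y.
  move=> KT KX; have hK := orT KT.
  pose z := \sum_m (3^-1 : R) *: vt K m.
  have lz m : lam K m z = 3^-1.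
    by rewrite (lam_uniq (c := fun=> 3^-1))// sum3; field.
  have nb : \forall y \near X, ball X d y by apply/nbhs_ballP; exists d.
  have [r r0 hr] := near_line (z - X) nb.
  pose s := Num.min (r / 2) 2^-1.
  have s0 : 0 < s by rewrite lt_min; apply/andP; split; lra.
  have sr : `|s| < r by rewrite gtr0_norm// gt_min; apply/orP; left; lra.
  have s1 : s < 1 by rewrite gt_min; apply/orP; right; lra.
  have lx m : 0 < lam K m (X + s *: (z - X)).
    move: KX; rewrite hullE// => /(_ m) lX; rewrite lam_line lz.
    apply: ltr_wpDl; first by apply: mulr_ge0 => //; lra.
    by apply: mulr_gt0 => //; lra.
  exists (X + s *: (z - X)) => //; split.
  - exact: (oK_sub KT).
  - exact: hr.
  - apply/eqP => E; have /mem_verts[m Xm] := Xv K KT KX.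
    have := lx (nx m); rewrite E {1}Xm lam_vt//.
    by rewrite (negbTE (nx_neq m).1.1) ltxx.
have pick y : S y -> exists2 K, K \in T & hull (verts K) y.
  by move=> [Oy _ _]; apply: coverT; exact: subset_closure.
pose f y : U := F (xget K0 [set K | K \in T /\ hull (verts K) y]).
have fE y K : S y -> K \in T -> hull (verts K) y -> f y = F K.
  move=> Sy KT Ky; rewrite /f; case: xgetP => [L _ [LT Ly]|/(_ K)[]//].
  exact: key Ly Ky.
move=> K L KT LT KX LX.
have [y Sy oy] := ex K KT KX; have [z Sz oz] := ex L LT LX.
have hy := oK_hull (orT KT) oy; have hz := oK_hull (orT LT) oz.
rewrite -(fE y K)// -(fE z L)//.
apply: (loc_const_connected (f := f) cS) => // w Sw.
have := near_hull w; apply: filterS => v hv Sv.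
have [M MT Mv] := pick v Sv.
by rewrite (fE v M)// (fE w M)//; exact: hv.
Unshelve. all: by end_near.
Qed.
End Star.

Lemma vertices_generic : exists d, forall K i L j, K \in T -> L \in T ->
  vt K i != vt L j -> cross (vt K i - vt L j) d != 0.
Proof.
pose I := (seq_sub T * 'I_3)%type.
pose s := [seq v <- codom (fun p : I * I => vt (val p.1.1) p.1.2 - vt (val p.2.1) p.2.2) | v != 0].
have [d hd] : exists d, forall v, v \in s -> cross v d != 0.
  by apply: generic_direction => v; rewrite mem_filter => /andP[].
exists d => K i L j KT LT KL; apply: hd; rewrite mem_filter subr_eq0 KL /=.
apply/codomP; by exists ((SeqSub KT, i), (SeqSub LT, j)).
Qed.

(* An extreme vertex V of Z for a generic linear functional, and the edge of Z
   at V of largest slope. *)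
Lemma exit_edge (Z : pred (tri R)) K0 : K0 \in T -> Z K0 ->
  exists K i, [/\ K \in T, Z K & forall L j, L \in T -> Z L -> ~~ nbr K i L j].
Proof.
move=> K0T ZK0; have [d hd] := vertices_generic.
pose I := (seq_sub T * 'I_3)%type.
pose Fm (p : I) : R := - cross (vt (val p.1) p.2) d.
have P0 : Z (val (SeqSub K0T, ord0 : 'I_3).1) by [].
case: (@Order.TotalTheory.arg_maxP _ _ I (SeqSub K0T, ord0) (fun p : I => Z (val p.1)) Fm P0).
move=> [K1 l1] /= ZK1 maxV; set V := vt (val K1) l1.
have minV L m : L \in T -> Z L -> vt L m != V -> 0 < cross (vt L m - V) d.
  move=> LT ZL LV; have := maxV (SeqSub LT, m) ZL; rewrite /Fm /= lerN2 => h.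
  rewrite lt_neqAle eq_sym hd ?ssvalP//=.
  by move: h; rewrite -subr_ge0 => h; rewrite (le_trans h)// /cross /=; lra.
pose J := (seq_sub T * ('I_3 * 'I_3))%type.
pose PJ (p : J) := [&& Z (val p.1), vt (val p.1) p.2.1 == V & p.2.2 != p.2.1].
(* All other vertices of triangles of [Z] have a larger functional than [V], so this cotangent
   orders the edges at [V] by angle. *)
pose sl x := dot (x - V) d / cross (x - V) d.
have PJ0 : PJ (K1, (l1, nx l1)) by rewrite /PJ /= ZK1 eqxx (nx_neq l1).1.1.
case: (@Order.TotalTheory.arg_maxP _ _ J _ PJ (fun p : J => sl (vt (val p.1) p.2.2)) PJ0).
move=> [[K KT] [l m]] /and3P[/= ZK /eqP Vl ml] maxW; set W := vt K m.
have hK := orT KT.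
have d0 : 0 < d.1 ^+ 2 + d.2 ^+ 2.
  rewrite lt_neqAle eq_sym addr_ge0 ?sqr_ge0// andbT; apply/negP.
  rewrite paddr_eq0 ?sqr_ge0// !sqrf_eq0 => /andP[/eqP z1 /eqP z2].
  have := hd K m K l KT KT; rewrite /cross z1 z2 !mulr0 subrr eqxx.
  by rewrite (inj_eq (vt_inj hK)) ml => /(_ isT).
have side (L : tri R) u : L \in T -> Z L -> V \in verts L -> vt L u != V ->
    cross (W - V) (vt L u - V) <= 0.
  move=> LT ZL /mem_verts[v Vv] uV.
  have WV : vt K m != V by rewrite -Vl (inj_eq (vt_inj hK)).
  have cW := minV K m KT ZK WV; have cU := minV L u LT ZL uV.
  have : PJ (SeqSub LT, (v, u)).
    rewrite /PJ /= ZL Vv eqxx /=; apply/eqP => E; move: uV; by rewrite E Vv eqxx.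
  move=> /maxW /=; rewrite /sl ler_pdivrMr// mulrAC ler_pdivlMr// -/W.
  rewrite -subr_le0 => h; rewrite -(pmulr_rle0 _ d0); apply: le_trans h.
  by rewrite le_eqVlt; apply/orP; left; apply/eqP; rewrite /dot /cross /=; ring.
have [i [il im]] : exists i, i != l /\ i != m.
  case: (ord3_cases l m) ml => ->; rewrite ?eqxx// => _.
    by exists (nx (nx l)); rewrite (nx_neq l).1.2 (nx_neq l).2.
  by exists (nx l); rewrite (nx_neq l).1.1 eq_sym (nx_neq l).2.
have VW : (V = ea K i /\ W = eb K i) \/ (V = eb K i /\ W = ea K i).
  by rewrite -Vl /W /ea /eb; case: (ord3_others il im ml) => -[-> ->]; [left|right].
exists K, i; split=> // L j LT ZL; apply/negP => hn.
have hL := orT LT.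
have VL : V \in verts L /\ vt L j != V.
  suff [u [uj ->]] : exists u, u != j /\ V = vt L u.
    split; first by apply/mem_verts; exists u.
    by rewrite (inj_eq (vt_inj hL)) eq_sym.
  case/andP: hn => _ /orP[]/andP[/eqP e1 /eqP e2]; case: VW => [[-> _]|[-> _]];
    rewrite -?e1 -?e2; try (by exists (nx j); rewrite (nx_neq j).1.1);
    by exists (nx (nx j)); rewrite (nx_neq j).1.2.
have s1 := side L j LT ZL VL.1 VL.2.
have s2 : cross (W - V) (vt K i - V) <= 0.
  apply: side => //; first by rewrite -Vl; apply/mem_verts; exists l.
  by rewrite -Vl (inj_eq (vt_inj hK)).
have op := nbr_opp KT LT hn.
have c1 := cross_edge i (vt L j) hK; have := cross_edge i (vt K i) hK.
rewrite lam_vt1// mulr1 => c2.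
(* A neighbour in [Z] would have its third vertex on the other side of the line through [V] and [W],
   which makes this product negative. Maximality of the slope puts both third vertices on the same
   side. *)
have sq : cross (W - V) (vt L j - V) * cross (W - V) (vt K i - V) =
    orient K ^+ 2 * lam K i (vt L j).
  rewrite expr2 -mulrA mulrCA mulrC -c1 -{1}c2.
  by case: VW => [[-> ->]|[-> ->]]; rewrite /cross /=; ring.
have : 0 <= cross (W - V) (vt L j - V) * cross (W - V) (vt K i - V) by rewrite mulr_le0.
by rewrite sq leNgt => /negP[]; rewrite pmulr_rlt0// exprn_even_gt0.
Qed.

(** An edge without neighbour. By [bd_free] and [free_bd] these edges make up the boundary of
    Omega. *)
Definition free K i : bool := ~~ has (fun L => [exists j, nbr K i L j]) T.

Lemma freeP K i : reflect (forall L j, L \in T -> ~~ nbr K i L j) (free K i).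
Proof.
apply: (iffP idP) => [/hasPn h L j LT|h].
  by have := h L LT; rewrite negb_exists => /forallP.
by apply/hasPn => L LT; rewrite negb_exists; apply/forallP => j; exact: h.
Qed.

Lemma nfreeP K i : ~~ free K i -> exists L j, L \in T /\ nbr K i L j.
Proof.
by rewrite negbK => /hasP[L LT /existsP[j hj]]; exists L, j.
Qed.

Lemma nbr_nfree K i L j : L \in T -> nbr K i L j -> free K i = false.
Proof. move=> LT hn; apply/negbTE; rewrite negbK; apply/hasP; exists L => //.
by apply/existsP; exists j. Qed.

Lemma edge_endpoint K i x : K \in T -> hull [:: ea K i; eb K i] x ->
  [\/ x = ea K i, x = eb K i | oedge K i x].
Proof.
move=> KT /seg_hullP[t [t0 t1 xE]].
have [tz|tz] := eqVneq t 0; first by constructor 1; rewrite xE tz scale0r addr0.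
have [to|to] := eqVneq t 1; first by constructor 2; rewrite xE to scale1r addrC subrK.
constructor 3; apply/oedgeP; first exact: orT.
by exists t; rewrite !lt_neqAle eq_sym tz to.
Qed.

Lemma oedge_meet K i L j x : K \in T -> L \in T -> oedge K i x -> hull [:: ea L j; eb L j] x ->
  (K = L /\ i = j) \/ nbr K i L j.
Proof.
move=> KT LT ox ex; have hL := orT LT; have [l1 l2 l3] := ox.
have [h1 h2 h3] := (edge_hullP j x hL).1 ex.
have [KL|KL] := eqVneq K L.
  left; split=> //; subst L; case: (ord3_cases i j) => E //; exfalso; rewrite E in h1.
    by move: l2; rewrite h1 ltxx.
  by move: l3; rewrite h1 ltxx.
right; have [j' hn] := oedge_nbrP KT LT KL ox (edge_sub_hull hL ex).
have [m1 m2 m3] := oedge_nbr (orT KT) hL hn ox.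
by case: (ord3_cases j' j) h1 => E h; rewrite E //; rewrite E in h; lra.
Qed.

Lemma free_meet K i L j x : K \in T -> L \in T -> free K i -> free L j ->
  hull [:: ea K i; eb K i] x -> hull [:: ea L j; eb L j] x ->
  (K = L /\ i = j) \/ (x = ea K i \/ x = eb K i) /\ (x = ea L j \/ x = eb L j).
Proof.
move=> KT LT fK fL Kx Lx.
case: (edge_endpoint KT Kx) => hK; try by
  (case: (edge_endpoint LT Lx) => hL; [by right; split; auto..|];
   have [[-> ->]|hn] := oedge_meet LT KT hL Kx; [by left|];
   rewrite (nbr_nfree KT hn) in fL).
have [[-> ->]|hn] := oedge_meet KT LT hK Lx; first by left.
by rewrite (nbr_nfree LT hn) in fK.
Qed.

(** * Chains of boundary edges *)

Section Boundary.
Local Notation P := (closure Omega `\` Omega).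

(** If all free edges stayed away from [x], one could pick a nearby boundary point that is no mesh
    vertex. It would lie in the open part of a shared edge, hence inside Omega. *)
Lemma bd_free x : P x -> exists K i, [/\ K \in T, free K i & hull [:: ea K i; eb K i] x].
Proof.
move=> Px; apply: contrapT => no.
have h1 : \forall y \near x, forall K, K \in T -> forall i, free K i ->
    ~ hull [:: ea K i; eb K i] y.
  apply: near_seq => K KT; apply: near_forall => i.
  have [fr|fr] := boolP (free K i); last exact: pt_nearW.
  have /near_nhull : ~ hull [:: ea K i; eb K i] x by move=> h; apply: no; exists K, i.
  exact: filterS.
move/nbhs_ballP: h1 => [e /= e0 he].
have [y [Py xy yF]] := bdperf [seq x <- flatten [seq verts K | K <- T] | true] Px e0.
have [cy nOy] := Py; have [K KT Ky] := coverT cy.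
have [i hi] := hull_oK (orT KT) Ky (fun h => nOy (oK_sub KT h)).
have nv m : y <> vt K m.
  move=> E; move/negP: yF; apply; rewrite filter_predT; apply/flattenP.
  by exists (verts K); [exact: map_f|apply/mem_verts; exists m].
case: (edge_endpoint KT hi) => [/nv//|/nv//|oy].
have := he y xy K KT i; have [fr /(_ isT)//|/nfreeP[L [j [LT hn]]] _] := boolP (free K i).
by apply: nOy; exact: (nbr_edge_in KT LT hn).
Qed.

Lemma free_bd K i x : K \in T -> free K i -> hull [:: ea K i; eb K i] x -> P x.
Proof.
move=> KT /freeP fr hx; split; last exact: (free_edge_out KT fr hx).
by apply: (hullT KT); exact: (edge_sub_hull (orT KT) hx).
Qed.

Local Notation I := (seq_sub T * 'I_3)%type.
Definition hea (h : seq_sub T * 'I_3) := ea (val h.1) h.2.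
Definition heb (h : seq_sub T * 'I_3) := eb (val h.1) h.2.

(** A real chain of free edges with boundary [A] minus [B], the boundary being expressed by its
    pairing with all functions. *)
Definition bdchain (c : I -> R) A B :=
  (forall h, ~~ free (val h.1) h.2 -> c h = 0) /\
  forall f : pt R -> R, \sum_h c h * (f (hea h) - f (heb h)) = f A - f B.

Lemma bdchain_refl A : exists c, bdchain c A A.
Proof.
by exists (fun=> 0); split=> // f; rewrite subrr big1// => h _; rewrite mul0r.
Qed.

Lemma bdchain_trans A B C : (exists c, bdchain c A B) -> (exists c, bdchain c B C) ->
  exists c, bdchain c A C.
Proof.
move=> [c [c1 c2]] [c' [c'1 c'2]]; exists (fun h => c h + c' h); split.
  by move=> h hh; rewrite c1// c'1// addr0.
move=> f; under eq_bigr do rewrite mulrDl; rewrite big_split /= c2 c'2; ring.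
Qed.

Lemma bdchain_sym A B : (exists c, bdchain c A B) -> exists c, bdchain c B A.
Proof.
move=> [c [c1 c2]]; exists (fun h => - c h); split.
  by move=> h hh; rewrite c1// oppr0.
by move=> f; under eq_bigr do rewrite mulNr; rewrite sumrN c2 opprB.
Qed.

Lemma bdchain_edge K i A B : K \in T -> free K i -> A = ea K i \/ A = eb K i ->
  B = ea K i \/ B = eb K i -> exists c, bdchain c A B.
Proof.
move=> KT fr.
have h : exists c, bdchain c (ea K i) (eb K i).
  pose h0 : I := (SeqSub KT, i); exists (fun h => (h == h0)%:R); split.
    by move=> h nf; case: eqP => // E; move: nf; rewrite E /= fr.
  move=> f; rewrite (bigD1 h0)//= eqxx mul1r big1 ?addr0// => h /negbTE ->.
  by rewrite mul0r.
move=> [->|->] [->|->]//; by [exact: bdchain_refl|exact: bdchain_sym].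
Qed.

(** Being on a free edge reachable from [A] is a locally constant property along the boundary, and
    the boundary is connected. *)
Lemma bdchain_all K i L j A B : K \in T -> L \in T -> free K i -> free L j ->
  A = ea K i \/ A = eb K i -> B = ea L j \/ B = eb L j -> exists c, bdchain c A B.
Proof.
move=> KT LT fK fL hA hB.
have end_hull (M : tri R) m C : C = ea M m \/ C = eb M m -> hull [:: ea M m; eb M m] C.
  by move=> [->|->]; [exact: seg_hulll|exact: seg_hullr].
pose f x : Prop := exists M m, [/\ M \in T, free M m, hull [:: ea M m; eb M m] x &
  exists c, bdchain c A (ea M m)].
have conn M m N n x : M \in T -> N \in T -> free M m -> free N n ->
    hull [:: ea M m; eb M m] x -> hull [:: ea N n; eb N n] x ->
    (exists c, bdchain c A (ea M m)) -> exists c, bdchain c A (ea N n).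
  move=> MT NT fM fN Mx Nx hc; have [[<- <-]//|[h1 h2]] := free_meet MT NT fM fN Mx Nx.
  apply: bdchain_trans (hc) _; apply: (@bdchain_trans _ x).
    by apply: bdchain_edge fM _ h1 => //; left.
  by apply: bdchain_edge fN h2 _ => //; left.
have fA : f A.
  exists K, i; split=> //; first exact: end_hull.
  by apply: bdchain_edge fK hA _ => //; left.
have fAB : f A = f B.
  apply: (loc_const_connected (f := f) bdconn).
  - move=> x Px.
    have : \forall y \near x, forall M, M \in T -> forall m, hull [:: ea M m; eb M m] y ->
        hull [:: ea M m; eb M m] x.
      apply: near_seq => M MT; apply: near_forall => m.
      have [h|/near_nhull] := pselect (hull [:: ea M m; eb M m] x); first exact: pt_nearW.
      by apply: filterS.
    apply: filterS => y hy Py; apply/propext; split.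
      by move=> [M [m [MT fM My hc]]]; exists M, m; split=> //; exact: hy.
    move=> [M [m [MT fM Mx hc]]]; have [N [n [NT fN Ny]]] := bd_free Py.
    exists N, n; split=> //; exact: conn Mx (hy N NT n Ny) hc.
  - by apply: (free_bd KT fK); exact: end_hull.
  - by apply: (free_bd LT fL); exact: end_hull.
move: fA; rewrite fAB => -[M [m [MT fM MB hc]]].
apply: bdchain_trans (conn M m L j B MT LT fM fL MB (end_hull _ _ _ hB) hc) _.
by apply: bdchain_edge fL _ hB => //; left.
Qed.

(** Fixes a base vertex and a boundary chain to it from every mesh vertex outside Omega, so that
    defects of a chain on the boundary can be transported to one point. *)
Lemma bdchain_vertex : T != [::] -> exists A0 (g : pt R -> I -> R), forall h X,
  X = hea h \/ X = heb h -> ~ Omega X -> bdchain (g X) X A0.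
Proof.
move=> T0; have [K0 K0T] : exists K0, K0 \in T.
  by case: T T0 => [//|K0 T'] _; exists K0; exact: mem_head.
have [K [i [KT _ fr]]] := exit_edge (Z := predT) K0T isT.
have {}fr : free K i by apply/freeP => L j LT; exact: fr.
exists (ea K i), (fun X => xget (fun=> 0) [set c | bdchain c X (ea K i)]) => h X hX nX.
case: xgetP => [c _ //|no]; exfalso.
have hh := ssvalP h.1; have hK := orT hh.
have Kx : hull [:: ea (val h.1) h.2; eb (val h.1) h.2] X.
  by case: hX => ->; [exact: seg_hulll|exact: seg_hullr].
have PX : P X by split=> //; apply: (hullT hh); exact: edge_sub_hull Kx.
have [L [j [LT fL LX]]] := bd_free PX.
have Xv : X \in verts L.
  apply: (vert_in hh LT (edge_sub_hull (orT LT) LX)).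
  by case: hX => ->; apply/mem_verts; [exists (nx h.2)|exists (nx (nx h.2))].
have XL : X = ea L j \/ X = eb L j.
  case: (edge_endpoint LT LX) => [|  |[l1 l2 l3]]; [by left|by right|].
  case/mem_verts: Xv => m Xm; move: l1; rewrite Xm !lam_vt ?orT//.
  by case: (ord3_cases j m) => ->; [rewrite eqxx => /eqP; rewrite oner_eq0|left|right].
have [c hc] := bdchain_all LT KT fL fr XL (or_introl erefl).
exact: (no c).
Qed.
End Boundary.

End MeshTopology.

(** * Discrete potentials for constant jumps *)

Section Glue.

Local Notation I := (seq_sub T * 'I_3)%type.

Definition hnbr (h h' : I) := nbr (val h.1) h.2 (val h'.1) h'.2.
Definition hfree (h : I) := free (val h.1) h.2.

(** The same edge seen from the other triangle. Free edges are fixed, so sums over the shared edges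
    can be reindexed by this involution. *)
Definition mate (h : I) : I := odflt h [pick h' | hnbr h h'].

Lemma hnbr_uniq h h1 h2 : hnbr h h1 -> hnbr h h2 -> h1 = h2.
Proof.
case: h1 h2 => [k1 i1] [k2 j2] n1 n2.
have [e1 e2] := nbr_uniq (ssvalP _) (ssvalP _) (ssvalP _) n1 n2.
by rewrite /= in e1 e2; rewrite (val_inj e1) e2.
Qed.

Lemma mate_eq h h' : hnbr h h' -> mate h = h'.
Proof.
move=> hn; rewrite /mate; case: pickP => [h2 hn2|/(_ h')]; last by rewrite hn.
exact: hnbr_uniq hn2 hn.
Qed.

Lemma mate_nbr h : ~~ hfree h -> hnbr h (mate h).
Proof.
move=> /nfreeP[L [j [LT hn]]].
by rewrite (mate_eq (h' := (SeqSub LT, j))).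
Qed.

Lemma hnbr_sym h h' : hnbr h h' -> hnbr h' h.
Proof. exact: nbr_sym. Qed.

Lemma hnbr_nfree h h' : hnbr h h' -> hfree h = false.
Proof. by move=> hn; apply: nbr_nfree hn; exact: ssvalP. Qed.

Lemma mateK h : ~~ hfree h -> mate (mate h) = h.
Proof. by move=> /mate_nbr/hnbr_sym/mate_eq. Qed.

Lemma mate_nfree h : ~~ hfree h -> ~~ hfree (mate h).
Proof. by move=> /mate_nbr/hnbr_sym/hnbr_nfree ->. Qed.

Lemma mate_free h : hfree h -> mate h = h.
Proof.
move=> hf; rewrite /mate; case: pickP => // h' /hnbr_nfree; by rewrite hf.
Qed.

Lemma sum_mate (F : I -> R) : \sum_(h | ~~ hfree h) F (mate h) = \sum_(h | ~~ hfree h) F h.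
Proof.
rewrite [RHS](reindex_onto mate mate) => [|h]; last exact: mateK.
apply: eq_bigl => h; have [fh|fh] := boolP (hfree h); first by rewrite mate_free// fh.
by rewrite mateK// eqxx mate_nfree.
Qed.

Lemma edge_sum0 (F : I -> R) : (forall h, hfree h -> F h = 0) ->
  (forall h h', hnbr h h' -> F h + F h' = 0) -> \sum_h F h = 0.
Proof.
move=> F0 Fn; rewrite (bigID hfree)/= big1 ?add0r//.
set S := \sum_(h | _) _; have : S + S = 0.
  rewrite {2}/S -sum_mate /S -big_split big1// => h fh.
  by apply: Fn; exact: mate_nbr.
by move=> h; lra.
Qed.

Local Notation sK h := (Num.sg (orient (val (h : I).1))).

Lemma telescope_edges (g : seq_sub T -> pt R -> R) :
  \sum_(h : I) sK h * (g h.1 (hea h) - g h.1 (heb h)) = 0.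
Proof.
rewrite -(pair_bigA _ (fun (k : seq_sub T) i => Num.sg (orient (val k)) *
  (g k (ea (val k) i) - g k (eb (val k) i)))) /= big1// => k _.
by rewrite sum3 /ea /eb /nx /=; ring.
Qed.

Section Potential.
Local Notation P := (closure Omega `\` Omega).
Variable G : tri R -> pt R -> R.
Hypothesis Gjump : forall K i L j, K \in T -> L \in T -> nbr K i L j ->
  G K (ea K i) - G L (ea K i) = G K (eb K i) - G L (eb K i).

Let J (h : I) : R := G (val h.1) (hea h) - G (val (mate h).1) (hea h).
(** The jump carried by the counterclockwise edge. Each shared edge occurs twice with equal
    contributions, hence the factor 1/2. *)
Let c0 (h : I) : R := if hfree h then 0 else 2^-1 * (sK h * J h).

(** Summation by parts: against a function that vanishes outside Omega, the boundary of the jump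
    chain is a sum, over the triangles, of boundaries of their closed contours weighted by [G].
    Hence the chain is a cycle relative to the boundary. *)
Lemma chain_interior (f : pt R -> R) : (forall x, ~ Omega x -> f x = 0) ->
  \sum_h c0 h * (f (hea h) - f (heb h)) = 0.
Proof.
move=> f0; pose t (h : I) := sK h * (G (val h.1) (hea h) * f (hea h) -
   G (val h.1) (heb h) * f (heb h)).
have t0 : \sum_h t h = 0.
  exact: (telescope_edges (fun k x => G (val k) x * f x)).
have tf h : hfree h -> t h = 0.
  move=> /freeP fr; have hT := ssvalP h.1.
  have out x : hull [:: hea h; heb h] x -> f x = 0.
    by move=> hx; apply: f0; exact: (free_edge_out hT fr hx).
  by rewrite /t !out ?mulr0 ?subrr ?mulr0//; [exact: seg_hullr|exact: seg_hulll].
have t1 : \sum_(h | ~~ hfree h) t h = 0.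
  by move: t0; rewrite (bigID hfree)/= big1 ?add0r.
rewrite (bigID hfree)/= big1 ?add0r; last first.
  by move=> h fh; rewrite /c0 fh mul0r.
have : \sum_(h | ~~ hfree h) (t h + t (mate h)) = 0 by rewrite big_split /= sum_mate t1 addr0.
move=> E; transitivity (2^-1 * \sum_(h | ~~ hfree h) (t h + t (mate h))).
  rewrite mulr_sumr; apply: eq_bigr => h nf; rewrite /c0 (negbTE nf).
  have hn := mate_nbr nf; have gj := Gjump (ssvalP h.1) (ssvalP (mate h).1) hn.
  rewrite -mulrA; congr (_ * _); rewrite /t /J.
  case: (nbr_sign (ssvalP h.1) (ssvalP (mate h).1) hn); rewrite -/(hea h) -/(heb h)
    -/(hea (mate h)) -/(heb (mate h)) => -[-> -> ->];
  rewrite !mulrBr; move: gj; rewrite -/(hea h) -/(heb h);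
  move: (G _ (hea h)) (G _ (hea h)) (G _ (heb h)) (G _ (heb h)) => a b c d;
  by move=> /(canRL (subrK _)) ->; ring.
by rewrite E mulr0.
Qed.

(* The closed chain is completed along the boundary; its winding number is the
   potential. *)
Lemma potential : exists b : tri R -> R, forall K i L j, K \in T -> L \in T -> nbr K i L j ->
  G K (ea K i) - G L (ea K i) = b K - b L.
Proof.
have [T0|T0] := eqVneq T [::]; first by exists (fun=> 0) => K i L j; rewrite T0 in_nil.
have [A0 [g hg]] := bdchain_vertex T0.
pose ind (x : pt R) : R := (`[< ~ Omega x >])%:R.
(* The defect of [c0] at a vertex outside Omega is carried along the boundary to [A0]. *)
pose c1 (h : I) : R := - \sum_h' c0 h' * (ind (hea h') * g (hea h') h - ind (heb h') * g (heb h') h).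
have c1f h : ~~ hfree h -> c1 h = 0.
  move=> nf; rewrite /c1 big1 ?oppr0// => h' _.
  have z X : X = hea h' \/ X = heb h' -> ind X * g X h = 0.
    move=> hX; rewrite /ind; case: asboolP => nX; last by rewrite mul0r.
    by rewrite (hg h' X hX nX).1 ?mulr0.
  by rewrite !z ?subrr ?mulr0//; auto.
have kir (f : pt R -> R) : \sum_h (c0 h + c1 h) * (f (hea h) - f (heb h)) = 0.
  under eq_bigr do rewrite mulrDl; rewrite big_split /=.
  have -> : \sum_h c1 h * (f (hea h) - f (heb h)) =
      - \sum_h' c0 h' * (ind (hea h') * (f (hea h') - f A0) - ind (heb h') * (f (heb h') - f A0)).
    rewrite /c1; under eq_bigr do rewrite mulNr mulr_suml.
    rewrite sumrN exchange_big /=; congr (- _); apply: eq_bigr => h' _.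
    have e X : X = hea h' \/ X = heb h' ->
        ind X * (f X - f A0) = \sum_h ind X * g X h * (f (hea h) - f (heb h)).
      move=> hX; rewrite /ind; case: asboolP => nX; last first.
        by rewrite mul0r big1// => h _; rewrite !mul0r.
      by rewrite -(hg h' X hX nX).2 mul1r; apply: eq_bigr => h _; rewrite mul1r.
    rewrite (e (hea h')); last by left.
    rewrite (e (heb h')); last by right.
    rewrite -sumrB mulr_sumr; apply: eq_bigr => h _; ring.
  (* Subtracting the constant [f A0] changes no difference, and the factor [1 - ind] makes the
     function admissible for [chain_interior]. *)
  have z1 : \sum_h c0 h * ((1 - ind (hea h)) * (f (hea h) - f A0) -
      (1 - ind (heb h)) * (f (heb h) - f A0)) = 0.
    apply: (chain_interior (f := fun x => (1 - ind x) * (f x - f A0))) => x nx.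
    by rewrite /ind asboolT// subrr mul0r.
  rewrite -sumrB -[RHS]z1; apply: eq_bigr => h _; ring.
pose c h := c0 h + c1 h; pose he (h : I) := (hea h, heb h).
have [d hd] := vertices_generic.
have gen h : cross ((he h).2 - (he h).1) d != 0.
  apply: hd; [exact: ssvalP|exact: ssvalP|].
  by rewrite eq_sym; exact: (edge_neq h.2 (orT (ssvalP h.1))).
pose N := winding d c he.
pose cen K := \sum_m (3^-1 : R) *: vt K m.
have cenK K : K \in T -> oK K (cen K).
  by move=> KT m; rewrite (lam_uniq (c := fun=> 3^-1)) ?orT// sum3; field.
have Nconst K y : K \in T -> oK K y -> N y = N (cen K).
  move=> KT Ky; apply: (loc_const_connected (f := N) (S := oK K)) => //; last exact: cenK.
    apply: convex_connected => u v t hu hv t0 t1 m; rewrite lam_line.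
    by apply: convex_gt0.
  move=> u hu; have nu h : ~ hull [:: (he h).1; (he h).2] u.
    move=> Lu; have LT := ssvalP h.1; have := edge_hullP h.2 u (orT LT) => -[+ _].
    move=> /(_ Lu)[l1 _ _].
    have [E|KL] := eqVneq K (val h.1); first by have := hu h.2; rewrite E l1 ltxx.
    have [m hm] := conf_zero KT LT KL (oK_hull (orT KT) hu) (edge_sub_hull (orT LT) Lu).
    by have := hu m; rewrite hm ltxx.
  by have := winding_loc_const gen kir nu; apply: filterS => v hv _.
(* The winding number is constant on each open triangle, so its value at the centroid represents
   it. *)
exists (fun K => N (cen K)) => K i L j KT LT hn.
have hK := orT KT; have hL := orT LT.
pose h1 : I := (SeqSub KT, i); pose h2 : I := (SeqSub LT, j).
have hn1 : hnbr h1 h2 by [].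
have h12 : h1 != h2.
  by apply/eqP => -[E _]; case/andP: hn => /eqP E' _; apply: E'.
have nf1 := hnbr_nfree hn1; have nf2 := hnbr_nfree (hnbr_sym hn1).
pose x := ea K i + 2^-1 *: (eb K i - ea K i).
have ox : oedge K i x by apply/oedgeP => //; exists 2^-1; split=> //; lra.
have ox2 := oedge_nbr hK hL hn ox.
pose Jp := pred2 h1 h2.
have j1 h : ~~ Jp h -> ~ hull [:: (he h).1; (he h).2] x.
  move=> /norP[n1 n2] hx; have MT := ssvalP h.1.
  have [[E1 E2]|hn'] := oedge_meet KT MT ox hx.
    move/eqP: n1; apply; rewrite /h1 E2; case: h {hx n2 MT E2} E1 => k m /= E1.
    by congr (_, _); exact: val_inj.
  have hn2 : hnbr h1 h by [].
  by move/eqP: n2; apply; exact: hnbr_uniq hn2 hn1.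
have j2 h : Jp h -> exists t : R, [/\ 0 < t, t < 1 & x = (he h).1 + t *: ((he h).2 - (he h).1)].
  by move=> /orP[]/eqP ->; [exact/(oedgeP i x hK)|exact/(oedgeP j x hL)].
have [r r0 hr] := winding_jump c gen j1 j2.
have : \forall y \near x, [/\ 0 < lam K (nx i) y, 0 < lam K (nx (nx i)) y,
    0 < lam L (nx j) y & 0 < lam L (nx (nx j)) y].
  have [_ k2 k3] := ox; have [_ l2 l3] := ox2.
  near=> y; split; near: y; exact: lam_near_gt0.
move=> /(near_line d)[e e0 he'].
pose s := Num.min (e / 2) (r / 2).
have s0 : 0 < s by rewrite lt_min; apply/andP; split; lra.
have se : `|s| < e by rewrite gtr0_norm// gt_min; apply/orP; left; lra.
have sr : s < r by rewrite gt_min; apply/orP; right; lra.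
have [p1 p2 p3 p4] := he' s se.
have se' : `|- s| < e by rewrite normrN.
have := he' (- s) se'; rewrite scaleNr => -[q1 q2 q3 q4].
have Dgen := gen h1; set D := cross _ d in Dgen.
have lamK (u : R) : orient K * lam K i (x + u *: d) = u * D.
  rewrite -cross_edge// /D /he /h1 /hea /heb /x /cross /= /GRing.scale /=.
  by move: (ea K i) (eb K i) => [a1 a2] [b1 b2] /=; field.
have lamL y : lam K i y = lam K i (vt L j) * lam L j y by exact: nbr_lam.
have op := nbr_opp KT LT hn.
have oKy y : 0 < lam K i y -> 0 < lam K (nx i) y -> 0 < lam K (nx (nx i)) y -> oK K y.
  by move=> a b e1 m; case: (ord3_cases i m) => ->.
have oLy y : lam K i y < 0 -> 0 < lam L (nx j) y -> 0 < lam L (nx (nx j)) y -> oK L y.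
  move=> a b e1 m; case: (ord3_cases j m) => -> //.
  by move: a; rewrite lamL nmulr_rlt0.
have sJ (F : I -> R) : \sum_(h | Jp h) F h = F h1 + F h2.
  rewrite (bigD1 h1) /=; last by rewrite eqxx.
  rewrite (bigD1 h2) /=; last by rewrite eqxx orbT eq_sym.
  rewrite big1 ?addr0// => h /andP[/andP[/orP[]/eqP -> h1n h2n]].
    by rewrite eqxx in h1n.
  by rewrite eqxx in h2n.
have cE1 : c h1 = 2^-1 * (Num.sg (orient K) * (G K (hea h1) - G L (hea h1))).
  by rewrite /c c1f ?nf1// addr0 /c0 nf1 /J (mate_eq hn1).
have cE2 : c h2 = 2^-1 * (Num.sg (orient L) * (G L (hea h2) - G K (hea h2))).
  by rewrite /c c1f ?nf2// addr0 /c0 nf2 /J (mate_eq (hnbr_sym hn1)).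
have := hr s s0 sr; rewrite sJ -/D cE1 cE2 [he h2]/= [_.2]/= [_.1]/=.
have gj := Gjump KT LT hn.
(* The two copies of the edge contribute equally, which absorbs the factor 1/2. *)
have -> : 2^-1 * (Num.sg (orient K) * (G K (hea h1) - G L (hea h1))) * Num.sg D +
    2^-1 * (Num.sg (orient L) * (G L (hea h2) - G K (hea h2))) *
      Num.sg (cross (heb h2 - hea h2) d) =
    Num.sg (orient K) * Num.sg D * (G K (ea K i) - G L (ea K i)).
  rewrite /D /he /hea /heb /=.
  case: (nbr_sign KT LT hn) => -[-> -> ->]; first by field.
  rewrite -[ea K i - eb K i]opprB.
  have -> : cross (- (eb K i - ea K i)) d = - cross (eb K i - ea K i) d.
    by rewrite /cross /=; ring.
  by rewrite sgrN; move: gj => /(canRL (subrK _)) ->; field.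
have sgl (u : R) : Num.sg (orient K) * Num.sg (lam K i (x + u *: d)) = Num.sg u * Num.sg D.
  by rewrite -!sgrM lamK.
have := sgl s; rewrite (gtr0_sg s0) mul1r => sg1.
have := sgl (- s); rewrite sgrN (gtr0_sg s0) scaleNr mulN1r => sg2.
have sK2 : Num.sg (orient K) * Num.sg (orient K) = 1 by rewrite -expr2 sqr_sg hK.
have D2 : Num.sg (orient K) * Num.sg D != 0 by rewrite mulf_neq0 ?sgr_eq0.
have e1 : Num.sg (lam K i (x + s *: d)) = Num.sg (orient K) * Num.sg D.
  by rewrite -sg1 mulrA sK2 mul1r.
have e2 : Num.sg (lam K i (x - s *: d)) = - (Num.sg (orient K) * Num.sg D).
  by rewrite -mulrN -sg2 mulrA sK2 mul1r.
move: e1 e2 D2; rewrite -sgrM; case: sgrP => hD e1 e2 D2; first by rewrite eqxx in D2.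
  rewrite -/N (Nconst K (x + s *: d)) ?(Nconst L (x - s *: d))// => [E||].
  - by rewrite E mul1r.
  - by apply: oLy => //; rewrite -sgr_lt0 e2 ltrN10.
  - by apply: oKy => //; rewrite -sgr_gt0 e1.
rewrite -/N (Nconst L (x + s *: d)) ?(Nconst K (x - s *: d))// => [E||].
- by apply: oppr_inj; rewrite -mulN1r -E opprB.
- by apply: oKy => //; rewrite -sgr_gt0 e2 opprK.
- by apply: oLy => //; rewrite -sgr_lt0 e1 ltrN10.
Unshelve. all: by end_near.
Qed.
End Potential.

End Glue.

(** * Integration by parts on the mesh and weak divergence *)

Section MeshIntegrals.
Implicit Types (F G V psi phi : pt R -> R) (f g : tri R -> pt R -> R).
Notation mu := (@leb2 R).
Notation mpt := (measurableTypeR R * measurableTypeR R)%type.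

Local Notation I := (seq_sub T * 'I_3)%type.
Local Notation sK h := (Num.sg (orient (val (h : I).1))).

Definition rep F f := {in T, forall K, ae_on (hull (verts K)) (fun x => F x = f K x)}.
Definition polys k f := {in T, forall K, polyn k (f K)}.

(** A measurable representative of a piecewise function. It is zero on the edges, a null set. *)
Definition pw f x : R := \sum_(k : seq_sub T) \1_(oK (val k)) x * f (val k) x.

Lemma oK_disjoint K L x : K \in T -> L \in T -> oK K x -> hull (verts L) x -> K = L.
Proof.
move=> KT LT Kx Lx; apply/eqP/negPn/negP => KL.
have [m hm] := conf_zero KT LT KL (oK_hull (orT KT) Kx) Lx.
by have := Kx m; rewrite hm ltxx.
Qed.

Lemma pw_in f K x : K \in T -> oK K x -> pw f x = f K x.
Proof.
move=> KT Kx; rewrite /pw (bigD1 (SeqSub KT))//= indicE mem_set// mul1r big1 ?addr0//.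
move=> k hk; rewrite indicE memNset ?mul0r// => kx; move/eqP: hk; apply.
apply: val_inj; apply/esym; apply: oK_disjoint Kx (oK_hull (orT (ssvalP k)) kx) => //.
exact: ssvalP.
Qed.

Lemma hull_oK_negl K : K \in T -> mu.-negligible (hull (verts K) `\` oK K).
Proof.
move=> KT; have hK := orT KT.
apply: negligibleS (negligible_bigcup_countable (fun i => lam_line_negligible i hK)).
move=> x [Kx nx]; have [i hi] := hull_oK hK Kx nx; exists i => //.
by have [] := (edge_hullP i x hK).1 hi.
Qed.

Lemma cover_negl : mu.-negligible (Omega `\` [set x | exists2 K, K \in T & oK K x]).
Proof.
apply: negligibleS (negligible_bigcup_countable
  (fun k : seq_sub T => hull_oK_negl (ssvalP k))) => x [Ox nx].
have [K KT Kx] := coverT (subset_closure Ox).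
exists (SeqSub KT) => //; split=> //= oKx; apply: nx; by exists K.
Qed.

Lemma rep_oK F f : {in T, forall K, ae_on (oK K) (fun x => F x = f K x)} -> rep F f.
Proof. by move=> h K KT; apply: ae_onD (hull_oK_negl KT) (h K KT). Qed.

Lemma rep_pw f : rep (pw f) f.
Proof. by apply: rep_oK => K KT; apply: ae_onW => x; exact: pw_in. Qed.

Lemma ae_cover (P : pt R -> Prop) : {in T, forall K, ae_on (hull (verts K)) P} -> ae_on Omega P.
Proof.
move=> h; apply: ae_onD cover_negl _; apply/ae_onE.
have hk (k : seq_sub T) := (ae_onE _ _).1 (h (val k) (ssvalP k)).
apply: negligibleS (negligible_bigcup_countable hk) => x [[K KT Kx] nP].
by exists (SeqSub KT) => //; split=> //; exact: (oK_hull (orT KT)).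
Qed.

Lemma rep_ae F G f : rep F f -> rep G f -> ae_on Omega (fun x => F x = G x).
Proof.
move=> hF hG; apply: ae_cover => K KT.
by apply: ae_on2 (hF K KT) (hG K KT) _ => x _ -> ->.
Qed.

Lemma ae_rep F G f : rep F f -> ae_on Omega (fun x => F x = G x) -> rep G f.
Proof.
move=> hF h; apply: rep_oK => K KT.
have h1 := ae_onS (fun x _ => id) (oK_hull (orT KT)) (hF K KT).
have h2 := ae_onS (fun x _ => id) (oK_sub KT) h.
by apply: ae_on2 h1 h2 _ => x _ -> ->.
Qed.

Lemma rep_uniq k F f g K : K \in T -> polyn k (f K) -> polyn k (g K) -> rep F f -> rep F g -> f K = g K.
Proof.
by move=> KT pf pg hf hg; apply: (@restr_poly_uniq _ k F _ _ K (orT KT)); split=> //; [exact: hf|exact: hg].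
Qed.

Lemma mesh_box : exists2 r : R, 0 < r & closure Omega `<=` box r.
Proof.
have [r r0 hr] := bounded_box bO; exists r => //.
have /closure_id -> : closed (box r : set (pt R)).
  by apply: compact_closed; [exact: norm_hausdorff|exact: box_compact].
exact: closureS.
Qed.

Lemma oK_box r K : closure Omega `<=` box r -> K \in T -> oK K `<=` box r.
Proof. by move=> hr KT x hx; apply/hr/(hullT KT); exact: (oK_hull (orT KT)). Qed.

Lemma pw_measurable k f : polys k f -> measurable_fun setT (pw f : mpt -> R).
Proof.
move=> pf; apply: measurable_sum => K; apply: measurable_funM.
  exact: measurable_indic (oK_measurable _).
apply: continuous_measurable2; exact: polyn_continuous (pf _ (ssvalP K)).
Qed.

Lemma pw_L2 k f : polys k f -> L2 Omega (pw f).
Proof.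
move=> pf; have [r r0 hr] := mesh_box.
rewrite /L2.
have [C hC] : exists C : R, forall x, box r x -> `|pw f x| <= C.
  have hk (K : seq_sub T) := polyn_bounded r (pf _ (ssvalP K)).
  have /choice[C hC] := hk.
  exists (\sum_K `|C K|) => x xr; rewrite (le_trans (ler_norm_sum _ _ _))// ler_sum// => K _.
  rewrite normrM -[leRHS]mul1r ler_pM//; last by rewrite (le_trans (hC K x xr))// ler_norm.
  by rewrite indicE; case: (_ \in _); rewrite ?normr0 ?normr1.
apply: (Lfun2_bounded (r := r) (C := C)).
- exact: open_measurable2.
- by apply: subset_trans hr; exact: subset_closure.
- exact: pw_measurable pf.
- by move=> x /subset_closure /hr; exact: hC.
Qed.

Lemma L2_ext F G : L2 Omega F -> (forall x, Omega x -> F x = G x) -> L2 Omega G.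
Proof.
rewrite /L2 => hF h; rewrite (_ : G \_ Omega = F \_ Omega)//.
by apply/funext => x; rewrite !patchE; case: ifPn => // /set_mem /h ->.
Qed.

Lemma L2D F G (a b : R) : L2 Omega F -> L2 Omega G -> L2 Omega (fun x => a * F x + b * G x).
Proof.
rewrite /L2 => hF hG.
have -> : (fun x => a * F x + b * G x) \_ Omega = (a *: (F \_ Omega) + b *: (G \_ Omega)).
  apply/funext => x; rewrite !patchE fctE /= /GRing.scale /= !patchE.
  have p0 : (point : R) = 0 by [].
  by rewrite p0 /GRing.scale /=; case: ifP => // _; rewrite !mulr0 addr0.
have p1 : (1 <= 2%:E :> \bar R)%E by rewrite lee_fin; lra.
have [h0 hl] := @Lfun_submod_closed _ _ R mu 2%:E p1.
have hbG : b *: (G \_ Omega) + 0 \in Lfun mu 2%:E by exact: hl.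
by rewrite addr0 in hbG; exact: hl.
Qed.

Lemma Lfun2_dom F G : measurable_fun setT (F : mpt -> R) -> G \in Lfun mu 2%:E ->
  (forall x, `|F x| <= `|G x|) -> F \in Lfun mu 2%:E.
Proof.
move=> mF hG FG; rewrite inE; apply/andP; split; rewrite inE //=.
rewrite /finite_norm unlock /= poweR_lty//.
have /integrableP[mG2] := Lfun2_integrable_sqr hG; apply: le_lt_trans.
apply: ge0_le_integral => //.
- apply/measurable_EFinP; apply: (measurableT_comp (measurable_powR _)) => //.
  exact: measurableT_comp.
- exact: measurableT_comp.
- move=> x _; rewrite /= lee_fin powR_mulrn// normrX ler_pXn2r ?nnegrE//.
Qed.

Lemma L2_sub (A B : set (pt R)) F : measurable (A : set mpt) -> A `<=` B -> L2 B F -> L2 A F.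
Proof.
move=> mA AB; rewrite /L2 => hF.
have E : F \_ A = (F \_ B) \_ A.
  apply/funext => x; rewrite !patchE; case: ifPn => // /set_mem Ax.
  by rewrite mem_set//; exact: AB.
apply: (Lfun2_dom _ hF).
  rewrite E; apply/(measurable_restrictT _ mA); apply: measurable_funTS.
  by move: hF; rewrite inE => /andP[/[!inE] /=].
by move=> x; rewrite E [X in `|X|]patchE; case: ifP => // _; rewrite normr0.
Qed.

(** The regularity that Green's formula needs; test functions and all their derivatives satisfy
    it. *)
Definition adm psi := continuous psi /\ exists r, forall x, ~ box r x -> psi x = 0.

Lemma adm_Lfun2 psi : adm psi -> psi \in Lfun mu 2%:E.
Proof. by move=> [c [r hr]]; exact: Lfun2_compact c (@box_compact _ r) hr. Qed.

Lemma test_adm phi a b : test_function Omega phi -> adm (pd a b phi).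
Proof.
move=> tp; split; first exact: test_continuous tp.
have [_ cs _] := tp; have [r r0 hr] := compact_box cs.
by exists r => x nx; apply: pd_out => /hr.
Qed.

Lemma int_integrable F psi : L2 Omega F -> adm psi ->
  mu.-integrable setT (EFin \o (fun x => (F \_ Omega) x * psi x)).
Proof. by move=> hF /adm_Lfun2 h; exact: Lfun2_integrable. Qed.

Lemma int_rep k F f psi : polys k f -> L2 Omega F -> rep F f -> adm psi ->
  \int[mu]_(x in Omega) (F x * psi x) =
  \sum_(K : seq_sub T) \int[mu]_x (\1_(oK (val K)) x * (f (val K) x * psi x)).
Proof.
move=> pf hF rF ap; rewrite Rintegral_restrict.
have mp : measurable_fun setT (psi : mpt -> R) by apply: continuous_measurable2; exact: ap.1.
have ik (K : seq_sub T) : mu.-integrable setT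
    (EFin \o (fun x => \1_(oK (val K)) x * (f (val K) x * psi x))).
  have [r r0 hr] := mesh_box.
  have [C hC] := polyn_bounded r (pf _ (ssvalP K)).
  have h2 : (f (val K)) \_ (oK (val K)) \in Lfun mu 2%:E.
    apply: (Lfun2_bounded (r := r) (C := C)).
    - exact: oK_measurable.
    - exact: oK_box hr (ssvalP K).
    - by apply: continuous_measurable2; exact: polyn_continuous (pf _ (ssvalP K)).
    - by move=> x /(oK_box hr (ssvalP K)); exact: hC.
  apply: eq_integrable (Lfun2_integrable h2 (adm_Lfun2 ap)) => // x _ /=.
  rewrite patchE indicE; case: (x \in _); first by rewrite mul1r.
  by rewrite !mul0r.
rewrite -(Rint_sum _ ik).2; apply: Rint_ae.
- have /measurable_EFinP := measurable_int mu (int_integrable hF ap); exact.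
- have /measurable_EFinP := measurable_int mu (Rint_sum (index_enum _) ik).1; exact.
have : ae_on Omega (fun x => F x = pw f x) by apply: rep_ae rF (rep_pw f).
move=> /ae_onE; apply: negligibleS => x /= hx.
have [Ox|nOx] := pselect (Omega x).
  split=> // E; apply: hx => _; rewrite patchE mem_set// E /pw mulr_suml.
  by apply: eq_bigr => K _; rewrite mulrA.
exfalso; apply: hx => _; rewrite patchE memNset// mul0r big1// => K _.
rewrite indicE memNset ?mul0r// => /(oK_sub (ssvalP K)); exact: nOx.
Qed.

Lemma tri_integrable K k p psi : polyn k p -> adm psi ->
  mu.-integrable setT (EFin \o (fun x => \1_(oK K) x * (p x * psi x))).
Proof.
move=> pp [cpsi [r hr]].
have [C hC] := polyn_bounded r pp.
have [D hD] := Gx_bounded cpsi hr.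
apply: (@oK_integrable _ K _ r (C * D)).
- by apply: continuous_measurable2 => x; apply: cvgM; [exact: polyn_continuous pp x|exact: cpsi].
- by move=> x nx; rewrite hr// mulr0.
- by move=> x xr; rewrite normrM ler_pM// hC.
Qed.

Lemma triD K k p q (psi chi : pt R -> R) : polyn k p -> polyn k q -> adm psi -> adm chi ->
  \int[mu]_x (\1_(oK K) x * (p x * psi x)) + \int[mu]_x (\1_(oK K) x * (q x * chi x)) =
  \int[mu]_x (\1_(oK K) x * (p x * psi x + q x * chi x)).
Proof.
move=> pp pq a1 a2; rewrite -RintegralD//; last 2 first.
- exact: tri_integrable pp a1.
- exact: tri_integrable pq a2.
by apply: eq_Rintegral => x _; rewrite mulrDr.
Qed.

Definition flux f g psi (h : I) : R :=
  sK h * (((heb h).2 - (hea h).2) * lint (hea h) (heb h) (fun x => f (val h.1) x * psi x) -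
          ((heb h).1 - (hea h).1) * lint (hea h) (heb h) (fun x => g (val h.1) x * psi x)).

Lemma lint_ext A B F G : (forall x, hull [:: A; B] x -> F x = G x) -> lint A B F = lint A B G.
Proof.
move=> h; apply: eq_Rintegral => t /set_mem; rewrite /= in_itv /= => /andP[t0 t1].
by apply: h; apply/seg_hullP; exists t.
Qed.

Lemma seg_cont A B : continuous (fun t : R => A + t *: (B - A)).
Proof. exact: line_cont. Qed.

Lemma lint_lin A B F G (a b : R) : continuous F -> continuous G ->
  lint A B (fun x => a * F x + b * G x) = a * lint A B F + b * lint A B G.
Proof.
move=> cF cG.
have ci (H : pt R -> R) : continuous H -> (@lebesgue_measure R).-integrable `[0%R, 1%R]
    (EFin \o (fun t : R => H (A + t *: (B - A)))).
  move=> cH; apply: (@continuous_compact_integrable R _ _ (@segment_compact R 0 1)).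
  apply: continuous_subspaceT => t; apply: continuous_comp; [exact: seg_cont|exact: cH].
rewrite /lint /lint01 -!RintegralZl//; try exact: ci.
rewrite -RintegralD//.
  apply: (ci (fun x => a * F x)) => x; apply: cvgM; [exact: cvg_cst|exact: cF].
apply: (ci (fun x => b * G x)) => x; apply: cvgM; [exact: cvg_cst|exact: cG].
Qed.

Lemma lint_sym A B F : continuous F -> lint B A F = lint A B F.
Proof.
move=> cF; rewrite /lint -[RHS]lint01_rev; last first.
  by move=> t; apply: continuous_comp; [exact: seg_cont|exact: cF].
congr lint01; apply/funext => t; congr F.
by pt_ring.
Qed.

Lemma lint_gt0 A B F (t : R) : continuous F -> (forall x, 0 <= F x) -> 0 < t -> t < 1 ->
  0 < F (A + t *: (B - A)) -> 0 < lint A B F.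
Proof.
move=> cF F0 t0 t1 Ft; apply: (lint01_gt0 (t0 := t)) => //.
by move=> s; apply: continuous_comp; [exact: seg_cont|exact: cF].
Qed.

Lemma lint0 A B F : (forall x, hull [:: A; B] x -> F x = 0) -> lint A B F = 0.
Proof.
move=> h; rewrite (lint_ext (G := fun=> 0))// /lint /lint01 Rintegral_cst ?mul0r//.
Qed.

(** The jump of the normal component of [(f, g)], scaled by the edge length. *)
Definition jump f g (h h' : I) x : R :=
  ((heb h).2 - (hea h).2) * (f (val h.1) x - f (val h'.1) x) -
  ((heb h).1 - (hea h).1) * (g (val h.1) x - g (val h'.1) x).

Lemma flux_jump k f g psi h h' : polys k f -> polys k g -> continuous psi -> hnbr h h' ->
  flux f g psi h + flux f g psi h' =
  sK h * lint (hea h) (heb h) (fun x => jump f g h h' x * psi x).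
Proof.
move=> pf pg cpsi hn.
have cfp p : polyn k p -> continuous (fun x => p x * psi x).
  by move=> pp x; apply: cvgM; [exact: polyn_continuous pp x|exact: cpsi].
have := cfp _ (pf _ (ssvalP h.1)); have := cfp _ (pf _ (ssvalP h'.1)).
have := cfp _ (pg _ (ssvalP h.1)); have := cfp _ (pg _ (ssvalP h'.1)).
rewrite /jump /flux; move: (f (val h.1)) (f (val h'.1)) (g (val h.1)) (g (val h'.1)).
move=> p p' q q' c4 c3 c2 c1.
set d2 := (heb h).2 - _; set d1 := (heb h).1 - _.
have -> : (fun x => (d2 * (p x - p' x) - d1 * (q x - q' x)) * psi x) =
  (fun x => 1 * (d2 * (p x * psi x) + (- d2) * (p' x * psi x)) +
     1 * ((- d1) * (q x * psi x) + d1 * (q' x * psi x))).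
  by apply/funext => x; ring.
have cl (a b : R) (F G : pt R -> R) : continuous F -> continuous G ->
    continuous (fun x => a * F x + b * G x).
  by move=> cF cG x; apply: cvgD; apply: cvgM; by [exact: cvg_cst|exact: cF|exact: cG].
rewrite lint_lin; [|exact: cl|exact: cl]; rewrite lint_lin// lint_lin//.
case: (nbr_sign (ssvalP h.1) (ssvalP h'.1) hn); rewrite -/(hea h) -/(heb h)
  -/(hea h') -/(heb h') => -[-> -> ->].
  rewrite -/d1 -/d2; ring.
rewrite (lint_sym (hea h) (heb h) c2) (lint_sym (hea h) (heb h) c4) /d1 /d2; ring.
Qed.

Definition inO psi := forall x, ~ Omega x -> psi x = 0.

Lemma flux_free f g psi h : inO psi -> hfree h -> flux f g psi h = 0.
Proof.
move=> pO /freeP fr; have z F : lint (hea h) (heb h) (fun x => F x * psi x) = 0.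
  apply: lint0 => x hx; rewrite pO ?mulr0//.
  exact: (free_edge_out (ssvalP h.1) fr hx).
by rewrite /flux !z !mulr0 subrr mulr0.
Qed.

Definition matching f g := forall h h', hnbr h h' ->
  forall x, hull [:: hea h; heb h] x -> jump f g h h' x = 0.

Lemma flux_sum0 k f g psi : polys k f -> polys k g -> continuous psi -> inO psi ->
  matching f g -> \sum_h flux f g psi h = 0.
Proof.
move=> pf pg cpsi pO mt; apply: edge_sum0 => [h|h h' hn]; first exact: flux_free.
rewrite (flux_jump pf pg cpsi hn) lint0 ?mulr0// => x hx.
by rewrite (mt h h' hn x hx) mul0r.
Qed.

(** Partial derivatives are treated as divergences of fields with one zero component. *)
Definition zero_fam : tri R -> pt R -> R := fun _ _ => 0.

Section Direction.
(** The two coordinate directions are handled together: [green_x] and [green_y] are the instances,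
    with [s] the matching component of the rotated edge vector. *)
Variables (v : pt R) (s : pt R -> R).
Hypothesis green : forall K G Gv r, orient K != 0 -> continuous G -> continuous Gv ->
  (forall x, is_derive x v G (Gv x)) -> (forall x, ~ box r x -> G x = 0) ->
  (forall x, ~ box r x -> Gv x = 0) ->
  Num.sg (orient K) * \int[mu]_x (\1_(oK K) x * Gv x) =
  \sum_i s (eb K i - ea K i) * lint (ea K i) (eb K i) G.

Lemma green_tri K k p psi psiv : K \in T -> polyn k p -> adm psi -> adm psiv ->
  (forall x, is_derive x v psi (psiv x)) ->
  \int[mu]_x (\1_(oK K) x * (p x * psiv x)) + \int[mu]_x (\1_(oK K) x * ('D_v p x * psi x)) =
  Num.sg (orient K) * \sum_i s (eb K i - ea K i) * lint (ea K i) (eb K i) (fun x => p x * psi x).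
Proof.
move=> KT pp a1 a2 dpsi; have hK := orT KT.
have pD : polyn k ('D_v p) by apply: polyn_leq (polyn_D _ pp); exact: leq_pred.
rewrite (triD _ pp pD a2 a1); have [c1 [r1 h1]] := a1; have [c2 [r2 h2]] := a2.
pose r := Num.max r1 r2.
have bx q : q <= r -> box q `<=` box r.
  by move=> qr x [/=]; rewrite !in_itv /= -!ler_norml => ? ?; split;
    rewrite /= in_itv /= -ler_norml (le_trans _ qr).
have s1 x : ~ box r x -> psi x = 0 by move=> nx; apply: h1 => /bx h; apply/nx/h; rewrite le_max lexx.
have s2 x : ~ box r x -> psiv x = 0.
  by move=> nx; apply: h2 => /bx h; apply/nx/h; rewrite le_max lexx orbT.
have cp := polyn_continuous pp; have cD := polyn_continuous pD.
pose Gv x := p x * psiv x + 'D_v p x * psi x.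
have k1 : continuous (fun x => p x * psi x) by move=> x; apply: cvgM; [exact: cp|exact: c1].
have k2 : continuous Gv.
  by move=> x; apply: cvgD; apply: cvgM; [exact: cp|exact: c2|exact: cD|exact: c1].
have k3 x : is_derive x v (fun x => p x * psi x) (Gv x).
  have := is_deriveM (derivableP (@polyn_derivable R k p x v pp)) (dpsi x).
  by rewrite /Gv /GRing.scale /= [psi x * _]mulrC.
have k4 x : ~ box r x -> p x * psi x = 0 by move=> nx; rewrite s1 ?mulr0.
have k5 x : ~ box r x -> Gv x = 0 by move=> nx; rewrite /Gv s1 ?s2 ?mulr0 ?addr0.
by rewrite -(green hK k1 k2 k3 k4 k5) mulrA -expr2 sqr_sg hK mul1r.
Qed.

Definition flux1 f psi (h : I) : R :=
  sK h * (s (heb h - hea h) * lint (hea h) (heb h) (fun x => f (val h.1) x * psi x)).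

Lemma flux1_zero psi h : flux1 zero_fam psi h = 0.
Proof. by rewrite /flux1 lint0 ?mulr0// => x _; rewrite mul0r. Qed.

Lemma flux_dir k f psi psiv : polys k f -> adm psi -> adm psiv ->
  (forall x, is_derive x v psi (psiv x)) ->
  \sum_(K : seq_sub T) \int[mu]_x (\1_(oK (val K)) x * (f (val K) x * psiv x)) =
  \sum_h flux1 f psi h -
  \sum_(K : seq_sub T) \int[mu]_x (\1_(oK (val K)) x * ('D_v (f (val K)) x * psi x)).
Proof.
move=> pf a1 a2 dpsi; apply/eqP; rewrite -subr_eq opprK -big_split /=; apply/eqP.
rewrite -(pair_bigA _ (fun k i => flux1 f psi (k, i))) /=; apply: eq_bigr => K _.
by rewrite (green_tri (ssvalP K) (pf _ (ssvalP K)) a1 a2 dpsi) mulr_sumr.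
Qed.

Lemma weak_dir k f F V psi psiv : polys k f -> L2 Omega F -> rep F f ->
  L2 Omega V -> rep V (fun K => 'D_v (f K)) -> \sum_h flux1 f psi h = 0 ->
  adm psi -> adm psiv -> (forall x, is_derive x v psi (psiv x)) ->
  \int[mu]_(x in Omega) (F x * psiv x) = - \int[mu]_(x in Omega) (V x * psi x).
Proof.
move=> pf hF rF hV rV z a1 a2 dpsi.
have pD : polys k (fun K => 'D_v (f K)).
  by move=> K KT; apply: polyn_leq (polyn_D _ (pf K KT)); exact: leq_pred.
by rewrite (int_rep pf hF rF a2) (int_rep pD hV rV a1) (flux_dir pf a1 a2 dpsi) z sub0r.
Qed.
End Direction.

Local Notation flux_x := (flux1 (fun e => e.2)).
Local Notation flux_y := (flux1 (fun e => - e.1)).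

Lemma fluxE f g psi h : flux f g psi h = flux_x f psi h + flux_y g psi h.
Proof. by rewrite /flux /flux1 /=; ring. Qed.

Lemma zero_polys k : polys k zero_fam.
Proof. by move=> K KT; exact: polyn_cst. Qed.

Lemma weak_x k f F V psi psix : polys k f -> L2 Omega F -> rep F f ->
  L2 Omega V -> rep V (fun K => 'D_(1, 0) (f K)) -> matching f zero_fam ->
  adm psi -> adm psix -> inO psi -> (forall x, is_derive x (1, 0) psi (psix x)) ->
  \int[mu]_(x in Omega) (F x * psix x) = - \int[mu]_(x in Omega) (V x * psi x).
Proof.
move=> pf hF rF hV rV mt a1 a2 pO; apply: (weak_dir (@green_x R) pf hF rF hV rV _ a1 a2).
rewrite -[RHS](flux_sum0 pf (zero_polys k) a1.1 pO mt); apply: eq_bigr => h _.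
by rewrite fluxE flux1_zero addr0.
Qed.

Lemma weak_y k g F V psi psiy : polys k g -> L2 Omega F -> rep F g ->
  L2 Omega V -> rep V (fun K => 'D_(0, 1) (g K)) -> matching zero_fam g ->
  adm psi -> adm psiy -> inO psi -> (forall x, is_derive x (0, 1) psi (psiy x)) ->
  \int[mu]_(x in Omega) (F x * psiy x) = - \int[mu]_(x in Omega) (V x * psi x).
Proof.
move=> pf hF rF hV rV mt a1 a2 pO; apply: (weak_dir (@green_y R) pf hF rF hV rV _ a1 a2).
rewrite -[RHS](flux_sum0 (zero_polys k) pf a1.1 pO mt); apply: eq_bigr => h _.
by rewrite fluxE flux1_zero add0r.
Qed.

Lemma test_inO phi : test_function Omega phi -> inO phi.
Proof. by move=> [_ _ sub] x nx; apply: tsupp_out => /sub. Qed.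

Lemma test_derive_x phi x : test_function Omega phi -> is_derive x (1, 0) phi (pd 1 0 phi x).
Proof. by move=> [h _ _]; apply: derivableP; apply: diff_derivable; exact: (h 0 0). Qed.

Lemma test_derive_y phi x : test_function Omega phi -> is_derive x (0, 1) phi (pd 0 1 phi x).
Proof. by move=> [h _ _]; apply: derivableP; apply: diff_derivable; exact: (h 0 0). Qed.

Lemma intD F G psi chi : L2 Omega F -> L2 Omega G -> adm psi -> adm chi ->
  \int[mu]_(x in Omega) (F x * psi x + G x * chi x) =
  \int[mu]_(x in Omega) (F x * psi x) + \int[mu]_(x in Omega) (G x * chi x).
Proof.
move=> hF hG a1 a2; rewrite (Rintegral_restrict Omega F psi) (Rintegral_restrict Omega G chi).
rewrite -RintegralD//; last 2 first.
- exact: int_integrable.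
- exact: int_integrable.
rewrite Rintegral_mkcond; apply: eq_Rintegral => x _; rewrite !patchE.
by case: ifP => // _; rewrite !mul0r addr0.
Qed.

Lemma intB F G psi : L2 Omega F -> L2 Omega G -> adm psi ->
  \int[mu]_(x in Omega) ((F x - G x) * psi x) =
  \int[mu]_(x in Omega) (F x * psi x) - \int[mu]_(x in Omega) (G x * psi x).
Proof.
move=> hF hG a1; rewrite (Rintegral_restrict Omega F psi) (Rintegral_restrict Omega G psi).
rewrite -RintegralB//; last 2 first.
- exact: int_integrable.
- exact: int_integrable.
rewrite Rintegral_mkcond; apply: eq_Rintegral => x _; rewrite !patchE.
by case: ifP => // _; rewrite ?mulrBl// !mul0r subr0.
Qed.

Lemma flux_div k f g F G V phi : polys k f -> polys k g -> L2 Omega F -> L2 Omega G ->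
  rep F f -> rep G g -> L2 Omega V ->
  rep V (fun K x => 'D_(1, 0) (f K) x + 'D_(0, 1) (g K) x) -> test_function Omega phi ->
  \int[mu]_(x in Omega) (F x * pd 1 0 phi x + G x * pd 0 1 phi x) =
  \sum_h flux f g phi h - \int[mu]_(x in Omega) (V x * phi x).
Proof.
move=> pf pg hF hG rF rG hV rV tp.
have a0 : adm phi := test_adm 0 0 tp.
have a1 := test_adm 1 0 tp; have a2 := test_adm 0 1 tp.
have pDf : polys k (fun K => 'D_(1, 0) (f K)).
  by move=> K KT; apply: polyn_leq (polyn_D _ (pf K KT)); exact: leq_pred.
have pDg : polys k (fun K => 'D_(0, 1) (g K)).
  by move=> K KT; apply: polyn_leq (polyn_D _ (pg K KT)); exact: leq_pred.
have pV : polys k (fun K x => 'D_(1, 0) (f K) x + 'D_(0, 1) (g K) x).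
  by move=> K KT; apply: polynD; [exact: pDf|exact: pDg].
rewrite intD// (int_rep pf hF rF a1) (int_rep pg hG rG a2) (int_rep pV hV rV a0).
have E1 := flux_dir (s := fun e => e.2) (@green_x R) pf a0 a1 (fun x => test_derive_x x tp).
have E2 := flux_dir (s := fun e => - e.1) (@green_y R) pg a0 a2 (fun x => test_derive_y x tp).
rewrite [X in X + _ = _]E1 [X in _ + X = _]E2.
under [in RHS]eq_bigr do rewrite fluxE.
rewrite big_split /= addrACA -opprD; congr (_ - _); rewrite -big_split /=.
apply: eq_bigr => K _; rewrite (triD _ (pDf _ (ssvalP K)) (pDg _ (ssvalP K)) a0 a0).
by apply: eq_Rintegral => x _; rewrite mulrDl.
Qed.

Lemma weak_div_fwd k f g F G V : polys k f -> polys k g -> L2 Omega F -> L2 Omega G ->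
  rep F f -> rep G g -> L2 Omega V ->
  rep V (fun K x => 'D_(1, 0) (f K) x + 'D_(0, 1) (g K) x) -> matching f g ->
  forall phi, test_function Omega phi ->
  \int[mu]_(x in Omega) (F x * pd 1 0 phi x + G x * pd 0 1 phi x) =
  - \int[mu]_(x in Omega) (V x * phi x).
Proof.
move=> pf pg hF hG rF rG hV rV mt phi tp.
rewrite (flux_div pf pg hF hG rF rG hV rV tp).
rewrite (flux_sum0 pf pg _ (test_inO tp) mt) ?sub0r//.
exact: (test_continuous (a := 0) (b := 0) tp).
Qed.

Lemma edge_oK K (h : I) x : K \in T -> hull [:: hea h; heb h] x -> ~ oK K x.
Proof.
move=> KT hx Kx; have hL := orT (ssvalP h.1).
have E := oK_disjoint KT (ssvalP h.1) Kx (edge_sub_hull hL hx).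
have [l _ _] := (edge_hullP h.2 x hL).1 hx.
by have := Kx h.2; rewrite E l ltxx.
Qed.

(** Test functions supported in one open triangle see no edge terms, so the fundamental lemma
    identifies the weak divergence with the classical one there. *)
Lemma weak_div_rep k f g F G V : polys k f -> polys k g -> L2 Omega F -> L2 Omega G ->
  rep F f -> rep G g -> L2 Omega V ->
  (forall phi, test_function Omega phi ->
    \int[mu]_(x in Omega) (F x * pd 1 0 phi x + G x * pd 0 1 phi x) =
    - \int[mu]_(x in Omega) (V x * phi x)) ->
  rep V (fun K x => 'D_(1, 0) (f K) x + 'D_(0, 1) (g K) x).
Proof.
move=> pf pg hF hG rF rG hV hw; set d := (fun K x => _).
have pD : polys k d.
  by move=> K KT; apply: polynD; apply: polyn_leq (leq_pred k) _; apply: polyn_D;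
    [exact: pf|exact: pg].
pose W := pw d; have hW : L2 Omega W := pw_L2 pD.
apply: rep_oK => K KT.
suff : ae_on (oK K) (fun x => V x - W x = 0).
  by apply: ae_onS => // x Kx /eqP; rewrite subr_eq0 => /eqP ->; exact: pw_in.
have hVW : L2 Omega (fun x => V x - W x).
  by apply: L2_ext (L2D 1 (-1) hV hW) _ => x _; ring.
apply: fundamental_lemma; first exact: oK_open.
  exact: L2_sub (oK_measurable K) (oK_sub KT) hVW.
move=> phi tpK.
have tp : test_function Omega phi.
  have [t1 t2 t3] := tpK; split=> //; exact: subset_trans (oK_sub KT).
have out x : ~ oK K x -> phi x = 0.
  by have [_ _ sub] := tpK; move=> nx; apply: tsupp_out => /sub.
have -> : \int[mu]_(x in oK K) ((V x - W x) * phi x) =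
    \int[mu]_(x in Omega) ((V x - W x) * phi x).
  rewrite [LHS]Rintegral_mkcond [RHS]Rintegral_mkcond; apply: eq_Rintegral => x _.
  rewrite !patchE; have [Kx|nKx] := pselect (oK K x).
    by rewrite !mem_set//; exact: (oK_sub KT).
  by rewrite memNset// out// mulr0; case: ifP.
have a0 : adm phi := test_adm 0 0 tp.
rewrite (intB hV hW a0).
have := flux_div pf pg hF hG rF rG hW (rep_pw d) tp; rewrite hw// big1 => [|h _].
  by rewrite sub0r => /oppr_inj ->; rewrite subrr.
have z (H : pt R -> R) : lint (hea h) (heb h) (fun x => H x * phi x) = 0.
  by apply: lint0 => x hx; rewrite out ?mulr0//; exact: edge_oK KT hx.
by rewrite /flux !z !mulr0 subrr mulr0.
Qed.

(** At a point of the open edge with nonzero jump, take a bump so small that it meets no other edge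
    and that the jump keeps its sign on it. The resulting flux is nonzero. *)
Lemma weak_div_matching k f g F G V : polys k f -> polys k g -> L2 Omega F -> L2 Omega G ->
  rep F f -> rep G g -> L2 Omega V ->
  (forall phi, test_function Omega phi ->
    \int[mu]_(x in Omega) (F x * pd 1 0 phi x + G x * pd 0 1 phi x) =
    - \int[mu]_(x in Omega) (V x * phi x)) ->
  matching f g.
Proof.
move=> pf pg hF hG rF rG hV hw h h' hn.
have rV := weak_div_rep pf pg hF hG rF rG hV hw.
have flux0 phi : test_function Omega phi -> \sum_h flux f g phi h = 0.
  move=> tp; have := flux_div pf pg hF hG rF rG hV rV tp; rewrite hw// => E; apply: (addIr (- \int[mu]_(x in Omega) (V x * phi x))).
  by rewrite -E add0r.
have KT := ssvalP h.1; have LT := ssvalP h'.1; have hK := orT KT; have hL := orT LT.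
pose J := jump f g h h'.
have pJ : polyn k J.
  by apply: polynB; apply: polynZ; apply: polynB; by [exact: pf|exact: pg].
pose A := hea h; pose B := heb h.
suff J0 (t : R) : 0 < t -> t < 1 -> J (A + t *: (B - A)) = 0.
  have [q _ hq] := polyn_line A (B - A) pJ.
  have q0 : q = 0.
    by apply: (poly_zero_itv ltr01) => t t0 t1; rewrite -(hq t).1; exact: J0.
  by move=> x /seg_hullP[t [_ _ ->]]; rewrite -/J (hq t).1 q0 horner0.
move=> t0 t1; set x0 := A + t *: (B - A); apply/eqP/negPn/negP => Jx.
have ox : oedge (val h.1) h.2 x0 by apply/oedgeP => //; exists t.
have Ox : Omega x0 := nbr_edge_in KT LT hn ox.
have hh : h != h'.
  apply/eqP => E; case/andP: hn => /eqP h1 _; by apply: h1; rewrite -E.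
have n1 : \forall y \near x0, 0 < J x0 * J y.
  apply: (@near_gt0 _ (fun y => J x0 * J y)).
    by move=> y; apply: cvgM; [exact: cvg_cst|exact: polyn_continuous pJ y].
  by rewrite -expr2 exprn_even_gt0.
have n2 : \forall y \near x0, forall h2 : I, h2 != h -> h2 != h' -> ~ hull [:: hea h2; heb h2] y.
  apply: near_forall => h2; have [e1|e1] := eqVneq h2 h; first exact: pt_nearW.
  have [e2|e2] := eqVneq h2 h'; first by apply: pt_nearW.
  have nh : ~ hull [:: hea h2; heb h2] x0.
    move=> hx; have [[E1 E2]|hn2] := oedge_meet KT (ssvalP h2.1) ox hx.
      move/eqP: e1; apply; case: h2 {e2 hx} E1 E2 => c d /= E1 E2.
      case: h {hn KT LT hK hL J pJ A B x0 Jx ox Ox hh n1} E1 E2 => a b /= E1 E2.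
      by rewrite E2; congr (_, _); exact: val_inj.
    by move/eqP: e2; apply; exact: (hnbr_uniq hn2 hn).
  by have := near_nhull nh; apply: filterS.
have n3 : \forall y \near x0, Omega y by exact: open_nbhs_nbhs.
have : \forall y \near x0, [/\ 0 < J x0 * J y, Omega y &
    forall h2 : I, h2 != h -> h2 != h' -> ~ hull [:: hea h2; heb h2] y].
  by near=> y; split; near: y.
move=> /nbhs_ballP[e /= e0 he].
have [d d0 de] : exists2 d : R, 0 < d & d < e by exists (e / 2); lra.
have ballP y : x0.1 - d <= y.1 -> y.1 <= x0.1 + d -> x0.2 - d <= y.2 -> y.2 <= x0.2 + d ->
    ball x0 e y.
  move=> a1 a2 a3 a4; apply/ball_prodE; rewrite !ltr_norml.
  move: (x0.1) (y.1) (x0.2) (y.2) a1 a2 a3 a4 => b1 b2 b3 b4 a1 a2 a3 a4.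
  by split; apply/andP; split; lra.
pose phi := bump2 (x0.1 - d) (x0.1 + d) (x0.2 - d) (x0.2 + d) 1.
have tp : test_function Omega phi.
  apply: bump2_test; [lra|lra|exact: ltr01|] => y [/=]; rewrite !in_itv /=.
  by move=> /andP[a1 a2] /andP[a3 a4]; have [] := he y (ballP y a1 a2 a3 a4).
have phi_out y : ~ ball x0 e y -> phi y = 0.
  move=> nb; rewrite /phi /bump2 /bumpn.
  have [/andP[h1 h2]|/negP c] := boolP (x0.1 - d < y.1 < x0.1 + d); last by rewrite bump_out ?mul0r.
  have [/andP[h3 h4]|/negP c] := boolP (x0.2 - d < y.2 < x0.2 + d); last by rewrite [X in _ * X]bump_out ?mulr0.
  by case: nb; apply: ballP; exact: ltW.
have phi_ge0 y : 0 <= phi y by rewrite /phi /bump2 /bumpn mulr_ge0 ?bump_ge0.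
have phi_gt0 : 0 < phi x0.
  by rewrite /phi /bump2 /bumpn mulr_gt0 ?bump_gt0//; lra.
have cphi : continuous phi := test_continuous (a := 0) (b := 0) tp.
have := flux0 phi tp; rewrite (bigD1 h)//= (bigD1 h') /=; last by rewrite eq_sym.
rewrite big1 ?addr0 => [|h2 /andP[e1 e2]]; last first.
  have z (H : pt R -> R) : lint (hea h2) (heb h2) (fun x => H x * phi x) = 0.
    apply: lint0 => y hy; rewrite phi_out ?mulr0// => yb.
    by have [_ _ /(_ h2 e1 e2)] := he y yb.
  by rewrite /flux !z !mulr0 subrr mulr0.
rewrite (flux_jump pf pg cphi hn) -/J -/A -/B => /eqP; rewrite mulf_eq0 sgr_eq0 (negbTE hK) /=.
have cJ : continuous (fun y => J y * phi y).
  by move=> y; apply: cvgM; [exact: polyn_continuous pJ y|exact: cphi].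
have : 0 < lint A B (fun y => J x0 * (J y * phi y) + 0 * (J y * phi y)).
  apply: (lint_gt0 (t := t)) => //.
  - by move=> y; apply: cvgD; apply: cvgM; by [exact: cvg_cst|exact: cJ].
  - move=> y; rewrite mul0r addr0 mulrA.
    have [yb|/phi_out ->] := pselect (ball x0 e y); last by rewrite mulr0.
    by rewrite mulr_ge0//; have [/ltW] := he y yb.
  - rewrite mul0r addr0 mulrA mulr_gt0// -expr2 exprn_even_gt0//.
rewrite lint_lin// mul0r addr0 => hp /eqP z; by rewrite z mulr0 ltxx in hp.
Unshelve. all: by end_near.
Qed.
End MeshIntegrals.

(** * Weak second derivatives of piecewise polynomials of class C^1 *)

Section C1Families.
Implicit Types (p q : tri R -> pt R -> R) (U V F G phi psi : pt R -> R) (k a b : nat).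

Definition contE q := forall K i L j, K \in T -> L \in T -> nbr K i L j ->
  forall x, hull [:: ea K i; eb K i] x -> q K x = q L x.

Definition C1 q := [/\ contE q, contE (fun K => dir (1, 0) (q K)) & contE (fun K => dir (0, 1) (q K))].

Lemma contE_matching p q : contE p -> contE q -> matching p q.
Proof.
move=> hp hq [K i] [L j] hn x hx; rewrite /jump /=.
have e1 : p (val K) x = p (val L) x by apply: hp hn _ hx; exact: ssvalP.
have e2 : q (val K) x = q (val L) x by apply: hq hn _ hx; exact: ssvalP.
by rewrite e1 e2 !subrr !mulr0 subrr.
Qed.

Lemma contE_zero : contE zero_fam.
Proof. by []. Qed.

Lemma L2N F : L2 Omega F -> L2 Omega (fun x => - F x).
Proof.
by move=> hF; apply: L2_ext (L2D (-1) 0 hF hF) _ => x _; rewrite mulN1r mul0r addr0.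
Qed.

Lemma pd_inO phi a b : test_function Omega phi -> inO (pd a b phi).
Proof. by move=> [_ _ sub] x nx; apply: pd_out => /sub. Qed.

Lemma pd_derive_x phi a b x : test_function Omega phi -> is_derive x (1, 0) (pd a b phi) (pd a.+1 b phi x).
Proof. by move=> [h _ _]; apply: derivableP; apply: diff_derivable; exact: (h a b). Qed.

Lemma pd_derive_y phi b x : test_function Omega phi -> is_derive x (0, 1) (pd 0 b phi) (pd 0 b.+1 phi x).
Proof. by move=> [h _ _]; apply: derivableP; apply: diff_derivable; exact: (h 0 b). Qed.

Lemma polys_dir k p v : polys k p -> polys k.-1 (fun K => dir v (p K)).
Proof. by move=> hp K KT; apply: polyn_dir; exact: hp. Qed.

Lemma polys_pw_rep k p : polys k p -> L2 Omega (pw p) /\ rep (pw p) p.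
Proof. by move=> hp; split; [exact: pw_L2 hp|exact: rep_pw]. Qed.

Lemma sum2P (n m : nat) : (n + m = 2)%N ->
  [\/ n = 2%N /\ m = 0%N, n = 1%N /\ m = 1%N | n = 0%N /\ m = 2%N].
Proof. by case: n m => [|[|[|n]]] [|[|[|m]]] //; [constructor 3|constructor 2|constructor 1]. Qed.

Lemma sum1P (n m : nat) : (n + m <= 1)%N ->
  [\/ n = 0%N /\ m = 0%N, n = 1%N /\ m = 0%N | n = 0%N /\ m = 1%N].
Proof. by case: n m => [|[|n]] [|[|m]] // _; [constructor 1|constructor 3|constructor 2]. Qed.

Lemma weak_pd_C0 k p U V a b : polys k p -> contE p -> L2 Omega U -> rep U p -> (a + b <= 1)%N ->
  L2 Omega V -> rep V (fun K => pd a b (p K)) -> weak_pd Omega a b U V.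
Proof.
move=> hp c0 LU rU ab LV rV phi tp; have ad a' b' := test_adm a' b' tp.
have m0x := contE_matching c0 contE_zero; have m0y := contE_matching contE_zero c0.
move: rV; have [[-> ->]|[-> ->]|[-> ->]] := sum1P ab => rV; rewrite ?expr0 ?expr1 ?mul1r ?mulN1r.
- by rewrite (int_rep hp LU rU (ad 0%N 0%N)) (int_rep hp LV rV (ad 0%N 0%N)).
- exact: (weak_x hp LU rU LV rV m0x (ad 0%N 0%N) (ad 1%N 0%N) (pd_inO 0 0 tp) (fun x => pd_derive_x 0 0 x tp)).
- exact: (weak_y hp LU rU LV rV m0y (ad 0%N 0%N) (ad 0%N 1%N) (pd_inO 0 0 tp) (fun x => pd_derive_y 0 x tp)).
Qed.

(** Each derivative is moved by one integration by parts: continuity of the values removes the edge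
    terms of the first, continuity of the gradient those of the second. *)
Lemma weak_pd_C1 k p U V a b : polys k p -> C1 p -> L2 Omega U -> rep U p -> (a + b <= 2)%N ->
  L2 Omega V -> rep V (fun K => pd a b (p K)) -> weak_pd Omega a b U V.
Proof.
move=> hp [c0 cx cy] LU rU ab LV rV; have [ab1|ab2] := leqP (a + b) 1; first exact: (weak_pd_C0 hp c0 LU rU ab1 LV rV).
move=> phi tp.
have ad a' b' := test_adm a' b' tp.
have [Lx rx] := polys_pw_rep (polys_dir (1, 0) hp).
have [Ly ry] := polys_pw_rep (polys_dir (0, 1) hp).
have m0x := contE_matching c0 contE_zero; have m0y := contE_matching contE_zero c0.
have hpx := polys_dir (1, 0) hp; have hpy := polys_dir (0, 1) hp.
have mxx := contE_matching cx contE_zero; have mxy := contE_matching contE_zero cx.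
have myy := contE_matching contE_zero cy.
have yx K : K \in T -> pd 1 1 (p K) = dir (0, 1) (dir (1, 0) (p K)).
  by move=> KT; rewrite (dir_comm (0, 1) (1, 0) (hp K KT)) dirF.
rewrite dirF in Lx rx Ly ry hpx hpy mxx mxy myy yx.
have {ab ab2} : (a + b)%N = 2%N by apply/eqP; rewrite eqn_leq ab.
move: rV => /[swap] /sum2P[] [-> ->] rV; rewrite -signr_odd /= expr0 mul1r.
- rewrite (weak_x hp LU rU Lx rx m0x (ad 1%N 0%N) (ad 2%N 0%N) (pd_inO 1 0 tp) (fun x => pd_derive_x 1 0 x tp)).
  by rewrite (weak_x hpx Lx rx LV rV mxx (ad 0%N 0%N) (ad 1%N 0%N) (pd_inO 0 0 tp) (fun x => pd_derive_x 0 0 x tp)) opprK.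
- rewrite (weak_x hp LU rU Lx rx m0x (ad 0%N 1%N) (ad 1%N 1%N) (pd_inO 0 1 tp) (fun x => pd_derive_x 0 1 x tp)).
  have rV' : rep V (fun K => 'D_(0, 1) (dir_def (1, 0) (p K))).
    by move=> K KT; have := rV K KT; rewrite yx.
  by rewrite (weak_y hpx Lx rx LV rV' mxy (ad 0%N 0%N) (ad 0%N 1%N) (pd_inO 0 0 tp) (fun x => pd_derive_y 0 x tp)) opprK.
- rewrite (weak_y hp LU rU Ly ry m0y (ad 0%N 1%N) (ad 0%N 2%N) (pd_inO 0 1 tp) (fun x => pd_derive_y 1 x tp)).
  by rewrite (weak_y hpy Ly ry LV rV myy (ad 0%N 0%N) (ad 0%N 1%N) (pd_inO 0 0 tp) (fun x => pd_derive_y 0 x tp)) opprK.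
Qed.

Lemma weak_pd_uniq a b U F G : L2 Omega F -> L2 Omega G ->
  weak_pd Omega a b U F -> weak_pd Omega a b U G -> ae_on Omega (fun x => F x = G x).
Proof.
move=> LF LG wF wG.
have LB : L2 Omega (fun x => F x - G x).
  by apply: L2_ext (L2D 1 (-1) LF LG) _ => x _; rewrite mul1r mulN1r.
have : ae_on Omega (fun x => F x - G x = 0).
  apply: fundamental_lemma => // phi tp.
  rewrite (intB LF LG (test_adm 0 0 tp)); apply/eqP; rewrite subr_eq0; apply/eqP.
  have := wF phi tp; rewrite (wG phi tp) => /(mulfI _) h; apply/esym/h.
  by rewrite expf_neq0// oppr_eq0 oner_eq0.
by apply: ae_onS => // x _ /eqP; rewrite subr_eq0 => /eqP.
Qed.

Lemma polyn_pd a b k (f : pt R -> R) : polyn k f -> polyn (k - a - b) (pd a b f).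
Proof.
move=> hf; rewrite subnAC; have h : polyn (k - b) (pd 0 b f).
  by elim: b {hf} (hf) => [|b IH] hf; [rewrite subn0|rewrite subnS; apply: polyn_D; exact: IH].
by elim: a => [|a IH]; [rewrite subn0|rewrite subnS; apply: polyn_D; exact: IH].
Qed.

Lemma polys_pd k p a b : polys k p -> polys (k - a - b) (fun K => pd a b (p K)).
Proof. by move=> hp K KT; apply: polyn_pd; exact: hp. Qed.

Definition airy_rep p (sigma : pt R -> 'M[R]_2) :=
  [/\ rep (fun x => sigma x 0 0) (fun K => pd 0 2 (p K)),
      rep (fun x => sigma x 0 1) (fun K x => - pd 1 1 (p K) x),
      rep (fun x => sigma x 1 0) (fun K x => - pd 1 1 (p K) x)
    & rep (fun x => sigma x 1 1) (fun K => pd 2 0 (p K))].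

Lemma rep_N F q : rep F (fun K x => - q K x) -> rep (fun x => - F x) q.
Proof. by move=> h K KT; apply: ae_onS (h K KT) => // x _ ->; rewrite opprK. Qed.

Lemma C1_airy k p U sigma : polys k p -> C1 p -> L2 Omega U -> rep U p ->
  L2S Omega sigma -> airy_rep p sigma -> is_airy Omega U sigma.
Proof.
move=> hp cp LU rU [sS LS] [r1 r2 r3 r4]; split.
- split=> //; split=> // a b ab.
  have [Lv rv] := polys_pw_rep (polys_pd a b hp).
  by exists (pw (fun K => pd a b (p K))) => //; exact: weak_pd_C1 hp cp LU rU ab Lv rv.
- exact: weak_pd_C1 hp cp LU rU _ (LS _ _) r1.
- exact: weak_pd_C1 hp cp LU rU _ (L2N (LS _ _)) (rep_N r2).
- exact: weak_pd_C1 hp cp LU rU _ (L2N (LS _ _)) (rep_N r3).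
- exact: weak_pd_C1 hp cp LU rU _ (LS _ _) r4.
Qed.

Lemma airy_C1 k p U sigma : polys k p -> C1 p -> L2 Omega U -> rep U p ->
  is_airy Omega U sigma -> airy_rep p sigma.
Proof.
move=> hp cp LU rU [[_ [_ LS]] w1 w2 w3 w4].
have key a b F : (a + b <= 2)%N -> L2 Omega F -> weak_pd Omega a b U F -> rep F (fun K => pd a b (p K)).
  move=> ab LF wF; have [Lv rv] := polys_pw_rep (polys_pd a b hp).
  apply: (ae_rep rv); apply: (weak_pd_uniq Lv LF _ wF).
  exact: weak_pd_C1 hp cp LU rU ab Lv rv.
have N F q : rep (fun x => - F x) q -> rep F (fun K x => - q K x).
  by move=> h K KT; apply: ae_onS (h K KT) => // x _ <-; rewrite opprK.
split.
- exact: key (LS _ _) w1.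
- by apply: N; exact: key (L2N (LS _ _)) w2.
- by apply: N; exact: key (L2N (LS _ _)) w3.
- exact: key (LS _ _) w4.
Qed.

Lemma airy_exists k p : polys k p -> exists2 sigma, L2S Omega sigma & airy_rep p sigma.
Proof.
move=> hp; pose N := pw (fun K x => - pd 1 1 (p K) x).
have hN : polys (k - 1 - 1) (fun K x => - pd 1 1 (p K) x).
  by move=> K KT; apply: polynN; exact: (polys_pd 1 1 hp).
exists (fun x => \matrix_(i, j) if i == 0 then if j == 0 then pw (fun K => pd 0 2 (p K)) x else N x
  else if j == 0 then N x else pw (fun K => pd 2 0 (p K)) x).
  split; first apply: ae_onW => x _.
    by apply/matrixP => i j; rewrite !mxE; case: (i == 0); case: (j == 0).
  have h (a b : nat) := (polys_pw_rep (polys_pd a b hp)).1.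
  have hN' := (polys_pw_rep hN).1.
  by move=> i j; apply: (@L2_ext (if i == 0 then if j == 0 then pw (fun K => pd 0 2 (p K)) else N
    else if j == 0 then N else pw (fun K => pd 2 0 (p K)))) => [|x _]; rewrite ?mxE;
    case: (i == 0); case: (j == 0).
split.
- by under eq_fun do rewrite !mxE /=; exact: rep_pw.
- by under eq_fun do rewrite !mxE /=; exact: rep_pw.
- by under eq_fun do rewrite !mxE /=; exact: rep_pw.
- by under eq_fun do rewrite !mxE /=; exact: rep_pw.
Qed.

Lemma edge_const k K i (f : pt R -> R) : polyn k f ->
  (forall x, hull [:: ea K i; eb K i] x -> dir (eb K i - ea K i) f x = 0) ->
  forall x, hull [:: ea K i; eb K i] x -> f x = f (ea K i).
Proof.
move=> hf h x /seg_hullP[t [t0 t1 ->]].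
apply: (line_const hf ltr01) => s s0 s1; apply: h.
by apply/seg_hullP; exists s; split=> //; exact: ltW.
Qed.

(** The hypothesis makes every jump constant along its edge, which is what [potential] requires. *)
Lemma glue k p : polys k p ->
  (forall K i L j, K \in T -> L \in T -> nbr K i L j -> forall x, hull [:: ea K i; eb K i] x ->
    dir (eb K i - ea K i) (fun y => p K y - p L y) x = 0) ->
  exists c : tri R -> R, contE (fun K x => p K x - c K).
Proof.
move=> hp h.
have key K i L j (KT : K \in T) (LT : L \in T) (hn : nbr K i L j) :=
  edge_const (polynB (hp K KT) (hp L LT)) (h K i L j KT LT hn).
have [|c hc] := potential (G := p).
  move=> K i L j KT LT hn; exact: (esym (key K i L j KT LT hn _ (seg_hullr _ _))).
exists c => K i L j KT LT hn x hx; have := key K i L j KT LT hn x hx.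
by rewrite (hc _ _ _ _ KT LT hn) => e; rewrite -(subrK (p L x) (p K x)) e; ring.
Qed.
End C1Families.

(** * From local Airy potentials to a global one *)

Section Gluing.
Implicit Types (v w : pt R) (p q : tri R -> pt R -> R).

Definition aff (a b c : R) x : R := a * x.1 + b * x.2 + c.

Lemma aff_polyn a b c : polyn 1 (aff a b c).
Proof. by apply: (@polyn1I _ c a b) => x; rewrite /aff; ring. Qed.

Lemma dir_cst v (c : R) : dir v (fun=> c) = fun=> 0.
Proof. by apply/funext => x; rewrite dirF /dir_def derive_cst. Qed.

Lemma dir_fst v : dir v (fun x : pt R => x.1) = fun=> v.1.
Proof. by rewrite dirF; apply/funext => x; exact: (@derive_val _ _ _ _ _ _ _ (is_derive_fst x v)). Qed.

Lemma dir_snd v : dir v (fun x : pt R => x.2) = fun=> v.2.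
Proof. by rewrite dirF; apply/funext => x; exact: (@derive_val _ _ _ _ _ _ _ (is_derive_snd x v)). Qed.

Lemma dir_aff v a b c : dir v (aff a b c) = fun=> a * v.1 + b * v.2.
Proof.
have h1 := polynZ a (polyn_fst R); have h2 := polynZ b (polyn_snd R).
rewrite /aff (dirD v (polynD h1 h2) (polyn_cst 1 c)) (dirD v h1 h2).
by rewrite (dirZ v a (polyn_fst R)) (dirZ v b (polyn_snd R)) dir_fst dir_snd dir_cst; apply/funext => x; rewrite addr0.
Qed.

Lemma dir_subaff k v (f : pt R -> R) a b c : polyn k.+1 f ->
  dir v (fun x => f x - aff a b c x) = fun x => dir v f x - (a * v.1 + b * v.2).
Proof. by move=> hf; rewrite (dirB v hf (polyn_leq _ (aff_polyn a b c)))// dir_aff. Qed.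

Lemma dir_subcst k v (f : pt R -> R) c : polyn k f -> dir v (fun x => f x - c) = dir v f.
Proof.
move=> hf; rewrite (dirB v hf (polyn_cst k c)) dir_cst.
by apply/funext => x; rewrite subr0.
Qed.

Lemma pd20 (f : pt R -> R) : pd 2 0 f = dir (1, 0) (dir (1, 0) f). Proof. by rewrite dirF. Qed.
Lemma pd11 (f : pt R -> R) : pd 1 1 f = dir (1, 0) (dir (0, 1) f). Proof. by rewrite dirF. Qed.
Lemma pd02 (f : pt R -> R) : pd 0 2 f = dir (0, 1) (dir (0, 1) f). Proof. by rewrite dirF. Qed.

Lemma pd00 (f : pt R -> R) : pd 0 0 f = f. Proof. by []. Qed.
Lemma pd10 (f : pt R -> R) : pd 1 0 f = dir (1, 0) f. Proof. by rewrite dirF. Qed.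
Lemma pd01 (f : pt R -> R) : pd 0 1 f = dir (0, 1) f. Proof. by rewrite dirF. Qed.
Lemma dnE e (f : pt R -> R) : dn e f = dir (normal e) f. Proof. by rewrite dirF. Qed.
Lemma dttE e (f : pt R -> R) : dtt e f = dir (tangent e) (dir (tangent e) f). Proof. by rewrite dirF. Qed.
Lemma dtnE e (f : pt R -> R) : dtn e f = dir (tangent e) (dir (normal e) f). Proof. by rewrite dirF. Qed.

Lemma dir_line k f A v : polyn k f -> exists2 g : {poly R}, (size g <= k.+1)%N &
  forall t, f (A + t *: v) = g.[t] /\ dir v f (A + t *: v) = g^`().[t].
Proof. by rewrite dirF; exact: polyn_line. Qed.

Opaque pd.

Lemma pd2_subaff k (f : pt R -> R) a b c (n m : nat) : polyn k.+1 f -> (n + m = 2)%N ->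
  pd n m (fun x => f x - aff a b c x) = pd n m f.
Proof.
move=> hf; have hd v := polyn_dir v hf; move=> /sum2P[] [-> ->].
- by rewrite !pd20 (dir_subaff _ _ _ _ hf) (dir_subcst _ _ (hd _)).
- by rewrite !pd11 (dir_subaff _ _ _ _ hf) (dir_subcst _ _ (hd _)).
- by rewrite !pd02 (dir_subaff _ _ _ _ hf) (dir_subcst _ _ (hd _)).
Qed.

Lemma matching_nbr f g K i L j x : matching f g -> K \in T -> L \in T -> nbr K i L j ->
  hull [:: ea K i; eb K i] x ->
  (eb K i - ea K i).2 * (f K x - f L x) - (eb K i - ea K i).1 * (g K x - g L x) = 0.
Proof. by move=> h KT LT hn hx; exact: (h (SeqSub KT, i) (SeqSub LT, j) hn x hx). Qed.

(** Normal continuity of the stress says that the tangential derivative of each gradient component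
    is continuous across edges. So [glue] applies to the two components and then, once the gradients
    agree, to the values. *)
Lemma airy_glue k q : polys k.+1 q ->
  matching (fun K => pd 0 2 (q K)) (fun K x => - pd 1 1 (q K) x) ->
  matching (fun K x => - pd 1 1 (q K) x) (fun K => pd 2 0 (q K)) ->
  exists p, [/\ polys k.+1 p, C1 p &
    {in T, forall K, forall n m : nat, (n + m = 2)%N -> pd n m (p K) = pd n m (q K)}].
Proof.
move=> hq m1' m2'; have hqx := polys_dir (1, 0) hq; have hqy := polys_dir (0, 1) hq.
have [|cy hcy] := glue hqy.
  move=> K i L j KT LT hn x hx; have := matching_nbr m1' KT LT hn hx.
  rewrite (dirB _ (hqy K KT) (hqy L LT)); set t := eb K i - ea K i.
  rewrite (dir_coord t x (hqy K KT)) (dir_coord t x (hqy L LT)).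
  rewrite (pd02 (q K)) (pd02 (q L)) (pd11 (q K)) (pd11 (q L)) => e; rewrite -[RHS]e; ring.
have [|cx hcx] := glue hqx.
  move=> K i L j KT LT hn x hx; have := matching_nbr m2' KT LT hn hx.
  rewrite (dirB _ (hqx K KT) (hqx L LT)); set t := eb K i - ea K i.
  rewrite (dir_coord t x (hqx K KT)) (dir_coord t x (hqx L LT)).
  rewrite (dir_comm (0, 1) (1, 0) (hq K KT)) (dir_comm (0, 1) (1, 0) (hq L LT)).
  rewrite (pd20 (q K)) (pd20 (q L)) (pd11 (q K)) (pd11 (q L)) => e; rewrite -[RHS]oppr0 -[in RHS]e; ring.
(* The linear corrections make the gradient continuous, so the remaining jumps of the values are
   constants. *)
pose q1 K x := q K x - aff (cx K) (cy K) 0 x.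
have hq1 : polys k.+1 q1.
  by move=> K KT; apply: polynB; [exact: hq|exact: polyn_leq (aff_polyn _ _ _)].
have Dq1 K v : K \in T -> dir v (q1 K) = fun x => dir v (q K) x - (cx K * v.1 + cy K * v.2).
  by move=> KT; apply: dir_subaff; exact: hq.
have [|c hc] := glue hq1.
  move=> K i L j KT LT hn x hx; have := hcx K i L j KT LT hn x hx; have := hcy K i L j KT LT hn x hx.
  rewrite (dirB _ (hq1 K KT) (hq1 L LT)) (Dq1 K _ KT) (Dq1 L _ LT); set t := eb K i - ea K i.
  rewrite (dir_coord t x (hq K KT)) (dir_coord t x (hq L LT)).
  move=> /(canRL (subrK _)) -> /(canRL (subrK _)) ->; ring.
exists (fun K x => q K x - aff (cx K) (cy K) (c K) x).
have hp : polys k.+1 (fun K x => q K x - aff (cx K) (cy K) (c K) x).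
  by move=> K KT; apply: polynB; [exact: hq|exact: polyn_leq (aff_polyn _ _ _)].
split=> //.
- split=> K i L j KT LT hn x hx.
  + by have := hc K i L j KT LT hn x hx; rewrite /q1 /aff !addr0 !opprD !addrA.
  + rewrite (dir_subaff _ _ _ _ (hq K KT)) (dir_subaff _ _ _ _ (hq L LT)) /= !mulr1 !mulr0 !addr0.
    exact: hcx K i L j KT LT hn x hx.
  + rewrite (dir_subaff _ _ _ _ (hq K KT)) (dir_subaff _ _ _ _ (hq L LT)) /= !mulr1 !mulr0 !add0r.
    exact: hcy K i L j KT LT hn x hx.
- by move=> K KT n m nm; apply: pd2_subaff nm; exact: hq.
Qed.
End Gluing.

End Triangulation.

(** * Vanishing of quartic jumps along an edge *)

Section Hermite.
Variable R : realType.
Implicit Types (f w : pt R -> R) (x y u v t A B : pt R) (s : R).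

Lemma dir_lin k f (a b : R) v u x : polyn k f ->
  dir (a *: v + b *: u) f x = a * dir v f x + b * dir u f x.
Proof.
move=> hf; rewrite (dir_coord (a *: v + b *: u) x hf) (dir_coord v x hf) (dir_coord u x hf).
by rewrite /= /GRing.scale /=; ring.
Qed.

Lemma dirNv k f v x : polyn k f -> dir (- v) f x = - dir v f x.
Proof. by move=> hf; rewrite (dir_coord _ x hf) (dir_coord v x hf) /=; ring. Qed.

Lemma poly5E (g : {poly R}) : (size g <= 5)%N ->
  exists a0 a1 a2 a3 a4, g = a0%:P + a1 *: 'X + a2 *: 'X^2 + a3 *: 'X^3 + a4 *: 'X^4.
Proof.
move=> sg; exists g`_0, g`_1, g`_2, g`_3, g`_4; apply/polyP => -[|[|[|[|[|n]]]]];
  rewrite !coefE /= ?mulr0 ?mulr1 ?addr0 ?add0r//.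
by apply: nth_default; apply: leq_trans sg _.
Qed.

Lemma deriv5 (a0 a1 a2 a3 a4 : R) :
  (a0%:P + a1 *: 'X + a2 *: 'X^2 + a3 *: 'X^3 + a4 *: 'X^4)^`() =
  a1%:P + (2 * a2) *: 'X + (3 * a3) *: 'X^2 + (4 * a4) *: 'X^3 + 0 *: 'X^4.
Proof.
apply/polyP => -[|[|[|[|[|n]]]]]; rewrite coef_deriv !coefE /=; ring.
Qed.

Lemma horner5 (a0 a1 a2 a3 a4 s : R) :
  (a0%:P + a1 *: 'X + a2 *: 'X^2 + a3 *: 'X^3 + a4 *: 'X^4).[s] =
  a0 + a1 * s + a2 * s ^+ 2 + a3 * s ^+ 3 + a4 * s ^+ 4.
Proof. by rewrite !hornerD !hornerZ !hornerXn hornerC hornerX. Qed.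

Lemma line4 f A v : polyn 4 f -> exists a0 a1 a2 a3 a4 : R, forall s,
  [/\ f (A + s *: v) = a0 + a1 * s + a2 * s ^+ 2 + a3 * s ^+ 3 + a4 * s ^+ 4,
      dir v f (A + s *: v) = a1 + 2 * a2 * s + 3 * a3 * s ^+ 2 + 4 * a4 * s ^+ 3
    & dir v (dir v f) (A + s *: v) = 2 * a2 + 6 * a3 * s + 12 * a4 * s ^+ 2].
Proof.
move=> hf; have [g sg hg] := dir_line A v hf.
have [g2 _ hg2] := dir_line A v (polyn_dir v hf).
have e : g^`() = g2.
  apply: subr0_eq; set d := g^`() - g2.
  by apply: (poly_zero_itv ltr01) => s _ _; rewrite /d hornerE hornerN -(hg s).2 -(hg2 s).1 subrr.
have [a0 [a1 [a2 [a3 [a4 gE]]]]] := poly5E sg.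
exists a0, a1, a2, a3, a4 => s; split.
- by rewrite (hg s).1 gE horner5.
- by rewrite (hg s).2 gE deriv5 horner5 mul0r addr0.
- by rewrite (hg2 s).2 -e gE deriv5 deriv5 horner5; ring.
Qed.

Lemma pow01 : [/\ (forall n, (0 : R) ^+ n.+1 = 0), (forall n, (1 : R) ^+ n = 1) &
  [/\ (2^-1 : R) ^+ 2 = 4^-1, (2^-1 : R) ^+ 3 = 8^-1 & (2^-1 : R) ^+ 4 = 16^-1]].
Proof. by split=> [n|n|]; [rewrite expr0n|rewrite expr1n|split; field]. Qed.

Lemma lineA A v : A + (0 : R) *: v = A. Proof. by rewrite scale0r addr0. Qed.
Lemma lineB A B : A + (1 : R) *: (B - A) = B. Proof. by rewrite scale1r addrC subrK. Qed.
Lemma lineM A B : A + (2^-1 : R) *: (B - A) = mid (A, B).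
Proof. by apply: pairE; rewrite /= /GRing.scale /=; field. Qed.

Lemma cubic_zero f A B : polyn 3 f -> f A = 0 -> f B = 0 -> dir (B - A) f A = 0 ->
  dir (B - A) f B = 0 -> forall s, f (A + s *: (B - A)) = 0.
Proof.
move=> hf; have [a0 [a1 [a2 [a3 [a4 h]]]]] := line4 A (B - A) (polyn_leq (isT : (3 <= 4)%N) hf).
have [g sg hg] := dir_line A (B - A) hf.
have a40 : a4 = 0.
  pose G : {poly R} := a0%:P + a1 *: 'X + a2 *: 'X^2 + a3 *: 'X^3 + a4 *: 'X^4.
  have e : g - G = 0.
    apply: (poly_zero_itv ltr01) => s _ _; have [h1 _ _] := h s.
    by rewrite hornerD hornerN -(hg s).1 h1 /G !hornerE; ring.
  have := congr1 (fun q : {poly R} => q`_4) e; rewrite /G !coefE /= !mulr0 !mulr1 !add0r.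
  by rewrite nth_default// sub0r => /eqP; rewrite oppr_eq0 => /eqP.
have [z o _] := pow01.
have [h1 h2 _] := h 0; have [k1 k2 _] := h 1; move: h1 h2 k1 k2.
rewrite lineA lineB !o !z a40 => h1 h2 h3 h4 e1 e2 e3 e4 s; have [-> _ _] := h s.
rewrite e1 in h1; rewrite e2 in h3; rewrite e3 in h2; rewrite e4 in h4.
have [b0 b1 b2 b3] : [/\ a0 = 0, a1 = 0, a2 = 0 & a3 = 0].
  by move: h1 h2 h3 h4; clear; split; lra.
by rewrite b0 b1 b2 b3 a40; ring.
Qed.

(** Value and slope at both ends are four conditions on the quartic along the edge; the last
    hypothesis is the fifth. The gradient components are cubic along the edge, and they vanish
    because their values and tangential derivatives do so at both ends. *)
Lemma hermite_edge w A B t t' : polyn 4 w -> w A = 0 -> w B = 0 ->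
  (forall u, dir u w A = 0) -> (forall u, dir u w B = 0) ->
  cross t (B - A) != 0 -> cross t' (B - A) != 0 ->
  (forall u, dir t (dir u w) A = 0) -> (forall u, dir t' (dir u w) B = 0) ->
  w (mid (A, B)) = 0 \/ dir (B - A) (dir (B - A) w) A = 0 ->
  forall s, w (A + s *: (B - A)) = 0 /\ forall u, dir u w (A + s *: (B - A)) = 0.
Proof.
move=> hw wA wB dA dB ct ct' HA HB h5; set v := B - A in ct ct' h5 *.
have [a0 [a1 [a2 [a3 [a4 h]]]]] := line4 A v hw.
have [z o [p2 p3 p4]] := pow01.
have [h1 h2 h3] := h 0; have [k1 k2 k3] := h 1; have [l1 _ _] := h 2^-1.
move: h1 h2 h3 k1 k2 k3 l1; rewrite lineA lineB lineM wA wB dA dB !o !z p2 p3 p4.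
move=> h1 h2 h3 k1 k2 k3 l1.
have [b0 b1 b2 b3 b4] : [/\ a0 = 0, a1 = 0, a2 = 0, a3 = 0 & a4 = 0].
  move: h1 h2 h3 k1 k2 l1 h5; move: (w _) (dir v _ A) => m q; clear; by move=> ? ? ? ? ? ? []; split; lra.
have vvA : dir v (dir v w) A = 0 by rewrite h3 b2 b3 b4; ring.
have vvB : dir v (dir v w) B = 0 by rewrite k3 b2 b3 b4; ring.
(* The hypotheses control the Hessian in a direction transversal to the edge, and the vanishing of
   [w] along the edge controls the double tangential derivative. *)
have full X T : cross T v != 0 -> dir v (dir v w) X = 0 -> (forall u, dir T (dir u w) X = 0) ->
    forall u, dir v (dir u w) X = 0.
  move=> cT vv HT u; rewrite (dir_comm v u hw) (cross_decomp u cT) (dir_lin _ _ _ _ _ (polyn_dir v hw)).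
  by rewrite HT vv !mulr0 addr0.
move=> s; split; first by have [-> _ _] := h s; rewrite b0 b1 b2 b3 b4; ring.
by move=> u; exact: (cubic_zero (polyn_dir u hw) (dA u) (dB u) (full A t ct vvA HA u) (full B t' ct' vvB HB u)).
Qed.

(* On each half of a macro edge the jump vanishes to third order at the vertex
   and has no second derivative at the midpoint, so it is [beta s^3 (s - 2)];
   matching the two halves at the midpoint to first order forces [beta = 0]. *)
Lemma hermite_half w w' A A' B : polyn 4 w -> polyn 4 w' -> B = mid (A, A') ->
  (forall f C, (f, C) \in [:: (w, A); (w', A')] -> [/\ f C = 0, forall u, dir u f C = 0,
     forall u v, dir u (dir v f) C = 0 & dir (B - C) (dir (B - C) f) B = 0]) ->
  w B = w' B -> (forall u, dir u w B = dir u w' B) ->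
  forall s, w (A + s *: (B - A)) = 0.
Proof.
move=> hw hw' BE h e1 e2.
have [wA dA HA HB] := h w A (mem_head _ _).
have [] := h w' A'; first by rewrite !inE eqxx orbT.
move=> wA' dA' HA' HB' {h}.
have vE : B - A' = - (B - A) by rewrite BE; apply: pairE; rewrite /= /GRing.scale /=; field.
have [a0 [a1 [a2 [a3 [a4 h]]]]] := line4 A (B - A) hw.
have [b0 [b1 [b2 [b3 [b4 k]]]]] := line4 A' (B - A') hw'.
have [z o _] := pow01.
have [h1 h2 h3] := h 0; have [l1 l2 l3] := h 1; move: h1 h2 h3 l1 l2 l3.
have [k1 k2 k3] := k 0; have [m1 m2 m3] := k 1; move: k1 k2 k3 m1 m2 m3.
rewrite !lineA !lineB wA wA' dA dA' HA HA' HB HB' e1 e2 !o !z.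
have -> : dir (B - A') w' B = - dir (B - A) w' B by rewrite vE (dirNv _ _ hw').
move: (w' B) (dir (B - A) w' B) => c d k1 k2 k3 m1 m2 m3 h1 h2 h3 l1 l2 l3 s.
have [c0 c1 c2 c3 c4] : [/\ a0 = 0, a1 = 0, a2 = 0, a3 = 0 & a4 = 0].
  by move: k1 k2 k3 m1 m2 m3 h1 h2 h3 l1 l2 l3; clear; split; lra.
have [-> _ _] := h s.
by rewrite c0 c1 c2 c3 c4; ring.
Qed.
End Hermite.

(** * The four sub-triangles of a macro-element *)

Section Subdivision.
Variable R : realType.
Implicit Types (K L M N : tri R) (x y X A B : pt R) (i j m a : 'I_3) (t : R).

Definition K1 M : tri R := (M.1.2, m1 M, m2 M).
Definition K2 M : tri R := (M.1.1, m1 M, m2 M).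
Definition K3 M : tri R := (M.1.1, m1 M, m3 M).
Definition K4 M : tri R := (M.2, m1 M, m3 M).

Lemma subP M (P : tri R -> Prop) : P (K1 M) -> P (K2 M) -> P (K3 M) -> P (K4 M) ->
  forall K, K \in subtris M -> P K.
Proof. by move=> h1 h2 h3 h4 K; rewrite !inE => /or4P[]/eqP ->. Qed.

Lemma sub_orient M : [/\ orient (K1 M) = orient M / 4, orient (K2 M) = - (orient M / 4),
  orient (K3 M) = orient M / 4 & orient (K4 M) = - (orient M / 4)].
Proof.
by split; rewrite /orient /cross /K1 /K2 /K3 /K4 /m1 /m2 /m3 /mid /= /GRing.scale /=; field.
Qed.

Lemma sub_orient0 M K : orient M != 0 -> K \in subtris M -> orient K != 0.
Proof.
have [h1 h2 h3 h4] := sub_orient M.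
by move=> hM; move: K; apply: subP; rewrite ?h1 ?h2 ?h3 ?h4 ?oppr_eq0 mulf_neq0.
Qed.

Section Lam.
Variables (M : tri R) (x : pt R).
Hypothesis hM : orient M != 0.
Local Notation l0 := (lam M i0 x).
Local Notation l1 := (lam M i1 x).
Local Notation l2 := (lam M i2 x).

Lemma lam_from K (c : 'I_3 -> R) : orient K != 0 -> \sum_i c i = 1 ->
  x = \sum_i c i *: vt K i -> forall i, lam K i x = c i.
Proof. by move=> hK c1 xE i; rewrite {1}xE (lam_uniq (c := c)). Qed.

Definition c3 (a b c : R) (i : 'I_3) : R := if i == i0 then a else if i == i1 then b else c.

Lemma lamK K (a b c : R) : K \in subtris M -> a + b + c = 1 ->
  l0 *: M.1.1 + l1 *: M.1.2 + l2 *: M.2 = a *: K.1.1 + b *: K.1.2 + c *: K.2 ->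
  [/\ lam K i0 x = a, lam K i1 x = b & lam K i2 x = c].
Proof.
move=> KM s1 xE; have hK := sub_orient0 hM KM.
have h := @lam_from K (c3 a b c) hK.
have hs : \sum_i c3 a b c i = 1 by rewrite sum3.
have hx : x = \sum_i c3 a b c i *: vt K i.
  by rewrite {1}(lam_dec x hM) !sum3; exact: xE.
by split; rewrite (h hs hx).
Qed.

Lemma lam_total : l0 + l1 + l2 = 1.
Proof. by have := lam_sum x hM; rewrite sum3. Qed.

Lemma lamK1 : [/\ lam (K1 M) i0 x = l1 - l0 - l2, lam (K1 M) i1 x = 2 * l2 & lam (K1 M) i2 x = 2 * l0].
Proof.
have s := lam_total; apply: lamK; rewrite ?inE ?eqxx ?orbT//; first by rewrite -[RHS]s; ring.
by apply: pairE; rewrite /K1 /m1 /m2 /mid /= /GRing.scale /=; field.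
Qed.

Lemma lamK2 : [/\ lam (K2 M) i0 x = l0 - l1 + l2, lam (K2 M) i1 x = 2 * l2 & lam (K2 M) i2 x = 2 * (l1 - l2)].
Proof.
have s := lam_total; apply: lamK; rewrite ?inE ?eqxx ?orbT//; first by rewrite -[RHS]s; ring.
by apply: pairE; rewrite /K2 /m1 /m2 /mid /= /GRing.scale /=; field.
Qed.

Lemma lamK3 : [/\ lam (K3 M) i0 x = l0 - l2 + l1, lam (K3 M) i1 x = 2 * l1 & lam (K3 M) i2 x = 2 * (l2 - l1)].
Proof.
have s := lam_total; apply: lamK; rewrite ?inE ?eqxx ?orbT//; first by rewrite -[RHS]s; ring.
by apply: pairE; rewrite /K3 /m1 /m3 /mid /= /GRing.scale /=; field.
Qed.

Lemma lamK4 : [/\ lam (K4 M) i0 x = l2 - l0 - l1, lam (K4 M) i1 x = 2 * l1 & lam (K4 M) i2 x = 2 * l0].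
Proof.
have s := lam_total; apply: lamK; rewrite ?inE ?eqxx ?orbT//; first by rewrite -[RHS]s; ring.
by apply: pairE; rewrite /K4 /m1 /m3 /mid /= /GRing.scale /=; field.
Qed.

Lemma hull3 K : orient K != 0 -> hull (verts K) x <->
  [/\ 0 <= lam K i0 x, 0 <= lam K i1 x & 0 <= lam K i2 x].
Proof.
by move=> hK; rewrite hullE//; split=> [h|[? ? ?]]; [split; exact: h|apply: ord3P].
Qed.

Lemma sub_hull K : K \in subtris M -> hull (verts K) x -> hull (verts M) x.
Proof.
have s := lam_total; move: K; apply: subP => /hull3.
- have [e0 e1 e2] := lamK1; rewrite e0 e1 e2.
  move=> /(_ (sub_orient0 hM _)); rewrite !inE !eqxx ?orbT => /(_ isT)[*]; apply/hull3 => //; split; lra.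
- have [e0 e1 e2] := lamK2; rewrite e0 e1 e2.
  move=> /(_ (sub_orient0 hM _)); rewrite !inE !eqxx ?orbT => /(_ isT)[*]; apply/hull3 => //; split; lra.
- have [e0 e1 e2] := lamK3; rewrite e0 e1 e2.
  move=> /(_ (sub_orient0 hM _)); rewrite !inE !eqxx ?orbT => /(_ isT)[*]; apply/hull3 => //; split; lra.
- have [e0 e1 e2] := lamK4; rewrite e0 e1 e2.
  move=> /(_ (sub_orient0 hM _)); rewrite !inE !eqxx ?orbT => /(_ isT)[*]; apply/hull3 => //; split; lra.
Qed.
End Lam.

Section Faces.
Variable (M : tri R).
Hypothesis hM : orient M != 0.

Lemma subH1 x : hull (verts (K1 M)) x <->
  [/\ 0 <= lam M i1 x - lam M i0 x - lam M i2 x, 0 <= lam M i2 x & 0 <= lam M i0 x].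
Proof.
rewrite hull3; last by apply: (sub_orient0 hM); rewrite !inE eqxx ?orbT.
by have [-> -> ->] := lamK1 x hM; split=> -[*]; split; lra.
Qed.

Lemma subH2 x : hull (verts (K2 M)) x <->
  [/\ 0 <= lam M i0 x - lam M i1 x + lam M i2 x, 0 <= lam M i2 x & 0 <= lam M i1 x - lam M i2 x].
Proof.
rewrite hull3; last by apply: (sub_orient0 hM); rewrite !inE eqxx ?orbT.
by have [-> -> ->] := lamK2 x hM; split=> -[*]; split; lra.
Qed.

Lemma subH3 x : hull (verts (K3 M)) x <->
  [/\ 0 <= lam M i0 x - lam M i2 x + lam M i1 x, 0 <= lam M i1 x & 0 <= lam M i2 x - lam M i1 x].
Proof.
rewrite hull3; last by apply: (sub_orient0 hM); rewrite !inE eqxx ?orbT.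
by have [-> -> ->] := lamK3 x hM; split=> -[*]; split; lra.
Qed.

Lemma subH4 x : hull (verts (K4 M)) x <->
  [/\ 0 <= lam M i2 x - lam M i0 x - lam M i1 x, 0 <= lam M i1 x & 0 <= lam M i0 x].
Proof.
rewrite hull3; last by apply: (sub_orient0 hM); rewrite !inE eqxx ?orbT.
by have [-> -> ->] := lamK4 x hM; split=> -[*]; split; lra.
Qed.

Lemma sub_cover x : hull (verts M) x -> exists2 K, K \in subtris M & hull (verts K) x.
Proof.
move=> /(hull3 x hM)[h0 h1 h2].
have [c1|c1] := leP (lam M i0 x + lam M i2 x) (lam M i1 x).
  by exists (K1 M); [rewrite !inE eqxx ?orbT|apply/subH1; split; lra].
have [c2|c2] := leP (lam M i0 x + lam M i1 x) (lam M i2 x).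
  by exists (K4 M); [rewrite !inE eqxx ?orbT|apply/subH4; split; lra].
have [c3|c3] := leP (lam M i2 x) (lam M i1 x).
  by exists (K2 M); [rewrite !inE eqxx ?orbT|apply/subH2; split; lra].
by exists (K3 M); [rewrite !inE eqxx ?orbT|apply/subH3; split; lra].
Qed.

(** The barycentric coordinates of the sub-triangles are linear in those of [M], so each pair of
    sub-triangles is a matter of linear arithmetic. *)
Lemma sub_disj K L x : K \in subtris M -> L \in subtris M -> K != L -> oK K x ->
  ~ hull (verts L) x.
Proof.
move=> KM LM KL oKx; move: (oKx i0) (oKx i1) (oKx i2); clear oKx.
have [a0 a1 a2] := lamK1 x hM; have [b0 b1 b2] := lamK2 x hM.
have [c0 c1 c2] := lamK3 x hM; have [d0 d1 d2] := lamK4 x hM.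
move: K KM L LM KL; apply: subP; apply: subP; rewrite ?eqxx //= => _;
  rewrite ?a0 ?a1 ?a2 ?b0 ?b1 ?b2 ?c0 ?c1 ?c2 ?d0 ?d1 ?d2 => o0 o1 o2;
  first [move=> /subH1[*] | move=> /subH2[*] | move=> /subH3[*] | move=> /subH4[*]]; lra.
Qed.

Lemma sub_face_same K L x i : K \in subtris M -> L \in subtris M -> hull (verts K) x ->
  hull (verts L) x -> lam K i x != 0 -> vt K i \in verts L.
Proof.
move=> KM LM.
have [a0 a1 a2] := lamK1 x hM; have [b0 b1 b2] := lamK2 x hM.
have [c0 c1 c2] := lamK3 x hM; have [d0 d1 d2] := lamK4 x hM.
have z (u : R) (b : bool) : u = 0 -> u != 0 -> b by move=> ->; rewrite eqxx.
move: K KM L LM; apply: subP; apply: subP;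
  first [move=> /subH1[? ? ?] | move=> /subH2[? ? ?] | move=> /subH3[? ? ?] | move=> /subH4[? ? ?]];
  first [move=> /subH1[? ? ?] | move=> /subH2[? ? ?] | move=> /subH3[? ? ?] | move=> /subH4[? ? ?]];
  move: i; apply: ord3P; rewrite ?a0 ?a1 ?a2 ?b0 ?b1 ?b2 ?c0 ?c1 ?c2 ?d0 ?d1 ?d2;
  rewrite /vt /K1 /K2 /K3 /K4 /= !inE ?eqxx ?orbT //; apply: z; lra.
Qed.

Lemma midC A B : mid (A, B) = mid (B, A).
Proof. by rewrite /mid /= addrC. Qed.

Lemma ept_m : [/\ ept M i0 = m1 M, ept M i2 = m2 M & ept M i1 = m3 M].
Proof. by split=> //; rewrite /ept /m3 midC. Qed.

(** The number [t] is the position on the macro edge from [ea M c] to [eb M c], and 1/2 is its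
    midpoint. Position alone decides which sub-vertices carry weight, which allows comparison with
    the macro-element on the other side. *)
Lemma sub_edge K x c : K \in subtris M -> hull (verts K) x -> lam M c x = 0 ->
  let t := lam M (nx (nx c)) x in
  [/\ forall i, lam K i x != 0 -> [\/ vt K i = ea M c /\ t < 2^-1, vt K i = eb M c /\ 2^-1 < t
        | vt K i = ept M c /\ 0 < t < 1],
    t < 2^-1 -> ea M c \in verts K, 2^-1 < t -> eb M c \in verts K
  & 0 < t < 1 -> ept M c \in verts K].
Proof.
move=> KM; have s := lam_total x hM.
have [a0 a1 a2] := lamK1 x hM; have [b0 b1 b2] := lamK2 x hM.
have [c0 c1 c2] := lamK3 x hM; have [d0 d1 d2] := lamK4 x hM.
have [e0 e2 e1] := ept_m.
have z (u : R) (b : Prop) : u = 0 -> u != 0 -> b by move=> ->; rewrite eqxx.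
move: K KM c; apply: subP; apply: ord3P;
  first [move=> /subH1[? ? ?] | move=> /subH2[? ? ?] | move=> /subH3[? ? ?] | move=> /subH4[? ? ?]];
  move=> lc t; rewrite ?e0 ?e1 ?e2; rewrite {}/t /=;
  rewrite /ea /eb /verts /= !inE ?eqxx ?orbT /=;
  (split=> [|? //|? //|/andP[? ?] //]; [apply: ord3P;
    rewrite ?a0 ?a1 ?a2 ?b0 ?b1 ?b2 ?c0 ?c1 ?c2 ?d0 ?d1 ?d2 /vt /= => ?; first
     [by apply: z; [|eassumption]; lra
     |by constructor 1; split; [|lra]
     |by constructor 2; split; [|lra]
     |by constructor 3; split; [|apply/andP; split; lra]]|..]; try (exfalso; lra)).
Qed.
End Faces.

End Subdivision.

(** * Symmetric matrices with vanishing normal component *)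

Section SymmetricMatrices.
Variable R : realType.
Implicit Types (t : pt R) (J : 'M[R]_2).

Definition tt t : 'M[R]_2 := vec t *m (vec t)^T.

Lemma ttE t (i j : 'I_2) : tt t i j = vec t i 0 * vec t j 0.
Proof. by rewrite /tt !mxE big_ord1 !mxE. Qed.

Lemma tt_entries t : [/\ tt t 0 0 = t.1 * t.1, tt t 0 1 = t.1 * t.2, tt t 1 0 = t.2 * t.1 & tt t 1 1 = t.2 * t.2].
Proof. by rewrite !ttE !mxE. Qed.

Lemma tt_sym t : (tt t)^T = tt t.
Proof. by rewrite /tt trmx_mul trmxK. Qed.

Lemma ttZ (a : R) t : tt (a *: t) = a ^+ 2 *: tt t.
Proof.
apply/matrixP => i j; rewrite ttE [RHS]mxE ttE !mxE.
by case: (i == 0); case: (j == 0); rewrite /= /GRing.scale /=; ring.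
Qed.

Lemma ord2P (P : 'I_2 -> Prop) : P 0 -> P 1 -> forall i, P i.
Proof.
move=> h0 h1 [[|[|//]] hi].
- by rewrite (_ : Ordinal hi = 0)//; exact: val_inj.
- by rewrite (_ : Ordinal hi = 1)//; exact: val_inj.
Qed.

Lemma mx2P (A B : 'M[R]_2) : A 0 0 = B 0 0 -> A 0 1 = B 0 1 -> A 1 0 = B 1 0 -> A 1 1 = B 1 1 -> A = B.
Proof. by move=> h1 h2 h3 h4; apply/matrixP; apply: ord2P; apply: ord2P. Qed.

(** The reason for the form of the tangential bubbles: normal continuity of a symmetric stress
    leaves a jump in only one direction of matrices. *)
Lemma sym_rank1 J t : J^T = J -> t != 0 -> (forall i : 'I_2, t.2 * J i 0 - t.1 * J i 1 = 0) ->
  exists a, J = a *: tt t.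
Proof.
move=> sJ t0 h; have h0 := h 0; have h1 := h 1.
have s01 : J 0 1 = J 1 0 by rewrite -{1}sJ mxE.
have [e0 e1 e2 e3] := tt_entries t.
have [z|nz] := eqVneq t.1 0.
  have n2 : t.2 != 0 by apply: contra t0 => /eqP z2; apply/eqP; apply: pairE.
  rewrite z mul0r subr0 in h0; rewrite z mul0r subr0 in h1.
  move/eqP: h0; rewrite mulf_eq0 (negbTE n2) => /eqP j00.
  move/eqP: h1; rewrite mulf_eq0 (negbTE n2) => /eqP j10.
  exists (J 1 1 / t.2 ^+ 2); apply: mx2P; rewrite mxE ?e0 ?e1 ?e2 ?e3 ?z ?mul0r ?mulr0 ?s01 ?j00 ?j10//.
  by rewrite -expr2 divfK// expf_neq0.
have j01 : J 0 1 = t.2 / t.1 * J 0 0 by apply: (mulfI nz); rewrite mulrA mulrCA divff// mulr1; apply/eqP; rewrite eq_sym -subr_eq0 h0.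
have j11 : J 1 1 = t.2 / t.1 * J 1 0 by apply: (mulfI nz); rewrite mulrA mulrCA divff// mulr1; apply/eqP; rewrite eq_sym -subr_eq0 h1.
exists (J 0 0 / t.1 ^+ 2); apply: mx2P; rewrite mxE ?e0 ?e1 ?e2 ?e3 ?j11 -?s01 ?j01; field; exact: nz.
Qed.
End SymmetricMatrices.

(** Independent rows in [W] are added one at a time: as long as there are fewer than [n] of them,
    some nonzero [zeta] is orthogonal to all, and duality provides an element of [W] not orthogonal
    to it. *)
Lemma full_subspace (F : fieldType) n (W : 'rV[F]_n -> Prop) : W 0 ->
  (forall (a : F) u v, W u -> W v -> W (a *: u + v)) ->
  (forall zeta : 'cV[F]_n, (forall w, W w -> w *m zeta = 0) -> zeta = 0) -> forall v, W v.
Proof.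
move=> W0 Wlin dual.
have Wsum m (c : 'I_m -> F) (r : 'I_m -> 'rV[F]_n) : (forall i, W (r i)) -> W (\sum_i c i *: r i).
  move=> hr; elim/big_ind: _ => // [u v hu hv|i _]; first by rewrite -[u]scale1r; exact: Wlin.
  by rewrite -[_ *: _]addr0; exact: Wlin.
suff [A fA WA] : exists2 A : 'M[F]_n, row_free A & forall i, W (row i A).
  move=> v; have uA : A \in unitmx by rewrite -row_free_unit.
  rewrite -(mulmxKV uA v) mulmx_sum_row; exact: Wsum.
suff h k : (k <= n)%N -> exists2 A : 'M[F]_(k, n), row_free A & forall i, W (row i A) by exact: h.
elim: k => [_|k IH kn]; first by exists 0; [rewrite /row_free mxrank0|case].
have [A fA WA] := IH (ltnW kn).
have [zeta z0 Az] : exists2 zeta : 'cV[F]_n, zeta != 0 & A *m zeta = 0.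
  have : kermx A^T != 0.
    by rewrite -mxrank_eq0 mxrank_ker mxrank_tr (eqP fA) subn_eq0 -ltnNge.
  move=> /rowV0Pn[u /sub_kermxP uA un]; exists u^T.
    by apply: contra un => /eqP /(congr1 trmx); rewrite trmxK trmx0 => ->.
  by rewrite -[A]trmxK -trmx_mul uA trmx0.
have [w Ww wz] : exists2 w, W w & w *m zeta != 0.
  apply: contrapT => h; move: z0; rewrite (dual zeta) ?eqxx// => w Ww.
  by apply/eqP/negPn/negP => wz; apply: h; exists w.
rewrite -addn1; exists (col_mx A w).
  apply/row_freeP; apply/row_freeP/inj_row_free => x; rewrite -[x]hsubmxK mul_row_col => e.
  have : (lsubmx x *m A + rsubmx x *m w) *m zeta = 0 by rewrite e mul0mx.
  rewrite mulmxDl -!mulmxA Az mulmx0 add0r [rsubmx x]mx11_scalar mul_scalar_mx => /eqP.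
  rewrite scaler_eq0 (negbTE wz) orbF => /eqP r0.
  have r00 : rsubmx x = 0 by apply/matrixP => i j; rewrite !ord1 r0 mxE.
  move: e; rewrite r00 mul0mx addr0 -[RHS](mul0mx _ A) => /(row_free_inj fA) ->.
  by rewrite mxE raddf0 row_mx0.
move=> i; case: (splitP i) => j ij.
  by have -> : i = lshift 1 j by [apply: val_inj]; rewrite rowKu.
by have -> : i = rshift k j by [apply: val_inj]; rewrite rowKd ord1 row_id.
Qed.

(** * Rigid motions and functionals on linear vector fields *)

Section Rigid.
Variable R : realType.
Implicit Types (K L M N : tri R) (x y u v w t X Y A B : pt R) (i j m c d k : 'I_3).
Implicit Types (f g : pt R -> R) (F G : pt R -> pt R).

Definition perp u : pt R := (- u.2, u.1).

Lemma dirM v (k l : nat) f g : polyn k f -> polyn l g ->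
  dir v (fun x => f x * g x) = fun x => f x * dir v g x + g x * dir v f x.
Proof.
move=> hf hg; rewrite dirF; apply/funext => x.
by apply: deriveM; [exact: polyn_derivable hf|exact: polyn_derivable hg].
Qed.

Lemma dir_lam K i u : dir u (lam K i) = fun=> cross (eb K i - ea K i) u / orient K.
Proof.
have -> : lam K i = aff (- (eb K i - ea K i).2 / orient K) ((eb K i - ea K i).1 / orient K) (lam K i 0).
  apply/funext => x; rewrite /aff /lam -/(ea K i) -/(eb K i) /cross /=.
  by rewrite !mulrBl; ring.
by rewrite dir_aff; apply/funext => _; rewrite /cross [RHS]mulrBl; ring.
Qed.

Definition rigid F := exists a b ga : R, forall x, F x = (a - ga * x.2, b + ga * x.1).

(** The value at [X] leaves only a rotation about [X]. It moves [Y] perpendicularly to [Y - X], with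
    component along [t] proportional to [cross (Y - X) t]. *)
Lemma rigid_eq F G X Y t : rigid F -> rigid G -> F X = G X -> dot (F Y - G Y) t = 0 ->
  cross (Y - X) t != 0 -> F = G.
Proof.
move=> [a [b [ga hF]]] [a' [b' [ga' hG]]]; rewrite !hF !hG => -[e1 e2] e3 ct.
have e4 : (ga - ga') * cross (Y - X) t = 0.
  rewrite -[RHS]e3 /dot /cross /=.
  have -> : a = a' - ga' * X.2 + ga * X.2 by rewrite -e1 subrK.
  have -> : b = b' + ga' * X.1 - ga * X.1 by rewrite -e2 addrK.
  ring.
have gg : ga = ga'.
  by move: e4 => /eqP; rewrite mulf_eq0 (negbTE ct) orbF subr_eq0 => /eqP.
apply/funext => x; rewrite hF hG -gg; rewrite -gg in e1 e2.
by move: e1 e2 => /addIr -> /addIr ->.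
Qed.

Lemma perp_cross X Y : X != Y -> cross (Y - X) (perp (Y - X)) != 0.
Proof.
move=> XY; have -> : cross (Y - X) (perp (Y - X)) = (Y - X).1 ^+ 2 + (Y - X).2 ^+ 2.
  by rewrite /cross /perp /=; ring.
rewrite paddr_eq0 ?sqr_ge0// !sqrf_eq0; apply: contra XY => /andP[/eqP h1 /eqP h2].
by rewrite eq_sym -subr_eq0; apply/eqP; exact: pairE.
Qed.

Lemma rigid_eq2 F G X Y : rigid F -> rigid G -> F X = G X -> F Y = G Y -> X != Y -> F = G.
Proof.
move=> rF rG e1 e2 XY; apply: (rigid_eq rF rG e1 _ (perp_cross XY)).
by rewrite e2 subrr /dot !mul0r addr0.
Qed.

Lemma dot_indep u v w : cross v w != 0 -> dot u v = 0 -> dot u w = 0 -> u = 0.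
Proof.
rewrite /dot => ct g1 g2; apply: pairE; apply: (mulIf ct); rewrite mul0r /cross.
  transitivity (w.2 * (u.1 * v.1 + u.2 * v.2) - v.2 * (u.1 * w.1 + u.2 * w.2)); first ring.
  by rewrite g1 g2 !mulr0 subrr.
transitivity (v.1 * (u.1 * w.1 + u.2 * w.2) - w.1 * (u.1 * v.1 + u.2 * v.2)); first ring.
by rewrite g1 g2 !mulr0 subrr.
Qed.

Lemma sum3_nx (V : nmodType) (F : 'I_3 -> V) c : \sum_i F i = F c + F (nx c) + F (nx (nx c)).
Proof.
rewrite (bigD1 c)//= (bigD1 (nx c)) ?(nx_neq c).1.1//= (big_pred1 (nx (nx c))) ?addrA// => k.
by case: (ord3_cases c k) => ->; move: c; apply: ord3P.
Qed.

Lemma half_neq : ((1 : R) != 2^-1) /\ ((2 : R)^-1 != 0).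
Proof. by split; apply/eqP => h; lra. Qed.

Lemma ept_inj M c d : orient M != 0 -> ept M c = ept M d -> c = d.
Proof.
move=> hM e; have := lam_ept c c hM; rewrite e lam_ept// eqxx; case: eqP => // _ /eqP.
by rewrite (negbTE half_neq.2).
Qed.

Lemma ept_vt M c k : orient M != 0 -> ept M c != vt M k.
Proof.
move=> hM; apply/eqP => e; have := lam_ept k c hM; rewrite e lam_vt// eqxx.
by case: ifP => _ /eqP; rewrite ?oner_eq0// (negbTE half_neq.1).
Qed.

(** The nodal data of the Lagrange basis function at [X]; thus [quad K (dlt X)] is the restriction
    of that function to [K]. *)
Definition dlt X Y : R := (Y == X)%:R.

Lemma quad_dlt0 K X : (forall i, X != vt K i) -> (forall i, X != ept K i) -> quad K (dlt X) = fun=> 0.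
Proof.
move=> hv he; apply/funext => x; rewrite /quad big1// => i _.
by rewrite /dlt ![_ == X]eq_sym (negbTE (hv i)) (negbTE (he i)) !mul0r addr0.
Qed.

Section Element.
Variables (K : tri R) (z : 'I_3 -> pt R).
Hypothesis hK : orient K != 0.
Local Notation o := (orient K).

Lemma dir_quad s t x : let D i := cross (eb K i - ea K i) t / o in
  dir t (quad K s) x = \sum_i (s (vt K i) * ((4 * lam K i x - 1) * D i) +
    s (ept K i) * (4 * (lam K (nx i) x * D (nx (nx i)) + lam K (nx (nx i)) x * D (nx i)))).
Proof.
move=> D; pose F i y := s (vt K i) * (lam K i y * (2 * lam K i y - 1)) +
  s (ept K i) * (4 * (lam K (nx i) y * lam K (nx (nx i)) y)).
have h i : polyn 1 (lam K i) by exact: lam_polyn.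
have h2 i : polyn 1 (fun y => 2 * lam K i y - 1) by apply: polynB; [exact: polynZ|exact: polyn_cst].
have p1 i : polyn 2 (fun y => lam K i y * (2 * lam K i y - 1)) by exact: (polynM (k := 1) (l := 1)).
have p2 i : polyn 2 (fun y => lam K (nx i) y * lam K (nx (nx i)) y) by exact: (polynM (k := 1) (l := 1)).
have pF i : polyn 2 (F i) by apply: polynD; apply: polynZ => //; exact: polynZ.
have dF i : dir t (F i) x = s (vt K i) * ((4 * lam K i x - 1) * D i) +
    s (ept K i) * (4 * (lam K (nx i) x * D (nx (nx i)) + lam K (nx (nx i)) x * D (nx i))).
  rewrite /F (dirD t (polynZ _ (p1 i)) (polynZ _ (polynZ _ (p2 i)))) (dirZ t _ (p1 i)).
  rewrite (dirZ t _ (polynZ _ (p2 i))) (dirZ t _ (p2 i)) (dirM t (h i) (h2 i)).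
  rewrite (dirM t (h (nx i)) (h (nx (nx i)))) (dirB t (polynZ 2 (h i)) (polyn_cst 1 1)).
  by rewrite (dirZ t 2 (h i)) dir_cst !dir_lam /D; ring.
have -> : quad K s = fun y => F i0 y + F i1 y + F i2 y by apply/funext => y; rewrite /quad sum3.
by rewrite (dirD t (polynD (pF i0) (pF i1)) (pF i2)) (dirD t (pF i0) (pF i1)) sum3 !dF.
Qed.

(** The functional with coefficients [z k] at the vertices, applied to the divergence of [f] times
    [tt t]; that divergence is the derivative of [f] along [t] times [t]. *)
Definition ell f t : R := \sum_k dot (z k) t * dir t f (vt K k).

Lemma ell0 t : ell (fun=> 0) t = 0.
Proof. by rewrite /ell big1// => k _; rewrite dir_cst mulr0. Qed.

Lemma ell_ept i t : let D i := cross (eb K i - ea K i) t / o in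
  ell (quad K (dlt (ept K i))) t = 4 * (dot (z (nx i)) t * D (nx (nx i)) + dot (z (nx (nx i))) t * D (nx i)).
Proof.
move=> D.
have e j : dlt (ept K i) (ept K j) = (j == i)%:R.
  by congr (nat_of_bool _)%:R; apply/eqP/eqP => [/(ept_inj hK)|->].
have v j : dlt (ept K i) (vt K j) = 0 by rewrite /dlt eq_sym (negbTE (ept_vt i j hK)).
rewrite /ell !sum3 !dir_quad !sum3 !v !e !lam_vt//; rewrite /D.
by move: i {e v}; apply: ord3P; rewrite /= /nx /=; ring.
Qed.

Lemma ell_vt i t : ell (quad K (dlt (vt K i))) t =
  (4 * dot (z i) t - \sum_j dot (z j) t) * (cross (eb K i - ea K i) t / o).
Proof.
have e j : dlt (vt K i) (vt K j) = (j == i)%:R.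
  by congr (nat_of_bool _)%:R; apply/eqP/eqP => [/(vt_inj hK)|->].
have v j : dlt (vt K i) (ept K j) = 0 by rewrite /dlt (negbTE (ept_vt j i hK)).
rewrite /ell !sum3 !dir_quad !sum3 !v !e !lam_vt//.
by move: i {e v}; apply: ord3P; rewrite /=; ring.
Qed.

(** The hypothesis says that the displacements [z] do not stretch any edge to first order, and three
    edges leave a translation and an infinitesimal rotation. *)
Lemma rigid_nodes : (forall c, dot (z (nx c) - z (nx (nx c))) (eb K c - ea K c) = 0) ->
  exists (c0 : pt R) (be : R), forall k, z k = c0 + be *: perp (vt K k).
Proof.
move=> h; have := h i0; have := h i1; have := h i2; rewrite /dot /ea /eb /vt /= => e2 e1 e0.
pose be := - dot (z i2 - z i0) (K.1.2 - K.1.1) / o.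
exists (z i0 - be *: perp K.1.1), be.
have hb : be * o = - dot (z i2 - z i0) (K.1.2 - K.1.1) by rewrite divfK.
have ct : cross (K.1.2 - K.1.1) (K.2 - K.1.1) != 0 by exact: hK.
have nx3 : [/\ nx i0 = i1, nx i1 = i2 & nx i2 = i0] by split; exact: val_inj.
have [n0 n1 n2] := nx3; rewrite !n0 !n1 !n2 in e0 e1 e2.
have zP (i : 'I_3) (X : pt R) : (i, X) \in [:: (i1, K.1.2); (i2, K.2)] -> z i - z i0 - be *: perp (X - K.1.1) = 0.
  move=> iX; apply: (dot_indep ct); move: iX hb e0 e1 e2; rewrite !inE /orient /cross /dot /perp /=;
    rewrite /GRing.scale /= => /orP[]/eqP[-> ->]; move: (z i0) (z i1) (z i2) be => [? ?] [? ?] [? ?] be /=;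
    clear; lra.
move=> k; rewrite /vt; move: k; apply: ord3P => /=; first by rewrite subrK.
- have /eqP := zP i1 K.1.2 (mem_head _ _); rewrite subr_eq0 subr_eq => /eqP ->.
  by pt_ring.
- have /eqP := zP i2 K.2 (mem_last (i1, K.1.2) [:: (i2, K.2)]); rewrite subr_eq0 subr_eq => /eqP ->.
  by pt_ring.
Qed.

Variables (c0 : pt R) (be : R).
(** One sixth of the L^2 Riesz density of the functional: inverting the mass matrix of linear
    elements gives [4 *: z k] minus the sum of the [z] at vertex [k], up to a factor, and [|o| / 2]
    is the area. *)
Definition react x : pt R := `|o|^-1 *: (c0 + be *: perp (4 *: x - \sum_k vt K k)).

Lemma react_rigid : rigid react.
Proof.
rewrite /react; move: (\sum_k _) => s.
exists (`|o|^-1 * (c0.1 + be * s.2)), (`|o|^-1 * (c0.2 - be * s.1)), (`|o|^-1 * (be * 4)) => x.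
by apply: pairE; rewrite /perp /= /GRing.scale /=; ring.
Qed.

Let sgE : o^-1 = Num.sg o * `|o|^-1.
Proof.
rewrite [in LHS](numEsg o) invfM; congr (_ * _).
by case: (sgrP o) => // _; rewrite ?invr0 ?invr1 ?invrN ?invr1.
Qed.

Hypothesis zE : forall k, z k = c0 + be *: perp (vt K k).

(** Against a rigid density, integration by parts leaves only edge integrals of cubics, for which
    Simpson's rule is exact. Its weight 4/6 at the midpoint, times the factor 6 absorbed by [react],
    gives the 4. *)
Lemma ell_ept_react i t : ell (quad K (dlt (ept K i))) t =
  - 4 * (dot (react (ept K i)) t * cross (Num.sg o *: (eb K i - ea K i)) t).
Proof.
rewrite ell_ept !zE /react sgE; move: (Num.sg o) `|o|^-1 => s a.
rewrite (sum3_nx _ i) /dot /cross /perp /ea /eb /ept /mid !nxK /= /GRing.scale /=; by field.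
Qed.

(** Here Simpson's rule has weight 1/6 on each of the two edges at the vertex, and the sum of their
    vectors is minus the opposite edge. *)
Lemma ell_vt_react i t : ell (quad K (dlt (vt K i))) t =
  dot (react (vt K i)) t * cross (Num.sg o *: (eb K i - ea K i)) t.
Proof.
rewrite ell_vt !(sum3_nx _ i) !zE /react sgE (sum3_nx _ i); move: (Num.sg o) `|o|^-1 => s a.
by rewrite /dot /cross /perp /ea /eb /= /GRing.scale /=; ring.
Qed.

Lemma react0 : (forall x, react x = 0) -> forall k, z k = 0.
Proof.
have a0 : `|o|^-1 != 0 by rewrite invr_neq0// normr_eq0.
move=> h; have e x : c0 + be *: perp (4 *: x - \sum_k vt K k) = 0.
  by have /eqP := h x; rewrite scaler_eq0 (negbTE a0) => /eqP.
have b0 : be = 0.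
  have := e (\sum_k vt K k); have := e (1 + \sum_k vt K k); move: (\sum_k vt K k) => s.
  by move=> /(congr1 snd) + /(congr1 snd); rewrite /perp /= /GRing.scale /= => h1 h2; lra.
by move: (e 0); rewrite b0 scale0r addr0 => c00 k; rewrite zE c00 b0 scale0r addr0.
Qed.
End Element.

End Rigid.

(** * The macro mesh, its subdivision and the finite element spaces *)

Section MacroMesh.
Variable R : realType.
Variables (Omega : set (pt R)) (Mh : seq (tri R)).
Hypothesis conf : conforming_mesh Omega Mh.
Hypothesis oO : open Omega.
Hypothesis cO : connected Omega.
Hypothesis iO : (closure Omega)^° `<=` Omega.
Hypothesis bO : bounded_set Omega.
Hypothesis bdconn : connected (closure Omega `\` Omega).
Hypothesis bdperf : forall (F : seq (pt R)) x (e : R), (closure Omega `\` Omega) x -> 0 < e ->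
  exists y, [/\ (closure Omega `\` Omega) y, ball x e y & y \notin F].
Hypothesis punct : forall X (e : R), closure Omega X -> 0 < e ->
  exists2 r : R, 0 < r <= e & connected [set y | [/\ Omega y, ball X r y & y != X]].
Let T := submesh Mh.

Implicit Types (K L M N : tri R) (x y X : pt R) (i j m c : 'I_3).

(** * Conformity of the subdivision *)

Section SubMesh.
Implicit Types (A B : pt R) (a : 'I_3) (t : R).

Lemma submeshP K : reflect (exists2 M, M \in Mh & K \in subtris M) (K \in submesh Mh).
Proof. exact: flatten_mapP. Qed.

Lemma hull_face K L x : orient K != 0 -> hull (verts K) x ->
  (forall i, lam K i x != 0 -> vt K i \in verts L) ->
  hull [seq v <- verts K | v \in verts L] x.
Proof.
move=> hK hx h; have [h0 h1 h2] := (hull3 x hK).1 hx.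
have s := lam_total x hK; have xE := lam_dec x hK; rewrite sum3 in xE.
have z i : vt K i \notin verts L -> lam K i x = 0.
  by move=> /negP nL; apply/eqP/negPn/negP => /h.
have [z0 z1 z2] := And3 (z i0) (z i1) (z i2); clear z h.
move: xE z0 z1 z2 h0 h1 h2 s; move: (lam K i0 x) (lam K i1 x) (lam K i2 x) => a b d.
rewrite /vt /verts /= => -> .
case: (K.1.1 \in _); case: (K.1.2 \in _); case: (K.2 \in _) => z0 z1 z2 h0 h1 h2 s.
- exists (c3 a b d); split; rewrite ?sum3//; first by apply: ord3P.
- exists (fun i : 'I_2 => if i == ord0 then a else b); split.
  + by move=> i; case: ifP.
  + by rewrite !big_ord_recl big_ord0 /=; rewrite -s z2// !addr0.
  + by rewrite !big_ord_recl big_ord0 /= z2// scale0r !addr0.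
- exists (fun i : 'I_2 => if i == ord0 then a else d); split.
  + by move=> i; case: ifP.
  + by rewrite !big_ord_recl big_ord0 /=; rewrite -s z1// !addr0.
  + by rewrite !big_ord_recl big_ord0 /= z1// scale0r !addr0.
- exists (fun i : 'I_1 => a); split => //.
  + by rewrite !big_ord_recl big_ord0 /=; rewrite -s z1// z2// !addr0.
  + by rewrite !big_ord_recl big_ord0 /= z1// z2// !scale0r !addr0.
- exists (fun i : 'I_2 => if i == ord0 then b else d); split.
  + by move=> i; case: ifP.
  + by rewrite !big_ord_recl big_ord0 /=; rewrite -s z0// !addr0 add0r.
  + by rewrite !big_ord_recl big_ord0 /= z0// scale0r !addr0 add0r.
- exists (fun i : 'I_1 => b); split => //.
  + by rewrite !big_ord_recl big_ord0 /=; rewrite -s z0// z2// !addr0 add0r.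
  + by rewrite !big_ord_recl big_ord0 /= z0// z2// !scale0r !addr0 add0r.
- exists (fun i : 'I_1 => d); split => //.
  + by rewrite !big_ord_recl big_ord0 /=; rewrite -s z0// z1// !addr0 !add0r.
  + by rewrite !big_ord_recl big_ord0 /= z0// z1// !scale0r !addr0 !add0r.
- by exfalso; move: s; rewrite z0// z1// z2// !addr0 => /esym/eqP; rewrite oner_eq0.
Qed.

Lemma verts_uniq K : orient K != 0 -> uniq (verts K).
Proof.
move=> hK; have v := vt_inj hK; rewrite /= !inE negb_or andbT.
rewrite -!andbA; apply/and3P; split; apply/eqP => e.
- by have := v i0 i1 e.
- by have := v i0 i2 e.
- by have := v i1 i2 e.
Qed.

Definition bary K : pt R := 3^-1 *: (K.1.1 + K.1.2 + K.2).

Lemma lam_bary K i : orient K != 0 -> lam K i (bary K) = 3^-1.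
Proof.
move=> hK; have -> : bary K = \sum_i 3^-1 *: vt K i by rewrite sum3 /bary /= !scalerDr.
by rewrite (lam_uniq (c := fun=> 3^-1))// sum3; field.
Qed.

(** With three common vertices [L] would contain the barycentre of [K]. *)
Lemma common_size K L : orient K != 0 -> ~ hull (verts L) (bary K) ->
  (size [seq v <- verts K | v \in verts L] <= 2)%N.
Proof.
move=> hK nL; rewrite leqNgt; apply/negP; rewrite size_filter => h3.
have : all (mem (verts L)) (verts K).
  by rewrite all_count eqn_leq count_size; exact: h3.
move=> /allP hall; apply: nL; apply: (@hull_sub _ (verts K)).
- by move=> v /hall.
- exact: verts_uniq.
- rewrite hullE// => i; rewrite lam_bary//; lra.
Qed.

Lemma nT K : K \in T -> orient K != 0.
Proof. by move=> /submeshP[M MM]; apply: sub_orient0; exact: (orT conf). Qed.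

Lemma oK_macro M K : orient M != 0 -> K \in subtris M -> oK K `<=` oK M.
Proof.
move=> hM KM x hx.
have s := lam_total x hM; move: (hx i0) (hx i1) (hx i2); clear hx.
have [a0 a1 a2] := lamK1 x hM; have [b0 b1 b2] := lamK2 x hM.
have [c0 c1 c2] := lamK3 x hM; have [d0 d1 d2] := lamK4 x hM.
by move: K KM; apply: subP; rewrite ?a0 ?a1 ?a2 ?b0 ?b1 ?b2 ?c0 ?c1 ?c2 ?d0 ?d1 ?d2 => ? ? ?;
  apply: ord3P; lra.
Qed.

Lemma vertex_sub N L b x : orient N != 0 -> L \in subtris N -> hull (verts L) x -> x = vt N b ->
  x \in verts L /\ forall i, lam L i x != 0 -> vt L i = x.
Proof.
move=> hN LN Lx xE; have l0 : lam N (nx (nx b)) x = 0.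
  by rewrite xE lam_vt// (negbTE (nx_neq b).1.2).
have [h1 h2 _ _] := sub_edge hN LN Lx l0; rewrite nxK in h1 h2.
have lt : lam N (nx b) x = 0 by rewrite xE lam_vt// (negbTE (nx_neq b).1.1).
rewrite lt /ea nxK -xE in h1 h2; split; first by apply: h2; lra.
by move=> i /h1[[->]|[_ h]|[_ /andP[h _]]] //; move: h; rewrite ?ltxx// ltNge invr_ge0 ler0n.
Qed.

(** A common point of two macro-elements is a common vertex or lies in the open part of a common
    edge. On such an edge both subdivisions use the same midpoint, so they induce the same two
    halves. *)
Lemma sub_face M N K L x i : M \in Mh -> N \in Mh -> M != N -> K \in subtris M ->
  L \in subtris N -> hull (verts K) x -> hull (verts L) x -> lam K i x != 0 ->
  vt K i \in verts L.
Proof.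
move=> MM NM MN KM LN Kx Lx li; have [hM hN] := (orT conf MM, orT conf NM).
have Mx := sub_hull hM KM Kx; have Nx := sub_hull hN LN Lx.
have [c lc] := conf_zero conf MM NM MN Mx Nx.
have h := (hullE hM); rewrite eqEsubset in h; move: h => -[/(_ x Mx) /= pos _].
have vtx a : x = vt M a -> vt K i \in verts L.
  move=> xa; have [_ /(_ i li) ->] := vertex_sub hM KM Kx xa.
  have : x \in verts N by apply: (vert_in conf MM NM Nx); apply/mem_verts; exists a.
  by move=> /mem_verts[b xb]; have [] := vertex_sub hN LN Lx xb.
have s := lam_sum x hM; have xE := lam_dec x hM.
rewrite (bigD1 c)//= lc add0r in s; rewrite (bigD1 c)//= lc scale0r add0r in xE.
have E2 (V : nmodType) (F : 'I_3 -> V) : \sum_(i | i != c) F i = F (nx c) + F (nx (nx c)).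
  by rewrite (bigD1 (nx c)) ?(nx_neq c).1.1//= (big_pred1 (nx (nx c)))// => k;
    case: (ord3_cases c k) => ->; move: c {lc s xE}; apply: ord3P.
rewrite !E2 in s xE.
have [z1|n1] := eqVneq (lam M (nx c) x) 0.
  by apply: (vtx (nx (nx c))); rewrite xE z1 scale0r add0r; move: s; rewrite z1 add0r => ->; rewrite scale1r.
have [z2|n2] := eqVneq (lam M (nx (nx c)) x) 0.
  by apply: (vtx (nx c)); rewrite xE z2 scale0r addr0; move: s; rewrite z2 addr0 => ->; rewrite scale1r.
have oe : oedge M c x by split=> //; rewrite lt_neqAle eq_sym ?n1 ?n2 pos.
have [d hn] := oedge_nbrP conf MM NM MN oe Nx.
have [_ o1 o2] := oe.
have ld : lam N d x = 0 by have [] := oedge_nbr hM hN hn oe.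
have [/(_ i li) s1 _ _ _] := sub_edge hM KM Kx lc.
have [_ r2 r3 r4] := sub_edge hN LN Lx ld.
have key : (ea N d = ea M c /\ eb N d = eb M c /\ lam N (nx (nx d)) x = lam M (nx (nx c)) x) \/
  (ea N d = eb M c /\ eb N d = ea M c /\ lam N (nx (nx d)) x = lam M (nx c) x).
  have [_ e1 e2] := lam_ea d hN; have [_ e3 e4] := lam_eb d hN.
  case/andP: hn => _ /orP[]/andP[/eqP e5 /eqP e6]; [left|right]; do 2!split=> //.
    by rewrite {1}xE lam_aff// -/(ea M c) -/(eb M c) -e5 -e6 e2 e4 mulr0 mulr1 add0r.
  by rewrite {1}xE lam_aff// -/(ea M c) -/(eb M c) -e5 -e6 e2 e4 mulr0 mulr1 addr0.
have midE : ept N d = ept M c.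
  rewrite /ept -/(ea N d) -/(eb N d) -/(ea M c) -/(eb M c).
  by case: key => -[-> [-> _]] //; exact: midC.
case: key => -[ka [kb kt]]; rewrite ka kb kt midE in r2 r3 r4; case: s1 => -[-> ht].
- exact: r2.
- exact: r3.
- exact: r4.
- by apply: r3; lra.
- by apply: r2; lra.
- by apply: r4; lra.
Qed.

Lemma sub_vert K L x i : K \in T -> L \in T -> hull (verts K) x -> hull (verts L) x ->
  lam K i x != 0 -> vt K i \in verts L.
Proof.
move=> /submeshP[M MM KM] /submeshP[N NM LN]; have [MN|MN] := eqVneq M N.
  by rewrite -MN in LN; have hM := orT conf MM; exact: sub_face_same hM _ _ _ _ KM LN.
exact: (sub_face MM NM).
Qed.

Lemma sub_disjT K L x : K \in T -> L \in T -> K != L -> oK K x -> ~ hull (verts L) x.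
Proof.
move=> /submeshP[M MM KM] /submeshP[N NM LN] KL ox; have [MN|MN] := eqVneq M N.
  by rewrite -MN in LN; have hM := orT conf MM; exact: sub_disj hM _ _ _ KM LN KL ox.
move=> /(sub_hull (orT conf NM) LN) Nx; have oM := oK_macro (orT conf MM) KM ox.
have [c lc] := conf_zero conf MM NM MN (oK_hull (orT conf MM) oM) Nx.
by have := oM c; rewrite lc ltxx.
Qed.

Lemma submesh_conforming : conforming_mesh Omega T.
Proof.
split; first exact: nT.
  have [_ -> _] := conf; apply/seteqP; split=> x /= -[K KT Kx].
    have [L LK Lx] := sub_cover (orT conf KT) Kx; exists L => //.
    by apply/submeshP; exists K.
  case/submeshP: KT => M MM KM; exists M => //.
  by have hM := orT conf MM; exact: (@sub_hull R M x hM K KM Kx).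
move=> K L KT LT KL; split.
  apply: common_size; first exact: nT.
  apply: (sub_disjT KT LT KL) => i; rewrite lam_bary ?nT//; lra.
apply/seteqP; split=> x.
  by move=> [Kx Lx]; apply: hull_face; [exact: nT|exact: Kx|move=> i; exact: sub_vert].
have uf : uniq [seq x <- verts K | x \in verts L] by rewrite filter_uniq// verts_uniq// nT.
move: uf; set s := [seq _ <- _ | _] => uf hx.
by split; apply: hull_sub hx => // v; rewrite mem_filter => /andP[].
Qed.
End SubMesh.

Let confT : conforming_mesh Omega T := submesh_conforming.
Let hT K : K \in T -> orient K != 0 := orT confT (K := K).

(** * Classification of the edges of the subdivision *)

Section SubEdges.
Implicit Types (A B : pt R) (a d : 'I_3) (b : bool).

(** The sub-triangle and edge number that cover one half of macro edge [c]: the half at [ea M c] for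
    [false], at [eb M c] for [true]. *)
Definition half M c b : tri R * 'I_3 :=
  match val c with
  | 0%N => if b then (K4 M, i2) else (K1 M, i2)
  | 1%N => if b then (K3 M, i1) else (K4 M, i1)
  | _ => if b then (K1 M, i1) else (K2 M, i1) end.

Definition hv M c b : pt R := if b then eb M c else ea M c.

(** The three interior edges of the macro-element, each given by its two sides. *)
Definition inner M : seq ((tri R * 'I_3) * (tri R * 'I_3)) :=
  [:: ((K1 M, i0), (K2 M, i0)); ((K2 M, i2), (K3 M, i2)); ((K3 M, i0), (K4 M, i0))].

Definition inner2 M q q' := ((q, q') \in inner M) || ((q', q) \in inner M).

Lemma sub_mem M : [/\ K1 M \in subtris M, K2 M \in subtris M, K3 M \in subtris M & K4 M \in subtris M].
Proof. by split; rewrite !inE eqxx ?orbT. Qed.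

Lemma innerP M (P : tri R * 'I_3 -> tri R * 'I_3 -> Prop) :
  P (K1 M, i0) (K2 M, i0) -> P (K2 M, i2) (K3 M, i2) -> P (K3 M, i0) (K4 M, i0) ->
  forall q q', (q, q') \in inner M -> P q q'.
Proof. by move=> h1 h2 h3 q q'; rewrite !inE => /or3P[]/eqP[-> ->]. Qed.

Lemma half_mem M c b : (half M c b).1 \in subtris M.
Proof. by have [h1 h2 h3 h4] := sub_mem M; move: c b; apply: ord3P => -[]. Qed.

Lemma inner_mem M q q' : inner2 M q q' -> q.1 \in subtris M /\ q'.1 \in subtris M.
Proof.
have [h1 h2 h3 h4] := sub_mem M.
by move=> /orP[]; move: q q' => q q'; [move: q q'|move: q' q]; apply: innerP.
Qed.

Lemma sub_edgeP M K i : K \in subtris M -> (exists q, inner2 M (K, i) q) \/ exists c b, (K, i) = half M c b.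
Proof.
move=> KM; move: K KM i; apply: subP; apply: ord3P.
- by left; exists (K2 M, i0); rewrite /inner2 !inE !eqxx.
- by right; exists i2, true.
- by right; exists i0, false.
- by left; exists (K1 M, i0); rewrite /inner2 !inE !eqxx ?orbT.
- by right; exists i2, false.
- by left; exists (K3 M, i2); rewrite /inner2 !inE !eqxx ?orbT.
- by left; exists (K4 M, i0); rewrite /inner2 !inE !eqxx ?orbT.
- by right; exists i1, true.
- by left; exists (K2 M, i2); rewrite /inner2 !inE !eqxx ?orbT.
- by left; exists (K3 M, i0); rewrite /inner2 !inE !eqxx ?orbT.
- by right; exists i1, false.
- by right; exists i0, true.
Qed.

Lemma lam_half M c b x : orient M != 0 -> lam (half M c b).1 (half M c b).2 x = 2 * lam M c x.
Proof.
move=> hM.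
have [a0 a1 a2] := lamK1 x hM; have [b0 b1 b2] := lamK2 x hM.
have [c0 c1 c2] := lamK3 x hM; have [d0 d1 d2] := lamK4 x hM.
by move: c b; apply: ord3P => -[].
Qed.

Lemma half_ends M c b : let q := half M c b in
  (ea q.1 q.2 = hv M c b /\ eb q.1 q.2 = ept M c) \/ (ea q.1 q.2 = ept M c /\ eb q.1 q.2 = hv M c b).
Proof.
have [e0 e2 e1] := ept_m M.
by move: c b; apply: ord3P => -[]; rewrite /= /hv ?e0 ?e1 ?e2; by [left|right].
Qed.

Lemma sub_neq M : orient M != 0 -> uniq (subtris M).
Proof.
move=> hM; have v := vt_inj hM; have [s1 s2 s3 s4] := sub_orient M.
have h1 : orient M / 4 != - (orient M / 4).
  by rewrite -subr_eq0 opprK -mulr2n mulrn_eq0 /= mulf_neq0.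
rewrite /= !inE !negb_or !andbT.
apply/and3P; split; [apply/and3P; split|apply/andP; split|]; apply/negP => /eqP e.
- by have [/(v i1 i0)] : K1 M = K2 M by [].
- by have [/(v i1 i0)] : K1 M = K3 M by [].
- by have [/(v i1 i2)] : K1 M = K4 M by [].
- by move: h1; rewrite -s2 -s3 /K2 /K3 e eqxx.
- by have [/(v i0 i2)] : K2 M = K4 M by [].
- by have [/(v i0 i2)] : K3 M = K4 M by [].
Qed.

Lemma inner_nbr M q q' : orient M != 0 -> inner2 M q q' -> nbr q.1 q.2 q'.1 q'.2.
Proof.
move=> hM; have := sub_neq hM; rewrite /= !inE !negb_or -/(K1 M) -/(K2 M) -/(K3 M) -/(K4 M).
move=> /and4P[/and3P[n12 n13 n14] /andP[n23 n24] n34 _] /orP[h|h]; last apply: nbr_sym;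
  move: h; [move: q q'|move: q' q]; apply: innerP;
  by rewrite /nbr eq_sym ?n12 ?n23 ?n34 /ea /eb /= /vt /= !eqxx.
Qed.

Lemma inner_ept M : [/\ [/\ mid (E1 M) = ept (K1 M) i0, mid (E2 M) = ept (K2 M) i2 & mid (E3 M) = ept (K3 M) i0],
  [/\ tangent (E1 M) = eb (K1 M) i0 - ea (K1 M) i0, tangent (E2 M) = - (eb (K2 M) i2 - ea (K2 M) i2) &
  tangent (E3 M) = eb (K3 M) i0 - ea (K3 M) i0] & True].
Proof. by split=> //; split=> //; rewrite ?opprB // /ept midC. Qed.

Lemma sub_macro_uniq M N K : M \in Mh -> N \in Mh -> K \in subtris M -> K \in subtris N -> M = N.
Proof.
move=> MM NM KM KN; have hM := orT conf MM; have hN := orT conf NM; apply/eqP/negPn/negP => MN.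
have hK := sub_orient0 hM KM.
have o : oK K (bary K) by move=> i; rewrite lam_bary//; lra.
have oM := oK_macro hM KM o; have Nb := sub_hull hN KN (oK_hull hK o).
have [c lc] := conf_zero conf MM NM MN (oK_hull hM oM) Nb.
by have := oM c; rewrite lc ltxx.
Qed.

Lemma memT M K : M \in Mh -> K \in subtris M -> K \in T.
Proof. by move=> MM KM; apply/submeshP; exists M. Qed.

Lemma half_oedge M c b : orient M != 0 ->
  let x := mid (hv M c b, ept M c) in oedge M c x /\ oedge (half M c b).1 (half M c b).2 x.
Proof.
move=> hM x; have hK := sub_orient0 hM (half_mem M c b).
have [a1 a2 a3] := lam_ea c hM; have [b1 b2 b3] := lam_eb c hM; split.
  rewrite /x /mid /= scalerDr /ept /mid -/(ea M c) -/(eb M c) scalerDr.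
  have lE i : lam M i (2^-1 *: hv M c b + 2^-1 *: (2^-1 *: ea M c + 2^-1 *: eb M c)) =
    2^-1 * lam M i (hv M c b) + 2^-1 * (2^-1 * lam M i (ea M c) + 2^-1 * lam M i (eb M c)).
    by rewrite !lam_aff//; field.
  by rewrite /oedge !lE /hv; case: b {x hK lE}; rewrite a1 a2 a3 b1 b2 b3; split; lra.
have [k1 k2 k3] := lam_ea (half M c b).2 hK; have [l1 l2 l3] := lam_eb (half M c b).2 hK.
have xE : x = mid (ea (half M c b).1 (half M c b).2, eb (half M c b).1 (half M c b).2).
  by case: (half_ends M c b) => -[-> ->] //; rewrite /x midC.
rewrite xE /mid /= scalerDr /oedge !lam_aff ?k1 ?k2 ?k3 ?l1 ?l2 ?l3; try by field.
by split; lra.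
Qed.

Lemma midxx A : mid (A, A) = A.
Proof. by apply: pairE; rewrite /= /GRing.scale /=; field. Qed.

Lemma ept_hv M c b : orient M != 0 -> ept M c != hv M c b.
Proof.
move=> hM; apply/eqP => e; have [[_ h2 h3] _] := half_oedge c b hM.
have [a1 a2 a3] := lam_ea c hM; have [b1 b2 b3] := lam_eb c hM.
move: h2 h3; rewrite e midxx.
by rewrite /hv; case: b {e}; rewrite ?a2 ?a3 ?b2 ?b3 ltxx.
Qed.

Lemma nbr_half M N c d b : M \in Mh -> N \in Mh -> nbr M c N d ->
  exists b', [/\ nbr (half M c b).1 (half M c b).2 (half N d b').1 (half N d b').2,
    hv M c b = hv N d b' & ept M c = ept N d].
Proof.
move=> MM NM hn.
have MN : N != M by case/andP: hn.
have ne b' : (half N d b').1 != (half M c b).1.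
  apply: contra MN => /eqP e; apply/eqP; apply: (sub_macro_uniq NM MM (half_mem N d b')).
  by rewrite e half_mem.
have [b' hE eE] : exists2 b', hv M c b = hv N d b' & ept M c = ept N d.
  rewrite /ept -/(ea N d) -/(eb N d) -/(ea M c) -/(eb M c).
  case/andP: hn => _ /orP[]/andP[/eqP e1 /eqP e2].
    by exists b => //; rewrite /hv e1 e2.
  by exists (~~ b); rewrite /hv e1 e2; [case: (b)|exact: midC].
exists b'; split=> //; rewrite /nbr ne /=.
by case: (half_ends M c b) => -[-> ->]; case: (half_ends N d b') => -[-> ->]; rewrite hE eE !eqxx ?orbT.
Qed.

Lemma nbrT K L i j : K \in T -> L \in T -> nbr K i L j ->
  (exists2 M, M \in Mh & inner2 M (K, i) (L, j)) \/
  exists M N c d b b', [/\ M \in Mh, N \in Mh, nbr M c N d, (K, i) = half M c b /\ (L, j) = half N d b' &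
    hv M c b = hv N d b' /\ ept M c = ept N d].
Proof.
move=> KT LT hn; case/submeshP: (KT) => M MM KM; case/submeshP: (LT) => N NM LN.
have hM := orT conf MM; have hN := orT conf NM.
have inn (P Q : tri R) (k l : 'I_3) q M' : M' \in Mh -> P \in T -> Q \in T -> nbr P k Q l -> inner2 M' (P, k) q -> (Q, l) = q.
  move=> MM' PT QT hPQ hi; have hM' := orT conf MM'; have [_ qM] := inner_mem hi.
  have [-> ->] := nbr_uniq confT PT QT (memT MM' qM) hPQ (inner_nbr hM' hi).
  by case: (q).
case: (sub_edgeP i KM) => [[q hq]|[c [b Ki]]].
  by left; exists M => //; rewrite (inn _ _ _ _ _ _ MM KT LT hn hq).
case: (sub_edgeP j LN) => [[q hq]|[d [b' Lj]]].
  left; exists N => //; have := inn _ _ _ _ _ _ NM LT KT (nbr_sym hn) hq.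
  by move=> e; rewrite /inner2 orbC; rewrite -e in hq.
right; have [EK Ei] : K = (half M c b).1 /\ i = (half M c b).2 by rewrite -Ki.
have [EL Ej] : L = (half N d b').1 /\ j = (half N d b').2 by rewrite -Lj.
(* This point lies in the open macro edge and in the open sub-edge, so it identifies the neighbours
   at both levels. *)
have [xM xK] := half_oedge c b hM; set x := mid _ in xM xK.
rewrite -EK -Ei in xK; have hK := orT confT KT; have hL := orT confT LT.
have xL := oedge_nbr hK hL hn xK.
have MN : M != N.
  apply/eqP => e; subst N; have := nbr_opp confT KT LT hn.
  rewrite {1}EK {1}Ei lam_half//; have : hull (verts M) (vt L j).
    by apply: (sub_hull hM LN); exact: hull_vt.
  by rewrite hullE// => /(_ c) h1; rewrite pmulr_rlt0 ?ltr0n// ltNge h1.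
have ohull (P : tri R) k : orient P != 0 -> oedge P k x -> hull (verts P) x.
  move=> hP [p1 p2 p3]; rewrite hullE// => m.
  by case: (ord3_cases k m) => ->; rewrite ?p1//; exact: ltW.
have Lx := ohull _ _ hL xL; have Nx := sub_hull hN LN Lx.
have [d' hn'] := oedge_nbrP conf MM NM MN xM Nx.
have xN' := oedge_nbr hM hN hn' xM.
have dd : d' = d.
  have z : lam N d x = 0.
    by have [+ _ _] := xL; rewrite {1}EL {1}Ej lam_half// => /eqP; rewrite mulf_eq0 pnatr_eq0 /= => /eqP.
  have [_ p2 p3] := xN'; case: (ord3_cases d' d) => e //.
    by move: p2; rewrite -e z ltxx.
  by move: p3; rewrite -e z ltxx.
rewrite dd in hn'.
have eE : ept M c = ept N d.
  rewrite /ept -/(ea N d) -/(eb N d) -/(ea M c) -/(eb M c).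
  by case/andP: hn' => _ /orP[]/andP[/eqP -> /eqP ->]//; exact: midC.
exists M, N, c, d, b, b'; split=> //; split=> //.
have n1 := ept_hv c b hM; have n2 := ept_hv d b' hN.
case/andP: hn => _; rewrite EK Ei EL Ej.
case: (half_ends M c b) => -[-> ->]; case: (half_ends N d b') => -[-> ->];
  rewrite eE in n1 *; move=> /orP[]/andP[/eqP e1 /eqP e2] //.
all: by rewrite ?e1 ?e2 ?eqxx in n1 n2 *.
Qed.
End SubEdges.

Implicit Types (u v Y : pt R) (d : 'I_3) (b : bool) (f g : pt R -> R) (S : tri R -> pt R -> 'M[R]_2).

(** * The conditions of the potential space on families of pieces *)

Section USpace.
Implicit Types (t A B : pt R) (p q : tri R -> pt R -> R).

(** Inside an edge this is the hypothesis; at a vertex one passes from [K] to [L] through the star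
    of that vertex. *)
Lemma single_valued q K L x : contE T q -> K \in T -> L \in T -> hull (verts K) x ->
  hull (verts L) x -> q K x = q L x.
Proof.
move=> cq KT LT Kx Lx; have [->//|KL] := eqVneq K L.
have hK := orT confT KT; have [i li] := conf_zero confT KT LT KL Kx Lx.
have h := hullE hK; rewrite eqEsubset in h; move: h => -[/(_ x Kx) /= pos _].
have vtx X : x = X -> X \in verts K -> q K x = q L x.
  move=> xX XK; apply: (@star_const R Omega T confT iO punct R (fun K => q K x) x) => //.
    by exists K; rewrite // xX.
  move=> K' i' L' j' KT' LT' hn hx; apply: (cq _ _ _ _ KT' LT' hn).
  by case: hx => ->; [exact: seg_hulll|exact: seg_hullr].
have s := lam_sum x hK; have xE := lam_dec x hK.
rewrite !(sum3_nx _ i) li scale0r !add0r in s xE.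
have [z1|n1] := eqVneq (lam K (nx i) x) 0.
  apply: (vtx (vt K (nx (nx i)))); last by apply/mem_verts; exists (nx (nx i)).
  by rewrite xE z1 scale0r add0r; move: s; rewrite z1 add0r => ->; rewrite scale1r.
have [z2|n2] := eqVneq (lam K (nx (nx i)) x) 0.
  apply: (vtx (vt K (nx i))); last by apply/mem_verts; exists (nx i).
  by rewrite xE z2 scale0r addr0; move: s; rewrite z2 addr0 => ->; rewrite scale1r.
have oe : oedge K i x by split=> //; rewrite lt_neqAle eq_sym ?n1 ?n2 pos.
have [j hn] := oedge_nbrP confT KT LT KL oe Lx.
apply: (cq _ _ _ _ KT LT hn); apply/edge_hullP => //; split=> //; exact: pos.
Qed.

(** The list [edges] runs through the edge opposite to the second vertex against the cyclic order,
    hence the exception for [i1]. *)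
Definition edge M c := if c == i1 then (eb M c, ea M c) else (ea M c, eb M c).

Lemma edgesP M e : e \in edges M <-> exists c, e = edge M c.
Proof.
split=> [|[c ->]]; last by move: c; apply: ord3P; rewrite !inE eqxx ?orbT.
by rewrite !inE => /or3P[]/eqP ->; [exists i0|exists i2|exists i1].
Qed.

Lemma edge_mid M c : mid (edge M c) = ept M c.
Proof. by rewrite /edge; case: ifP => // _; rewrite midC. Qed.

Lemma edge_tangent M c : exists2 s : R, s != 0 & tangent (edge M c) = s *: (eb M c - ea M c).
Proof.
rewrite /edge; case: ifP => _; [exists (-1)|exists 1]; rewrite ?oppr_eq0 ?oner_eq0//.
  by rewrite scaleN1r opprB.
by rewrite scale1r.
Qed.

Definition eqD (S : seq (tri R)) p (D : (pt R -> R) -> pt R -> R) X :=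
  forall K L, K \in S -> L \in S -> hull (verts K) X -> hull (verts L) X -> D (p K) X = D (p L) X.

Lemma cont_atE (S : seq (tri R)) (f : pt R -> R) p D X : {subset S <= T} -> rep T f p -> polys T 4 p ->
  cont_at S f D X <-> eqD S p D X.
Proof.
move=> ST rf pp; have rp K : K \in S -> restr_poly (hull (verts K)) 4 f (p K).
  by move=> KS; split; [apply: pp; exact: ST|apply: rf; exact: ST].
split=> h K L.
  move=> KS LS KX LX; exact: (h K L (p K) (p L) KS LS KX LX (rp K KS) (rp L LS)).
move=> g g' KS LS KX LX [pg rg] [pg' rg'].
have e k f1 : k \in S -> restr_poly (hull (verts k)) 4 f f1 -> f1 = p k.
  by move=> kS r1; apply: (restr_poly_uniq (orT confT (ST k kS)) r1); exact: rp.
by rewrite (e K g KS (conj pg rg)) (e L g' LS (conj pg' rg')); exact: h.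
Qed.

Definition Ucond p := [/\
  forall M X, M \in Mh -> X \in verts M -> forall a b : nat, (a + b <= 2)%N -> eqD T p (pd a b) X,
  forall M c, M \in Mh -> [/\ forall a b : nat, (a + b <= 1)%N -> eqD (subtris M) p (pd a b) (ept M c),
     eqD (subtris M) p (dtt (edge M c)) (ept M c) & eqD (subtris M) p (dtn (edge M c)) (ept M c)],
  forall M c, M \in Mh -> [/\ eqD T p (dn (edge M c)) (ept M c),
     eqD T p (dtn (edge M c)) (ept M c) & eqD T p (dtt (edge M c)) (ept M c)]
  & forall M, M \in Mh -> eqD (subtris M) p id (mid (E1 M)) /\ eqD (subtris M) p id (mid (E3 M))].

Lemma Uh_Ucond f p : L2 Omega f -> rep T f p -> polys T 4 p -> Uh Omega Mh f <-> Ucond p.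
Proof.
move=> Lf rf pp.
have sT M : M \in Mh -> {subset subtris M <= T} by move=> MM K; exact: memT.
have TT : {subset T <= T} by [].
split=> [[_ hM hV hE]|[F1 F2 F3 F4]].
  split=> [M X MM XM a b ab|M c MM|M c MM|M MM].
  - exact: (cont_atE _ _ TT rf pp).1 (hV M MM X XM a b ab).
  - have [_ _ _ /(_ (edge M c)) h _] := hM M MM.
    have {h} [h1 [h2 h3]] := h ((edgesP _ _).2 (ex_intro _ c erefl)).
    rewrite edge_mid in h1 h2 h3; split=> [a b ab||].
    + exact: (cont_atE _ _ (sT M MM) rf pp).1 (h1 a b ab).
    + exact: (cont_atE _ _ (sT M MM) rf pp).1 h2.
    + exact: (cont_atE _ _ (sT M MM) rf pp).1 h3.
  - have [h1 h2 h3] := hE M MM (edge M c) ((edgesP _ _).2 (ex_intro _ c erefl)).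
    rewrite edge_mid in h1 h2 h3; split.
    + exact: (cont_atE _ _ TT rf pp).1 h1.
    + exact: (cont_atE _ _ TT rf pp).1 h2.
    + exact: (cont_atE _ _ TT rf pp).1 h3.
  - have [_ _ _ _ h] := hM M MM; split.
    + by apply: (cont_atE _ _ (sT M MM) rf pp).1; apply: h; rewrite mem_head.
    + by apply: (cont_atE _ _ (sT M MM) rf pp).1; apply: h; rewrite !inE eqxx orbT.
split; first exact: Lf.
- move=> M MM; split.
  + apply: (@L2_sub _ _ Omega) Lf; first by apply: open_measurable2; exact: open_interior.
    apply: subset_trans iO; apply: interiorS; exact: (hullT conf MM).
  + by move=> K KM; exists (p K); split; [exact: pp (sT M MM K KM)|exact: rf (sT M MM K KM)].
  + move=> a b ab; apply: (cont_atE _ _ (sT M MM) rf pp).2 => K L KM LM.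
    by apply: F1 (sT M MM K KM) (sT M MM L LM) => //; [exact: MM|rewrite mem_head].
  + move=> e /edgesP[c ->]; have [h1 h2 h3] := F2 M c MM; rewrite edge_mid; split=> [a b ab|].
      exact: (cont_atE _ _ (sT M MM) rf pp).2 (h1 a b ab).
    by split; apply: (cont_atE _ _ (sT M MM) rf pp).2.
  + have [h1 h2] := F4 M MM.
    by move=> e; rewrite !inE => /orP[]/eqP ->; apply: (cont_atE _ _ (sT M MM) rf pp).2.
- by move=> M MM X XM a b ab; apply: (cont_atE _ _ TT rf pp).2; exact: (F1 M X MM XM a b ab).
- move=> M MM e eM; have [c ->] := (edgesP M e).1 eM; have [h1 h2 h3] := F3 M c MM; rewrite edge_mid.
  by split; apply: (cont_atE _ _ TT rf pp).2.
Qed.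

Lemma Uh_rep f : Uh Omega Mh f -> exists2 p, polys T 4 p & rep T f p.
Proof.
move=> [_ hM _ _].
have h K : exists g, K \in T -> restr_poly (hull (verts K)) 4 f g.
  have [|nT] := boolP (K \in T); last by exists (fun=> 0).
  by move=> /submeshP[M MM KM]; have [_ /(_ K KM)[g hg] _ _ _] := hM M MM; exists g.
have [p hp] := choice h; exists p => K KT; first by have [] := hp K KT.
by have [] := hp K KT.
Qed.
End USpace.

(** * Members of the potential space are of class C^1 *)

Section UGluing.
Implicit Types (t A B : pt R) (p q : tri R -> pt R -> R).

Lemma diff1 f g X : polyn 4 f -> polyn 4 g -> dir (1, 0) f X = dir (1, 0) g X ->
  dir (0, 1) f X = dir (0, 1) g X -> forall u, dir u (fun x => f x - g x) X = 0.
Proof.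
move=> hf hg e1 e2 u.
by rewrite (dirB u hf hg) (dir_coord u X hf) (dir_coord u X hg) e1 e2 subrr.
Qed.

Definition hess f X := (dir (1, 0) (dir (1, 0) f) X, dir (1, 0) (dir (0, 1) f) X, dir (0, 1) (dir (0, 1) f) X).

Lemma diff2 f g X : polyn 4 f -> polyn 4 g -> hess f X = hess g X -> forall u v, dir u (dir v (fun x => f x - g x)) X = 0.
Proof.
move=> hf hg [e1 e2 e3] u v.
have E h : polyn 4 h -> dir u (dir v h) X = u.1 * (v.1 * dir (1, 0) (dir (1, 0) h) X + v.2 * dir (1, 0) (dir (0, 1) h) X) +
    u.2 * (v.1 * dir (1, 0) (dir (0, 1) h) X + v.2 * dir (0, 1) (dir (0, 1) h) X).
  move=> hh; rewrite (dir_coord u X (polyn_dir v hh)) (dir_comm (1, 0) v hh) (dir_comm (0, 1) v hh).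
  rewrite (dir_coord v X (polyn_dir (1, 0) hh)) (dir_coord v X (polyn_dir (0, 1) hh)).
  by rewrite (dir_comm (0, 1) (1, 0) hh).
by rewrite (dirB v hf hg) (dirB u (polyn_dir v hf) (polyn_dir v hg)) (E f hf) (E g hg) e1 e2 e3 subrr.
Qed.

Lemma dirZv k f (s : R) v X : polyn k f -> dir (s *: v) f X = s * dir v f X.
Proof. by move=> hf; have := dir_lin s 0 v 0 X hf; rewrite mul0r !addr0 scale0r addr0. Qed.

Lemma normal_cross (e : pt R * pt R) : tangent e != 0 -> cross (normal e) (tangent e) != 0.
Proof.
move=> v0; have -> : cross (normal e) (tangent e) = (tangent e).1 ^+ 2 + (tangent e).2 ^+ 2.
  by rewrite /cross /normal /=; ring.
rewrite paddr_eq0 ?sqr_ge0// !sqrf_eq0; apply: contra v0 => /andP[/eqP v1 /eqP v2].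
by apply/eqP; apply: pairE.
Qed.

Lemma difft f g X e (s : R) v : polyn 4 f -> polyn 4 g -> s != 0 -> v != 0 -> tangent e = s *: v ->
  dtt e f X = dtt e g X -> dtn e f X = dtn e g X -> forall u, dir v (dir u (fun x => f x - g x)) X = 0.
Proof.
move=> hf hg s0 v0 te; rewrite dttE (dttE e g) dtnE (dtnE e g) => e1 e2 u.
set w := fun x => _; have hw : polyn 4 w by exact: polynB.
have ct : cross (normal e) (tangent e) != 0.
  by apply: normal_cross; rewrite te scaler_eq0 negb_or s0.
have h1 : dir (tangent e) (dir (tangent e) w) X = 0.
  by rewrite (dirB _ hf hg) (dirB _ (polyn_dir _ hf) (polyn_dir _ hg)) e1 subrr.
have h2 : dir (tangent e) (dir (normal e) w) X = 0.
  by rewrite (dirB _ hf hg) (dirB _ (polyn_dir _ hf) (polyn_dir _ hg)) e2 subrr.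
have h3 : dir (tangent e) (dir u w) X = 0.
  rewrite (dir_comm _ u hw) (cross_decomp u ct) (dir_lin _ _ _ _ _ (polyn_dir _ hw)).
  by rewrite (dir_comm (normal e) (tangent e) hw) h1 h2 !mulr0 addr0.
by move: h3; rewrite te (dirZv _ _ _ (polyn_dir _ hw)) => /eqP; rewrite mulf_eq0 (negbTE s0) => /eqP.
Qed.

Lemma line_dir k f A v : polyn k f -> (forall s, f (A + s *: v) = 0) -> forall s, dir v f (A + s *: v) = 0.
Proof.
move=> hf h s; have [g _ hg] := dir_line A v hf.
have -> : dir v f (A + s *: v) = g^`().[s] by have [] := hg s.
rewrite (_ : g = 0) ?deriv0 ?horner0//.
by apply: (poly_zero_itv ltr01) => r _ _; have [<- _] := hg r.
Qed.

Definition jetE p K i L := forall x, hull [:: ea K i; eb K i] x ->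
  p K x = p L x /\ forall u, dir u (p K) x = dir u (p L) x.

Lemma jetI p K i L : polyn 4 (p K) -> polyn 4 (p L) ->
  (forall s, (fun x => p K x - p L x) (ea K i + s *: (eb K i - ea K i)) = 0 /\
     forall u, dir u (fun x => p K x - p L x) (ea K i + s *: (eb K i - ea K i)) = 0) -> jetE p K i L.
Proof.
move=> hK hL h x /seg_hullP[s [_ _ ->]]; have [h1 h2] := h s; split=> [|u].
  by apply: subr0_eq.
by apply: subr0_eq; have := h2 u; rewrite (dirB u hK hL).
Qed.

Lemma jetC p K i L j : nbr K i L j -> jetE p K i L -> jetE p L j K.
Proof.
move=> hn h x hx; rewrite -(nbr_hull hn) in hx.
by have [-> h2] := h x hx; split=> // u; rewrite h2.
Qed.

Lemma tangent_neq M c : orient M != 0 -> eb M c - ea M c != 0.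
Proof. by move=> hM; rewrite subr_eq0 eq_sym edge_neq. Qed.

Lemma inner_cross M : orient M != 0 ->
  [/\ cross (eb M i0 - ea M i0) (m2 M - m1 M) != 0, cross (eb M i2 - ea M i2) (m2 M - m1 M) != 0,
      cross (eb M i0 - ea M i0) (m1 M - M.1.1) != 0,
      cross (eb M i0 - ea M i0) (m3 M - m1 M) != 0 & cross (eb M i1 - ea M i1) (m3 M - m1 M) != 0].
Proof.
move=> hM; have s1 : orient M / 2 != 0 by rewrite mulf_neq0.
have s2 : - (orient M / 2) != 0 by rewrite oppr_eq0.
have s3 : - orient M != 0 by rewrite oppr_eq0.
split.
- have -> : cross (eb M i0 - ea M i0) (m2 M - m1 M) = orient M / 2 => //.
  by rewrite /orient /cross /ea /eb /m1 /m2 /mid /vt /= /GRing.scale /=; field.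
- have -> : cross (eb M i2 - ea M i2) (m2 M - m1 M) = - (orient M / 2) => //.
  by rewrite /orient /cross /ea /eb /m1 /m2 /mid /vt /= /GRing.scale /=; field.
- have -> : cross (eb M i0 - ea M i0) (m1 M - M.1.1) = - orient M => //.
  by rewrite /orient /cross /ea /eb /m1 /m2 /mid /vt /= /GRing.scale /=; field.
- have -> : cross (eb M i0 - ea M i0) (m3 M - m1 M) = orient M / 2 => //.
  by rewrite /orient /cross /ea /eb /m1 /m3 /mid /vt /= /GRing.scale /=; field.
- have -> : cross (eb M i1 - ea M i1) (m3 M - m1 M) = - (orient M / 2) => //.
  by rewrite /orient /cross /ea /eb /m1 /m3 /mid /vt /= /GRing.scale /=; field.
Qed.

Variable p : tri R -> pt R -> R.
Hypothesis pp : polys T 4 p.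
Hypothesis Up : Ucond p.

Lemma U_vertex M X K L : M \in Mh -> X \in verts M -> K \in T -> L \in T ->
  hull (verts K) X -> hull (verts L) X -> let w := fun x => p K x - p L x in
  [/\ w X = 0, forall u, dir u w X = 0 & forall u v, dir u (dir v w) X = 0].
Proof.
move=> MM XM KT LT KX LX; have [F1 _ _ _] := Up.
have e (a n : nat) : (a + n <= 2)%N -> pd a n (p K) X = pd a n (p L) X.
  by move=> ab; apply: (F1 M X MM XM a n ab).
split.
- by have := e 0%N 0%N isT; rewrite !pd00 => ->; rewrite subrr.
- by have := e 1%N 0%N isT; have := e 0%N 1%N isT; rewrite !pd10 !pd01 => e2 e1; exact: diff1 (pp KT) (pp LT) e1 e2.
- apply: diff2 (pp KT) (pp LT) _; have := e 2%N 0%N isT; have := e 1%N 1%N isT; have := e 0%N 2%N isT.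
  by rewrite !pd20 !pd11 !pd02 /hess => -> -> ->.
Qed.

Lemma U_mid M c K L : M \in Mh -> K \in subtris M -> L \in subtris M ->
  hull (verts K) (ept M c) -> hull (verts L) (ept M c) -> let w := fun x => p K x - p L x in
  [/\ w (ept M c) = 0, forall u, dir u w (ept M c) = 0 &
      forall u, dir (eb M c - ea M c) (dir u w) (ept M c) = 0].
Proof.
move=> MM KM LM KX LX; have [_ F2 _ _] := Up; have [h1 h2 h3] := F2 M c MM.
have [KT LT] := (memT MM KM, memT MM LM).
have e (a n : nat) : (a + n <= 1)%N -> pd a n (p K) (ept M c) = pd a n (p L) (ept M c).
  by move=> ab; apply: h1.
split.
- by have := e 0%N 0%N isT; rewrite !pd00 => ->; rewrite subrr.
- by have := e 1%N 0%N isT; have := e 0%N 1%N isT; rewrite !pd10 !pd01 => e2 e1; exact: diff1 (pp KT) (pp LT) e1 e2.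
- have [s s0 te] := edge_tangent M c.
  apply: (difft (pp KT) (pp LT) s0 (tangent_neq c (orT conf MM)) te); [exact: h2|exact: h3].
Qed.

(** The fifth condition of [hermite_edge] is the value at the midpoint for [E1] and [E3], and the
    second derivative at the first vertex for [E2]. *)
Lemma U_inner M h h' : M \in Mh -> (h, h') \in inner M -> jetE p h.1 h.2 h'.1.
Proof.
move=> MM; have hM := orT conf MM; have [h1 h2 h3 h4] := sub_mem M.
have [k1 k2 k3 k4] := And4 (memT MM h1) (memT MM h2) (memT MM h3) (memT MM h4).
have [c1 c2 c3' c4 c5] := inner_cross hM; have [e0 e2 e1] := ept_m M.
have [_ _ _ /(_ M MM)[F41 F42]] := Up.
have hv K i : hull (verts K) (vt K i) by exact: hull_vt.
have o K : K \in subtris M -> orient K != 0 by exact: sub_orient0.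
move: h h'; apply: innerP => /=; (apply: jetI; [exact: pp|exact: pp|]).
- have A := @U_mid M i0 (K1 M) (K2 M) MM h1 h2; rewrite e0 in A.
  have [a1 a2 a3] := A (hv (K1 M) i1) (hv (K2 M) i1).
  have B := @U_mid M i2 (K1 M) (K2 M) MM h1 h2; rewrite e2 in B.
  have [b1 b2 b3] := B (hv (K1 M) i2) (hv (K2 M) i2).
  apply: (hermite_edge (polynB (pp k1) (pp k2)) a1 b1 a2 b2 c1 c2 a3 b3); left.
  have := F41 _ _ h1 h2; rewrite /= => ->; rewrite ?subrr//.
    by apply: (@edge_sub_hull _ (K1 M) i0 _ (o _ h1)); apply/seg_hullP; exists 2^-1; rewrite lineM; split=> //; lra.
  by apply: (@edge_sub_hull _ (K2 M) i0 _ (o _ h2)); apply/seg_hullP; exists 2^-1; rewrite lineM; split=> //; lra.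
- have [a1 a2 a3] := @U_vertex M M.1.1 (K2 M) (K3 M) MM (mem_head _ _) k2 k3 (hv (K2 M) i0) (hv (K3 M) i0).
  have B := @U_mid M i0 (K2 M) (K3 M) MM h2 h3; rewrite e0 in B.
  have [b1 b2 b3] := B (hv (K2 M) i1) (hv (K3 M) i1).
  by apply: (hermite_edge (polynB (pp k2) (pp k3)) a1 b1 a2 b2 c3' c3' (a3 _) b3); right; exact: a3.
- have A := @U_mid M i0 (K3 M) (K4 M) MM h3 h4; rewrite e0 in A.
  have [a1 a2 a3] := A (hv (K3 M) i1) (hv (K4 M) i1).
  have B := @U_mid M i1 (K3 M) (K4 M) MM h3 h4; rewrite e1 in B.
  have [b1 b2 b3] := B (hv (K3 M) i2) (hv (K4 M) i2).
  apply: (hermite_edge (polynB (pp k3) (pp k4)) a1 b1 a2 b2 c4 c5 a3 b3); left.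
  have := F42 _ _ h3 h4; rewrite /= => ->; rewrite ?subrr//.
    by apply: (@edge_sub_hull _ (K3 M) i0 _ (o _ h3)); apply/seg_hullP; exists 2^-1; rewrite lineM; split=> //; lra.
  by apply: (@edge_sub_hull _ (K4 M) i0 _ (o _ h4)); apply/seg_hullP; exists 2^-1; rewrite lineM; split=> //; lra.
Qed.

Lemma half_hull M c b : let K := (half M c b).1 in
  hull (verts K) (hv M c b) /\ hull (verts K) (ept M c).
Proof.
by rewrite /=; case: (half_ends M c b) => -[<- <-]; split; exact: hull_vt.
Qed.

Lemma hv_mem M c b : hv M c b \in verts M.
Proof. by apply/mem_verts; rewrite /hv /ea /eb; case: b; [exists (nx (nx c))|exists (nx c)]. Qed.

Lemma ept_sub_hv M c b : exists2 s : R, s != 0 & ept M c - hv M c b = s *: (eb M c - ea M c).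
Proof.
rewrite /ept -/(ea M c) -/(eb M c) /hv /mid; case: b; [exists (- 2^-1)|exists 2^-1];
  rewrite ?oppr_eq0 ?invr_eq0 ?pnatr_eq0//; apply: pairE; rewrite /= /GRing.scale /=; by field.
Qed.

Lemma U_macro_mid M c K L : M \in Mh -> K \in T -> L \in T ->
  hull (verts K) (ept M c) -> hull (verts L) (ept M c) -> let w := fun x => p K x - p L x in
  dir (normal (edge M c)) w (ept M c) = 0 /\ forall u, dir (eb M c - ea M c) (dir u w) (ept M c) = 0.
Proof.
move=> MM KT LT KX LX; have [_ _ F3 _] := Up; have [h1 h2 h3] := F3 M c MM.
split.
  have := h1 K L KT LT KX LX; rewrite dnE (dnE _ (p L)) => e.
  by rewrite (dirB _ (pp KT) (pp LT)) e subrr.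
have [s s0 te] := edge_tangent M c.
by apply: (difft (pp KT) (pp LT) s0 (tangent_neq c (orT conf MM)) te); [exact: h3|exact: h2].
Qed.

(** No value is prescribed at the midpoint of a macro edge, so one half alone is underdetermined.
    The jumps on both halves agree there to first order, because each macro-element is C^1 at the
    midpoint. Once the jump vanishes along the half, the normal derivative at the midpoint completes
    the gradient, which is then cubic with vanishing end data. *)
Lemma U_half M N c d b b' : M \in Mh -> N \in Mh -> nbr M c N d ->
  nbr (half M c b).1 (half M c b).2 (half N d b').1 (half N d b').2 ->
  hv M c b = hv N d b' -> ept M c = ept N d -> jetE p (half M c b).1 (half M c b).2 (half N d b').1.
Proof.
move=> MM NM hn hn1 hvE eE.
have [b2 [hn2 hv2E _]] := nbr_half (~~ b) MM NM hn.
pose K := (half M c b).1; pose L := (half N d b').1.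
pose K' := (half M c (~~ b)).1; pose L' := (half N d b2).1.
have [KT K'T] : K \in T /\ K' \in T by split; apply: (memT MM); exact: half_mem.
have [LT L'T] : L \in T /\ L' \in T by split; apply: (memT NM); exact: half_mem.
set A := hv M c b in hvE; set A' := hv M c (~~ b) in hv2E; set B := ept M c in eE.
have [KA KB] := half_hull M c b; have [K'A K'B] := half_hull M c (~~ b).
have [LA LB] := half_hull N d b'; have [L'A L'B] := half_hull N d b2.
rewrite -hvE -eE in LA LB; rewrite -hv2E -eE in L'A L'B.
have [wA dA HA] := U_vertex MM (hv_mem M c b) KT LT KA LA.
have [wA' dA' HA'] := U_vertex MM (hv_mem M c (~~ b)) K'T L'T K'A L'A.
have [nB tB] := U_macro_mid MM KT LT KB LB; have [_ tB'] := U_macro_mid MM K'T L'T K'B L'B.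
have pw := polynB (pp KT) (pp LT); have pw' := polynB (pp K'T) (pp L'T).
have [m0 m1 _] := U_mid MM (half_mem M c b) (half_mem M c (~~ b)) KB K'B.
have [n0 n1 _] : let w := fun x => p L x - p L' x in
  [/\ w B = 0, forall u, dir u w B = 0 & forall u, dir (eb N d - ea N d) (dir u w) B = 0].
  rewrite eE; rewrite eE in LB L'B.
  exact: (U_mid NM (half_mem N d b') (half_mem N d b2) LB L'B).
have [s s0 vE] := ept_sub_hv M c b; have [s' s0' vE'] := ept_sub_hv M c (~~ b).
have z : forall r, (fun x => p K x - p L x) (A + r *: (B - A)) = 0.
  apply: (@hermite_half R _ (fun x => p K' x - p L' x) A A' B pw pw').
  - by rewrite /B /A /A' /ept /hv -/(ea M c) -/(eb M c); case: (b) => //=; rewrite midC.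
  - move=> f C; rewrite !inE => /orP[]/eqP[-> ->]; split=> //.
      by rewrite vE (dirZv _ _ _ (polyn_dir _ pw)) tB mulr0.
    by rewrite vE' (dirZv _ _ _ (polyn_dir _ pw')) tB' mulr0.
  - move: m0 n0; rewrite /= -/K -/K' -/L -/L' -/B => /eqP; rewrite subr_eq0 => /eqP -> /eqP.
    by rewrite subr_eq0 => /eqP ->.
  - move=> u; move: (m1 u) (n1 u); rewrite -/K -/K' -/L -/L' -/B.
    rewrite (dirB u (pp KT) (pp K'T)) (dirB u (pp LT) (pp L'T)) (dirB u (pp KT) (pp LT)) (dirB u (pp K'T) (pp L'T)).
    by move=> /eqP; rewrite subr_eq0 => /eqP -> /eqP; rewrite subr_eq0 => /eqP ->.
have dz := line_dir pw z.
have vn0 : cross (normal (edge M c)) (B - A) != 0.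
  have [s1 s10 te] := edge_tangent M c.
  have te0 : tangent (edge M c) != 0 by rewrite te scaler_eq0 negb_or s10 tangent_neq//; exact: (orT conf MM).
  have := normal_cross te0.
  have -> : cross (normal (edge M c)) (tangent (edge M c)) = (s1 / s) * cross (normal (edge M c)) (B - A).
    by rewrite te /B /A vE !crossZ mulrA divfK.
  by rewrite mulf_eq0 negb_or => /andP[].
have dB u : dir u (fun x => p K x - p L x) B = 0.
  rewrite (cross_decomp u vn0) (dir_lin _ _ _ _ _ pw) nB.
  have := dz 1; rewrite (lineB A B) => ->; by rewrite !mulr0 addr0.
have full r u : dir u (fun x => p K x - p L x) (A + r *: (B - A)) = 0.
  apply: (cubic_zero (polyn_dir u pw) (dA u) (dB u) (HA _ _)).
  by rewrite vE (dirZv _ _ _ (polyn_dir _ pw)) tB mulr0.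
have onl x : hull [:: A; B] x -> p K x = p L x /\ forall u, dir u (p K) x = dir u (p L) x.
  move=> /seg_hullP[r [_ _ ->]]; split=> [|u].
    by apply: subr0_eq; exact: z.
  by apply: subr0_eq; have := full r u; rewrite (dirB u (pp KT) (pp LT)).
move=> x hx; apply: onl; move: hx; case: (half_ends M c b) => -[-> ->] //.
move=> /seg_hullP[r [r0 r1 ->]]; apply/seg_hullP; exists (1 - r).
by split; [lra|lra|pt_ring].
Qed.

Lemma Ucond_jet K i L j : K \in T -> L \in T -> nbr K i L j -> jetE p K i L.
Proof.
move=> KT LT hn; have [[M MM /orP[h|h]]|] := nbrT KT LT hn.
- exact: (U_inner MM h).
- apply: (jetC (nbr_sym hn)); exact: (U_inner MM h).
move=> [M [N [c [d [b [b' [MM NM hn' [EK EL] [h1 h2]]]]]]]].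
have [e1 e2] : K = (half M c b).1 /\ i = (half M c b).2 by rewrite -EK.
have [e3 e4] : L = (half N d b').1 /\ j = (half N d b').2 by rewrite -EL.
by rewrite e1 e2 e3 e4 in hn *; exact: U_half hn' hn h1 h2.
Qed.

Lemma Ucond_C1 : C1 T p.
Proof.
split=> K i L j KT LT hn x hx; have [h1 h2] := Ucond_jet KT LT hn hx => //; exact: h2.
Qed.
End UGluing.

(** * Stress families and the Hessians of potentials *)

Section AiryFamilies.
Implicit Types (t A B : pt R) (p q : tri R -> pt R -> R).

(** The piecewise description of the stress space: [Scond_Sigma] and [Sigma_Scond] give the two
    directions. The last clause compares only sub-triangles of one macro-element, since tangential
    jumps between macro-elements are allowed at these midpoints. *)
Definition Scond S := [/\
  forall K, K \in T -> polynmx 2 (S K) /\ forall x, (S K x)^T = S K x,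
  forall i : 'I_2, matching T (fun K x => S K x i 0) (fun K x => S K x i 1),
  forall M X, M \in Mh -> X \in verts M -> forall K L, K \in T -> L \in T ->
    hull (verts K) X -> hull (verts L) X -> S K X = S L X
  & forall M c, M \in Mh -> forall K L, K \in subtris M -> L \in subtris M ->
    hull (verts K) (ept M c) -> hull (verts L) (ept M c) -> S K (ept M c) = S L (ept M c)].

Lemma ept_oedge M c : orient M != 0 -> oedge M c (ept M c).
Proof.
move=> hM; rewrite /oedge !lam_ept// eqxx (negbTE (nx_neq c).1.1) (negbTE (nx_neq c).1.2).
by rewrite invr_gt0 ltr0n.
Qed.

Lemma ept_tri M c K : M \in Mh -> K \in T -> hull (verts K) (ept M c) -> K \in subtris M \/
  exists N d, [/\ N \in Mh, K \in subtris N, nbr M c N d & ept N d = ept M c].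
Proof.
move=> MM KT KX; case/submeshP: KT => N NM KN; have [<-|MN] := eqVneq N M; [by left|right].
have hM := orT conf MM; have Nx := sub_hull (orT conf NM) KN KX.
rewrite eq_sym in MN; have [d hn] := oedge_nbrP conf MM NM MN (ept_oedge c hM) Nx.
exists N, d; split=> //.
by have [b [_ _ <-]] := nbr_half false MM NM hn.
Qed.

Lemma sub_nhull M : orient M != 0 -> [/\ ~ hull (verts (K1 M)) (ept M i1), ~ hull (verts (K2 M)) (ept M i1),
  ~ hull (verts (K3 M)) (ept M i2) & ~ hull (verts (K4 M)) (ept M i2)].
Proof.
move=> hM; have l i j := lam_ept i j hM.
split; [move=> /(subH1 hM)[+ _ _]|move=> /(subH2 hM)[_ _]|move=> /(subH3 hM)[_ _]|move=> /(subH4 hM)[+ _ _]];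
  rewrite !l /= => h; lra.
Qed.

(** All four sub-triangles meet at the midpoint opposite to the first vertex, and just two at each
    of the other midpoints. *)
Lemma sub_star (U : Type) (F : tri R -> U) M c : orient M != 0 ->
  (c = i0 -> [/\ F (K1 M) = F (K2 M), F (K2 M) = F (K3 M) & F (K3 M) = F (K4 M)]) ->
  (c = i1 -> F (K3 M) = F (K4 M)) -> (c = i2 -> F (K1 M) = F (K2 M)) ->
  forall K L, K \in subtris M -> L \in subtris M -> hull (verts K) (ept M c) ->
    hull (verts L) (ept M c) -> F K = F L.
Proof.
move=> hM; have [nh1 nh2 nh3 nh4] := sub_nhull hM.
move: c; apply: ord3P => h0 h1 h2 K L KM LM; move: K KM L LM.
- have [f1 f2 f3] := h0 erefl.
  by apply: subP; apply: subP => //= _ _; rewrite ?f1 ?f2 ?f3.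
- have f3 := h1 erefl.
  by apply: subP; apply: subP; (try by move=> /nh1); (try by move=> /nh2);
    (try by move=> _ /nh1); (try by move=> _ /nh2); rewrite ?f3.
- have f3 := h2 erefl.
  by apply: subP; apply: subP; (try by move=> /nh3); (try by move=> /nh4);
    (try by move=> _ /nh3); (try by move=> _ /nh4); rewrite ?f3.
Qed.

Lemma hess_zero f X t v : polyn 4 f -> cross t v != 0 -> (forall u, dir t (dir u f) X = 0) ->
  (forall u, dir v (dir u f) X = 0) -> forall u u', dir u (dir u' f) X = 0.
Proof.
move=> hf ct h1 h2 u u'; rewrite (cross_decomp u ct) (dir_lin _ _ _ _ _ (polyn_dir _ hf)).
by rewrite h1 h2 !mulr0 addr0.
Qed.

Lemma hessP f g X : polyn 4 f -> polyn 4 g ->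
  (forall u u', dir u (dir u' (fun x => f x - g x)) X = 0) -> hess f X = hess g X.
Proof.
move=> hf hg h; have e u u' : dir u (dir u' f) X = dir u (dir u' g) X.
  have := h u u'; rewrite (dirB u' hf hg) (dirB u (polyn_dir u' hf) (polyn_dir u' hg)).
  by move=> /eqP; rewrite subr_eq0 => /eqP.
by rewrite /hess !e.
Qed.

Lemma hess_diff f g X : polyn 4 f -> polyn 4 g -> hess f X = hess g X ->
  forall u u', dir u (dir u' f) X = dir u (dir u' g) X.
Proof.
move=> hf hg e u u'; apply: subr0_eq.
have := diff2 hf hg e u u'.
by rewrite (dirB u' hf hg) (dirB u (polyn_dir u' hf) (polyn_dir u' hg)).
Qed.

Section Family.
Variable p : tri R -> pt R -> R.
Hypothesis pp : polys T 4 p.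

Definition H2cond :=
  (forall M X, M \in Mh -> X \in verts M -> forall K L, K \in T -> L \in T ->
    hull (verts K) X -> hull (verts L) X -> hess (p K) X = hess (p L) X) /\
  (forall M c, M \in Mh -> forall K L, K \in subtris M -> L \in subtris M ->
    hull (verts K) (ept M c) -> hull (verts L) (ept M c) -> hess (p K) (ept M c) = hess (p L) (ept M c)).

Lemma C1_edge_hess K i L j x : C1 T p -> K \in T -> L \in T -> nbr K i L j ->
  hull [:: ea K i; eb K i] x -> forall u, dir (eb K i - ea K i) (dir u (fun y => p K y - p L y)) x = 0.
Proof.
move=> [_ cx cy] KT LT hn /seg_hullP[s [_ _ ->]] u; have pw := polynB (pp KT) (pp LT).
apply: (line_dir (polyn_dir u pw)); apply: (line_zero (polyn_dir u pw) ltr01) => r r0 r1.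
have hx : hull [:: ea K i; eb K i] (ea K i + r *: (eb K i - ea K i)).
  by apply/seg_hullP; exists r; split=> //; exact: ltW.
apply: diff1 (pp KT) (pp LT) _ _ u.
- exact: cx KT LT hn _ hx.
- exact: cy KT LT hn _ hx.
Qed.

(** At the midpoint of a macro edge the definition controls the Hessian rows along the macro edge.
    Continuity of the gradient across an interior edge ending there controls a second, independent
    direction. *)
Lemma Ucond_H2 : Ucond p -> H2cond.
Proof.
move=> Up; have cp := Ucond_C1 pp Up; split.
  move=> M X MM XM K L KT LT KX LX; have [F1 _ _ _] := Up.
  have e (a n : nat) : (a + n <= 2)%N -> pd a n (p K) X = pd a n (p L) X.
    by move=> an; apply: (F1 M X MM XM a n an).
  have := e 2%N 0%N isT; have := e 1%N 1%N isT; have := e 0%N 2%N isT.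
  by rewrite !pd20 !pd11 !pd02 /hess => -> -> ->.
move=> M c MM; have hM := orT conf MM; have [c1 c2 c3' c4 c5] := inner_cross hM.
have [h1 h2 h3 h4] := sub_mem M; have [e0 e2 e1] := ept_m M.
have [k1 k2 k3 k4] := And4 (memT MM h1) (memT MM h2) (memT MM h3) (memT MM h4).
have key K i L j d : K \in subtris M -> L \in subtris M -> inner2 M (K, i) (L, j) ->
    ea K i = ept M d \/ eb K i = ept M d ->
    cross (eb M d - ea M d) (eb K i - ea K i) != 0 -> hess (p K) (ept M d) = hess (p L) (ept M d).
  move=> KM LM hi hX ct; have [KT LT] := (memT MM KM, memT MM LM).
  have hn := inner_nbr hM hi; have pw := polynB (pp KT) (pp LT).
  have hx : hull [:: ea K i; eb K i] (ept M d) by case: hX => <-; [exact: seg_hulll|exact: seg_hullr].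
  have Kx := edge_sub_hull (sub_orient0 hM KM) hx.
  have Lx : hull (verts L) (ept M d).
    by rewrite (nbr_hull hn) in hx; exact: edge_sub_hull (sub_orient0 hM LM) hx.
  have [_ _ h] := U_mid pp Up MM KM LM Kx Lx.
  apply: (hessP (pp KT) (pp LT)); apply: (hess_zero pw ct h).
  exact: C1_edge_hess cp KT LT hn hx.
have in12 : inner2 M (K1 M, i0) (K2 M, i0) by rewrite /inner2 !inE eqxx.
have in23 : inner2 M (K2 M, i2) (K3 M, i2) by rewrite /inner2 !inE eqxx ?orbT.
have in34 : inner2 M (K3 M, i0) (K4 M, i0) by rewrite /inner2 !inE eqxx ?orbT.
apply: (sub_star (F := fun K => hess (p K) (ept M c)) hM) => -> /=.
- split.
  + exact: (key (K1 M) i0 (K2 M) i0 i0 h1 h2 in12 (or_introl (esym e0)) c1).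
  + exact: (key (K2 M) i2 (K3 M) i2 i0 h2 h3 in23 (or_intror (esym e0)) c3').
  + exact: (key (K3 M) i0 (K4 M) i0 i0 h3 h4 in34 (or_introl (esym e0)) c4).
- exact: (key (K3 M) i0 (K4 M) i0 i1 h3 h4 in34 (or_intror (esym e1)) c5).
- exact: (key (K1 M) i0 (K2 M) i0 i2 h1 h2 in12 (or_intror (esym e2)) c2).
Qed.

Lemma sv1 (a n : nat) K L x : C1 T p -> (a + n <= 1)%N -> K \in T -> L \in T ->
  hull (verts K) x -> hull (verts L) x -> pd a n (p K) x = pd a n (p L) x.
Proof.
move=> [c0 cx cy] an KT LT Kx Lx.
have [[-> ->]|[-> ->]|[-> ->]] := sum1P an.
- rewrite !pd00; exact: (single_valued c0 KT LT Kx Lx).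
- rewrite !pd10; exact: (single_valued cx KT LT Kx Lx).
- rewrite !pd01; exact: (single_valued cy KT LT Kx Lx).
Qed.

(** Within a macro-element the Hessians agree; between two of them, the continuous gradient may be
    differentiated along the common edge. *)
Lemma C1_mid_hess M c K L : C1 T p -> H2cond -> M \in Mh -> K \in T -> L \in T ->
  hull (verts K) (ept M c) -> hull (verts L) (ept M c) ->
  forall u, dir (tangent (edge M c)) (dir u (p K)) (ept M c) = dir (tangent (edge M c)) (dir u (p L)) (ept M c).
Proof.
move=> cp [_ hm] MM KT LT KX LX u; set t := tangent _.
have [s s0 te] := edge_tangent M c; have [s' s0' ve] := ept_sub_hv M c false.
pose K0 := (half M c false).1; have K0M : K0 \in subtris M by exact: half_mem.
have K0T := memT MM K0M; have [_ K0X] := half_hull M c false.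
suff h K' : K' \in T -> hull (verts K') (ept M c) ->
    dir t (dir u (p K')) (ept M c) = dir t (dir u (p K0)) (ept M c) by rewrite (h K)// (h L).
move=> K'T K'X; have [K'M|[N [d [NM K'N hn eE]]]] := ept_tri MM K'T K'X.
  exact: (hess_diff (pp K'T) (pp K0T) (hm M c MM K' K0 K'M K0M K'X K0X)).
have [b [hn' hvE _]] := nbr_half false MM NM hn.
pose L0 := (half N d b).1; have L0N : L0 \in subtris N by exact: half_mem.
have L0T := memT NM L0N; have [_ L0X] := half_hull N d b; rewrite eE in L0X.
transitivity (dir t (dir u (p L0)) (ept M c)).
  rewrite -eE in K'X L0X *.
  exact: (hess_diff (pp K'T) (pp L0T) (hm N d NM K' L0 K'N L0N K'X L0X)).
have hx : hull [:: ea K0 (half M c false).2; eb K0 (half M c false).2] (ept M c).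
  by rewrite /K0; case: (half_ends M c false) => -[-> ->]; [exact: seg_hullr|exact: seg_hulll].
have := C1_edge_hess cp K0T L0T hn' hx u; set v := eb _ _ - ea _ _.
have [r vE] : exists r, t = r *: v.
  have tv : exists r, ept M c - hv M c false = r *: v.
    rewrite /v /K0; case: (half_ends M c false) => -[-> ->]; [exists 1|exists (-1)].
      by rewrite scale1r.
    by rewrite scaleN1r opprB.
  have [r rE] := tv; exists (s / s' * r); rewrite /t te -scalerA -rE ve scalerA divfK//.
rewrite vE !(dirZv _ _ _ (polyn_dir u (pp _)))//.
rewrite (dirB u (pp K0T) (pp L0T)) (dirB v (polyn_dir u (pp K0T)) (polyn_dir u (pp L0T))).
by move=> /eqP; rewrite subr_eq0 => /eqP ->.
Qed.

Lemma H2_Ucond : C1 T p -> H2cond -> Ucond p.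
Proof.
move=> cp h2; have [hv' hm] := h2; split.
- move=> M X MM XM a n; rewrite leq_eqVlt ltnS => /orP[/eqP|] an K L KT LT KX LX.
    have := hv' M X MM XM K L KT LT KX LX; rewrite /hess => -[g1 g2 g3].
    by have [[-> ->]|[-> ->]|[-> ->]] := sum2P an; rewrite ?(pd20 (p _)) ?(pd11 (p _)) ?(pd02 (p _)).
  exact: sv1.
- move=> M c MM; split=> [a n an||] K L KM LM KX LX; have [KT LT] := (memT MM KM, memT MM LM).
  + exact: sv1.
  + by rewrite dttE (dttE _ (p L)); exact: (C1_mid_hess cp h2 MM KT LT KX LX).
  + by rewrite dtnE (dtnE _ (p L)); exact: (C1_mid_hess cp h2 MM KT LT KX LX).
- move=> M c MM; split=> K L KT LT KX LX.
  + rewrite dnE (dnE _ (p L)) (dir_coord _ _ (pp KT)) (dir_coord _ _ (pp LT)).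
    have := sv1 (a := 1) (n := 0) cp isT KT LT KX LX; have := sv1 (a := 0) (n := 1) cp isT KT LT KX LX.
    by rewrite !pd10 !pd01 => -> ->.
  + by rewrite dtnE (dtnE _ (p L)); exact: (C1_mid_hess cp h2 MM KT LT KX LX).
  + by rewrite dttE (dttE _ (p L)); exact: (C1_mid_hess cp h2 MM KT LT KX LX).
- by move=> M MM; split=> K L KM LM KX LX; have [KT LT] := (memT MM KM, memT MM LM);
    have := sv1 (a := 0) (n := 0) cp isT KT LT KX LX; rewrite !pd00.
Qed.

Definition airyS K x : 'M[R]_2 := \matrix_(i, j)
  if i == 0 then if j == 0 then (hess (p K) x).2 else - (hess (p K) x).1.2
  else if j == 0 then - (hess (p K) x).1.2 else (hess (p K) x).1.1.

Lemma hess_airyS K L X : hess (p K) X = hess (p L) X -> airyS K X = airyS L X.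
Proof. by move=> e; apply/matrixP => i j; rewrite !mxE e. Qed.

Lemma airyS_hess K L X : airyS K X = airyS L X -> hess (p K) X = hess (p L) X.
Proof.
move=> /matrixP e; move: (e 0 0) (e 0 1) (e 1 1); rewrite !mxE /=.
by rewrite /hess => -> /oppr_inj -> ->.
Qed.

Let alg1 (t1 t2 a b c d : R) : t1 * (c - d) + t2 * (a - b) = 0 -> t2 * (a - b) - t1 * (- c - - d) = 0.
Proof. by move=> <-; ring. Qed.

Let alg2 (t1 t2 a b c d : R) : t1 * (c - d) + t2 * (a - b) = 0 -> t2 * (- a - - b) - t1 * (c - d) = 0.
Proof. by move=> e; rewrite -[RHS]oppr0 -[in RHS]e; ring. Qed.

Lemma airyS_match : C1 T p -> forall i : 'I_2, matching T (fun K x => airyS K x i 0) (fun K x => airyS K x i 1).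
Proof.
move=> cp i [K k] [L l] hn x hx; have [KT LT] := (ssvalP K, ssvalP L).
have h := C1_edge_hess cp KT LT hn hx; rewrite /jump !mxE /=.
have hD u v : dir v (dir u (fun y => p (val K) y - p (val L) y)) x =
    v.1 * (dir (1, 0) (dir u (p (val K))) x - dir (1, 0) (dir u (p (val L))) x) +
    v.2 * (dir (0, 1) (dir u (p (val K))) x - dir (0, 1) (dir u (p (val L))) x).
  rewrite (dirB u (pp KT) (pp LT)) (dirB v (polyn_dir u (pp KT)) (polyn_dir u (pp LT))).
  rewrite (dir_coord v x (polyn_dir u (pp KT))) (dir_coord v x (polyn_dir u (pp LT))); ring.
have a1 := h (0, 1); have a2 := h (1, 0); rewrite hD in a1; rewrite hD in a2.
rewrite (dir_comm (0, 1) (1, 0) (pp KT)) (dir_comm (0, 1) (1, 0) (pp LT)) in a2.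
rewrite /hess /hea /heb /=.
move: a1 a2; set v := eb _ _ - ea _ _; rewrite -/v.
by case: (i == 0) => a1 a2; [exact: alg1 a1|exact: alg2 a2].
Qed.

Lemma airyS_Scond : Ucond p -> Scond airyS.
Proof.
move=> Up; have [hv' hm] := Ucond_H2 Up; split.
- move=> K KT; split=> [i j|x].
    have h u v : polyn 2 (dir u (dir v (p K))) by exact: (polyn_dir u (polyn_dir v (pp KT))).
    rewrite (_ : (fun x => airyS K x i j) = if i == 0 then if j == 0 then dir (0, 1) (dir (0, 1) (p K))
        else fun x => - dir (1, 0) (dir (0, 1) (p K)) x
      else if j == 0 then fun x => - dir (1, 0) (dir (0, 1) (p K)) x else dir (1, 0) (dir (1, 0) (p K))).
      by case: (i == 0); case: (j == 0); try apply: polynN; exact: h.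
    by apply/funext => x; rewrite mxE; case: (i == 0); case: (j == 0).
  by apply/matrixP => i j; rewrite !mxE; case: (i == 0); case: (j == 0).
- by have cp := Ucond_C1 pp Up; exact: airyS_match cp.
- by move=> M X MM XM K L KT LT KX LX; apply: hess_airyS; exact: (hv' M X MM XM K L KT LT KX LX).
- by move=> M c MM K L KM LM KX LX; apply: hess_airyS; exact: (hm M c MM K L KM LM KX LX).
Qed.
End Family.

End AiryFamilies.

(** * Quadratic Lagrange basis functions on the subdivision *)

Section Lagrange.
Implicit Types (t A B : pt R) (q : tri R -> pt R -> R) (s : pt R -> R).

Lemma quad_edge K i s (r : R) : orient K != 0 ->
  quad K s (ea K i + r *: (eb K i - ea K i)) =
  s (ea K i) * ((1 - r) * (1 - 2 * r)) + s (eb K i) * (r * (2 * r - 1)) +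
  s (mid (ea K i, eb K i)) * (4 * (r * (1 - r))).
Proof.
move=> hK; have [a1 a2 a3] := lam_ea i hK; have [b1 b2 b3] := lam_eb i hK.
rewrite /quad (sum3_nx _ i) !lam_line nxK a1 a2 a3 b1 b2 b3 /ept nxK -/(ea K i) -/(eb K i).
by rewrite ?mulr0 ?mulr1 ?addr0 ?add0r ?mul0r ?subr0; rewrite /ea /eb; ring.
Qed.

Lemma quad_ext K s g x : (forall i, s (vt K i) = g (vt K i)) -> (forall i, s (ept K i) = g (ept K i)) ->
  quad K s x = quad K g x.
Proof. by move=> h1 h2; apply: eq_bigr => i _; rewrite h1 h2. Qed.

Lemma node_cases K X : X \in verts K ++ [seq mid e | e <- edges K] ->
  (exists i, X = vt K i) \/ exists i, X = ept K i.
Proof.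
rewrite mem_cat => /orP[/mem_verts[i ->]|/mapP[e eK ->]]; first by left; exists i.
by have [c ->] := (edgesP K e).1 eK; right; exists c; rewrite edge_mid.
Qed.

Lemma node_vt K i : vt K i \in verts K ++ [seq mid e | e <- edges K].
Proof. by rewrite mem_cat; apply/orP; left; apply/mem_verts; exists i. Qed.

Lemma node_ept K i : ept K i \in verts K ++ [seq mid e | e <- edges K].
Proof.
rewrite mem_cat; apply/orP; right; apply/mapP; exists (edge K i); last by rewrite edge_mid.
by apply/edgesP; exists i.
Qed.

Lemma ept_hull K i : orient K != 0 -> hull (verts K) (ept K i).
Proof. by move=> hK; rewrite hullE// => j; rewrite lam_ept//; case: ifP => _; rewrite ?invr_ge0 ?ler0n. Qed.

Lemma lagrange2_quad X (Phi : pt R -> R) K x : lagrange2 T X Phi -> K \in T ->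
  orient K != 0 -> hull (verts K) x -> Phi x = quad K (dlt X) x.
Proof.
move=> [_ hp hn] KT hK Kx; have [p pp pE] := hp K KT; have nd := hn K KT.
rewrite pE// (polyn2_quad x hK pp); apply: quad_ext => i.
  by rewrite -pE ?nd ?node_vt//; exact: hull_vt.
by rewrite -pE ?nd ?node_ept//; exact: ept_hull.
Qed.

(** On an edge the interpolant depends only on the three nodes of that edge. *)
Lemma contE_quad s : contE T (fun K => quad K s).
Proof.
move=> K i L j KT LT hn x /seg_hullP[r [r0 r1 ->]].
rewrite quad_edge ?hT//; case/andP: hn => _ /orP[]/andP[/eqP e1 /eqP e2].
  by rewrite -e1 -e2 quad_edge ?hT.
rewrite -e1 -e2; have -> : eb L j + r *: (ea L j - eb L j) = ea L j + (1 - r) *: (eb L j - ea L j).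
  by pt_ring.
by rewrite quad_edge ?hT// (midC (eb L j)); ring.
Qed.

(** A triangle chosen for each covered point; for a single-valued family the glued function does not
    depend on the choice. *)
Definition pickT x : tri R := nth (0, 0, 0) T (find (fun K => `[< hull (verts K) x >]) T).

Lemma pickTP K x : K \in T -> hull (verts K) x -> pickT x \in T /\ hull (verts (pickT x)) x.
Proof.
move=> KT Kx; have h : has (fun K => `[< hull (verts K) x >]) T by apply/hasP; exists K => //; exact/asboolP.
split; first by rewrite mem_nth// -has_find.
by have := nth_find (0, 0, 0) h => /asboolP.
Qed.

Definition glued q x : R := q (pickT x) x.

Lemma gluedE q K x : contE T q -> K \in T -> hull (verts K) x -> glued q x = q K x.
Proof.
move=> cq KT Kx; have [PT Px] := pickTP KT Kx.
exact: (single_valued cq PT KT Px Kx).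
Qed.

Lemma glued_continuous q k : contE T q -> polys T k q ->
  {within [set x | exists2 K, K \in T & hull (verts K) x], continuous (glued q)}.
Proof.
move=> cq pq; suff h (S : seq (tri R)) : {subset S <= T} ->
    {within [set x | exists2 K, K \in S & hull (verts K) x], continuous (glued q)} by exact: h.
elim: S => [|K S IH] ST.
  rewrite (_ : [set x | _] = set0); first exact: continuous_subspace0.
  by apply/seteqP; split=> x //= [K].
have KT : K \in T by apply: ST; exact: mem_head.
have ST' : {subset S <= T} by move=> L LS; apply: ST; rewrite inE LS orbT.
rewrite (_ : [set x | _] = hull (verts K) `|` [set x | exists2 L, L \in S & hull (verts L) x]); last first.
  apply/seteqP; split=> x /=.
    by move=> [L]; rewrite inE => /orP[/eqP ->|LS] Lx; [left|right; exists L].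
  by move=> [Kx|[L LS Lx]]; [exists K; rewrite ?mem_head|exists L; rewrite // inE LS orbT].
apply: withinU_continuous.
- exact: hull_closed (orT confT KT).
- rewrite (_ : [set x | _] = \bigcup_(L in [set` S]) hull (verts L)).
    apply: closed_bigcup => [|L LS]; first exact: finite_seq.
    by apply: hull_closed; apply: (orT confT); exact: ST'.
  by apply/seteqP; split=> x /= [L LS Lx]; exists L.
- apply: (@subspace_eq_continuous _ (hull (verts K)) _ (q K) (glued q)).
    by move=> x /set_mem Kx; exact: (esym (gluedE cq KT Kx)).
  by apply: continuous_subspaceT; exact: polyn_continuous (pq K KT).
- exact: IH.
Qed.

Definition lagr X := glued (fun K => quad K (dlt X)).

Lemma lagr_quad X K x : K \in T -> hull (verts K) x -> lagr X x = quad K (dlt X) x.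
Proof. by move=> KT Kx; apply: gluedE => //; exact: contE_quad. Qed.

Lemma lagr_lagrange X : lagrange2 T X (lagr X).
Proof.
have cq : contE T (fun K => quad K (dlt X)) by exact: contE_quad.
split.
- by apply: (@glued_continuous _ 2) => // K KT; exact: quad_polyn.
- by move=> K KT; exists (quad K (dlt X)); [exact: quad_polyn|move=> x Kx; exact: lagr_quad].
- move=> K KT Y /node_cases[[i ->]|[i ->]].
    by rewrite (lagr_quad _ KT (hull_vt _ _)) quad_vt ?(orT confT).
  by rewrite (lagr_quad _ KT (ept_hull _ (orT confT KT))) quad_ept ?(orT confT).
Qed.
End Lagrange.

(** * Stress families belong to the stress space *)

Section SigmaFromFamily.
Implicit Types (t A B : pt R) (q : tri R -> pt R -> R) (s : pt R -> R) (sigma : pt R -> 'M[R]_2).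

Definition pwM S x : 'M[R]_2 := \matrix_(i, j) pw T (fun K y => S K y i j) x.
Definition repM sigma S := {in T, forall K, ae_on (hull (verts K)) (fun x => sigma x = S K x)}.

Lemma pwM_in S K x : K \in T -> oK K x -> pwM S x = S K x.
Proof. by move=> KT ox; apply/matrixP => i j; rewrite mxE (pw_in confT _ KT ox). Qed.

Lemma pwM_rep S : repM (pwM S) S.
Proof.
move=> K KT; apply: ae_onD (hull_oK_negl confT KT) _.
by apply: ae_onW => x; exact: pwM_in.
Qed.

Lemma repM_rep sigma S (i j : 'I_2) : repM sigma S -> rep T (fun x => sigma x i j) (fun K x => S K x i j).
Proof. by move=> h K KT; apply: ae_onS (h K KT) => // x _ ->. Qed.

Lemma rep_repM sigma S : (forall i j : 'I_2, rep T (fun x => sigma x i j) (fun K x => S K x i j)) -> repM sigma S.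
Proof.
move=> h K KT.
have := ae_on2 (h 0 0 K KT) (h 0 1 K KT) (S := fun x => sigma x 0 0 = S K x 0 0 /\ sigma x 0 1 = S K x 0 1) (fun x _ e1 e2 => conj e1 e2).
have := ae_on2 (h 1 0 K KT) (h 1 1 K KT) (S := fun x => sigma x 1 0 = S K x 1 0 /\ sigma x 1 1 = S K x 1 1) (fun x _ e1 e2 => conj e1 e2).
move=> h1 h2; apply: (ae_on2 h1 h2) => x _ [e1 e2] [e3 e4]; exact: mx2P.
Qed.

Lemma pwM_L2S k S : (forall K, K \in T -> polynmx k (S K) /\ forall x, (S K x)^T = S K x) -> L2S Omega (pwM S).
Proof.
move=> h; split.
  apply: (ae_cover confT) => K KT; apply: ae_onS (pwM_rep S KT) => // x _ ->.
  by have [_ ->] := h K KT.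
move=> i j; apply: (@L2_ext _ _ (pw T (fun K y => S K y i j))) => [|x _]; last by rewrite mxE.
by apply: (@pw_L2 R Omega T oO bO k) => K KT; have [pK _] := h K KT; exact: pK.
Qed.

Definition tau_div S K x : 'cV[R]_2 :=
  \col_i (dir (1, 0) (fun y => S K y i 0) x + dir (0, 1) (fun y => S K y i 1) x).

Lemma Scond_div k S sigma (v : pt R -> 'cV[R]_2) : (forall K, K \in T -> polynmx k (S K)) ->
  (forall i : 'I_2, matching T (fun K x => S K x i 0) (fun K x => S K x i 1)) ->
  (forall i j : 'I_2, L2 Omega (fun x => sigma x i j)) -> repM sigma S ->
  L2V Omega v -> (forall i : 'I_2, rep T (fun x => v x i 0) (fun K x => tau_div S K x i 0)) ->
  is_div Omega sigma v.
Proof.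
move=> pS mS LS rS Lv rv; split=> // i phi tp.
have pi (j : 'I_2) : polys T k (fun K x => S K x i j) by move=> K KT; exact: (pS K KT i j).
apply: (weak_div_fwd confT oO iO bO (pi 0) (pi 1) (LS i 0) (LS i 1) (repM_rep i 0 rS) (repM_rep i 1 rS) (Lv i) _ (mS i) tp).
by move=> K KT; apply: ae_onS (rv i K KT) => // x _ ->; rewrite mxE dirF.
Qed.

Lemma contE_Hk1 k p : polys T k p -> contE T p -> Hk 1 Omega (pw T p).
Proof.
move=> hp cp; have [Lp rp] := polys_pw_rep confT oO bO hp; split=> // a n an.
have [Lv rv] := polys_pw_rep confT oO bO (polys_pd a n hp).
by exists (pw T (fun K => pd a n (p K))) => //; exact: (weak_pd_C0 confT oO iO bO hp cp Lp rp an Lv rv).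
Qed.

Section Decomposition.
Variable S : tri R -> pt R -> 'M[R]_2.
Hypothesis HS : Scond S.

(** The continuous part takes at each node the value of one chosen triangle; another choice would
    only change the bubble part. *)
Definition nodal X : 'M[R]_2 := S (pickT X) X.
Definition cfam K x : 'M[R]_2 := \matrix_(i, j) quad K (fun Y => nodal Y i j) x.

Lemma S_poly K : K \in T -> polynmx 2 (S K). Proof. by have [h _ _ _] := HS; move=> /h[]. Qed.
Lemma S_sym K x : K \in T -> (S K x)^T = S K x. Proof. by have [h _ _ _] := HS; move=> /h[_]. Qed.

Lemma S_jump K i L j x : K \in T -> L \in T -> nbr K i L j -> hull [:: ea K i; eb K i] x ->
  exists a, S K x - S L x = a *: tt (eb K i - ea K i).
Proof.
move=> KT LT hn hx; have [_ mS _ _] := HS; apply: sym_rank1.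
- by rewrite linearB /= !S_sym.
- exact: tangent_neq (orT confT KT).
- by move=> k; have := matching_nbr (mS k) KT LT hn hx; rewrite !mxE.
Qed.

Lemma half_tangent M c b : exists r : R,
  eb (half M c b).1 (half M c b).2 - ea (half M c b).1 (half M c b).2 = r *: (eb M c - ea M c).
Proof.
have [s _ vE] := ept_sub_hv M c b; case: (half_ends M c b) => -[-> ->]; first by exists s.
by exists (- s); rewrite scaleNr -vE opprB.
Qed.

Lemma S_mid M c K L : M \in Mh -> K \in subtris M -> hull (verts K) (ept M c) ->
  L \in T -> hull (verts L) (ept M c) ->
  exists a, S K (ept M c) - S L (ept M c) = a *: tt (tangent (edge M c)).
Proof.
move=> MM KM KX LT LX; have [_ _ _ hm] := HS.
have [LM|[N [d [NM LN hn eE]]]] := ept_tri MM LT LX.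
  by exists 0; rewrite (hm M c MM K L KM LM KX LX) subrr scale0r.
have [b [hn' _ _]] := nbr_half false MM NM hn.
have K0M := half_mem M c false; have L0N := half_mem N d b.
have [_ K0X] := half_hull M c false; have [_ L0X] := half_hull N d b; rewrite eE in L0X.
rewrite (hm M c MM K _ KM K0M KX K0X) -eE in LX L0X *.
rewrite -eE in K0X; rewrite (hm N d NM L _ LN L0N LX L0X) eE.
have hx : hull [:: ea (half M c false).1 (half M c false).2; eb (half M c false).1 (half M c false).2] (ept M c).
  by case: (half_ends M c false) => -[-> ->]; [exact: seg_hullr|exact: seg_hulll].
have [a ->] := S_jump (memT MM K0M) (memT NM L0N) hn' hx.
have [r ->] := half_tangent M c false; have [s s0 ->] := edge_tangent M c.
exists (a * r ^+ 2 / s ^+ 2); rewrite !ttZ !scalerA; congr (_ *: _).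
by rewrite divfK// expf_neq0.
Qed.

Lemma S_ept K i L : K \in T -> L \in T -> hull (verts L) (ept K i) ->
  exists a, S K (ept K i) - S L (ept K i) = a *: tt (eb K i - ea K i).
Proof.
move=> KT LT LX; have hK := orT confT KT; have [<-|KL] := eqVneq K L.
  by exists 0; rewrite subrr scale0r.
have [j hn] := oedge_nbrP confT KT LT KL (ept_oedge i hK) LX.
apply: (S_jump KT LT hn); apply/seg_hullP; exists 2^-1; rewrite lineM.
by split=> //; lra.
Qed.

Lemma sub_vertP M K k : K \in subtris M -> vt K k \in verts M \/ exists c, vt K k = ept M c.
Proof.
have [e0 e2 e1] := ept_m M; move=> KM; move: K KM k; apply: subP; apply: ord3P;
  first [by left; rewrite /vt /= !inE eqxx ?orbT|by right; exists i0|by right; exists i1; rewrite e1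
    |by right; exists i2; rewrite e2].
Qed.

Lemma ept_node M c : exists K k, K \in subtris M /\ ept M c = vt K k.
Proof.
have [e0 e2 e1] := ept_m M; have [h1 h2 h3 h4] := sub_mem M.
by move: c; apply: ord3P; [exists (K1 M), i1|exists (K3 M), i2|exists (K1 M), i2]; rewrite ?e0 ?e1 ?e2.
Qed.

Lemma ept_ept M c K k : M \in Mh -> K \in T -> ept K k != ept M c.
Proof.
move=> MM KT; apply/eqP => e; have hK := orT confT KT.
have [K' [k' [K'M eE]]] := ept_node M c.
have : ept K k \in verts K.
  apply: (vert_in confT (memT MM K'M) KT); first exact: ept_hull.
  by apply/mem_verts; exists k'; rewrite e.
by move=> /mem_verts[l /eqP]; rewrite (negbTE (ept_vt k l hK)).
Qed.

Lemma nodal_pick K X : K \in T -> hull (verts K) X -> pickT X \in T /\ hull (verts (pickT X)) X.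
Proof. exact: pickTP. Qed.

Lemma vertex_nodal M X K : M \in Mh -> X \in verts M -> K \in T -> hull (verts K) X -> S K X = nodal X.
Proof.
move=> MM XM KT KX; have [PT PX] := nodal_pick KT KX; have [_ _ hv _] := HS.
exact: (hv M X MM XM).
Qed.

(** The coefficient is common to the sub-triangles of [M] because the family has one value per
    macro-element at that midpoint. *)
Lemma mid_coef : exists a : tri R -> 'I_3 -> R, forall M c K, M \in Mh -> K \in subtris M ->
  hull (verts K) (ept M c) -> S K (ept M c) - nodal (ept M c) = a M c *: tt (tangent (edge M c)).
Proof.
have h (Mc : tri R * 'I_3) : exists a : R, Mc.1 \in Mh -> forall K, K \in subtris Mc.1 ->
    hull (verts K) (ept Mc.1 Mc.2) -> S K (ept Mc.1 Mc.2) - nodal (ept Mc.1 Mc.2) = a *: tt (tangent (edge Mc.1 Mc.2)).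
  case: Mc => M c /=; have [MM|] := boolP (M \in Mh); last by exists 0.
  have [K0 [k [K0M eE]]] := ept_node M c.
  have K0X : hull (verts K0) (ept M c) by rewrite eE; exact: hull_vt.
  have [PT PX] := nodal_pick (memT MM K0M) K0X.
  have [a aE] := S_mid MM K0M K0X PT PX; exists a => _ K KM KX.
  by have [_ _ _ hm] := HS; rewrite (hm M c MM K K0 KM K0M KX K0X).
have [a ha] := choice h; exists (fun M c => a (M, c)) => M c K MM KM KX.
exact: (ha (M, c) MM K KM KX).
Qed.

Lemma edge_coef : exists b : tri R -> 'I_3 -> R, forall K i, K \in T ->
  S K (ept K i) - nodal (ept K i) = b K i *: tt (eb K i - ea K i).
Proof.
have h (Ki : tri R * 'I_3) : exists a : R, Ki.1 \in T ->
    S Ki.1 (ept Ki.1 Ki.2) - nodal (ept Ki.1 Ki.2) = a *: tt (eb Ki.1 Ki.2 - ea Ki.1 Ki.2).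
  case: Ki => K i /=; have [KT|] := boolP (K \in T); last by exists 0.
  have [PT PX] := nodal_pick KT (ept_hull i (orT confT KT)).
  by have [a aE] := S_ept KT PT PX; exists a.
by have [b hb] := choice h; exists (fun K i => b (K, i)) => K i; exact: (hb (K, i)).
Qed.

Definition rem (a : tri R -> 'I_3 -> R) M K x : 'M[R]_2 :=
  S K x - cfam K x - \sum_c (a M c * quad K (dlt (ept M c)) x) *: tt (tangent (edge M c)).

Definition bub (be : tri R -> 'I_3 -> R) K x : 'M[R]_2 :=
  \sum_i (4 * (lam K (nx i) x * lam K (nx (nx i)) x) * be K i) *: tt (eb K i - ea K i).

(** Two quadratics are compared at the six nodes. At sub-vertices both vanish: the continuous part
    settles the macro vertices and the tangential generators the macro midpoints. At edge midpoints
    of [K], normal continuity leaves a multiple of the tangential matrix. *)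
Lemma rem_bub a be M K x :
  (forall M c K, M \in Mh -> K \in subtris M -> hull (verts K) (ept M c) ->
     S K (ept M c) - nodal (ept M c) = a M c *: tt (tangent (edge M c))) ->
  (forall K i, K \in T -> S K (ept K i) - nodal (ept K i) = be K i *: tt (eb K i - ea K i)) ->
  M \in Mh -> K \in subtris M -> rem a M K x = bub be K x.
Proof.
move=> ha hb MM KM; have KT := memT MM KM; have hK := orT confT KT; have hM := orT conf MM.
have cE Y (k : 'I_3) : Y = vt K k \/ Y = ept K k -> cfam K Y = nodal Y.
  by move=> h; apply/matrixP => i j; rewrite mxE; case: h => ->; rewrite ?quad_vt ?quad_ept.
have rv k : rem a M K (vt K k) = 0.
  rewrite /rem (cE _ k (or_introl erefl)); have [Xm|[c Xc]] := sub_vertP k KM.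
    rewrite (vertex_nodal MM Xm KT (hull_vt _ _)) subrr sub0r big1 ?oppr0// => c _.
    rewrite quad_vt// /dlt; case: eqP => [e|_]; last by rewrite mulr0 scale0r.
    by move: Xm => /mem_verts[l /eqP]; rewrite e (negbTE (ept_vt c l hM)).
  rewrite Xc (ha M c K MM KM); last by rewrite -Xc; exact: hull_vt.
  rewrite (bigD1 c)//= big1 => [|d dc]; rewrite -Xc quad_vt// /dlt Xc.
    by rewrite eqxx mulr1 addr0 subrr.
  by case: eqP => [/(ept_inj hM) e|_]; [rewrite e eqxx in dc|rewrite mulr0 scale0r].
have re k : rem a M K (ept K k) = be K k *: tt (eb K k - ea K k).
  rewrite /rem (cE _ k (or_intror erefl)) hb// big1 ?subr0// => c _.
  by rewrite quad_ept// /dlt (negbTE (ept_ept c k MM KT)) mulr0 scale0r.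
apply/matrixP => i j.
have pr : polyn 2 (fun y => rem a M K y i j).
  rewrite (_ : (fun y => _) = fun y => S K y i j - quad K (fun Y => nodal Y i j) y -
      \sum_c (tt (tangent (edge M c)) i j * a M c) * quad K (dlt (ept M c)) y).
    apply: polynB; first by apply: polynB; [exact: S_poly|exact: quad_polyn].
    apply: polyn_sum => c _; apply: polynZ; exact: quad_polyn.
  apply/funext => y; rewrite /rem !mxE summxE; congr (_ - _ - _).
  by apply: eq_bigr => c _; rewrite [LHS]mxE mulrC mulrA.
rewrite (polyn2_quad x hK pr) /quad /bub summxE; apply: eq_bigr => k _.
by rewrite rv re mxE mul0r add0r !mxE; ring.
Qed.

Lemma bub_polyn be K : polynmx 2 (bub be K).
Proof.
move=> i j; rewrite (_ : (fun x => _) = fun x => \sum_k (tt (eb K k - ea K k) i j * be K k * 4) *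
   (lam K (nx k) x * lam K (nx (nx k)) x)).
  apply: polyn_sum => k _; apply: polynZ; apply: (polynM (k := 1) (l := 1)); exact: lam_polyn.
by apply/funext => x; rewrite /bub summxE; apply: eq_bigr => k _; rewrite mxE; ring.
Qed.

Lemma bub_sym be K x : (bub be K x)^T = bub be K x.
Proof.
rewrite /bub linear_sum; apply: eq_bigr => k _.
by rewrite linearZ /= tt_sym.
Qed.

Lemma tt_normal t (s : R) : tt t *m vec (normal (0, s *: t)) = 0.
Proof.
rewrite /tt -mulmxA (_ : (vec t)^T *m vec _ = 0) ?mulmx0//.
apply/matrixP => i j; rewrite !mxE !big_ord_recl big_ord0 !mxE /= /tangent /= /GRing.scale /=; ring.
Qed.

Lemma normal_tangent (e e' : pt R * pt R) : tangent e = tangent e' -> normal e = normal e'.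
Proof. by rewrite /normal => ->. Qed.

Lemma edge_seg K c x : hull [:: (edge K c).1; (edge K c).2] x -> hull [:: ea K c; eb K c] x.
Proof.
rewrite /edge; case: ifP => // _ /seg_hullP[r [r0 r1 ->]]; apply/seg_hullP; exists (1 - r).
by split; [lra|lra|pt_ring].
Qed.

Lemma bub_edge be K c x : orient K != 0 -> hull [:: (edge K c).1; (edge K c).2] x ->
  bub be K x *m vec (normal (edge K c)) = 0.
Proof.
move=> hK /edge_seg /(edge_hullP c x hK)[l0 _ _].
have [s _ te] := edge_tangent K c.
have nE : normal (edge K c) = normal (0, s *: (eb K c - ea K c)).
  by apply: normal_tangent; rewrite te /tangent /= subr0.
rewrite /bub (sum3_nx _ c) nxK l0 !(mul0r, mulr0) !scale0r !addr0 -scalemxAl nE tt_normal.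
by rewrite scaler0.
Qed.
End Decomposition.

Lemma ae_onU (A B : set (pt R)) (P : pt R -> Prop) : ae_on A P -> ae_on B P -> ae_on (A `|` B) P.
Proof.
move=> /ae_onE h1 /ae_onE h2; apply/ae_onE; apply: negligibleS (negligibleU h1 h2).
by move=> x /= [[Ax|Bx] nP]; [left|right].
Qed.

Lemma ae_macro M (P : pt R -> Prop) : M \in Mh -> {in subtris M, forall K, ae_on (hull (verts K)) P} ->
  ae_on (hull (verts M)) P.
Proof.
move=> MM h; have [h1 h2 h3 h4] := sub_mem M.
have h' := ae_onU (ae_onU (h _ h1) (h _ h2)) (ae_onU (h _ h3) (h _ h4)).
apply: ae_onS h' => // x Mx; have [K KM Kx] := sub_cover (orT conf MM) Mx.
by move: KM Kx; move: K; apply: subP => Kx; [left; left|left; right|right; left|right; right].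
Qed.

Lemma bubble_Sigma S M : Scond S -> M \in Mh -> SigmaMb T M (pwM (fun K x => S K x - cfam S K x)).
Proof.
move=> HS MM; have [a ha] := mid_coef HS; have [be hb] := edge_coef HS.
have remE K x : K \in subtris M -> rem S a M K x = bub be K x by exact: rem_bub.
pose g0 := pwM (fun K => bub be K).
pose gc c x := lagr (ept M c) x *: tt (tangent (edge M c)).
(* Index 0 is the elementwise bubble with coefficient 1; the other three are the tangential
   generators at the macro midpoints. *)
exists 4%N, (fun k : 'I_4 => oapp (a M) 1 (unlift ord0 k)), (fun k : 'I_4 => oapp gc g0 (unlift ord0 k)).
split=> [k|].
  case: (unliftP ord0 k) => [c _|_] /=.
    apply: Or33; exists (edge M c), (lagr (ept M c)); split => //.
      by apply/edgesP; exists c.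
    by rewrite edge_mid; exact: lagr_lagrange.
  apply: Or31 => K KM; exists (bub be K); split.
  - by split; [exact: bub_polyn|exact: (pwM_rep _ (memT MM KM))].
  - exact: bub_sym.
  - move=> e eK x hx; have [c ec] := (edgesP K e).1 eK; rewrite ec in hx *.
    exact: bub_edge (sub_orient0 (orT conf MM) KM) hx.
apply: ae_macro => // K KM; have KT := memT MM KM.
apply: (ae_on2 (pwM_rep (fun K x => S K x - cfam S K x) KT) (pwM_rep (fun K => bub be K) KT)) => x Kx e1 e2.
rewrite e1 big_ord_recl unlift_none /= scale1r /g0 e2 -remE// /rem.
under eq_bigr => c _ do rewrite liftK /= /gc (lagr_quad _ KT Kx) scalerA.
by rewrite subrK.
Qed.

Lemma Scond_Sigma S sigma : Scond S -> L2S Omega sigma -> repM sigma S -> Sigma2h Omega Mh sigma.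
Proof.
move=> HS Ls rs; have [hp mS _ _] := HS.
have pS K : K \in T -> polynmx 2 (S K) by move=> /hp[].
have pd' (i : 'I_2) : polys T 1 (fun K x => tau_div S K x i 0).
  move=> K KT; rewrite (_ : (fun x => _) = fun x => dir (1, 0) (fun y => S K y i 0) x + dir (0, 1) (fun y => S K y i 1) x).
    by apply: polynD; exact: (polyn_dir _ (pS K KT i _)).
  by apply/funext => x; rewrite mxE.
split.
  split=> //; exists (fun x => \col_i pw T (fun K y => tau_div S K y i 0) x).
  apply: (Scond_div pS mS _ rs); first by have [] := Ls.
    move=> i; apply: (@L2_ext _ _ (pw T (fun K y => tau_div S K y i 0))) => [|x _]; last by rewrite mxE.
    exact: (@pw_L2 R Omega T oO bO 1 _ (pd' i)).
  by move=> i K KT; apply: ae_onS (rep_pw confT (fun K y => tau_div S K y i 0) KT) => // x _; rewrite mxE.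
have hc K : K \in T -> polynmx 2 (cfam S K) /\ forall x, (cfam S K x)^T = cfam S K x.
  move=> KT; split=> [i j|x].
    rewrite (_ : (fun x => _) = quad K (fun Y => nodal S Y i j)); first exact: quad_polyn.
    by apply/funext => x; rewrite mxE.
  apply/matrixP => i j; rewrite !mxE; have hK := orT confT KT.
  have ns X : hull (verts K) X -> nodal S X i j = nodal S X j i.
    by move=> KX; have [PT _] := nodal_pick KT KX; rewrite /nodal -{1}(S_sym HS X PT) mxE.
  by apply: quad_ext => k; rewrite ns//; [exact: hull_vt|exact: ept_hull].
exists (pwM (cfam S)), (pwM (fun K x => S K x - cfam S K x)); split.
- apply: (ae_cover confT) => K KT.
  have h1 := rs K KT; have h2 := pwM_rep (cfam S) KT.
  have h3 := pwM_rep (fun K x => S K x - cfam S K x) KT.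
  have h := ae_on2 h2 h3 (S := fun x => pwM (cfam S) x + pwM (fun K x => S K x - cfam S K x) x = S K x).
  apply: (ae_on2 h1 (h _)) => [x _ -> ->|x _ -> ->] //; by rewrite addrC subrK.
- split; first by have [] := pwM_L2S hc.
  move=> i j; rewrite (_ : (fun x => _) = pw T (fun K => quad K (fun Y => nodal S Y i j))).
    apply: (@contE_Hk1 2) => [K _|]; first exact: quad_polyn.
    by exact: contE_quad.
  by apply/funext => x; rewrite mxE; congr (pw T _ x); apply/funext => K; apply/funext => y; rewrite mxE.
- move=> K KT; have [h1 h2] := hc K KT; exists (cfam S K) => //; split=> //.
  exact: (pwM_rep _ KT).
- by move=> M MM; exact: bubble_Sigma.
Qed.
End SigmaFromFamily.

(** * Members of the stress space are stress families *)

Section FamilyFromSigma.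
Implicit Types (t A B : pt R) (q : tri R -> pt R -> R) (s : pt R -> R) (sigma : pt R -> 'M[R]_2).

(** Weak partial derivatives are weak divergences of [(F, 0)] and [(0, F)]. Both components of the
    edge vector times the jump vanish, and the edge vector is nonzero. *)
Lemma weak_pd_matching k p F : polys T k p -> L2 Omega F -> rep T F p -> Hk 1 Omega F -> contE T p.
Proof.
move=> hp LF rF [_ hk].
have L0 : L2 Omega (fun=> 0 : R) by apply: L2_ext (L2D 0 0 LF LF) _ => x _; rewrite !mul0r addr0.
have p0 : polys T k (@zero_fam R) by move=> K KT; exact: polyn_cst.
have r0 : rep T (fun=> 0 : R) (@zero_fam R) by move=> K KT; exact: ae_onW.
have [g1 Lg1 w1] := hk 1%N 0%N isT; have [g2 Lg2 w2] := hk 0%N 1%N isT.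
have m1 : matching T p (@zero_fam R).
  apply: (weak_div_matching confT oO iO bO hp p0 LF L0 rF r0 Lg1) => phi tp.
  have := w1 phi tp; rewrite expr1 mulN1r => <-; congr Rintegral; apply/funext => x.
  by rewrite mul0r addr0.
have m2 : matching T (@zero_fam R) p.
  apply: (weak_div_matching confT oO iO bO p0 hp L0 LF r0 rF Lg2) => phi tp.
  have := w2 phi tp; rewrite expr1 mulN1r => <-; congr Rintegral; apply/funext => x.
  by rewrite mul0r add0r.
move=> K i L j KT LT hn x hx; apply: subr0_eq.
have := matching_nbr m1 KT LT hn hx; have := matching_nbr m2 KT LT hn hx.
rewrite /zero_fam subrr !mulr0 sub0r subr0 => /eqP; rewrite oppr_eq0 mulf_eq0 => /orP[/eqP t1|/eqP //].
move=> /eqP; rewrite mulf_eq0 => /orP[/eqP t2|/eqP //].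
have := tangent_neq i (orT confT KT); suff -> : eb K i - ea K i = 0 by rewrite eqxx.
exact: pairE.
Qed.

(** The pointwise properties shared by all generators of the macro bubble space and kept by linear
    combinations. *)
Definition bubble_fam M (G : tri R -> pt R -> 'M[R]_2) := [/\
  forall K, K \in subtris M -> polynmx 2 (G K) /\ forall x, (G K x)^T = G K x,
  forall X K, X \in verts M -> K \in subtris M -> hull (verts K) X -> G K X = 0
  & forall c K L, K \in subtris M -> L \in subtris M -> hull (verts K) (ept M c) ->
      hull (verts L) (ept M c) -> G K (ept M c) = G L (ept M c)].

Lemma normals_zero (A : 'M[R]_2) u v : A *m vec u = 0 -> A *m vec v = 0 -> cross u v != 0 -> A = 0.
Proof.
move=> h1 h2 ct.
have e (w : pt R) (i : 'I_2) : A *m vec w = 0 -> A i 0 * w.1 + A i 1 * w.2 = 0.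
  move=> /matrixP/(_ i 0); rewrite !mxE !big_ord_recl big_ord0 !mxE /= addr0.
  by rewrite (_ : lift ord0 ord0 = 1)//; exact: val_inj.
apply/matrixP => i; suff [a0 a1] : A i 0 = 0 /\ A i 1 = 0 by apply: ord2P; rewrite mxE.
have := e u i h1; have := e v i h2 => g2 g1.
split; apply: (mulIf ct); rewrite mul0r /cross.
  transitivity (v.2 * (A i 0 * u.1 + A i 1 * u.2) - u.2 * (A i 0 * v.1 + A i 1 * v.2)); first ring.
  by rewrite g1 g2 !mulr0 subrr.
transitivity (u.1 * (A i 0 * v.1 + A i 1 * v.2) - v.1 * (A i 0 * u.1 + A i 1 * u.2)); first ring.
by rewrite g1 g2 !mulr0 subrr.
Qed.

Lemma edge_ends K c : hull [:: (edge K c).1; (edge K c).2] (ea K c) /\ hull [:: (edge K c).1; (edge K c).2] (eb K c).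
Proof. by rewrite /edge; case: ifP => _; split; (exact: seg_hulll || exact: seg_hullr). Qed.

Lemma normals_cross K k : orient K != 0 -> cross (normal (edge K (nx k))) (normal (edge K (nx (nx k)))) != 0.
Proof.
move=> hK; have [s1 s10 e1] := edge_tangent K (nx k); have [s2 s20 e2] := edge_tangent K (nx (nx k)).
have -> : cross (normal (edge K (nx k))) (normal (edge K (nx (nx k)))) = s1 * s2 * orient K.
  rewrite /normal e1 e2 /ea /eb nxK; move: k {e1 e2}; apply: ord3P;
    rewrite /orient /cross /vt /= /GRing.scale /=; ring.
by rewrite !mulf_neq0.
Qed.

(** Two edges meet at the vertex, and their normals are independent. *)
Lemma SigmaKb_vertex K (P : pt R -> 'M[R]_2) k : orient K != 0 ->
  {in edges K, forall e, forall x, hull [:: e.1; e.2] x -> P x *m vec (normal e) = 0} -> P (vt K k) = 0.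
Proof.
move=> hK hP; have ek c : edge K c \in edges K by apply/edgesP; exists c.
apply: (normals_zero _ _ (normals_cross k hK)); apply: hP => //.
- by have [_ +] := edge_ends K (nx k); rewrite /eb nxK.
- by have [+ _] := edge_ends K (nx (nx k)); rewrite /ea nxK.
Qed.

Lemma ept_in_verts M c K : M \in Mh -> K \in T -> hull (verts K) (ept M c) -> exists k, ept M c = vt K k.
Proof.
move=> MM KT KX; have [K' [k [K'M eE]]] := ept_node M c.
by apply/mem_verts; apply: (vert_in confT (memT MM K'M) KT KX); apply/mem_verts; exists k.
Qed.

Lemma vert_in_verts M X K : M \in Mh -> X \in verts M -> K \in subtris M -> hull (verts K) X ->
  exists k, X = vt K k.
Proof.
move=> MM /mem_verts[b Xb] KM KX; have [h _] := vertex_sub (orT conf MM) KM KX Xb.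
exact/mem_verts.
Qed.

Lemma fam_quad M Y (B : 'M[R]_2) : M \in Mh -> Y \notin verts M -> B^T = B ->
  bubble_fam M (fun K x => quad K (dlt Y) x *: B).
Proof.
move=> MM YM sB; have hM := orT conf MM; split.
- move=> K KM; split=> [i j|x]; last by rewrite linearZ /= sB.
  rewrite (_ : (fun x => _) = fun x => B i j * quad K (dlt Y) x).
    by apply: polynZ; exact: quad_polyn.
  by apply/funext => x; rewrite mxE mulrC.
- move=> X K XM KM KX; have [k Xk] := vert_in_verts MM XM KM KX.
  rewrite Xk quad_vt ?(sub_orient0 hM KM)// -Xk /dlt; case: eqP => [e|_]; last by rewrite scale0r.
  by rewrite e (negP YM) in XM || (move: YM; rewrite -e XM).
- move=> c K L KM LM KX LX.
  have [k Xk] := ept_in_verts MM (memT MM KM) KX; have [l Xl] := ept_in_verts MM (memT MM LM) LX.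
  by rewrite {1}Xk Xl !quad_vt ?(sub_orient0 hM KM) ?(sub_orient0 hM LM)// -Xk -Xl.
Qed.

Lemma mid_E_notin M e : M \in Mh -> e \in [:: E1 M; E2 M; E3 M] -> mid e \notin verts M.
Proof.
move=> MM; have hM := orT conf MM; have [[g1 g2 g3] _ _] := inner_ept M; have [h1 h2 h3 h4] := sub_mem M.
have key K i : K \in subtris M -> ept K i \notin verts M.
  move=> KM; apply/negP => h; have hK := sub_orient0 hM KM.
  have [k /eqP] := vert_in_verts MM h KM (ept_hull i hK).
  by rewrite (negbTE (ept_vt i k hK)).
move=> eM; have : [|| e == E1 M, e == E2 M | e == E3 M] by rewrite !inE in eM.
case/or3P => /eqP ->.
- by rewrite g1; exact: key h1.
- by rewrite g2; exact: key h2.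
- by rewrite g3; exact: key h3.
Qed.

Lemma gen_fam M (g : pt R -> 'M[R]_2) : M \in Mh -> bubble_gen T M g ->
  exists2 G, bubble_fam M G & {in subtris M, forall K, ae_on (hull (verts K)) (fun x => g x = G K x)}.
Proof.
move=> MM; have hM := orT conf MM.
have phi Y (Phi : pt R -> R) (B : 'M[R]_2) : Y \notin verts M -> B^T = B -> lagrange2 T Y Phi ->
    exists2 G, bubble_fam M G &
      {in subtris M, forall K, ae_on (hull (verts K)) (fun x => Phi x *: B = G K x)}.
  move=> YM sB hl; exists (fun K x => quad K (dlt Y) x *: B); first exact: fam_quad.
  move=> K KM; apply: ae_onW => x Kx.
  by rewrite (lagrange2_quad hl (memT MM KM) (sub_orient0 hM KM) Kx).
case=> [h|[e [Phi [he hl hg]]]|[e [Phi [he hl ->]]]].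
- have h' K : exists P, K \in subtris M -> [/\ restr_polymx (hull (verts K)) 2 g P,
      forall x, (P x)^T = P x & {in edges K, forall e, forall x, hull [:: e.1; e.2] x -> P x *m vec (normal e) = 0}].
    by have [/h[P hP]|_] := boolP (K \in subtris M); [exists P|exists (fun=> 0)].
  have [G hG] := choice h'; exists G; last by move=> K /hG[[]].
  have z K k : K \in subtris M -> G K (vt K k) = 0.
    by move=> KM; have [_ _ hn] := hG K KM; apply: SigmaKb_vertex hn; exact: sub_orient0 hM KM.
  split.
  + by move=> K KM; have [[pG _] sG _] := hG K KM.
  + by move=> X K XM KM KX; have [k ->] := vert_in_verts MM XM KM KX; exact: z.
  + move=> c K L KM LM KX LX.
    have [k Xk] := ept_in_verts MM (memT MM KM) KX; have [l Xl] := ept_in_verts MM (memT MM LM) LX.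
    by rewrite {1}Xk Xl !z.
- have YM := mid_E_notin MM he; case: hg => ->; apply: (phi _ _ _ YM) => //.
    by rewrite linearD /= !trmx_mul !trmxK addrC.
  by rewrite trmx_mul trmxK.
- have [c ec] := (edgesP M e).1 he; apply: phi hl; last exact: tt_sym.
  rewrite ec edge_mid; apply/negP => /mem_verts[k /eqP]; by rewrite (negbTE (ept_vt c k hM)).
Qed.

Lemma fam_lin M n (a : 'I_n -> R) (G : 'I_n -> tri R -> pt R -> 'M[R]_2) : (forall k, bubble_fam M (G k)) ->
  bubble_fam M (fun K x => \sum_k a k *: G k K x).
Proof.
move=> hG; split.
- move=> K KM; split=> [i j|x].
    rewrite (_ : (fun x => _) = fun x => \sum_k a k * G k K x i j).
      by apply: polyn_sum => k _; apply: polynZ; have [/(_ K KM)[h _] _ _] := hG k; exact: h.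
    by apply/funext => x; rewrite summxE; apply: eq_bigr => k _; rewrite mxE.
  by rewrite linear_sum; apply: eq_bigr => k _; rewrite linearZ /=; have [/(_ K KM)[_ ->] _ _] := hG k.
- by move=> X K XM KM KX; rewrite big1// => k _; have [_ h _] := hG k; rewrite h ?scaler0.
- by move=> c K L KM LM KX LX; apply: eq_bigr => k _; have [_ _ h] := hG k; rewrite (h c K L).
Qed.

Lemma SigmaMb_fam M (sb : pt R -> 'M[R]_2) : M \in Mh -> SigmaMb T M sb ->
  exists2 G, bubble_fam M G & {in subtris M, forall K, ae_on (hull (verts K)) (fun x => sb x = G K x)}.
Proof.
move=> MM [n [a [g [hg hs]]]].
have h k : exists G, bubble_fam M G /\ {in subtris M, forall K, ae_on (hull (verts K)) (fun x => g k x = G K x)}.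
  by have [G h1 h2] := gen_fam MM (hg k); exists G.
have [G hG] := choice h; exists (fun K x => \sum_k a k *: G k K x).
  by apply: fam_lin => k; have [] := hG k.
move=> K KM; have hsK : ae_on (hull (verts K)) (fun x => sb x = \sum_k a k *: g k x).
  by apply: ae_onS hs => // x; exact: (@sub_hull R M x (orT conf MM) K KM).
have : ae_on (hull (verts K)) (fun x => forall k, g k x = G k K x).
  apply/ae_onE; have : (leb2 R).-negligible (\bigcup_k [set x | hull (verts K) x /\ ~ g k x = G k K x]).
    apply: negligible_bigcup_countable => k.
    by apply/ae_onE; have [_ hk] := hG k; exact: hk.
  apply: negligibleS => x /= [Kx /existsNP[k hk]]; by exists k.
move=> h2; apply: (ae_on2 hsK h2) => x _ -> e; by apply: eq_bigr => k _; rewrite e.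
Qed.

(** Normal continuity comes from the divergence being square integrable. The point conditions come
    from the two summands: the first is continuous, and the bubbles vanish at macro vertices and
    have one value per macro-element at macro midpoints. *)
Lemma Sigma_Scond sigma : Sigma2h Omega Mh sigma -> exists2 S, Scond S & repM sigma S.
Proof.
move=> [[[sS LS] [v [Lv hv]]] [sc [sb [hs [scS scH] hc hb]]]].
have hc' K : exists P, K \in T -> restr_polymx (hull (verts K)) 2 sc P /\ forall x, (P x)^T = P x.
  by have [/hc[P h1 h2]|_] := boolP (K \in T); [exists P|exists (fun=> 0)].
have [cF hcF] := choice hc'.
have hb' M : exists G, M \in Mh -> bubble_fam M G /\ {in subtris M, forall K, ae_on (hull (verts K)) (fun x => sb x = G K x)}.
  have [MM|_] := boolP (M \in Mh); last by exists (fun _ _ => 0).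
  by have [G h1 h2] := SigmaMb_fam MM (hb M MM); exists G.
have [bF hbF] := choice hb'.
have hm K : exists M, K \in T -> M \in Mh /\ K \in subtris M.
  have [/submeshP[M MM KM]|_] := boolP (K \in T); [by exists M|by exists K].
have [mac hmac] := choice hm.
have macE M K : M \in Mh -> K \in subtris M -> mac K = M.
  move=> MM KM; have [h1 h2] := hmac K (memT MM KM); exact: (sub_macro_uniq h1 MM h2 KM).
pose S K x := cF K x + bF (mac K) K x.
have pS K : K \in T -> polynmx 2 (S K) /\ forall x, (S K x)^T = S K x.
  move=> KT; have [[pc _] sc'] := hcF K KT; have [MM KM] := hmac K KT.
  have [[/(_ K KM)[pb sb'] _ _] _] := hbF _ MM; split=> [i j|x]; last by rewrite linearD /= sc' sb'.
  rewrite (_ : (fun x => _) = fun x => cF K x i j + bF (mac K) K x i j); first exact: polynD.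
  by apply/funext => x; rewrite mxE.
have rS : repM sigma S.
  move=> K KT; have [[_ rc] _] := hcF K KT; have [MM KM] := hmac K KT; have [_ /(_ K KM) rb] := hbF _ MM.
  have rs : ae_on (hull (verts K)) (fun x => sigma x = sc x + sb x).
    by apply: ae_onD (hull_oK_negl confT KT) _; apply: ae_onS hs => // x; exact: (oK_sub confT iO KT).
  have := ae_on2 rc rb (S := fun x => sc x + sb x = S K x) (fun x _ e1 e2 => _).
  move=> h; have {}h : ae_on (hull (verts K)) (fun x => sc x + sb x = S K x).
    by apply: (ae_on2 rc rb) => x _ -> ->.
  by apply: (ae_on2 rs h) => x _ -> ->.
have pc (i j : 'I_2) : polys T 2 (fun K x => cF K x i j) by move=> K KT; have [[h _] _] := hcF K KT; exact: h.
have cc (i j : 'I_2) : contE T (fun K x => cF K x i j).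
  have [Lsc _] := scH i j; apply: (weak_pd_matching (pc i j) Lsc _ (scH i j)) => K KT.
  by have [[_ h] _] := hcF K KT; apply: ae_onS h => // x _ ->.
have cE K L x : K \in T -> L \in T -> hull (verts K) x -> hull (verts L) x -> cF K x = cF L x.
  move=> KT LT Kx Lx; apply/matrixP => i j.
  exact: (single_valued (cc i j) KT LT Kx Lx).
exists S => //; split=> //.
- move=> i; have pi (j : 'I_2) : polys T 2 (fun K x => S K x i j) by move=> K KT; have [h _] := pS K KT; exact: h.
  exact: (weak_div_matching confT oO iO bO (pi 0) (pi 1) (LS i 0) (LS i 1) (repM_rep i 0 rS) (repM_rep i 1 rS) (Lv i) (hv i)).
- move=> M X MM XM K L KT LT KX LX; rewrite /S (cE K L X)//.
  have z K' : K' \in T -> hull (verts K') X -> bF (mac K') K' X = 0.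
    move=> K'T K'X; have [NM K'N] := hmac K' K'T; have [[_ h _] _] := hbF _ NM; apply: h => //.
    by apply: (vert_in conf MM NM) XM; exact: (@sub_hull R _ X (orT conf NM) K' K'N K'X).
  by rewrite (z K)// (z L).
- move=> M c MM K L KM LM KX LX; have [KT LT] := (memT MM KM, memT MM LM).
  rewrite /S (cE K L)// (macE M K)// (macE M L)//; congr (_ + _).
  by have [[_ _ h] _] := hbF M MM; exact: (h c K L).
Qed.
End FamilyFromSigma.

(** * Surjectivity of the divergence *)

Section Surjectivity.
Implicit Types (t : pt R) (k : 'I_3) (A : pred (tri R)).

Lemma macro_vert M X K : M \in Mh -> X \in verts M -> K \in T -> hull (verts K) X -> exists k, X = vt K k.
Proof.
move=> MM XM /submeshP[N NM KN] KX; apply: (vert_in_verts NM _ KN KX).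
exact: (vert_in conf MM NM (sub_hull (orT conf NM) KN KX) XM).
Qed.

Definition tfam A X K x : R := if A K then quad K (dlt X) x else 0.
(** The test stresses: a Lagrange function cut down to the triangles selected by [A], times a
    rank-one matrix. *)
Definition tmat A X t K x : 'M[R]_2 := tfam A X K x *: tt t.

Lemma tfam_polyn A X K : polyn 2 (tfam A X K).
Proof.
rewrite /tfam; case: (A K); first exact: quad_polyn.
exact: polyn_cst.
Qed.

Lemma tfam_vt A X K k : K \in T -> tfam A X K (vt K k) = if A K then dlt X (vt K k) else 0.
Proof. by move=> KT; rewrite /tfam quad_vt ?hT. Qed.

(** Where the selection [A] cuts the support, the edge must be parallel to [t], so that the normal
    component vanishes on it. At a macro midpoint the selection must not separate sub-triangles of
    one macro-element. *)
Lemma tmat_Scond A X t : (forall M, M \in Mh -> X \notin verts M) ->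
  (forall M c K L, M \in Mh -> X = ept M c -> K \in subtris M -> L \in subtris M -> A K = A L) ->
  (forall K i L j, K \in T -> L \in T -> nbr K i L j -> A K -> ~~ A L ->
    X \in [:: ea K i; eb K i; ept K i] -> cross (eb K i - ea K i) t = 0) ->
  Scond (tmat A X t).
Proof.
move=> hX hm hn; split.
- move=> K KT; split=> [i j|x]; last by rewrite /tmat linearZ /= tt_sym.
  rewrite (_ : (fun x => _) = fun x => tt t i j * tfam A X K x); first exact: polynZ (tfam_polyn A X K).
  by apply/funext => x; rewrite mxE mulrC.
- move=> r; pose W K L x i := (eb K i - ea K i).2 * (tmat A X t K x r 0 - tmat A X t L x r 0) -
      (eb K i - ea K i).1 * (tmat A X t K x r 1 - tmat A X t L x r 1).
  have WE K L x i : W K L x i = (tfam A X K x - tfam A X L x) * vec t r 0 * - cross (eb K i - ea K i) t.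
    have tE P (r' : 'I_2) : tmat A X t P x r r' = tfam A X P x * (vec t r 0 * vec t r' 0) by rewrite mxE ttE.
    rewrite /W !tE /cross; move: (vec t r 0) => w; rewrite !mxE /=; ring.
  have key K i L j x : K \in T -> L \in T -> nbr K i L j -> A K -> ~~ A L -> hull [:: ea K i; eb K i] x ->
      tfam A X K x * cross (eb K i - ea K i) t = 0.
    move=> KT LT hKL AK AL /seg_hullP[s [_ _ ->]]; rewrite /tfam AK quad_edge ?hT//.
    have h := hn K i L j KT LT hKL AK AL.
    have [/h ->|] := boolP (X \in [:: ea K i; eb K i; ept K i]); first by rewrite mulr0.
    rewrite !inE !negb_or => /and3P[h1 h2 h3].
    by rewrite /dlt ![_ == X]eq_sym (negbTE h1) (negbTE h2) (negbTE h3) !mul0r !addr0 mul0r.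
  move=> [[K KT] i] [[L LT] j] hKL' x hx; have hKL : nbr K i L j := hKL'.
  rewrite -[LHS]/(W K L x i) WE.
  rewrite mulrN mulrAC; apply/eqP; rewrite oppr_eq0; apply/eqP.
  suff -> : (tfam A X K x - tfam A X L x) * cross (eb K i - ea K i) t = 0 by rewrite mul0r.
  have z P y : ~~ A P -> tfam A X P y = 0 by rewrite /tfam => /negbTE ->.
  have [AK|AK] := boolP (A K); have [AL|AL] := boolP (A L).
  + rewrite /tfam AK AL; rewrite (_ : quad K _ x = quad L (dlt X) x) ?subrr ?mul0r//.
    by apply: (contE_quad (dlt X) KT LT hKL).
  + by rewrite (z L)// subr0; apply: (key _ _ _ j _ KT LT hKL AK AL hx).
  + rewrite (z K)// sub0r.
    rewrite (nbr_hull hKL) in hx; have k0 := key _ _ _ i _ LT KT (nbr_sym hKL) AL AK hx.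
    case/andP: hKL => _ /orP[]/andP[/eqP e1 /eqP e2]; rewrite -e1 -e2 in k0 *.
      by rewrite mulNr k0 oppr0.
    by rewrite -[RHS]k0 /cross /=; ring.
  + by rewrite !z// subrr mul0r.
- move=> M Y MM YM; suff h K : K \in T -> hull (verts K) Y -> tmat A X t K Y = 0.
    by move=> K L KT LT KY LY; rewrite !h.
  move=> KT KY; have [k Yk] := macro_vert MM YM KT KY.
  rewrite /tmat Yk tfam_vt// -Yk /dlt; have [e|_] := eqVneq Y X; last by rewrite if_same scale0r.
  by have := hX M MM; rewrite -e YM.
- move=> M c MM; have h K : K \in subtris M -> hull (verts K) (ept M c) ->
      tmat A X t K (ept M c) = (if A K then dlt X (ept M c) else 0) *: tt t.
    move=> KM KX; have [k Xk] := ept_in_verts MM (memT MM KM) KX.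
    by rewrite /tmat {1}Xk tfam_vt ?(memT MM KM)// -Xk.
  move=> K L KM LM KX LX; rewrite !h//; congr (_ *: _); rewrite /dlt.
  have [e|_] := eqVneq (ept M c) X; last by rewrite !if_same.
  by rewrite (hm M c K L MM (esym e) KM LM).
Qed.

Lemma tmat_div A X t K x (r : 'I_2) : tau_div (tmat A X t) K x r 0 = vec t r 0 * dir t (tfam A X K) x.
Proof.
rewrite mxE; have p := tfam_polyn A X K.
have e (r' : 'I_2) : (fun y => tmat A X t K y r r') = fun y => (vec t r 0 * vec t r' 0) * tfam A X K y.
  by apply/funext => y; rewrite mxE ttE mulrC.
rewrite !e !(dirZ _ _ p) (dir_coord t x p) !mxE /=; ring.
Qed.

(** Testing with [w] itself shows that [w] is parallel to [e]; then [w + perp e] gives a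
    contradiction unless [w] vanishes. *)
Lemma dot_cross_test w e : e != 0 -> (forall t, dot w t * cross e t = 0) -> w = 0.
Proof.
move=> e0 h; have sq u : (dot u u == 0) = (u == 0).
  rewrite /dot -!expr2 paddr_eq0 ?sqr_ge0// !sqrf_eq0.
  apply/andP/eqP => [[/eqP h1 /eqP h2]|->]; [exact: pairE|by rewrite eqxx].
apply/eqP; rewrite -sq; apply/negPn/negP => w0.
have /eqP := h w; rewrite mulf_eq0 (negbTE w0) => /eqP c0.
have /eqP := h (w + perp e).
have -> : dot w (w + perp e) = dot w w + cross e w by rewrite /dot /cross /perp /=; ring.
have -> : cross e (w + perp e) = cross e w + dot e e by rewrite /dot /cross /perp /=; ring.
by rewrite c0 addr0 add0r mulf_eq0 (negbTE w0) sq (negbTE e0).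
Qed.

Lemma big_supp (s : seq (tri R)) (F : tri R -> R) : uniq s -> {subset s <= T} ->
  (forall K, K \in T -> K \notin s -> F K = 0) -> \sum_(K <- undup T) F K = \sum_(K <- s) F K.
Proof.
move=> us sT h; transitivity (\sum_(K <- [seq K <- undup T | K \in s]) F K).
  rewrite big_filter [RHS]big_mkcond; apply: eq_big_seq => K /=.
  by rewrite mem_undup => KT; case: ifPn => // /(h K KT).
apply: perm_big; apply: uniq_perm => //; first by rewrite filter_uniq ?undup_uniq.
by move=> K; rewrite mem_filter mem_undup andbC; case: (boolP (K \in s)) => [/sT ->|_]; rewrite ?andbF.
Qed.

Lemma cross_edges K c : cross (eb K (nx (nx c)) - ea K (nx (nx c))) (eb K c - ea K c) = orient K.
Proof. by move: c; apply: ord3P; rewrite /orient /cross /ea /eb /vt /=; ring. Qed.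

Lemma quad_dlt_hull K X : orient K != 0 -> ~ hull (verts K) X -> quad K (dlt X) = fun=> 0.
Proof.
move=> hK hX; apply: quad_dlt0 => i; apply/eqP => e; apply: hX; rewrite e; first exact: hull_vt.
exact: ept_hull.
Qed.

Lemma ept_macro K i M : K \in T -> M \in Mh -> ept K i \notin verts M.
Proof.
move=> KT MM; apply/negP => XM; have hK := hT KT.
have [k /eqP] := macro_vert MM XM KT (ept_hull i hK); by rewrite (negbTE (ept_vt i k hK)).
Qed.

Lemma nbr_ept K i L j : nbr K i L j -> ept L j = ept K i.
Proof.
rewrite /ept -/(ea K i) -/(eb K i) -/(ea L j) -/(eb L j).
by case/andP=> _ /orP[]/andP[/eqP -> /eqP ->] //; exact: midC.
Qed.

Lemma node_nbr K i L : K \in T -> L \in T -> K != L -> (forall j, ~~ nbr K i L j) ->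
  quad L (dlt (ept K i)) = fun=> 0.
Proof.
move=> KT LT KL hn; have hK := hT KT; apply: quad_dlt_hull (hT LT) _ => LX.
have [j h] := oedge_nbrP confT KT LT KL (ept_oedge i hK) LX.
by have := hn j; rewrite h.
Qed.

Section Dual.
(** A linear functional on piecewise linear fields, given by its coefficients on vertex values and
    assumed to annihilate all divergences. *)
Variable z : tri R -> 'I_3 -> pt R.
Hypothesis hz : forall S, Scond S ->
  \sum_(K <- undup T) \sum_k \sum_(i : 'I_2) vec (z K k) i 0 * tau_div S K (vt K k) i 0 = 0.

Lemma test_sum A X t (s : seq (tri R)) : Scond (tmat A X t) -> uniq s -> {subset s <= T} ->
  (forall K, K \in s -> A K) -> (forall K, K \in T -> K \notin s -> A K -> quad K (dlt X) = fun=> 0) ->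
  \sum_(K <- s) ell K (z K) (quad K (dlt X)) t = 0.
Proof.
move=> hS us sT sA h; rewrite -[RHS](hz hS) (big_supp us sT).
  rewrite big_seq [RHS]big_seq; apply: eq_bigr => K Ks; apply: eq_bigr => k _.
  rewrite !big_ord_recl big_ord0 !tmat_div !mxE /= /tfam sA// /dot; ring.
move=> K KT Ks; apply: big1 => k _; apply: big1 => i _; rewrite tmat_div.
have -> : tfam A X K = fun=> 0.
  by rewrite /tfam; apply/funext => x; case: ifP => // AK; rewrite (h K KT Ks AK).
by rewrite dir_cst !mulr0.
Qed.

(** The test is the bubble of one element at an edge midpoint with [t] along that edge; it forbids
    stretching of the edge. *)
Lemma z_rigid K : K \in T -> exists (c0 : pt R) (be : R), forall k, z K k = c0 + be *: perp (vt K k).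
Proof.
move=> KT; have hK := hT KT; apply: rigid_nodes hK _ => c; set t := eb K c - ea K c.
have hS : Scond (tmat (pred1 K) (ept K c) t).
  apply: tmat_Scond => [M MM|M d L L' MM /eqP|L i L' j LT L'T _ /eqP -> _].
  - exact: ept_macro.
  - by rewrite (negbTE (ept_ept _ _ MM KT)).
  - rewrite !inE !(negbTE (ept_vt c _ (hT KT))) /= => /eqP/(ept_inj (hT KT)) <-.
    by rewrite /cross mulrC subrr.
have : \sum_(P <- [:: K]) ell P (z P) (quad P (dlt (ept K c))) t = 0.
  apply: (@test_sum _ _ _ [:: K] hS isT) => [L|L|L _]; rewrite inE; [by move=> /eqP ->|by []|by move=> /negP h /h].
have -> : dot (z K (nx c) - z K (nx (nx c))) t = dot (z K (nx c)) t - dot (z K (nx (nx c))) t.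
  by rewrite /dot /=; ring.
have e : cross (eb K (nx c) - ea K (nx c)) t = - orient K.
  by rewrite -(cross_edges K c) /cross /t /ea /eb !nxK /=; ring.
have e2 : cross (eb K (nx (nx c)) - ea K (nx (nx c))) t = orient K by exact: cross_edges.
have four0 : (4 : R) != 0 by rewrite pnatr_eq0.
rewrite big_seq1 ell_ept ?hT// e2 e => h; apply: (mulfI four0); rewrite mulr0 -h.
by field; exact: hT.
Qed.

Section Reaction.
Variables (cz : tri R -> pt R) (bz : tri R -> R).
Hypothesis zE : forall K k, K \in T -> z K k = cz K + bz K *: perp (vt K k).
Let rt K := react K (cz K) (bz K).

Lemma edge_test K i t : K \in T -> Scond (tmat predT (ept K i) t).
Proof.
move=> KT; apply: tmat_Scond => [M MM|M d L L' MM /eqP|//]; first exact: ept_macro.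
by rewrite (negbTE (ept_ept _ _ MM KT)).
Qed.

Lemma sg_edge K i : K \in T -> Num.sg (orient K) *: (eb K i - ea K i) != 0.
Proof. by move=> KT; rewrite scaler_eq0 negb_or sgr_eq0 hT// tangent_neq ?hT. Qed.

Lemma four : (- 4 : R) != 0.
Proof. by rewrite oppr_eq0 pnatr_eq0. Qed.

Let ellE K i t (KT : K \in T) := ell_ept_react (hT KT) (fun k => zE k KT) i t.

(** The midpoint function of an edge is supported on its two triangles and may carry any matrix. The
    outward normals are opposite, so the two reactions must agree. *)
Lemma rt_nbr K i L j : K \in T -> L \in T -> nbr K i L j -> rt K (ept K i) = rt L (ept K i).
Proof.
move=> KT LT hn; have LK : L != K by case/andP: hn.
apply: subr0_eq; apply: dot_cross_test (sg_edge i KT) _ => t.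
have : \sum_(P <- [:: K; L]) ell P (z P) (quad P (dlt (ept K i))) t = 0.
  apply: (test_sum (edge_test i t KT)) => //.
  - by rewrite /= inE eq_sym LK.
  - by move=> P; rewrite !inE => /orP[]/eqP ->.
  - move=> P PT; rewrite !inE negb_or => /andP[PK PL] _; apply: node_nbr => // [|j']; first by rewrite eq_sym.
    apply/negP => hP; have [e _] := nbr_uniq confT KT LT PT hn hP.
    by rewrite e eqxx in PL.
rewrite big_cons big_seq1 (ellE i t KT) -{2}(nbr_ept hn) (ellE j t LT).
rewrite (nbr_ept hn) (nbr_orient confT KT LT hn) -/(rt K _) -/(rt L _) => h.
by apply: (mulfI four); rewrite mulr0 -h /dot /cross /=; ring.
Qed.

Lemma rt_free K i : K \in T -> (forall L j, L \in T -> ~~ nbr K i L j) -> rt K (ept K i) = 0.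
Proof.
move=> KT fr; apply: dot_cross_test (sg_edge i KT) _ => t.
have : \sum_(P <- [:: K]) ell P (z P) (quad P (dlt (ept K i))) t = 0.
  apply: (test_sum (edge_test i t KT)) => //; first by move=> P; rewrite !inE => /eqP ->.
  move=> P PT; rewrite !inE => PK _; apply: node_nbr => // [|j']; first by rewrite eq_sym.
  exact: fr.
by rewrite big_seq1 (ellE i t KT) => h; apply: (mulfI four); rewrite mulr0.
Qed.

(** The tangential generator at a macro midpoint. The selection cuts only along edges of [M], and
    among these the node lies only on the macro edge parallel to [t]. *)
Lemma macro_test M c : M \in Mh -> Scond (tmat (fun K => K \in subtris M) (ept M c) (eb M c - ea M c)).
Proof.
move=> MM; have hM := orT conf MM; apply: tmat_Scond.
- move=> N NM; apply/negP => XN; have := vert_in conf NM MM (ept_hull c hM) XN.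
  by move=> /mem_verts[k /eqP]; rewrite (negbTE (ept_vt c k hM)).
- move=> N d K L NM _ KN LN; have [<-|NM'] := eqVneq N M; first by rewrite KN LN.
  have h P : P \in subtris N -> (P \in subtris M) = false.
    by move=> PN; apply/negP => PM; case/eqP: NM'; exact: (sub_macro_uniq NM MM PN PM).
  by rewrite !h.
- move=> K i L j KT LT hn KM LM.
  case: (nbrT KT LT hn) => [[N NM /inner_mem[KN LN]]|[N [P [c' [d [b [b' [NM _ _ [Ki _] _]]]]]]]].
    by rewrite (sub_macro_uniq MM NM KM KN) LN in LM.
  have [EK Ei] : K = (half N c' b).1 /\ i = (half N c' b).2 by rewrite -Ki.
  have NE : N = M by apply: (sub_macro_uniq NM MM _ KM); rewrite EK half_mem.
  subst N; have hv' : ept M c != hv M c' b by rewrite /hv; case: (b); exact: ept_vt.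
  have ek : ept M c != ept K i by rewrite eq_sym (ept_ept _ _ MM KT).
  rewrite !inE (negbTE ek) orbF => hX.
  have cc : c = c'.
    apply: (ept_inj hM); apply/eqP; move: hX; rewrite EK Ei.
    by case: (half_ends M c' b) => -[-> ->]; rewrite (negbTE hv') ?orbF.
  have [r] := half_tangent M c' b; rewrite EK Ei cc => ->.
  by rewrite /cross /= /GRing.scale /=; ring.
Qed.

Lemma rt_ext K i L j : K \in T -> L \in T -> nbr K i L j -> forall Y t,
  dot (rt K Y - rt L Y) t = 0 -> cross (Y - ept K i) t != 0 -> rt K = rt L.
Proof.
move=> KT LT hn Y t; apply: rigid_eq; try exact: react_rigid.
exact: rt_nbr hn.
Qed.

(** A rigid motion needs three scalar conditions. Agreement at the midpoint of the interior edge
    gives two; the tangential test at a macro midpoint where the edge ends gives the third. At the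
    common endpoint of the three interior edges all four triangles enter, so the two outer pairs are
    settled first. *)
Lemma rt_macro M : M \in Mh -> [/\ rt (K1 M) = rt (K2 M), rt (K2 M) = rt (K3 M) & rt (K3 M) = rt (K4 M)].
Proof.
move=> MM; have hM := orT conf MM; have [h1 h2 h3 h4] := sub_mem M.
have [T1 T2 T3 T4] := And4 (memT MM h1) (memT MM h2) (memT MM h3) (memT MM h4).
have [e0 e2 e1] := ept_m M; have [c1 c2 c3' c4 c5] := inner_cross hM.
have [g1 g2 g3 g4] := sub_orient M.
have in12 : inner2 M (K1 M, i0) (K2 M, i0) by rewrite /inner2 !inE !eqxx.
have in23 : inner2 M (K2 M, i2) (K3 M, i2) by rewrite /inner2 !inE !eqxx ?orbT.
have in34 : inner2 M (K3 M, i0) (K4 M, i0) by rewrite /inner2 !inE !eqxx ?orbT.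
have sT : {subset subtris M <= T} by move=> K; exact: memT.
have E c : \sum_(P <- subtris M) ell P (z P) (quad P (dlt (ept M c))) (eb M c - ea M c) = 0.
  by apply: (test_sum (macro_test c MM)) => [|//|//|K _ /negbTE ->//]; exact: sub_neq.
have s4 : Num.sg (orient M / 4) = Num.sg (orient M) by rewrite sgrM (@gtr0_sg _ 4^-1) ?mulr1// invr_gt0 ltr0n.
have [nh1 nh2 nh3 nh4] := sub_nhull hM.
have V K k c t (KT : K \in T) : ept M c = vt K k -> ell K (z K) (quad K (dlt (ept M c))) t =
    dot (rt K (ept M c)) t * cross (Num.sg (orient K) *: (eb K k - ea K k)) t.
  by move=> ->; rewrite (ell_vt_react (hT KT) (fun k' => zE k' KT)).
have Z K c t (KT : K \in T) : ~ hull (verts K) (ept M c) -> ell K (z K) (quad K (dlt (ept M c))) t = 0.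
  by move=> h; rewrite (quad_dlt_hull (hT KT) h) ell0.
have so : Num.sg (orient M) * (orient M / 2) != 0 by rewrite !mulf_neq0 ?sgr_eq0// invr_neq0 ?pnatr_eq0.
have r12 : rt (K1 M) = rt (K2 M).
  apply: (rt_ext T1 T2 (inner_nbr hM in12) (Y := ept M i2) (t := eb M i2 - ea M i2)).
    have := E i2; rewrite /subtris !big_cons big_nil -/(K1 M) -/(K2 M) -/(K3 M) -/(K4 M).
    rewrite (V _ i2 _ _ T1 e2) (V _ i2 _ _ T2 e2) (Z _ _ _ T3 nh3) (Z _ _ _ T4 nh4) g1 g2 sgrN s4 => h.
    move: h; move: (rt (K1 M) (ept M i2)) (rt (K2 M) (ept M i2)) => u v h.
    apply: (mulIf so); rewrite mul0r -[RHS]oppr0 -[in RHS]h.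
    rewrite /dot /orient /cross /ea /eb /vt /= /m1 /m2 /mid /= /GRing.scale /=; by field.
  apply: contraNneq c2 => e; apply/eqP; rewrite -[RHS](mulr0 (- 2)) -[in RHS]e.
  rewrite e2 /cross /ept /ea /eb /vt /= /m1 /m2 /mid /= /GRing.scale /=; by field.
have r34 : rt (K3 M) = rt (K4 M).
  apply: (rt_ext T3 T4 (inner_nbr hM in34) (Y := ept M i1) (t := eb M i1 - ea M i1)).
    have := E i1; rewrite /subtris !big_cons big_nil -/(K1 M) -/(K2 M) -/(K3 M) -/(K4 M).
    rewrite (V _ i2 _ _ T3 e1) (V _ i2 _ _ T4 e1) (Z _ _ _ T1 nh1) (Z _ _ _ T2 nh2) g3 g4 sgrN s4 => h.
    move: h; move: (rt (K3 M) (ept M i1)) (rt (K4 M) (ept M i1)) => u v h.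
    apply: (mulIf so); rewrite mul0r -[RHS]oppr0 -[in RHS]h.
    rewrite /dot /orient /cross /ea /eb /vt /= /m1 /m3 /mid /= /GRing.scale /=; by field.
  apply: contraNneq c5 => e; apply/eqP; rewrite -[RHS](mulr0 (- 2)) -[in RHS]e.
  rewrite e1 /cross /ept /ea /eb /vt /= /m1 /m3 /mid /= /GRing.scale /=; by field.
split=> //.
apply: (rt_ext T2 T3 (inner_nbr hM in23) (Y := ept M i0) (t := eb M i0 - ea M i0)).
  have := E i0; rewrite /subtris !big_cons big_nil -/(K1 M) -/(K2 M) -/(K3 M) -/(K4 M).
  rewrite (V _ i1 _ _ T1 e0) (V _ i1 _ _ T2 e0) (V _ i1 _ _ T3 e0) (V _ i1 _ _ T4 e0).
  rewrite g1 g2 g3 g4 !sgrN s4 r12 -r34 => h.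
  move: h; move: (rt (K2 M) (ept M i0)) (rt (K3 M) (ept M i0)) => u v h.
  apply: (mulIf so); rewrite mul0r -[RHS](mulr0 (2^-1)) -[in RHS]h.
  rewrite /dot /orient /cross /ea /eb /vt /= /m1 /m2 /m3 /mid /= /GRing.scale /=; by field.
apply: contraNneq c3' => e; apply/eqP; rewrite -[RHS](mulr0 (- 2)) -[in RHS]e.
rewrite e0 /cross /ept /ea /eb /vt /= /m1 /mid /= /GRing.scale /=; by field.
Qed.

(** Take an extreme edge of the set of macro-elements with nonzero motion. Beyond each half of it
    there is no triangle or one with zero motion, so the reaction vanishes at the midpoints of both
    halves, and a rigid motion with two zeros is zero. *)
Lemma rt_zero K x : K \in T -> rt K x = 0.
Proof.
have sub M L : M \in Mh -> L \in subtris M -> rt L = rt (K1 M).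
  by move=> MM; have [f1 f2 f3] := rt_macro MM; move: L; apply: subP; rewrite -?f3 -?f2 -?f1.
have rz : rigid (fun=> 0 : pt R) by exists 0, 0, 0 => y; apply: pairE; rewrite /= ?mul0r; ring.
suff h M : M \in Mh -> rt (K1 M) = fun=> 0 by move=> /submeshP[M MM KM]; rewrite (sub M)// h.
move=> MM; apply: contrapT => nz.
have [N [c [NM ZN hN]]] := exit_edge conf (Z := fun N => `[< rt (K1 N) <> fun=> 0 >]) MM (asboolT nz).
move: ZN => /asboolP; apply; have hN0 := orT conf NM.
have q b : rt (K1 N) (mid (hv N c b, ept N c)) = 0.
  have KN := half_mem N c b; have KT := memT NM KN; have [xN xK] := half_oedge c b hN0.
  have -> : mid (hv N c b, ept N c) = ept (half N c b).1 (half N c b).2.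
    rewrite -[RHS]/(mid (ea (half N c b).1 (half N c b).2, eb (half N c b).1 (half N c b).2)).
    by case: (half_ends N c b) => -[-> ->] //; exact: midC.
  rewrite -(sub N _ NM KN).
  have [[P [d [PM hn]]]|nP] := pselect (exists P d, P \in Mh /\ nbr N c P d).
    have [b' [hn' _ _]] := nbr_half b NM PM hn; have LP := half_mem P d b'.
    rewrite (rt_nbr KT (memT PM LP) hn') (sub P _ PM LP).
    by have [->//|ZP] := pselect (rt (K1 P) = fun=> 0); have := hN P d PM (asboolT ZP); rewrite hn.
  apply: rt_free => // L j LT; apply/negP => hn.
  have xO := nbr_edge_in confT iO KT LT hn xK; apply: nP.
  have [P [d [PM hP]]] := edge_in_nbr conf oO NM xN xO; by exists P, d.
apply: (rigid_eq2 (react_rigid _ _ _) rz (q true) (q false)).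
rewrite /hv; apply: contra_neq (edge_neq c hN0) => /(congr1 (fun y : pt R => 2 *: y - ept N c)).
by rewrite /mid /= !scalerA divff ?pnatr_eq0// !scale1r !addrK => ->.
Qed.
End Reaction.

Lemma dual_zero K k : K \in T -> z K k = 0.
Proof.
have /choice[cb h] : forall L : tri R, exists cb : pt R * R, L \in T -> forall i, z L i = cb.1 + cb.2 *: perp (vt L i).
  move=> L; have [LT|LT] := boolP (L \in T); last by exists 0.
  by have [c0 [be h]] := z_rigid LT; exists (c0, be).
move=> KT; apply: (react0 (hT KT) (h K KT)) => x.
by apply: (rt_zero (cz := fun L => (cb L).1) (bz := fun L => (cb L).2)) => // L i LT; exact: h.
Qed.
End Dual.

Lemma polyn1_vt K f g : orient K != 0 -> polyn 1 f -> polyn 1 g -> (forall k, f (vt K k) = g (vt K k)) -> f = g.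
Proof.
move=> hK /polyn1E[a [b [c hf]]] /polyn1E[a' [b' [c' hg]]] h; apply/funext => x.
have e p (a0 b0 c0 : R) : (forall y, p y = a0 + b0 * y.1 + c0 * y.2) -> p x = \sum_k lam K k x * p (vt K k).
  move=> hp; have s1 := lam_sum x hK; rewrite hp {1 2}(lam_dec x hK); move: s1; rewrite !sum3 !hp.
  move: (lam K i0 x) (lam K i1 x) (lam K i2 x) => u v w e1.
  by rewrite -[a0 in LHS]mul1r -e1 /= /GRing.scale /=; ring.
by rewrite (e f _ _ _ hf) (e g _ _ _ hg); apply: eq_bigr => k _; rewrite h.
Qed.

Lemma tau_div_lin (a : R) S S' K x : polynmx 2 (S K) -> polynmx 2 (S' K) ->
  tau_div (fun L y => a *: S L y + S' L y) K x = a *: tau_div S K x + tau_div S' K x.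
Proof.
move=> pS pS'; apply/colP => r; rewrite !mxE.
have e (r' : 'I_2) : (fun y => (a *: S K y + S' K y) r r') = fun y => a * S K y r r' + S' K y r r'.
  by apply/funext => y; rewrite !mxE.
rewrite !e !(dirD _ (polynZ a (pS r _)) (pS' r _)) !(dirZ _ a (pS r _)); ring.
Qed.

Lemma Scond_lin (a : R) S S' : Scond S -> Scond S' -> Scond (fun L y => a *: S L y + S' L y).
Proof.
move=> [p1 m1 v1 w1] [p2 m2' v2 w2]; split.
- move=> K KT; have [q1 s1] := p1 K KT; have [q2 s2] := p2 K KT; split=> [i j|x].
    rewrite (_ : (fun y => _) = fun y => a * S K y i j + S' K y i j).
      by apply: polynD; [exact: polynZ (q1 _ _)|exact: q2].
    by apply/funext => y; rewrite !mxE.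
  by rewrite linearP /= s1 s2.
- move=> i h h' hn x hx; have := m1 i h h' hn x hx; have := m2' i h h' hn x hx.
  rewrite /jump !mxE => e2 e1; rewrite -[RHS](mulr0 a) -[in RHS]e1 -[LHS]addr0 -[X in _ + X]oppr0 -[in X in _ + X]e2.
  ring.
- by move=> M X MM XM K L KT LT KX LX; rewrite (v1 M X MM XM K L)// (v2 M X MM XM K L).
- by move=> M c MM K L KM LM KX LX; rewrite (w1 M c MM K L)// (w2 M c MM K L).
Qed.

Lemma Scond0 : Scond (fun _ _ => 0).
Proof.
split=> // [K KT|i h h' hn x hx]; last by rewrite /jump !mxE; ring.
by split=> [i j|x]; [rewrite (_ : (fun x => _) = fun=> 0); [exact: polyn_cst|apply/funext => x; rewrite mxE]|rewrite trmx0].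
Qed.

(** A piecewise linear field is its list of vertex values, so [full_subspace] turns the claim into
    [dual_zero]. *)
Lemma div_surjective (V : tri R -> pt R -> 'cV[R]_2) : (forall K, K \in T -> polynmx 1 (V K)) ->
  exists2 S, Scond S & forall K, K \in T -> forall x, tau_div S K x = V K x.
Proof.
move=> pV; set U := undup T; pose I := ('I_(size U) * ('I_3 * 'I_2))%type.
pose tr (i : 'I_(size U)) : tri R := nth (0, 0, 0) U i.
have trT (i : 'I_(size U)) : tr i \in T by rewrite -mem_undup mem_nth.
have pS S K : Scond S -> K \in T -> polynmx 2 (S K) by move=> [h _ _ _] /h[].
pose nodes (W : tri R -> pt R -> 'cV[R]_2) : 'rV[R]_#|{: I}| :=
  \row_l (let p := enum_val l in W (tr p.1) (vt (tr p.1) p.2.1) p.2.2 0).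
have [S hS SE] : exists2 S, Scond S & nodes V = nodes (tau_div S).
  apply: (@full_subspace _ _ (fun w => exists2 S, Scond S & w = nodes (tau_div S))).
  - exists (fun _ _ => 0); first exact: Scond0.
    have c0 (c : 'I_2) : (fun _ : pt R => (0 : 'M[R]_2) c 0) = fun=> 0 by apply/funext => y; rewrite mxE.
    have c1 (c : 'I_2) : (fun _ : pt R => (0 : 'M[R]_2) c 1) = fun=> 0 by apply/funext => y; rewrite mxE.
    by apply/rowP => l; rewrite [LHS]mxE [RHS]mxE /tau_div [RHS]mxE /= c0 c1 !dir_cst addr0.
  - move=> a w w' [S hS ->] [S' hS' ->]; exists (fun L y => a *: S L y + S' L y); first exact: Scond_lin.
    apply/rowP => l; rewrite [RHS]mxE /= (tau_div_lin a _ (pS S _ hS (trT _)) (pS S' _ hS' (trT _))).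
    by rewrite [LHS]mxE [X in X + _]mxE [RHS]mxE [X in _ = X + _]mxE ![nodes _ 0 l]mxE.
  - move=> zeta hz.
    (* The value 0 stands for triangles outside the enumeration. *)
    pose g (n : nat) k (r : 'I_2) : R := if insub n is Some j then zeta (enum_rank ((j, (k, r)) : I)) 0 else 0.
    pose z K k : pt R := (g (index K U) k 0, g (index K U) k 1).
    have zE (i : 'I_(size U)) k (r : 'I_2) : vec (z (tr i) k) r 0 = zeta (enum_rank ((i, (k, r)) : I)) 0.
      rewrite /z /tr index_uniq ?undup_uniq// /g valK mxE.
      by move: r; apply: ord2P.
    apply/colP => l; rewrite [RHS]mxE -[l]enum_valK; case: (enum_val l) => i [k r].
    rewrite -zE (@dual_zero z) //; first by rewrite mxE; case: ifP.
    move=> S hS; rewrite (big_nth (0, 0, 0)) big_mkord.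
    transitivity ((nodes (tau_div S) *m zeta) 0 0); last by rewrite (hz _ (ex_intro2 _ _ S hS erefl)) mxE.
    rewrite mxE (reindex (@enum_rank I))/=; last exact/onW_bij/enum_rank_bij.
    pose F (n : 'I_(size U)) k' (r' : 'I_2) :=
      nodes (tau_div S) 0 (enum_rank ((n, (k', r')) : I)) * zeta (enum_rank ((n, (k', r')) : I)) 0.
    transitivity (\sum_n \sum_k' \sum_r' F n k' r').
      apply: eq_bigr => n _; apply: eq_bigr => k' _; apply: eq_bigr => r' _.
      by rewrite /F zE mulrC [nodes _ _ _]mxE enum_rankK.
    rewrite (eq_bigr (fun n => \sum_(p : 'I_3 * 'I_2) F n p.1 p.2)) => [|n _]; last by rewrite pair_bigA.
    by rewrite pair_bigA; apply: eq_bigr => -[n [k' r']].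
exists S => // K KT x.
have iK : (index K U < size U)%N by rewrite index_mem mem_undup.
suff h (r : 'I_2) : (fun x => tau_div S K x r 0) = fun x => V K x r 0.
  by apply/colP => r; exact: (congr1 (@^~ x) (h r)).
apply: (polyn1_vt (hT KT)).
- have p := pS S K hS KT; rewrite (_ : (fun x => _) = fun x => dir (1, 0) (fun y => S K y r 0) x + dir (0, 1) (fun y => S K y r 1) x).
    by apply: polynD; exact: (polyn_dir _ (p _ _)).
  by apply/funext => y; rewrite mxE.
- exact: pV.
- move=> k; pose p : I := (Ordinal iK, (k, r)).
  have := congr1 (fun w : 'rV[R]_#|{: I}| => w 0 (enum_rank p)) SE; rewrite /nodes !(mxE _ _ _ (enum_rank p)) !enum_rankK.
  by rewrite /tr /= nth_index ?mem_undup.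
Qed.
End Surjectivity.

(** * Kernels and images of the complex *)

Section Complex.
Implicit Types (t : pt R) (k : 'I_3) (p : tri R -> pt R -> R).

Lemma airyS_entries p K : [/\ (fun x => airyS p K x 0 0) = pd 0 2 (p K),
  (fun x => airyS p K x 0 1) = (fun x => - pd 1 1 (p K) x),
  (fun x => airyS p K x 1 0) = (fun x => - pd 1 1 (p K) x) & (fun x => airyS p K x 1 1) = pd 2 0 (p K)].
Proof. by rewrite pd02 pd11 pd20; split; apply/funext => x; rewrite mxE /=; exact: erefl. Qed.

Lemma airy_repM p sigma : airy_rep T p sigma <-> repM sigma (airyS p).
Proof.
have repE F f f' K : f = f' -> ae_on (hull (verts K)) (fun x => F x = f x) ->
    ae_on (hull (verts K)) (fun x => F x = f' x) by move=> ->.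
split=> [[r1 r2 r3 r4]|h].
  apply: rep_repM => i j K KT; have [e00 e01 e10 e11] := airyS_entries p K.
  move: i j; apply: ord2P; apply: ord2P.
  - exact: repE (esym e00) (r1 K KT).
  - exact: repE (esym e01) (r2 K KT).
  - exact: repE (esym e10) (r3 K KT).
  - exact: repE (esym e11) (r4 K KT).
split=> K KT; have [e00 e01 e10 e11] := airyS_entries p K.
- exact: repE e00 (repM_rep 0 0 h KT).
- exact: repE e01 (repM_rep 0 1 h KT).
- exact: repE e10 (repM_rep 1 0 h KT).
- exact: repE e11 (repM_rep 1 1 h KT).
Qed.

Lemma tau_div_airyS p K x : polys T 4 p -> K \in T -> tau_div (airyS p) K x = 0.
Proof.
move=> hp KT; have pK := hp K KT; have [e00 e01 e10 e11] := airyS_entries p K.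
have pdd u v := polyn_dir u (polyn_dir v pK).
apply/colP => r; rewrite [LHS]mxE [RHS]mxE; move: r; apply: ord2P.
- rewrite e00 e01 pd02 pd11 (dirN _ (pdd _ _)) (dir_comm (1, 0) (0, 1) (polyn_dir (0, 1) pK)).
  by rewrite subrr.
- rewrite e10 e11 pd11 pd20 (dirN _ (pdd _ _)) (dir_comm (1, 0) (0, 1) pK).
  by rewrite (dir_comm (0, 1) (1, 0) (polyn_dir (1, 0) pK)) addNr.
Qed.

Lemma hess0_polyn1 (n : nat) f : polyn n f -> pd 0 2 f = (fun=> 0) -> pd 1 1 f = (fun=> 0) ->
  pd 2 0 f = (fun=> 0) -> polyn 1 f.
Proof.
rewrite pd02 pd11 pd20 => hf f02 f11 f20.
have cst l g : polyn l g -> dir (1, 0) g = (fun=> 0) -> dir (0, 1) g = (fun=> 0) -> forall x, g x = g 0.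
  move=> hg h1 h2 x; have z y : dir x g y = 0 by rewrite (dir_coord x y hg) h1 h2 !mulr0 addr0.
  have := line_const (A := 0) (v := x) hg ltr01 (fun s _ _ => z _) 1.
  by rewrite scale1r add0r.
have h1 := cst _ _ (polyn_dir (1, 0) hf); have h2 := cst _ _ (polyn_dir (0, 1) hf).
rewrite (dir_comm (0, 1) (1, 0) hf) f20 f11 in h1; rewrite f11 f02 in h2.
have {}h1 := h1 erefl erefl; have {}h2 := h2 erefl erefl.
set a := dir (1, 0) f 0 in h1; set b := dir (0, 1) f 0 in h2.
have hg : polyn n.+1 (fun x => f x - aff a b 0 x).
  by apply: polynB; [exact: polyn_leq hf|exact: polyn_leq (aff_polyn _ _ _)].
have hf1 : polyn n.+1 f by exact: polyn_leq hf.
have e := cst _ _ hg; rewrite !(dir_subaff _ _ _ _ hf1) in e.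
have {}e : forall x, f x - aff a b 0 x = f 0 - aff a b 0 0.
  by apply: e; apply/funext => x; rewrite ?h1 ?h2 /=; ring.
apply: (@polyn1I _ (f 0) a b) => x.
by have := e x; rewrite /aff /= !mulr0 !addr0 subr0 => <-; ring.
Qed.

Lemma polyn1_hess0 f : polyn 1 f -> [/\ pd 0 2 f = (fun=> 0), pd 1 1 f = (fun=> 0) & pd 2 0 f = (fun=> 0)].
Proof.
move=> /polyn1E[a [b [c e]]]; have -> : f = aff b c a by apply/funext => x; rewrite e /aff; ring.
by rewrite pd02 pd11 pd20 !dir_aff !dir_cst.
Qed.

(** The value attached to a triangle containing a point is locally constant on Omega, which is
    connected. *)
Lemma locally_equal_const (U : Type) (F : tri R -> U) :
  (forall K L x, K \in T -> L \in T -> hull (verts K) x -> hull (verts L) x -> F K = F L) ->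
  forall K L, K \in T -> L \in T -> F K = F L.
Proof.
move=> h K L KT LT; have hK := orT confT KT; have hL := orT confT LT.
have bK (P : tri R) : orient P != 0 -> oK P (bary P) by move=> hP i; rewrite lam_bary// invr_gt0 ltr0n.
have OK := oK_sub confT iO KT (bK K hK); have OL := oK_sub confT iO LT (bK L hL).
have e x P : P \in T -> hull (verts P) x -> F (pickT x) = F P.
  by move=> PT Px; have [QT Qx] := pickTP PT Px; exact: (h _ _ x).
rewrite -(e _ K KT (oK_hull hK (bK K hK))) -(e _ L LT (oK_hull hL (bK L hL))).
apply: (loc_const_connected (f := fun x => F (pickT x)) cO) OK OL => x Ox.
near=> y => Oy; have [P PT Py] := coverT confT (subset_closure Oy).
rewrite (e y P PT Py); apply/esym/(e x P PT); move: P PT Py.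
by near: y; exact: near_hull confT x.
Unshelve. all: by end_near.
Qed.

Lemma P1_rep f : P1 Omega f -> exists2 q, polyn 1 q & rep T f (fun=> q).
Proof.
move=> [Lf [q [hq qe]]]; exists q => // K KT.
apply: (ae_onD (B := oK K)); first exact: (hull_oK_negl confT KT).
by apply: ae_onS qe => //; exact: (oK_sub confT iO KT).
Qed.

Lemma const_Ucond q : polyn 1 q -> Ucond (fun=> q).
Proof.
move=> hq; have hp : polys T 4 (fun=> q) by move=> K KT; exact: polyn_leq hq.
by apply: (H2_Ucond hp) => //; split.
Qed.

Lemma P1_Uh : P1 Omega `<=` Uh Omega Mh.
Proof.
move=> f Pf; have [q hq rq] := P1_rep Pf; have [Lf _] := Pf.
apply/(Uh_Ucond Lf rq); last exact: const_Ucond.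
by move=> K KT; exact: polyn_leq hq.
Qed.

Lemma Uh_airy f : Uh Omega Mh f -> (exists sigma, is_airy Omega f sigma) /\
  forall sigma, is_airy Omega f sigma -> Sigma2h Omega Mh sigma /\ is_div Omega sigma (fun=> 0).
Proof.
move=> Uf; have [Lf _ _ _] := Uf; have [p hp rp] := Uh_rep Uf.
have Up := (Uh_Ucond Lf rp hp).1 Uf; have cp := Ucond_C1 hp Up.
split; first have [sigma Ls rs] := airy_exists confT oO bO hp.
  by exists sigma; exact: (C1_airy confT oO iO bO hp cp Lf rp Ls rs).
move=> sigma hs; have /airy_repM rs := airy_C1 confT oO iO bO hp cp Lf rp hs.
have [[_ Ls] _ _ _ _] := hs; have hS := airyS_Scond hp Up.
split; first exact: (Scond_Sigma hS Ls rs).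
have [pS mS _ _] := hS; have [_ LS] := Ls.
apply: (Scond_div _ mS LS rs) => [K KT|i|i K KT]; first exact: (pS K KT).1.
  rewrite (_ : (fun x => _) = fun=> 0); last by apply/funext => x; rewrite mxE.
  by apply: L2_ext (L2D 0 0 Lf Lf) _ => x _; rewrite !mul0r addr0.
by apply: ae_onW => x _; rewrite tau_div_airyS// !mxE.
Qed.

Lemma airy_kernel : [set f | Uh Omega Mh f /\ is_airy Omega f (fun=> 0)] = P1 Omega.
Proof.
have e0 (i j : 'I_2) : (fun _ : pt R => (0 : 'M[R]_2) i j) = fun=> 0 by apply/funext => x; rewrite mxE.
apply/seteqP; split=> [f [Uf hf]|f Pf] /=.
  have [Lf _ _ _] := Uf; have [p hp rp] := Uh_rep Uf.
  have Up := (Uh_Ucond Lf rp hp).1 Uf; have cp := Ucond_C1 hp Up.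
  have [r1 r2 _ r4] := airy_C1 confT oO iO bO hp cp Lf rp hf.
  have z K : K \in T -> polyn 1 (p K).
    move=> KT; have pK := hp K KT; have pdd u v := polyn_dir u (polyn_dir v pK).
    have c0 : polyn 2 (fun _ : pt R => 0 : R) by exact: polyn_cst.
    have r0 : rep T (fun=> 0 : R) (fun=> fun=> 0) by move=> L LT; exact: ae_onW.
    rewrite !e0 in r1 r2 r4; apply: (hess0_polyn1 pK).
    - by apply: (rep_uniq confT KT _ c0 r1 r0); rewrite pd02; exact: pdd.
    - have := rep_uniq confT KT _ c0 r2 r0 => /(_ (polynN _)).
      rewrite pd11 => /(_ (pdd _ _)) /(congr1 (fun g x => - g x)) h.
      by apply/funext => x; have := congr1 (fun g => g x) h; rewrite /= opprK oppr0.
    - by apply: (rep_uniq confT KT _ c0 r4 r0); rewrite pd20; exact: pdd.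
  (* Affine pieces with the same gradient and the same value at a common point coincide. *)
  have pE : forall K L, K \in T -> L \in T -> p K = p L.
    apply: locally_equal_const => K L x KT LT Kx Lx; have [c1 c2 c3] := cp.
    have [a [b [c hK]]] := polyn1E (z K KT); have [a' [b' [c' hL]]] := polyn1E (z L LT).
    have EK : p K = aff b c a by apply/funext => y; rewrite hK /aff; ring.
    have EL : p L = aff b' c' a' by apply/funext => y; rewrite hL /aff; ring.
    have := single_valued c1 KT LT Kx Lx.
    have := single_valued c2 KT LT Kx Lx; have := single_valued c3 KT LT Kx Lx.
    rewrite EK EL !dir_aff /= !mulr0 !mulr1 !addr0 !add0r => -> -> /addrI e.
    by rewrite e.
  split=> //; have [[K0 K0T]|nT] := pselect (exists K, K \in T).
    exists (p K0); split; first exact: z.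
    by apply: (ae_cover confT) => K KT; rewrite (pE _ _ K0T KT); exact: rp.
  exists (fun=> 0); split; first exact: polyn_cst.
  by apply: (ae_cover confT) => K KT; case: nT; exists K.
split; first exact: P1_Uh.
have [q hq rq] := P1_rep Pf; have [Lf _] := Pf; have [q02 q11 q20] := polyn1_hess0 hq.
have hp : polys T 4 (fun=> q) by move=> K KT; exact: polyn_leq hq.
apply: (C1_airy confT oO iO bO hp _ Lf rq) => //.
  split; first by apply: ae_onW => x _; rewrite trmx0.
  by move=> i j; rewrite e0; apply: L2_ext (L2D 0 0 Lf Lf) _ => x _; rewrite !mul0r addr0.
by split; rewrite e0 ?q02 ?q11 ?q20 => K KT; apply: ae_onW => // x _; rewrite oppr0.
Qed.

Lemma div_tau S sigma (v : pt R -> 'cV[R]_2) : Scond S -> repM sigma S -> L2S Omega sigma ->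
  is_div Omega sigma v -> forall i : 'I_2, rep T (fun x => v x i 0) (fun K x => tau_div S K x i 0).
Proof.
move=> [pS mS _ _] rS [_ LS] [Lv hv] i.
have pi (j : 'I_2) : polys T 2 (fun K x => S K x i j) by move=> K KT; exact: (pS K KT).1.
have r := weak_div_rep confT oO iO bO (pi 0) (pi 1) (LS i 0) (LS i 1) (repM_rep i 0 rS) (repM_rep i 1 rS) (Lv i) (hv i).
by move=> K KT; apply: ae_onS (r K KT) => // x _ ->; rewrite mxE dirF.
Qed.

Lemma tau_div_polyn S K (i : 'I_2) : Scond S -> K \in T -> polyn 1 (fun x => tau_div S K x i 0).
Proof.
move=> [pS _ _ _] KT; have [p _] := pS K KT.
rewrite (_ : (fun x => _) = fun x => dir (1, 0) (fun y => S K y i 0) x + dir (0, 1) (fun y => S K y i 1) x).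
  by apply: polynD; exact: (polyn_dir _ (p _ _)).
by apply/funext => x; rewrite mxE.
Qed.

(** The entries of the stress are the second derivatives of the glued potential, so the point
    conditions in [Scond] are those in [H2cond]. *)
Lemma div_kernel sigma : Sigma2h Omega Mh sigma -> is_div Omega sigma (fun=> 0) ->
  exists2 f, Uh Omega Mh f & is_airy Omega f sigma.
Proof.
move=> Ss ds; have [S hS rS] := Sigma_Scond Ss; have [[Ls _] _] := Ss.
have rv := div_tau hS rS Ls ds; have [pS mS vS wS] := hS.
have r0 (i : 'I_2) : rep T (fun x => (0 : 'cV[R]_2) i 0) (fun=> fun=> 0).
  by move=> K KT; apply: ae_onW => x _; rewrite mxE.
have td K x (i : 'I_2) : K \in T -> tau_div S K x i 0 = 0.
  move=> KT; exact: (congr1 (@^~ x) (rep_uniq confT KT (tau_div_polyn i hS KT) (polyn_cst 1 0) (rv i) (r0 i))).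
have s01 K x : K \in T -> S K x 1 0 = S K x 0 1 by move=> /pS[_ s]; rewrite -{1}s mxE.
have /choice[q hq] : forall K, exists q, K \in T -> [/\ polyn 4 q, pd 0 2 q = (fun x => S K x 0 0),
    pd 1 1 q = (fun x => - S K x 0 1) & pd 2 0 q = (fun x => S K x 1 1)].
  move=> K; have [KT|KT] := boolP (K \in T); last by exists (fun=> 0).
  have [pK _] := pS K KT; have d0 x := td K x 0 KT; have d1 x := td K x 1 KT.
  have e10 : (fun y => S K y 1 0) = fun y => S K y 0 1 by apply/funext => y; exact: s01.
  have [||q hq] := poly_airy (pK 0 0) (pK 0 1) (pK 1 1); last by exists q.
    by move=> x; rewrite -[RHS](d0 x) mxE.
  by move=> x; rewrite -[RHS](d1 x) mxE e10.
have hq4 : polys T 4 q by move=> K /hq[].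
have [p [hp cp hpq]] : exists p, [/\ polys T 4 p, C1 T p &
    {in T, forall K (n m : nat), (n + m)%N = 2%N -> pd n m (p K) = pd n m (q K)}].
  apply: (airy_glue confT oO iO bdconn bdperf hq4) => h h' hn x hx; have [_ h02 h11 h20] := hq _ (ssvalP h.1);
    have [_ k02 k11 k20] := hq _ (ssvalP h'.1); rewrite /jump h11 k11 ?h02 ?k02 ?h20 ?k20 !opprK.
    exact: (mS 0 h h' hn x hx).
  by rewrite -(s01 _ x (ssvalP h.1)) -(s01 _ x (ssvalP h'.1)); exact: (mS 1 h h' hn x hx).
have SE K x : K \in T -> S K x = airyS p K x.
  move=> KT; have [f00 f01 f10 f11] := airyS_entries p K; have [_ h02 h11 h20] := hq K KT.
  rewrite -(hpq K KT 0%N 2%N erefl) -f00 in h02; rewrite -(hpq K KT 2%N 0%N erefl) -f11 in h20.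
  rewrite -(hpq K KT 1%N 1%N erefl) in h11.
  have e (g g' : pt R -> R) : g = g' -> g x = g' x by move=> ->.
  have e01 : S K x 0 1 = airyS p K x 0 1 by rewrite (e _ _ f01) h11 opprK.
  apply: mx2P; [exact: esym (e _ _ h02)|exact: e01| |exact: esym (e _ _ h20)].
  by rewrite s01// e01 (e _ _ f01) -(e _ _ f10).
have Up : Ucond p.
  apply: (H2_Ucond hp cp); split.
    move=> M X MM XM K L KT LT KX LX; apply: airyS_hess; rewrite -!SE//.
    exact: (vS M X MM XM K L).
  move=> M c MM K L KM LM KX LX; apply: airyS_hess; rewrite -!SE ?(memT MM KM) ?(memT MM LM)//.
  exact: (wS M c MM K L).
have Lf := pw_L2 oO bO hp; have rp := rep_pw confT p.
exists (pw T p); first exact/(Uh_Ucond Lf rp hp).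
apply: (C1_airy confT oO iO bO hp cp Lf rp Ls); apply/airy_repM => K KT.
by apply: ae_onS (rS K KT) => // x _ ->; exact: SE.
Qed.

Lemma div_range : [set v | exists2 sigma, Sigma2h Omega Mh sigma & is_div Omega sigma v] = V2h Omega Mh.
Proof.
apply/seteqP; split=> v /=.
  move=> [sigma Ss ds]; have [S hS rS] := Sigma_Scond Ss; have [[Ls _] _] := Ss.
  have rv := div_tau hS rS Ls ds; have [Lv _] := ds; split=> // K KT.
  exists (tau_div S K); split=> [i j|]; first by rewrite ord1; exact: tau_div_polyn.
  apply: (ae_on2 (rv 0 K KT) (rv 1 K KT)) => x _ h0 h1; apply/colP; exact: ord2P.
move=> [Lv hv].
have /choice[V hV] : forall K, exists V, K \in T -> restr_polymx (hull (verts K)) 1 v V.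
  move=> K; have [KT|KT] := boolP (K \in T); last by exists (fun=> 0).
  by have [V h] := hv K KT; exists V.
have [S hS SV] := div_surjective (fun K KT => (hV K KT).1).
have [pS mS _ _] := hS; have rS := pwM_rep S; have Ls := pwM_L2S pS.
exists (pwM S); first exact: (Scond_Sigma hS Ls rS).
have [_ LS] := Ls; apply: (Scond_div (fun K KT => (pS K KT).1) mS LS rS Lv) => i K KT.
by apply: ae_onS (hV K KT).2 => // x _ ->; rewrite SV.
Qed.
End Complex.

End MacroMesh.

Theorem theorem4p5 (R : realType) (Omega : set (R * R)) (Mh : seq (tri R))
    (hOmega : polygonal_domain Omega) (hMh : conforming_mesh Omega Mh) :
  [/\ P1 Omega `<=` Uh Omega Mh,
      forall u, Uh Omega Mh u ->
        (exists sigma, is_airy Omega u sigma) /\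
        (forall sigma, is_airy Omega u sigma -> Sigma2h Omega Mh sigma),
      [set u | Uh Omega Mh u /\ is_airy Omega u (fun=> 0)] = P1 Omega,
      [set sigma | exists2 u, Uh Omega Mh u & is_airy Omega u sigma] =
        [set sigma | Sigma2h Omega Mh sigma /\ is_div Omega sigma (fun=> 0)]
    & [set v | exists2 sigma, Sigma2h Omega Mh sigma & is_div Omega sigma v] =
        V2h Omega Mh].
Proof.
have [oO cO bO [n [p [sp bdO]]]] := hOmega.
(* The polygon enters the mesh arguments only through this fact and the three that follow. *)
have iO := interior_closure_sub cO sp bdO.
have punct := punctured_connected oO cO sp bdO.
have bdconn : connected (closure Omega `\` Omega) by rewrite bdO; exact: boundary_connected.
have bdperf (F : seq (R * R)) x (e : R) : (closure Omega `\` Omega) x -> 0 < e ->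
    exists y, [/\ (closure Omega `\` Omega) y, ball x e y & y \notin F].
  by rewrite bdO; exact: boundary_perfect.
have airy := Uh_airy hMh oO iO bO punct.
split.
- exact: P1_Uh hMh iO punct.
- by move=> u /airy[ex h]; split=> // sigma /h[].
- exact: airy_kernel hMh oO cO iO bO punct.
- apply/seteqP; split=> sigma /= [].
    by move=> u /airy[_ h] /h.
  exact: div_kernel hMh oO iO bO bdconn bdperf punct sigma.
- exact: div_range hMh oO iO bO punct.
Qed.
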